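(* Let $N\ge3$, $\rho>0$. Assume that $b$ satisfies: (b0) $b:[0,+\infty)\to(0,+\infty)$ is of class $\mathcal C^1$; (b1) there exist $q\in(1,+\infty)$ and $c_1,c_2>0$ such that, for all $s\in\mathbb R$, $c_1(s^2+|s|^q)\le b(s^2)s^2\le c_2(s^2+|s|^q)$ and $c_1(s^2+|s|^q)\le B(s^2)\le c_2(s^2+|s|^q)$, where $B(s)=\int_0^s b(t)\,dt$; (b2) $b$ is increasing; and that $$2<p<\Big(1+\frac2N\Big)\min\{2,q\}.$$ Then there exists a nonnegative radially decreasing normalized ground state solution $u_\rho\in\mathcal X$ (for some $\lambda\in\mathbb R$) of $$\begin{cases}-\mathrm{div}\big(b(|\nabla u|^2)\nabla u\big)=|u|^{p-2}u-\lambda u & \text{in }\mathbb R^N,\\ u(x)\to0&\text{as }|x|\to+\infty,\\ \int_{\mathbb R^N}|u|^2\,dx=\rho^2.&\end{cases}$$ In particular, $I(u_\rho)=m(\rho)<0$.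
   Context: $\mathcal X=H^1(\mathbb R^N)\cap D^{1,q}(\mathbb R^N)$ is the completion of $\mathcal C_0^\infty(\mathbb R^N)$ with respect to $\|u\|_{\mathcal X}=(\|\nabla u\|_2^2+\|u\|_2^2+\|\nabla u\|_q^2)^{1/2}$. $S_\rho=\{u\in\mathcal X:\int_{\mathbb R^N}|u|^2dx=\rho^2\}$. The energy is $I(u)=\frac12\int_{\mathbb R^N}B(|\nabla u|^2)\,dx-\frac1p\|u\|_p^p$ on $\mathcal X$, and $m(\rho)=\inf_{u\in S_\rho}I(u)$. Solutions are weak solutions: $\int b(|\nabla u|^2)\nabla u\cdot\nabla\phi\,dx=\int(|u|^{p-2}u-\lambda u)\phi\,dx$ for all $\phi\in\mathcal X$; $\lambda$ is part of the unknown. A normalized ground state solution is a solution in $S_\rho$ whose energy $I$ is minimal among all solutions belonging to $S_\rho$. *)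

(* Defs.v *)
From HB Require Import structures.
From mathcomp Require Import all_boot all_order all_algebra.
From mathcomp Require Import all_classical all_reals all_analysis.
Import Order.TTheory GRing.Theory Num.Theory.
Import numFieldNormedType.Exports.

Set Implicit Arguments.
Unset Strict Implicit.
Unset Printing Implicit Defensive.

Local Open Scope classical_set_scope.
Local Open Scope ring_scope.

(* R^n is 'rV[R]_n, with the sigma-algebra generated by the coordinates (the
   Borel sets). *)
Section measurable_rV.
Variables (R : realType) (n : nat).

Let coord (i : 'I_n) (x : 'rV[R]_n) : R := x 0 i.

Let rV_set0 : g_sigma_preimage coord set0.
Proof. exact: sigma_algebra0. Qed.

Let rV_setC A : g_sigma_preimage coord A -> g_sigma_preimage coord (~` A).
Proof. exact: sigma_algebraC. Qed.

Let rV_bigcup (F : (set 'rV[R]_n)^nat) :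
  (forall i, g_sigma_preimage coord (F i)) ->
  g_sigma_preimage coord (\bigcup_i (F i)).
Proof. exact: sigma_algebra_bigcup. Qed.

HB.instance Definition _ := @isMeasurable.Build default_measure_display
  'rV[R]_n (g_sigma_preimage coord) rV_set0 rV_setC rV_bigcup.

Lemma measurable_coord (i : 'I_n) :
  measurable_fun [set: 'rV[R]_n] (fun x : 'rV[R]_n => x 0 i).
Proof.
move=> _ Y mY; rewrite setTI; apply: sub_sigma_algebra => /=.
rewrite -bigcup_seq/=; exists i => /=; first by rewrite mem_index_enum.
by exists Y => //; rewrite setTI.
Qed.

Lemma measurable_fun_rV d (T : measurableType d) (f : T -> 'rV[R]_n) :
  (forall i, measurable_fun [set: T] (fun t => f t 0 i)) ->
  measurable_fun [set: T] f.
Proof.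
move=> mf.
have sub : g_sigma_preimage (fun i => coord i \o f) `<=` measurable.
  apply: smallest_sub; first exact: sigma_algebra_measurable.
  case: n f mf @coord rV_set0 rV_setC rV_bigcup => [|m] f mf c _ _ _.
    by rewrite big_ord0.
  rewrite -bigcup_mkord_ord; apply: bigcup_sub => i Ii.
  by move=> A [B mB <-]; exact: mf.
move=> _ A mA; apply: sub; rewrite g_sigma_preimage_comp.
by exists A.
Qed.

End measurable_rV.

Section lebesgue_rV.
Variable R : realType.

Definition rV_cons n (z : 'rV[R]_n * R) : 'rV[R]_n.+1 :=
  row_mx (z.2%:M : 'rV_1) z.1.

Lemma rV_cons0 n (z : 'rV[R]_n * R) : rV_cons z 0 ord0 = z.2.
Proof.
have -> : ord0 = lshift n (ord0 : 'I_1) by exact/val_inj.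
by rewrite (row_mxEl (z.2%:M : 'rV_1)) mxE eqxx mulr1n.
Qed.

Lemma rV_consS n (z : 'rV[R]_n * R) (j : 'I_n) :
  rV_cons z 0 (lift ord0 j) = z.1 0 j.
Proof.
have -> : lift ord0 j = rshift 1 j by exact/val_inj.
by rewrite (row_mxEr (z.2%:M : 'rV_1)).
Qed.

Lemma measurable_rV_cons n : measurable_fun [set: 'rV[R]_n * R] (@rV_cons n).
Proof.
apply: measurable_fun_rV => i; case: (unliftP ord0 i) => [j|] ->.
  rewrite (_ : (fun z => _) = (fun x : 'rV[R]_n => x 0 j) \o fst).
    exact: (measurableT_comp (measurable_coord j)).
  by apply/funext => z; rewrite rV_consS.
rewrite (_ : (fun z => _) = snd)//.
by apply/funext => z; rewrite rV_cons0.
Qed.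

Definition lebesgue_step n (m : {measure set 'rV[R]_n -> \bar R}) :=
  pushforward (m \x @lebesgue_measure R)%E (@rV_cons n).

HB.instance Definition _ n (m : {measure set 'rV[R]_n -> \bar R}) :=
  Measure.copy (lebesgue_step m)
    (measure_function_pushforward__canonical__measure_function_Measure
      (m \x @lebesgue_measure R)%E (@measurable_rV_cons n)).

(* n-dimensional Lebesgue measure: iterated product of the library's
   one-dimensional one, see lebesgue_rV_box. *)
Fixpoint lebesgue_rV n : {measure set 'rV[R]_n -> \bar R} :=
  match n with
  | 0 => dirac (0 : 'rV[R]_0)
  | m.+1 => lebesgue_step (lebesgue_rV m)
  end.

Lemma lebesgue_rV_prod n (A : 'I_n -> set R) :
  (forall i, measurable (A i)) ->
  lebesgue_rV n [set x | forall i, A i (x 0 i)] =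
  (\prod_(i < n) lebesgue_measure (A i))%E.
Proof.
elim: n A => [|n IH] A mA.
  by rewrite big_ord0 /= diracE mem_set// => -[].
rewrite big_ord_recl muleC /= /lebesgue_step /pushforward -IH//.
rewrite (_ : _ @^-1` _ =
    [set x : 'rV[R]_n | forall i, A (lift ord0 i) (x 0 i)] `*` A ord0).
  rewrite product_measure1E//; last exact: mA.
  rewrite (_ : mkset _ = \bigcap_(i in [set: 'I_n])
      ((fun x : 'rV[R]_n => x 0 i) @^-1` A (lift ord0 i))).
    apply: fin_bigcap_measurable => // i _.
    rewrite -[X in measurable X]setTI; exact: measurable_coord.
  by apply/seteqP; split=> x /= Ax i; [move=> _; exact: Ax|exact: (Ax i I)].
apply/seteqP; split=> z /=.
  move=> Az; split=> [i|]; first by rewrite -rV_consS; exact: Az.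
  by rewrite -rV_cons0; exact: Az.
by move=> [A1 A2] i; case: (unliftP ord0 i) => [j|] ->;
  rewrite ?rV_consS ?rV_cons0.
Qed.

Lemma lebesgue_rV_box n (a b : 'rV[R]_n) : (forall i, a 0 i <= b 0 i) ->
  lebesgue_rV n [set x | forall i, x 0 i \in `[a 0 i, b 0 i]] =
  (\prod_(i < n) (b 0 i - a 0 i))%:E.
Proof.
move=> ab; rewrite (lebesgue_rV_prod (A := fun i => `[a 0 i, b 0 i]%classic))//.
rewrite -prodEFin; apply: eq_bigr => i _.
rewrite lebesgue_measure_itv/= lte_fin lt_neqAle ab andbT.
by case: eqP => //= ->; rewrite subrr.
Qed.

End lebesgue_rV.

Section sobolev.
Variables (R : realType) (N : nat).
Implicit Types (u v phi : 'rV[R]_N -> R) (q p rho : R).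

Local Notation mu := (lebesgue_rV R N).

Definition dot (x y : 'rV[R]_N) : R := \sum_(i < N) x 0 i * y 0 i.

(* Euclidean norm; the library's norm `|x| on 'rV[R]_N is the sup norm. *)
Definition enorm (x : 'rV[R]_N) : R := Num.sqrt (dot x x).

Definition partial (i : 'I_N) u : 'rV[R]_N -> R :=
  fun x => 'D_(delta_mx 0 i) u x.

Fixpoint Ck (k : nat) u : Prop :=
  match k with
  | 0 => continuous u
  | l.+1 => [/\ continuous u,
                forall i x, derivable u x (delta_mx 0 i) &
                forall i, Ck l (partial i u)]
  end.

Definition test_function phi : Prop :=
  (forall k, Ck k phi) /\ compact (closure [set x | phi x != 0]).

Definition L1loc u : Prop :=
  measurable_fun setT u /\
  forall K : set 'rV[R]_N, compact K -> mu.-integrable K (EFin \o u).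

Definition is_weak_gradient u (G : 'rV[R]_N -> 'rV[R]_N) : Prop :=
  [/\ L1loc u, forall i, L1loc (fun x => G x 0 i) &
      forall phi i, test_function phi ->
        \int[mu]_x (u x * partial i phi x) = - \int[mu]_x (G x 0 i * phi x)].

Definition weakly_differentiable u : Prop := exists G, is_weak_gradient u G.

(* A weak gradient is unique up to null sets; an arbitrary one is selected
   (and 0 if there is none). *)
Definition grad u : 'rV[R]_N -> 'rV[R]_N := xget (cst 0) (is_weak_gradient u).

Definition normX q u : \bar R :=
  ('N[mu]_(2%:E) [EFin \o (enorm \o grad u)] ^+ 2
   + 'N[mu]_(2%:E) [EFin \o u] ^+ 2
   + 'N[mu]_(q%:E) [EFin \o (enorm \o grad u)] ^+ 2)%E `^ 2^-1.

(* The completion of the test functions for normX q. The norm dominates the L^2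
   norms of u and of its gradient, so a Cauchy sequence converges in L^2 together
   with its gradients, and its limit is a function whose weak gradient is the
   limit of the gradients: the completion is the closure of the test functions
   among weakly differentiable functions. Elements are representatives of
   classes modulo null sets. *)
Definition spaceX q : set ('rV[R]_N -> R) := [set u |
  weakly_differentiable u /\
  exists phi : nat -> 'rV[R]_N -> R, (forall n, test_function (phi n)) /\
    normX q (fun x => u x - phi n x) @[n --> \oo] --> 0%E].

Definition sphere q rho : set ('rV[R]_N -> R) := [set u |
  spaceX q u /\ (\int[mu]_x (`|u x| ^+ 2)%:E = (rho ^+ 2)%:E)%E].

Definition primitive (b : R -> R) (s : R) : R :=
  \int[lebesgue_measure]_(t in `[0, s]) b t.

(* Extended-real valued; finite on spaceX under the growth conditions. *)
Definition energy (b : R -> R) p u : \bar R :=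
  ((2^-1)%:E * \int[mu]_x (primitive b (enorm (grad u x) ^+ 2))%:E
   - (p^-1)%:E * 'N[mu]_(p%:E) [EFin \o u] `^ p)%E.

Definition min_energy (b : R -> R) q p rho : \bar R :=
  ereal_inf [set energy b p u | u in sphere q rho].

Definition weak_solution (b : R -> R) q p (lambda : R) u : Prop :=
  spaceX q u /\
  forall phi, spaceX q phi ->
    \int[mu]_x (b (enorm (grad u x) ^+ 2) * dot (grad u x) (grad phi x)) =
    \int[mu]_x ((`|u x| `^ (p - 2) * u x - lambda * u x) * phi x).

Definition normalized_solution (b : R -> R) q p rho u : Prop :=
  sphere q rho u /\ exists lambda, weak_solution b q p lambda u.

Definition normalized_ground_state (b : R -> R) q p rho u : Prop :=
  normalized_solution b q p rho u /\
  forall v, normalized_solution b q p rho v -> (energy b p u <= energy b p v)%E.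

(* The value at the origin is left free: a radially decreasing class in spaceX
   only determines the profile on ]0, +oo[, where it may be unbounded near 0. *)
Definition radially_decreasing u : Prop := exists f : R -> R,
  (forall r s : R, 0 < r -> r <= s -> f s <= f r) /\
  (forall x, x != 0 -> u x = f (enorm x)).

Definition vanishes_at_infinity u : Prop :=
  forall e : R, 0 < e -> exists M : R, forall x, M < enorm x -> `|u x| < e.

End sobolev.

(* One-sided derivative at 0. *)
Definition C1_nonneg (R : realType) (b : R -> R) : Prop :=
  exists b' : R -> R, {within `[0, +oo[, continuous b'} /\
    forall s : R, 0 <= s ->
      (b t - b s) / (t - s) @[t --> within `[0, +oo[ s^'] --> b' s.

(* Main.v *)
(* Put Phi(xi) = B(|xi|^2), a convex function comparable to |xi|^2 + |xi|^q, and
   let m be the infimum of I over the test functions in the ball (not the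
   sphere) of radius rho of L^2. A weak-type Gagliardo-Nirenberg estimate with
   exponent 2 + 4/N > p shows that I is bounded below there and that u |-> |u|_p
   is continuous in L^2 as long as the gradients stay bounded; dilations give
   m < 0.

   Instead of rearrangements, two-point polarizations are used: among the
   nonnegative functions with equal L^2 and L^p norms to which the lower
   semicontinuous envelope of the gradient energy assigns at most the energy of
   a given test function, a minimizer of the second moment is invariant under
   all polarizations, hence radially nonincreasing. A minimizing sequence may
   therefore be taken radially nonincreasing; Helly's theorem extracts a limit u
   almost everywhere, a majorant of the form |x|^(-N/2) makes the L^p norms
   converge, and u attains m for the relaxed energy. Clarkson's inequality
   Phi((a+b)/2) + Phi((a-b)/2) <= (Phi(a) + Phi(b))/2, valid because B is convex,
   increasing and zero at 0, turns this into strong convergence of gradients, so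
   u belongs to X. If the L^2 norm of u were less than rho, a dilation would
   lower the energy below m < 0. Finally the derivative of I at u is nonnegative
   in each direction phi with (u, phi) < 0, since such directions enter the ball;
   it is therefore a multiple of (u, .). *)
Require Import Defs.
From HB Require Import structures.
From mathcomp Require Import all_boot all_order all_algebra.
From mathcomp Require Import ring lra.
From mathcomp Require Import all_classical all_reals all_analysis measurable_realfun.
Import Order.TTheory GRing.Theory Num.Theory.
Import numFieldNormedType.Exports.

Set Implicit Arguments.
Unset Strict Implicit.
Unset Printing Implicit Defensive.

Local Open Scope classical_set_scope.
Local Open Scope ring_scope.

(** * Lebesgue measure on R^n *)

(** Absolute values, polarizations and almost everywhere limits all leave the class of test
    functions, the only functions whose gradients are elementary. Two devices meet this.
    [relaxed v E] bounds the gradient energy at v through test functions near v in L^2, so v is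
    compared without having a gradient; one is constructed only for the final minimizer. And |t| is
    replaced by [softd del t], which vanishes near 0, has slope at most 1 and differs from |t| by at
    most 2 del.

    Growth and monotonicity of b force q >= 2, so the condition on p reads p < 2 + 4/N. The exponent
    2 + 4/N arises from averaging a translation estimate over a cube whose side is tuned to the
    level considered.

    The ball replaces the sphere because Fatou's lemma controls the L^2 norm of the limit only from
    above. The number 2 (m + |v|_p^p / p), called [level v], is the least gradient energy compatible
    with m being the infimum; midpoints of almost optimal test functions near v cannot fall far
    below it, and this is what Clarkson's inequality exploits. *)

Section sigma_finite_rV.
Variable R : realType.

Definition cube n (k : R) : set 'rV[R]_n := [set x | forall i, x 0 i \in `[- k, k]].

Lemma measurable_rect n (A : 'I_n -> set R) : (forall i, measurable (A i)) ->
  measurable [set x : 'rV[R]_n | forall i, A i (x 0 i)].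
Proof.
move=> mA.
rewrite (_ : mkset _ = \bigcap_(i in [set: 'I_n])
      ((fun x : 'rV[R]_n => x 0 i) @^-1` A i)).
  apply: fin_bigcap_measurable => // i _.
  rewrite -[X in measurable X]setTI; exact: measurable_coord.
by apply/seteqP; split=> x /= Ax i; [move=> _; exact: Ax|exact: (Ax i I)].
Qed.

Lemma measurable_cube n k : measurable (@cube n k).
Proof.
exact: (@measurable_rect n (fun=> [set` `[- k, k]])).
Qed.

Lemma cube_measure n (k : R) : 0 <= k ->
  lebesgue_rV R n (cube k) = ((2 * k) ^+ n)%:E.
Proof.
move=> k0; have := @lebesgue_rV_box R n (const_mx (- k)) (const_mx k).
rewrite (_ : (fun x => _) = cube k); last first.
  by apply/seteqP; split => x /= + i => /(_ i); rewrite !mxE.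
rewrite (_ : \prod_(i < n) _ = (2 * k) ^+ n); last first.
  under eq_bigr do rewrite !mxE opprK -mulr2n -[k *+ 2]mulr_natl.
  by rewrite prodr_const card_ord.
by apply=> i; rewrite !mxE; lra.
Qed.

Lemma cube_mx_norm n (x : 'rV[R]_n) (k : R) : 0 <= k -> cube k x <-> `|x| <= k.
Proof.
move=> k0; split=> [xk|xk i].
  rewrite [leLHS]mx_normrE; apply: bigmax_le => // -[i j] _ /=; rewrite ord1.
  by have := xk j; rewrite in_itv/= ler_norml.
rewrite in_itv/= -ler_norml; apply: le_trans xk.
by rewrite [leRHS]mx_normrE; apply: (le_bigmax _ _ (0, i)).
Qed.

Lemma lebesgue_rV_sigma_finite n : sigma_finite setT (lebesgue_rV R n).
Proof.
exists (fun k : nat => cube k%:R).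
  apply/seteqP; split => // x _.
  exists (Num.truncn `|x|).+1 => //=; apply/cube_mx_norm => //.
  by rewrite ltW// truncnS_gt.
move=> k; split; first exact: measurable_cube.
by rewrite cube_measure// ltry.
Qed.

(** A constant to which the sigma-finite structure is attached, since [lebesgue_rV] returns an
    already packed measure. Tonelli's theorem is applied to [leb] and its conclusions are read back
    by conversion. *)
Definition leb n : set 'rV[R]_n -> \bar R := lebesgue_rV R n.

HB.instance Definition _ n := Measure.copy (@leb n) (lebesgue_rV R n).
HB.instance Definition _ n :=
  Measure_isSigmaFinite.Build _ _ _ (@leb n) (@lebesgue_rV_sigma_finite n).

End sigma_finite_rV.

(** * Tonelli's theorem and affine changes of variables *)

Section fubini_rV.
Variable R : realType.
Local Open Scope ereal_scope.

Lemma tonelli d (T : measurableType d) (m : {sigma_finite_measure set T -> \bar R})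
  n (f : 'rV[R]_n * T -> \bar R) : measurable_fun setT f -> (forall z, 0 <= f z) ->
  \int[lebesgue_rV R n]_x \int[m]_t f (x, t) =
  \int[m]_t \int[lebesgue_rV R n]_x f (x, t).
Proof.
move=> mf f0.
by have := @fubini_tonelli _ _ _ _ R (@leb R n) m f mf f0.
Qed.

Lemma measurable_tonelli1 d (T : measurableType d) (m : {sigma_finite_measure set T -> \bar R})
  n (f : 'rV[R]_n * T -> \bar R) : measurable_fun setT f -> (forall z, 0 <= f z) ->
  measurable_fun setT (fun x => \int[m]_t f (x, t)).
Proof.
by move=> mf f0; exact: (@measurable_fun_fubini_tonelli_F _ _ _ _ R m f).
Qed.

Lemma measurable_tonelli2 d (T : measurableType d)
  n (f : 'rV[R]_n * T -> \bar R) : measurable_fun setT f -> (forall z, 0 <= f z) ->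
  measurable_fun setT (fun t => \int[lebesgue_rV R n]_x f (x, t)).
Proof.
by move=> mf f0; exact: (@measurable_fun_fubini_tonelli_G _ _ _ _ R (@leb R n) f).
Qed.

Lemma integral_rVS n (f : 'rV[R]_n.+1 -> \bar R) :
  measurable_fun setT f -> (forall z, 0 <= f z) ->
  \int[lebesgue_rV R n.+1]_x f x =
  \int[lebesgue_rV R n]_x \int[lebesgue_measure]_t f (rV_cons (x, t)).
Proof.
move=> mf f0.
have H0 := @ge0_integral_pushforward _ _ (Datatypes_prod__canonical__measurable_structure_Measurable
  'rV[R]_n (measurableTypeR R)) _ R (@rV_cons R n) (measurable_rV_cons (n := n)).
have := H0 (leb (n := n) \x @lebesgue_measure R) setT f measurableT mf (fun y _ => f0 y).
have mc : measurable_fun setT (f \o @rV_cons R n).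
  by apply: measurableT_comp => //; exact: measurable_rV_cons.
have E := @fubini_tonelli1 _ _ _ _ R (@leb R n) (@lebesgue_measure R) _ mc (fun z => f0 _).
by rewrite preimage_setT => H; exact: (etrans H E).
Qed.

(** By uniqueness of Lebesgue measure: c times the image measure under t |-> c t + a gives every
    half-open interval its length. The integral then transforms as a pushforward. *)
Lemma integral_affine1 (f : R -> \bar R) (c a : R) : (0 < c)%R ->
  measurable_fun setT f -> (forall t, 0 <= f t) ->
  \int[lebesgue_measure]_t f (c * t + a)%R = (c^-1)%:E * \int[lebesgue_measure]_t f t.
Proof.
move=> c0 mf f0.
have ci0 : (0 < c^-1)%R by rewrite invr_gt0.
pose phi (t : measurableTypeR R) : measurableTypeR R := (c * t + a)%R.
have mphi : measurable_fun setT phi.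
  by apply: measurable_funD => //; exact: mulrl_measurable.
rewrite -(@ge0_integral_mscale _ _ _ lebesgue_measure setT _ (NngNum (ltW ci0)) f)//.
rewrite -[in LHS](@ge0_integral_pushforward _ _ _ _ R phi mphi lebesgue_measure setT f)//.
have key (A : set (measurableTypeR R)) : measurable A ->
  lebesgue_measure A = mscale (NngNum (ltW c0)) (pushforward lebesgue_measure phi) A.
  move=> mA.
  apply: (@lebesgue_measure_unique R (mscale (NngNum (ltW c0)) (pushforward lebesgue_measure phi))) => //.
  move=> _ [[x y] _ <-]/=.
  rewrite /mscale/= /pushforward.
  rewrite (_ : phi @^-1` _ = [set` `](x - a)%R / c, (y - a)%R / c]%R]); last first.
    apply/seteqP; split => t; rewrite /phi/= !in_itv/= ltr_pdivrMr// ler_pdivlMr// ltrBlDr lerBrDr;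
    by rewrite [(t * c)%R]mulrC.
  rewrite !lebesgue_measure_itv/= !lte_fin ltr_pM2r// ltrD2r.
  case: ifPn => // xy; last by rewrite mule0.
  rewrite -!EFinD -EFinM; congr EFin; field; exact: lt0r_neq0.
apply: eq_measure_integral => A mA _.
rewrite /mscale/=.
transitivity ((c^-1)%:E * (c%:E * pushforward lebesgue_measure phi A)).
  by rewrite muleA -EFinM mulVf ?mul1e//; exact: lt0r_neq0.
by rewrite -[_ * pushforward _ _ _](key mphi).
Qed.

Lemma integral_opp1 (f : R -> \bar R) :
  measurable_fun setT f -> (forall t, 0 <= f t) ->
  \int[lebesgue_measure]_t f (- t)%R = \int[lebesgue_measure]_t f t.
Proof.
move=> mf f0.
pose phi (t : measurableTypeR R) : measurableTypeR R := (- t)%R.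
have mphi : measurable_fun setT phi by exact: oppr_measurable.
rewrite -[in LHS](@ge0_integral_pushforward _ _ _ _ R phi mphi lebesgue_measure setT f)//.
by apply: eq_measure_integral => A mA _; exact: lebesgue_measureN.
Qed.

Lemma measurable_rV_row d (T : measurableType d) n (f : T -> 'rV[R]_n) :
  measurable_fun setT f <-> forall i, measurable_fun setT (fun t => f t 0%R i).
Proof.
split=> [mf i|]; last exact: measurable_fun_rV.
exact: (measurableT_comp (measurable_coord i)).
Qed.

Lemma affineE n (c : R) (x a : 'rV[R]_n) i :
  ((c *: x + a) 0 i = c * x 0 i + a 0 i)%R.
Proof. by rewrite !mxE. Qed.

Lemma measurable_affine n (c : R) (a : 'rV[R]_n) :
  measurable_fun setT (fun x : 'rV[R]_n => c *: x + a)%R.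
Proof.
apply/measurable_rV_row => i; under eq_fun do rewrite !mxE.
apply: measurable_funD => //; apply: measurable_funM => //.
exact: measurable_coord.
Qed.

Lemma integral_affine n (f : 'rV[R]_n -> \bar R) (c : R) (a : 'rV[R]_n) : (0 < c)%R ->
  measurable_fun setT f -> (forall t, 0 <= f t) ->
  \int[lebesgue_rV R n]_t f (c *: t + a)%R =
  (c^-1 ^+ n)%:E * \int[lebesgue_rV R n]_t f t.
Proof.
move=> c0; elim: n f a => [f a mf f0|n IH f a mf f0].
  rewrite expr0 mul1e; apply: eq_integral => x _; congr f.
  by apply/rowP => -[].
rewrite !integral_rVS//; last first.
  by apply: measurableT_comp => //; exact: measurable_affine.
pose F (x : 'rV[R]_n) := \int[lebesgue_measure]_t f (rV_cons (x, t)).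
have mfc : measurable_fun setT (fun z : 'rV[R]_n * R => f (rV_cons z)).
  by apply: measurableT_comp => //; exact: measurable_rV_cons.
have mF : measurable_fun setT F by apply: (@measurable_tonelli1 _ _ lebesgue_measure _ (fun z => f (rV_cons z))).
have F0 x : 0 <= F x by apply: integral_ge0.
transitivity (\int[lebesgue_rV R n]_x ((c^-1)%:E * F (c *: x + \row_i a 0%R (lift ord0 i))%R)).
  apply: eq_integral => x _.
  rewrite /F -(@integral_affine1 _ c (a 0%R ord0)) => //; last first.
    by apply: (measurableT_comp mfc); exact: measurable_pair1.
  apply: eq_integral => t _; congr f; apply/rowP => i.
  case: (unliftP ord0 i) => [j|] ->; first by rewrite affineE !rV_consS affineE mxE.
  by rewrite affineE !rV_cons0.
rewrite ge0_integralZl_EFin; first by rewrite IH// muleA -EFinM exprS.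
- exact: measurableT.
- by move=> x _; exact: F0.
- by apply: (measurableT_comp mF); exact: measurable_affine.
- by rewrite invr_ge0 ltW.
Qed.

Lemma integral_shift n (f : 'rV[R]_n -> \bar R) (a : 'rV[R]_n) :
  measurable_fun setT f -> (forall t, 0 <= f t) ->
  \int[lebesgue_rV R n]_t f (t + a)%R = \int[lebesgue_rV R n]_t f t.
Proof.
move=> mf f0; rewrite -[RHS]mul1e -[X in X%:E * _](expr1n _ n) -invr1 -(@integral_affine _ _ _ a)//.
by under [RHS]eq_integral do rewrite scale1r.
Qed.

End fubini_rV.

(** * Scalar product and hyperplane reflections *)

Section reflection_rV.
Variable R : realType.

Lemma dotC n (x y : 'rV[R]_n) : dot x y = dot y x.
Proof. by apply: eq_bigr => i _; rewrite mulrC. Qed.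

Lemma dotDl n (x y z : 'rV[R]_n) : dot (x + y) z = dot x z + dot y z.
Proof. by rewrite -big_split/=; apply: eq_bigr => i _; rewrite mxE mulrDl. Qed.

Lemma dotDr n (x y z : 'rV[R]_n) : dot z (x + y) = dot z x + dot z y.
Proof. by rewrite dotC dotDl !(dotC z). Qed.

Lemma dotZl n k (x y : 'rV[R]_n) : dot (k *: x) y = k * dot x y.
Proof. by rewrite mulr_sumr; apply: eq_bigr => i _; rewrite mxE mulrA. Qed.

Lemma dotZr n k (x y : 'rV[R]_n) : dot x (k *: y) = k * dot x y.
Proof. by rewrite dotC dotZl dotC. Qed.

Lemma dotNl n (x y : 'rV[R]_n) : dot (- x) y = - dot x y.
Proof. by rewrite -scaleN1r dotZl mulN1r. Qed.

Lemma dotNr n (x y : 'rV[R]_n) : dot x (- y) = - dot x y.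
Proof. by rewrite dotC dotNl dotC. Qed.

Definition dotE := (dotDl, dotDr, dotNl, dotNr, dotZl, dotZr).

Lemma dot0 n (x : 'rV[R]_n) : dot 0 x = 0.
Proof. by rewrite -(scale0r 0) dotZl mul0r. Qed.

Lemma dot_ge0 n (x : 'rV[R]_n) : 0 <= dot x x.
Proof. by apply: sumr_ge0 => i _; rewrite -expr2 sqr_ge0. Qed.

Lemma dot_eq0 n (x : 'rV[R]_n) : (dot x x == 0) = (x == 0).
Proof.
apply/idP/eqP => [|->]; last by rewrite dot0.
rewrite psumr_eq0 => [/allP x0|i _]; last by rewrite -expr2 sqr_ge0.
apply/rowP => i; have := x0 i (mem_index_enum _).
by rewrite mxE /= -expr2 sqrf_eq0 => /eqP.
Qed.

Lemma dot_gt0 n (x : 'rV[R]_n) : (0 < dot x x) = (x != 0).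
Proof. by rewrite lt_def dot_ge0 andbT dot_eq0. Qed.

(** Orthogonal reflection in the hyperplane [dot w x = c]. For [w = 0] the division by zero yields
    the identity, a case that occurs in the induction on the dimension for [integral_refl]. *)
Definition refl n (w : 'rV[R]_n) (c : R) (x : 'rV[R]_n) : 'rV[R]_n :=
  x - (2 * (dot w x - c) / dot w w) *: w.

Lemma reflK n (w : 'rV[R]_n) c : w != 0 -> involutive (refl w c).
Proof.
move=> w0 x; have ww : dot w w != 0 by rewrite dot_eq0.
rewrite {1}/refl [X in dot w X]/refl !dotE {1}/refl -addrA -opprD -scalerDl.
rewrite (_ : _ / _ + _ = 0) ?scale0r ?subr0//; field; exact: ww.
Qed.

Lemma dot_cons n (w : 'rV[R]_n.+1) (z : 'rV[R]_n * R) :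
  dot w (rV_cons z) = dot (\row_i w 0 (lift ord0 i)) z.1 + w 0 ord0 * z.2.
Proof.
rewrite /dot big_ord_recl rV_cons0 addrC; congr (_ + _).
by apply: eq_bigr => i _; rewrite rV_consS mxE.
Qed.

Lemma measurable_dot d (T : measurableType d) n (f g : T -> 'rV[R]_n) :
  measurable_fun setT f -> measurable_fun setT g ->
  measurable_fun setT (fun x => dot (f x) (g x)).
Proof.
move=> /measurable_rV_row mf /measurable_rV_row mg.
apply: measurable_sum => i.
exact: measurable_funM.
Qed.

Lemma measurable_enorm d (T : measurableType d) n (f : T -> 'rV[R]_n) :
  measurable_fun setT f -> measurable_fun setT (fun x => enorm (f x)).
Proof.
move=> mf; apply: (measurableT_comp _ (measurable_dot mf mf)).
exact: continuous_measurable_fun (@sqrt_continuous R).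
Qed.

Lemma measurable_rV_add d (T : measurableType d) n (f g : T -> 'rV[R]_n) :
  measurable_fun setT f -> measurable_fun setT g ->
  measurable_fun setT (fun x => f x + g x).
Proof.
move=> /measurable_rV_row mf /measurable_rV_row mg; apply/measurable_rV_row => i.
by under eq_fun do rewrite mxE; exact: measurable_funD.
Qed.

Lemma measurable_rV_scale d (T : measurableType d) n (k : T -> R) (f : T -> 'rV[R]_n) :
  measurable_fun setT k -> measurable_fun setT f ->
  measurable_fun setT (fun x => k x *: f x).
Proof.
move=> mk /measurable_rV_row mf; apply/measurable_rV_row => i.
by under eq_fun do rewrite mxE; exact: measurable_funM.
Qed.

Lemma measurable_rV_opp d (T : measurableType d) n (f : T -> 'rV[R]_n) :
  measurable_fun setT f -> measurable_fun setT (fun x => - f x).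
Proof.
move=> mf; under eq_fun do rewrite -scaleN1r.
exact: measurable_rV_scale.
Qed.

Lemma measurable_refl n (w : 'rV[R]_n) c : measurable_fun setT (refl w c).
Proof.
apply: measurable_rV_add => //; apply: measurable_rV_opp.
apply: measurable_rV_scale => //.
apply: measurable_funM => //; apply: measurable_funM => //.
apply: measurable_funB => //; exact: measurable_dot.
Qed.

End reflection_rV.

(** * Invariance of Lebesgue measure under reflections *)

Section reflection_invariance.
Variable R : realType.
Local Open Scope ereal_scope.

Lemma integral_shift1 (f : R -> \bar R) (a : R) :
  measurable_fun setT f -> (forall t, 0 <= f t) ->
  \int[lebesgue_measure]_t f (t + a)%R = \int[lebesgue_measure]_t f t.
Proof.
move=> mf f0; rewrite -[RHS]mul1e -[X in X%:E * _]invr1 -(@integral_affine1 _ _ _ a)//.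
by under [RHS]eq_integral do rewrite mul1r.
Qed.

Lemma measurable_pairT d d1 d2 (T : measurableType d) (T1 : measurableType d1)
  (T2 : measurableType d2) (f : T -> T1) (g : T -> T2) :
  measurable_fun setT f -> measurable_fun setT g ->
  measurable_fun setT (fun x => (f x, g x)).
Proof. by move=> mf mg; exact/measurable_fun_pairP. Qed.

(** With t the coordinate 0 and x the remaining ones, the reflection decomposes into shears in t, a
    translation of x depending on t, and t |-> - t. Each preserves the integral by Tonelli's theorem
    and invariance in lower dimension. Shearing divides by [w0]. *)
Let integral_refl_head n (w : 'rV[R]_n.+1) (f : 'rV[R]_n.+1 -> \bar R) : w 0%R ord0 != 0%R ->
  measurable_fun setT f -> (forall x, 0 <= f x) ->
  \int[lebesgue_rV R n.+1]_x f (refl w 0%R x) = \int[lebesgue_rV R n.+1]_x f x.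
Proof.
set w0 := w 0%R ord0; set w' := \row_i w 0%R (lift ord0 i) => w00 mf f0.
have ww : dot w w = (dot w' w' + w0 ^+ 2)%R.
  by rewrite /dot big_ord_recl addrC expr2; congr (_ + _)%R; apply: eq_bigr => i _; rewrite !mxE.
have ww_gt0 : (0 < dot w w)%R.
  by rewrite ww ltr_wpDl ?dot_ge0// exprn_even_gt0.
pose k := (2 / dot w w)%R.
have kE : (k * (dot w' w' + w0 ^+ 2) = 2)%R.
  by rewrite -ww /k divfK// gt_eqF.
pose g (z : 'rV[R]_n * R) := f (rV_cons z).
have mg : measurable_fun setT g by apply: measurableT_comp => //; exact: measurable_rV_cons.
have g0 z : 0 <= g z by exact: f0.
have mfr : measurable_fun setT (fun x => f (refl w 0%R x)).
  by apply: measurableT_comp => //; exact: measurable_refl.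
have reflE (x : 'rV[R]_n) t : refl w 0%R (rV_cons (x, t)) =
    rV_cons (x - (k * (dot w' x + w0 * t)) *: w', t - k * (dot w' x + w0 * t) * w0)%R.
  apply/rowP => i; rewrite /refl dot_cons subr0 -/w' -/w0/= [X in X *: w](_ : _ = (k * (dot w' x + w0 * t)))%R; last by rewrite /k; ring.
  case: (unliftP ord0 i) => [j|] ->; rewrite ?rV_consS ?rV_cons0/=.
    by rewrite mxE rV_consS !mxE.
  by rewrite mxE rV_cons0 !mxE.
rewrite (integral_rVS mfr (fun x => f0 _)) (integral_rVS mf f0).
pose A (z : 'rV[R]_n * R) := (z.1 - (k * w0 * z.2) *: w', z.2 - dot w' z.1 / w0 - k * w0 ^+ 2 * z.2)%R.
have mA : measurable_fun setT A.
  apply: measurable_pairT.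
    apply: measurable_rV_add => //; apply: measurable_rV_opp; apply: measurable_rV_scale => //.
    exact: measurable_funM.
  apply: measurable_funB; last exact: measurable_funM.
  by apply: measurable_funB => //; apply: measurable_funM => //; exact: measurable_dot.
pose B (z : 'rV[R]_n * R) := (z.1, - z.2 - dot w' z.1 / w0)%R.
have mB : measurable_fun setT B.
  apply: measurable_pairT => //.
  apply: measurable_funB; first by apply: (measurableT_comp (@oppr_measurable R _)).
  by apply: measurable_funM => //; exact: measurable_dot.
(* after the shear t = tau - (w'.x)/w0, the reflection acts as x |-> x - k w0 tau w' *)
transitivity (\int[lebesgue_rV R n]_x \int[lebesgue_measure]_t (g \o A) (x, t)).
  apply: eq_integral => x _.
  rewrite -(@integral_shift1 (fun t => (g \o A) (x, t)) (dot w' x / w0)%R); last 2 first.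
  - apply: (measurableT_comp mg); apply: (measurableT_comp mA); exact: measurable_pair1.
  - by move=> t; exact: g0.
  apply: eq_integral => t _; rewrite reflE /A /g/=; congr (f (rV_cons (_, _))).
    by congr (_ - _ *: _)%R; field.
  by field.
rewrite (@tonelli _ _ _ lebesgue_measure _ (g \o A)); last 2 first.
- exact: measurableT_comp.
- by move=> z; exact: g0.
transitivity (\int[lebesgue_measure]_t \int[lebesgue_rV R n]_x (g \o B) (x, t)).
  apply: eq_integral => t _.
  rewrite -[RHS](@integral_shift R _ (fun x => (g \o B) (x, t)) (- ((k * w0 * t) *: w'))%R); last 2 first.
  - apply: (measurableT_comp mg); apply: (measurableT_comp mB); exact: measurable_pair2.
  - by move=> y; exact: g0.
  apply: eq_integral => x _; rewrite /A /B /g/=; congr (f (rV_cons (_, _))).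
  rewrite !dotE.
  (* The normalization [kE] of the reflection turns 1 - k w0^2 into - 1 + k |w'|^2, which is where
     the sign change of t appears. *)
  transitivity (t - dot w' x / w0 - (2 - k * dot w' w') * t)%R; first by rewrite -kE; ring.
  by field.
rewrite -(@tonelli _ _ _ lebesgue_measure _ (g \o B)); last 2 first.
- exact: measurableT_comp.
- by move=> z; exact: g0.
apply: eq_integral => x _.
have mgx : measurable_fun setT (fun t => g (x, t)).
  by apply: (measurableT_comp mg); exact: measurable_pair1.
transitivity (\int[lebesgue_measure]_t g (x, t - dot w' x / w0)%R).
  apply: (@integral_opp1 R (fun t => g (x, t - dot w' x / w0)%R)) => //.
  by apply: (measurableT_comp mgx); exact: measurable_funB.
exact: (@integral_shift1 (fun t => g (x, t))).
Qed.

(** Induction on the dimension: when the coordinate 0 of w vanishes, the reflection fixes this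
    coordinate and reflects the others with respect to the remaining part of w. *)
Let integral_refl0 n (w : 'rV[R]_n) (f : 'rV[R]_n -> \bar R) :
  measurable_fun setT f -> (forall x, 0 <= f x) ->
  \int[lebesgue_rV R n]_x f (refl w 0%R x) = \int[lebesgue_rV R n]_x f x.
Proof.
elim: n w f => [|n IH] w f mf f0.
  by apply: eq_integral => x _; congr f; apply/rowP => -[].
have [w0|] := eqVneq (w 0%R ord0) 0%R; last by move=> ?; exact: integral_refl_head.
set w' := \row_i w 0%R (lift ord0 i).
have ww : dot w w = dot w' w'.
  by rewrite /dot big_ord_recl w0 mul0r add0r; apply: eq_bigr => i _; rewrite !mxE.
have mfr : measurable_fun setT (fun x => f (refl w 0%R x)).
  by apply: measurableT_comp => //; exact: measurable_refl.
rewrite (integral_rVS mfr (fun x => f0 _)) (integral_rVS mf f0).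
rewrite -[RHS](IH w' (fun x => \int[lebesgue_measure]_t f (rV_cons (x, t)))); last first.
- by move=> x; apply: integral_ge0.
- apply: (@measurable_tonelli1 _ _ _ lebesgue_measure _ (fun z => f (rV_cons z))) => //.
  by apply: measurableT_comp => //; exact: measurable_rV_cons.
apply: eq_integral => x _; apply: eq_integral => t _; congr f.
apply/rowP => i; rewrite /refl dot_cons ww -/w' w0 mul0r addr0/=.
case: (unliftP ord0 i) => [j|] ->; rewrite ?rV_consS ?rV_cons0/= mxE ?rV_consS ?rV_cons0 !mxE//=.
by rewrite w0 mulr0 subr0.
Qed.

(** [refl w c] is [refl w 0] followed by the translation by 2 c w / |w|^2. *)
Lemma integral_refl n (w : 'rV[R]_n) (c : R) (f : 'rV[R]_n -> \bar R) :
  measurable_fun setT f -> (forall x, 0 <= f x) ->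
  \int[lebesgue_rV R n]_x f (refl w c x) = \int[lebesgue_rV R n]_x f x.
Proof.
move=> mf f0; rewrite -(@integral_shift R _ f ((2 * c / dot w w) *: w))//.
rewrite -[RHS](@integral_refl0 _ w)//; last first.
  by apply: measurableT_comp => //; exact: measurable_rV_add.
apply: eq_integral => x _; congr f; rewrite /refl -addrA; congr (_ + _)%R.
by apply/rowP => i; rewrite !mxE subr0; ring.
Qed.

End reflection_invariance.

(** * Borel sets and the Euclidean norm *)

Section borel_rV.
Variable R : realType.

(** The sigma-algebra is generated by the coordinates and the topology by the sup norm; the
    countably many open cubes with rational centre and side 2 / (k + 1) connect the two. *)
Lemma open_measurable_rV n (A : set 'rV[R]_n) : open A -> measurable A.
Proof.
move=> oA.
pose box (z : 'rV[rat]_n * nat) : set 'rV[R]_n :=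
  [set x | forall i, x 0 i \in `](ratr (z.1 0 i) - z.2.+1%:R^-1), (ratr (z.1 0 i) + z.2.+1%:R^-1)[ ].
have mbox z : measurable (box z).
  exact: (@measurable_rect R n (fun i => [set` `](ratr (z.1 0 i) - z.2.+1%:R^-1), (ratr (z.1 0 i) + z.2.+1%:R^-1)[])).
pose D := [set z | box z `<=` A].
have -> : A = \bigcup_(z in D) box z.
  apply/seteqP; split=> [x Ax|x [z Dz]]; last exact: Dz.
  have /nbhs_ballP[e /= e0 xeA] : nbhs x A by move: oA; rewrite openE; exact.
  have [k k2] : exists k : nat, k.+1%:R^-1 < e / 2.
    exists (Num.truncn (e / 2)^-1).
    by rewrite invf_plt ?posrE// ?divr_gt0// truncnS_gt.
  have qP i : exists q : rat, ratr q \in `](x 0 i - k.+1%:R^-1), (x 0 i + k.+1%:R^-1)[.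
    by apply: rat_in_itvoo; rewrite ltrD2l gtrN// invr_gt0.
  pose q := \row_i xchoose (qP i).
  have qx i : `|x 0 i - ratr (q 0 i)| < k.+1%:R^-1.
    rewrite mxE; have := xchooseP (qP i); rewrite in_itv/= distrC ltr_norml.
    by move=> /andP[? ?]; rewrite ltrBrDl; apply/andP; split=> //; rewrite ltrBlDl.
  exists (q, k); last first.
    move=> i /=; rewrite in_itv/=; have := qx i; rewrite ltr_norml.
    by move=> /andP[]; rewrite ltrBrDl => ->; rewrite ltrBlDl => ->.
  move=> y /= yq; apply: xeA; rewrite mx_norm_ball /ball_/=.
  rewrite [ltLHS]mx_normrE; apply: bigmax_lt => // -[i j] _ /=; rewrite ord1 !mxE.
  have := yq j; have := qx j; rewrite in_itv/= ltr_norml => /andP[a1 a2] /andP[b1 b2].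
  rewrite ltr_norml; move: k2 a1 a2 b1 b2; move: (ratr (q 0 j)) (k.+1%:R^-1 : R) => u v *.
  by apply/andP; split; lra.
by rewrite bigcup_mkcond; apply: countable_bigcupT_measurable => [|z]; [exact: countableP|case: ifP].
Qed.

Lemma continuous_measurable_rV n (f : 'rV[R]_n -> R) : continuous f ->
  measurable_fun setT f.
Proof.
move=> /continuousP cf; apply: (measurability _ (RGenOpens.measurableE R)).
move=> _ [_ [x [y ->]] <-]; rewrite setTI; apply: open_measurable_rV; apply: cf.
rewrite (_ : [set` _] = [set z | x < z] `&` [set z | z < y]).
  by apply: openI; [exact: open_gt|exact: open_lt].
by apply/seteqP; split => z /=; rewrite in_itv/= => /andP.
Qed.

Lemma rV_norm_lt n (x : 'rV[R]_n) (e : R) : 0 < e ->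
  (forall i, `|x 0 i| < e) -> `|x| < e.
Proof.
move=> e0 xe; rewrite [ltLHS]mx_normrE; apply: bigmax_lt => // -[i j] _ /=.
by rewrite ord1.
Qed.

Lemma rV_norm_le n (x : 'rV[R]_n) (e : R) : 0 <= e ->
  (forall i, `|x 0 i| <= e) -> `|x| <= e.
Proof.
move=> e0 xe; rewrite [leLHS]mx_normrE; apply: bigmax_le => // -[i j] _ /=.
by rewrite ord1.
Qed.

Lemma coord_le_norm n (x : 'rV[R]_n) i : `|x 0 i| <= `|x|.
Proof. by rewrite [leRHS]mx_normrE; apply: (le_bigmax _ _ (0, i)). Qed.

Lemma enormE n (x : 'rV[R]_n) : enorm x ^+ 2 = dot x x.
Proof. by rewrite sqr_sqrtr// dot_ge0. Qed.

Lemma enorm_ge0 n (x : 'rV[R]_n) : 0 <= enorm x.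
Proof. exact: sqrtr_ge0. Qed.

Lemma enormZ n (k : R) (x : 'rV[R]_n) : enorm (k *: x) = `|k| * enorm x.
Proof. by rewrite /enorm !dotE mulrA -expr2 sqrtrM ?sqr_ge0// sqrtr_sqr. Qed.

Lemma enorm0 n : enorm (0 : 'rV[R]_n) = 0.
Proof. by rewrite /enorm dot0 sqrtr0. Qed.

Lemma enorm_eq0 n (x : 'rV[R]_n) : (enorm x == 0) = (x == 0).
Proof. by rewrite sqrtr_eq0 le_eqVlt ltNge dot_ge0 orbF dot_eq0. Qed.

Lemma enorm_gt0 n (x : 'rV[R]_n) : (0 < enorm x) = (x != 0).
Proof. by rewrite lt_def enorm_ge0 andbT enorm_eq0. Qed.

Lemma coord_le_enorm n (x : 'rV[R]_n) i : `|x 0 i| <= enorm x.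
Proof.
rewrite -sqrtr_sqr ler_wsqrtr// /dot (bigD1 i)//= -expr2 lerDl.
by apply: sumr_ge0 => j _; rewrite -expr2 sqr_ge0.
Qed.

Lemma norm_le_enorm n (x : 'rV[R]_n) : `|x| <= enorm x.
Proof. by apply: rV_norm_le => // [|i]; rewrite ?enorm_ge0// coord_le_enorm. Qed.

Lemma dot_le_norm n (x : 'rV[R]_n) : dot x x <= n%:R * `|x| ^+ 2.
Proof.
have -> : n%:R = \sum_(i < n) 1 :> R by rewrite sumr_const card_ord.
rewrite mulr_suml; apply: ler_sum => i _; rewrite mul1r -expr2 -real_normK ?num_real//.
by rewrite ler_sqr ?nnegrE// coord_le_norm.
Qed.

Lemma enorm_le_norm n (x : 'rV[R]_n) : enorm x <= n%:R * `|x|.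
Proof.
rewrite -(@ler_pXn2r _ 2) ?nnegrE ?mulr_ge0 ?enorm_ge0// enormE exprMn.
apply: le_trans (dot_le_norm x) _; apply: ler_wpM2r; first exact: sqr_ge0.
by rewrite -natrX ler_nat; case: n {x} => // n; rewrite expnS expn1 leq_pmulr.
Qed.

Lemma dot_cauchy n (x y : 'rV[R]_n) : dot x y ^+ 2 <= dot x x * dot y y.
Proof.
have [->|y0] := eqVneq y 0; first by rewrite dotC !dot0 expr0n/= mulr0.
have y2 : 0 < dot y y by rewrite dot_gt0.
have := dot_ge0 (dot y y *: x - dot x y *: y).
rewrite !dotE (dotC y x).
rewrite (_ : _ + _ = dot y y * (dot x x * dot y y - dot x y ^+ 2)); last by ring.
by rewrite pmulr_rge0// subr_ge0.
Qed.

Lemma norm_dot_le n (x y : 'rV[R]_n) : `|dot x y| <= enorm x * enorm y.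
Proof.
rewrite -(@ler_pXn2r _ 2) ?nnegrE ?mulr_ge0 ?enorm_ge0// exprMn !enormE.
by rewrite real_normK ?num_real// dot_cauchy.
Qed.

Lemma enormD n (x y : 'rV[R]_n) : enorm (x + y) <= enorm x + enorm y.
Proof.
rewrite -(@ler_pXn2r _ 2) ?nnegrE ?addr_ge0 ?enorm_ge0// sqrrD !enormE.
have := norm_dot_le x y; have := ler_norm (dot x y).
rewrite !dotE (dotC y x) -mulr_natl => h1 h2; lra.
Qed.

Lemma enormN n (x : 'rV[R]_n) : enorm (- x) = enorm x.
Proof. by rewrite /enorm !dotE opprK. Qed.

Lemma continuous_dot n (f g : 'rV[R]_n -> 'rV[R]_n) : continuous f -> continuous g ->
  continuous (fun x => dot (f x) (g x)).
Proof.
move=> cf cg; apply: (@continuous_big R 'I_n +%R 0 xpredT) => [|i _ x]; first exact: add_continuous.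
apply: continuousM.
  by apply: (@continuous_comp _ _ _ f (fun M : 'rV[R]_n => M 0 i)); [exact: cf|exact: coord_continuous].
by apply: (@continuous_comp _ _ _ g (fun M : 'rV[R]_n => M 0 i)); [exact: cg|exact: coord_continuous].
Qed.

Lemma continuous_enorm n : continuous (@enorm R n).
Proof.
move=> x; apply: continuous_comp; last exact: sqrt_continuous.
by apply: continuous_dot => ?; exact: cvg_id.
Qed.

Definition eball n (r : R) : set 'rV[R]_n := [set x | enorm x < r].

Lemma measurable_eball n r : measurable (@eball n r).
Proof.
rewrite (_ : eball r = setT `&` (@enorm R n) @^-1` [set` `]-oo, r[]).
  exact: (measurable_enorm (@measurable_id _ 'rV[R]_n setT) measurableT (measurable_itv `]-oo, r[)).
by rewrite setTI; apply/seteqP; split => x; rewrite /eball /= in_itv/=.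
Qed.

Lemma cube_sub_eball n r : (0 < n)%N -> 0 < r -> cube (r / (2 * n%:R)) `<=` @eball n r.
Proof.
move=> n0 r0 x; have n0' : 0 < n%:R :> R by rewrite ltr0n.
move/cube_mx_norm => xr; rewrite /eball/=; apply: le_lt_trans (enorm_le_norm x) _.
have : `|x| <= r / (2 * n%:R) by apply: xr; rewrite divr_ge0 ?mulr_ge0// ltW.
rewrite -(ler_pM2l n0') => /le_lt_trans; apply.
rewrite [ltLHS](_ : _ = r / 2); last first.
  by rewrite invfM mulrCA mulrA mulrCA -mulrA divff ?mulr1 ?gt_eqF// mulrC.
by rewrite ltr_pdivrMr// ltr_pMr// ltr1n.
Qed.

Lemma eball_sub_cube n r : 0 < r -> @eball n r `<=` cube r.
Proof.
move=> r0 x /ltW xr; apply/cube_mx_norm; first exact: ltW.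
exact: le_trans (norm_le_enorm x) xr.
Qed.

Lemma eball_measure_ge n r : (0 < n)%N -> 0 < r ->
  (((r / n%:R) ^+ n)%:E <= lebesgue_rV R n (@eball n r))%E.
Proof.
move=> n0 r0; have n0' : n%:R != 0 :> R by rewrite pnatr_eq0 -lt0n.
have k0 : 0 <= r / (2 * n%:R) by rewrite divr_ge0 ?mulr_ge0// ltW.
rewrite (_ : r / n%:R = 2 * (r / (2 * n%:R))); last by field.
rewrite -cube_measure//; apply: le_measure; rewrite ?inE.
- exact: measurable_cube.
- exact: measurable_eball.
- exact: cube_sub_eball.
Qed.

Lemma eball_measure_lty n r : (lebesgue_rV R n (@eball n r) < +oo)%E.
Proof.
apply: (@le_lt_trans _ _ (lebesgue_rV R n (cube (Num.max r 1)))); last first.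
  by rewrite cube_measure ?ltry// le_max ler01 orbT.
apply: le_measure; rewrite ?inE.
- exact: measurable_eball.
- exact: measurable_cube.
- move=> x xr; apply: eball_sub_cube; first by rewrite lt_max ltr01 orbT.
  by apply: lt_le_trans xr _; rewrite le_max lexx.
Qed.

Lemma bounded_measure_lty n (A : set 'rV[R]_n) : measurable A -> bounded_set A ->
  (lebesgue_rV R n A < +oo)%E.
Proof.
move=> mA [M [Mr AM]].
apply: (@le_lt_trans _ _ (lebesgue_rV R n (cube (`|M| + 1)))); last first.
  by rewrite cube_measure ?ltry.
apply: le_measure; rewrite ?inE//; first exact: measurable_cube.
move=> x Ax; apply/cube_mx_norm => //; apply: AM => //.
by rewrite ltr_pwDr// ler_norm.
Qed.

Lemma compact_closed_rV n (K : set 'rV[R]_n) : compact K -> closed K.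
Proof. by apply: compact_closed; exact: norm_hausdorff. Qed.

Lemma compact_measurable_rV n (K : set 'rV[R]_n) : compact K -> measurable K.
Proof.
move=> /compact_closed_rV cK; rewrite -(setCK K); apply: measurableC.
by apply: open_measurable_rV; exact: closed_openC.
Qed.

Lemma compact_measure_lty n (K : set 'rV[R]_n) : compact K ->
  (lebesgue_rV R n K < +oo)%E.
Proof.
move=> cK; apply: bounded_measure_lty; first exact: compact_measurable_rV.
exact: compact_bounded.
Qed.

(** By Tonelli's theorem, because a line parallel to the first axis meets the sphere in at most two
    points. *)
Lemma sphere_null n r : (0 < n)%N ->
  lebesgue_rV R n [set x : 'rV[R]_n | enorm x = r] = 0%E.
Proof.
case: n => // n _.
have mS : measurable [set x : 'rV[R]_n.+1 | enorm x = r].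
  rewrite -[X in measurable X]setTI.
  exact: (measurable_enorm (@measurable_id _ 'rV[R]_n.+1 setT) measurableT (measurable_set1 r)).
transitivity (\int[lebesgue_rV R n.+1]_x (\1_[set x | enorm x = r] x)%:E)%E.
  by rewrite integral_indic// setIT.
rewrite integral_rVS; last 2 first.
- by apply/measurable_EFinP; exact: measurable_indic.
- by move=> x; rewrite lee_fin.
apply: integral0_eq => x _.
pose s := r ^+ 2 - dot x x.
have sub : [set t | enorm (rV_cons (x, t)) = r] `<=` [set Num.sqrt s] `|` [set - Num.sqrt s].
  move=> t /= /(congr1 (fun t => t ^+ 2)); rewrite enormE /dot big_ord_recl rV_cons0/= => ts.
  have {}ts : t ^+ 2 = s.
    rewrite /s -ts expr2; rewrite [X in _ = _ + X - _](_ : _ = dot x x); first by ring.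
    by apply: eq_bigr => i _; rewrite rV_consS.
  rewrite -ts sqrtr_sqr; case: (ger0P t) => _; first by left.
  by right; rewrite opprK.
apply/eqP; rewrite eq_le; apply/andP; split; last by apply: integral_ge0 => t _; rewrite lee_fin.
have mT : measurable [set t : R | enorm (rV_cons (x, t)) = r].
  have m1 : measurable_fun setT (fun t : R => enorm (rV_cons (x, t))).
    apply: measurable_enorm; apply: (measurableT_comp (@measurable_rV_cons R n)).
    exact: measurable_pair1.
  by have := m1 measurableT _ (measurable_set1 r); rewrite setTI.
rewrite (_ : integral _ _ _ = \int[@lebesgue_measure R]_t (\1_[set t | enorm (rV_cons (x, t)) = r] t)%:E)%E; last first.
  by apply: eq_integral => t _; rewrite !indicE.
rewrite integral_indic// setIT.
apply: (@le_trans _ _ (@lebesgue_measure R ([set Num.sqrt s] `|` [set - Num.sqrt s]))).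
  by apply: le_measure; rewrite ?inE//; apply: measurableU.
by rewrite countable_lebesgue_measure0//; apply: finite_set_countable.
Qed.

End borel_rV.

(** * Smooth calculus *)

Section derive_eps.
Variable R : realType.

(** The increment h = 0 is included and nothing is divided by h, so derivatives on different spaces
    are exchanged by rewriting one inequality. *)
Lemma is_derive_eps (V : normedModType R) (f : V -> R) (x v : V) (df : R) :
  is_derive x v f df <->
  forall e : R, 0 < e -> exists2 d : R, 0 < d & forall h : R, `|h| < d ->
    `|f (h *: v + x) - f x - h * df| <= e * `|h|.
Proof.
split=> [[fd <-] e e0|H].
  have : h^-1 *: ((f \o shift x) (h *: v) - f x) @[h --> 0^'] --> 'D_v f x by exact: fd.
  move/cvgrPdist_le => /(_ e e0); rewrite /dnbhs/= => -[d /= d0 dP].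
  exists d => // h hd; have [->|h0] := eqVneq h 0.
    by rewrite scale0r add0r subrr mul0r subrr normr0 mulr0.
  have := dP h; rewrite /= sub0r normrN => /(_ hd h0).
  rewrite distrC -(ler_pM2r (x := `|h|)) ?normr_gt0// -normrM; congr (_ <= _).
  congr (`| _ |); rewrite /= mulrBl [_ *: _]mulrC mulfVK//; ring.
have cvgH : h^-1 *: ((f \o shift x) (h *: v) - f x) @[h --> 0^'] --> df.
  apply/cvgrPdist_le => e e0; have [d d0 dP] := H _ e0.
  exists d => //= h /=; rewrite sub0r normrN => hd h0.
  rewrite distrC -(ler_pM2r (x := `|h|)) ?normr_gt0// -normrM.
  rewrite (_ : _ * h = f (h *: v + x) - f x - h * df) ?dP//.
  rewrite mulrBl [_ *: _]mulrC mulfVK//; ring.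
by split; [apply/cvg_ex; exists df|exact/cvg_lim].
Qed.

Lemma is_derive_dir (V : normedModType R) (f : V -> R) (x v : V) (df t : R) :
  is_derive (x + t *: v) v f df <-> is_derive t (1 : R) (fun h : R => f (x + h *: v)) df.
Proof.
have E h : h *: v + (x + t *: v) = x + (h *: (1 : R) + t) *: v.
  by rewrite [h *: 1]mulr1 scalerDl addrCA.
by split=> /is_derive_eps H; apply/is_derive_eps => e /H[d d0 dP]; exists d => // h hd;
  have := dP h hd; rewrite E.
Qed.

Lemma is_derive_dir0 (V : normedModType R) (f : V -> R) (x v : V) (df : R) :
  is_derive x v f df <-> is_derive (0 : R) (1 : R) (fun h : R => f (x + h *: v)) df.
Proof. by rewrite -is_derive_dir scale0r addr0. Qed.

Lemma is_derive_comp1 (V : normedModType R) (g : R -> R) (f : V -> R) (x v : V) (df dg : R) :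
  is_derive (f x) (1 : R) g dg -> is_derive x v f df ->
  is_derive x v (g \o f) (dg * df).
Proof.
move=> Hg /is_derive_dir0 Hf; apply/is_derive_dir0.
by apply: is_derive1_comp => //; rewrite scale0r addr0.
Qed.

Lemma is_derive_dirZ (V : normedModType R) (f : V -> R) (x v : V) (c df : R) :
  is_derive x v f df -> is_derive x (c *: v) f (c * df).
Proof.
move=> /is_derive_eps H; apply/is_derive_eps => e e0.
have c1 : 0 < `|c| + 1 by rewrite ltr_wpDl.
have [d d0 dP] := H (e / (`|c| + 1)) (divr_gt0 e0 c1).
exists (d / (`|c| + 1)) => [|h hd]; first exact: divr_gt0.
rewrite scalerA mulrA; apply: (le_trans (dP (h * c) _)).
  rewrite normrM; move: hd; rewrite ltr_pdivlMr//; apply: le_lt_trans.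
  by rewrite ler_wpM2l// lerDl.
by rewrite normrM mulrAC ler_pdivrMr// -!mulrA ler_wpM2l ?(ltW e0)// ler_wpM2l// lerDl.
Qed.

Lemma is_derive_cont1 (f : R -> R) (x df : R) : is_derive x (1 : R) f df -> {for x, continuous f}.
Proof. by move=> [fd _]; apply/differentiable_continuous/derivable1_diffP. Qed.

Lemma MVT_dir (V : normedModType R) (f : V -> R) (df : R -> R) (x v : V) (h : R) :
  (forall t, is_derive (x + t *: v) v f (df t)) ->
  exists2 c, `|c| <= `|h| & f (x + h *: v) - f x = df c * h.
Proof.
move=> H; pose g (t : R) := f (x + t *: v).
have gd t : is_derive t (1 : R) g (df t) by exact: (is_derive_dir f x v (df t) t).1 (H t).
have cg : continuous g by move=> t; exact: is_derive_cont1 (gd t).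
case: (leP 0 h) => h0.
  have [c ch E] := @MVT_segment R g df 0 h h0 (fun t _ => gd t) (continuous_subspaceT cg).
  exists c; first by move: ch; rewrite in_itv/= => /andP[c0 ch]; rewrite !ger0_norm.
  by move: E; rewrite /g scale0r addr0 subr0.
have [c ch E] := @MVT_segment R g df h 0 (ltW h0) (fun t _ => gd t) (continuous_subspaceT cg).
exists c; first by move: ch; rewrite in_itv/= => /andP[ch c0]; rewrite !ler0_norm ?(ltW h0)// lerN2.
by move: E; rewrite /g scale0r addr0 sub0r => E; rewrite -opprB E mulrN opprK.
Qed.

(** Go from x by h v, then by h w. The mean value theorem gives the second leg the slope B at a
    point near x, and continuity of B replaces it by B x. Iterated over the axes, this makes
    directional derivatives linear. *)
Lemma is_derive_dirD (V : normedModType R) (f A B : V -> R) (x v w : V) :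
  is_derive x v f (A x) -> (forall y, is_derive y w f (B y)) -> {for x, continuous B} ->
  is_derive x (v + w) f (A x + B x).
Proof.
move=> /is_derive_eps HA HB cB; apply/is_derive_eps => e e0.
have e2 : 0 < e / 2 by rewrite divr_gt0.
have [d1 d10 H1] := HA _ e2.
have /cvgrPdist_le/(_ _ e2)/nbhs_ballP[d2 /= d20 H2] : B y @[y --> x] --> B x := cB.
have n0 : 0 < `|v| + `|w| + 1 by rewrite ltr_wpDl ?addr_ge0.
exists (Num.min d1 (d2 / (`|v| + `|w| + 1))) => [|h].
  by rewrite lt_min d10 divr_gt0.
rewrite lt_min => /andP[hd1]; rewrite ltr_pdivlMr// => hd2.
have [c ch E] := @MVT_dir V f (fun t => B (h *: v + x + t *: w)) (h *: v + x) w h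
  (fun t => HB _).
rewrite (_ : h *: (v + w) + x = h *: v + x + h *: w); last by rewrite scalerDr addrAC.
rewrite (_ : f _ - _ - _ = (f (h *: v + x) - f x - h * A x) + (B (h *: v + x + c *: w) - B x) * h); last first.
  by rewrite mulrBl -E; ring.
apply: le_trans (ler_normD _ _) _; rewrite [leRHS](_ : _ = e / 2 * `|h| + e / 2 * `|h|); last by rewrite -mulrDl -splitr.
apply: lerD; first exact: H1.
rewrite normrM ler_wpM2r// distrC; apply: H2; rewrite -ball_normE /=.
rewrite [h *: v + x]addrC -addrA opprD addrA subrr add0r normrN.
apply: le_lt_trans hd2; apply: le_trans (ler_normD _ _) _; rewrite !normrZ.
have : `|c| * `|w| <= `|h| * `|w| by rewrite ler_wpM2r.
have := normr_ge0 h; nra.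
Qed.

End derive_eps.

Section smooth1.
Variable R : realType.

(** A coinductive form of class C^infinity: to prove a function smooth, exhibit a class containing
    it and closed under differentiation, with no iterated derivative to compute. *)
Definition smooth1 (f : R -> R) := exists S : set (R -> R), S f /\
  forall g, S g -> exists2 g', S g' & forall x, is_derive x (1 : R) g (g' x).

Lemma smooth1_prim f f' : (forall x, is_derive x (1 : R) f (f' x)) -> smooth1 f' -> smooth1 f.
Proof.
move=> ff' [S [Sf' SP]]; exists (f |` S); split; first by left.
by move=> g [->|/SP[g' Sg' gg']]; [exists f' => //; right|exists g' => //; right].
Qed.

Lemma smooth1_derive f : smooth1 f ->
  exists2 f', smooth1 f' & forall x, is_derive x (1 : R) f (f' x).
Proof. by move=> [S [/[dup] Sf + SP]] => /SP[f' Sf' ff']; exists f' => //; exists S. Qed.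

Lemma smooth1_cont f : smooth1 f -> continuous f.
Proof. by move=> /smooth1_derive[f' _ ff'] x; exact: is_derive_cont1 (ff' x). Qed.

Arguments smooth1_cont [f] _ x.

Lemma smooth1D f g : smooth1 f -> smooth1 g -> smooth1 (fun x => f x + g x).
Proof.
move=> [S [Sf SP]] [T [Tg TP]].
exists [set h | exists a b, [/\ S a, T b & h = (fun x => a x + b x)]]; split; first by exists f, g.
move=> _ [a [b [/SP[a' Sa' aa'] /TP[b' Tb' bb'] ->]]].
by exists (fun x => a' x + b' x) => [|x]; [exists a', b'|exact: is_deriveD].
Qed.

Lemma is_derive_affine1 (a b x : R) : is_derive x (1 : R) (fun x => a * x + b) a.
Proof.
apply/is_derive_eps => e e0; exists 1 => // h _.
by rewrite [h *: 1]mulr1 (_ : _ - _ = 0) ?normr0 ?mulr_ge0 ?(ltW e0)//; ring.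
Qed.

Lemma smooth1_affine f c a b : smooth1 f -> smooth1 (fun x => c * f (a * x + b)).
Proof.
move=> [S [Sf SP]].
exists [set h | exists d g, S g /\ h = (fun x => d * g (a * x + b))]; split; first by exists c, f.
move=> _ [d [g [/SP[g' Sg' gg'] ->]]].
exists (fun x => (d * a) * g' (a * x + b)) => [|x]; first by exists (d * a), g'.
have -> : d * a * g' (a * x + b) = d *: (g' (a * x + b) * a) by rewrite -[RHS]/(d * _); ring.
apply: is_deriveZ; apply: (@is_derive1_comp R g (fun x => a * x + b)) => //.
exact: is_derive_affine1.
Qed.

Lemma smooth1_expR : smooth1 (@expR R).
Proof.
by exists [set expR]; split => // _ ->; exists expR => // x; exact: is_derive_expR.
Qed.

(** The whole family r^(-k) e^(-1/r) is introduced, and not only e^(-1/r), because the span of the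
    family is stable under differentiation. *)
Definition flat k (r : R) : R := if 0 < r then r^-1 ^+ k * expR (- r^-1) else 0.

Lemma flat_ge0 k r : 0 <= flat k r.
Proof.
by rewrite /flat; case: ifP => // /ltW r0; rewrite mulr_ge0 ?expR_ge0 ?exprn_ge0 ?invr_ge0.
Qed.

(** The term of order k + 2 in the exponential series of 1/r beats r^(-k) by a factor r^2. This
    quadratic smallness gives the derivative 0 at the origin. *)
Lemma flat_le k r : 0 < r -> flat k r <= (k.+2)`!%:R * r ^+ 2.
Proof.
move=> r0; rewrite /flat r0 expRN; have ri : 0 < r^-1 by rewrite invr_gt0.
have := @expR_ge1Dxn R r^-1 k.+1 (ltW ri).
have f0 : 0 < (k.+2)`!%:R :> R by rewrite ltr0n fact_gt0.
move=> H; have {}H : r^-1 ^+ k.+2 / (k.+2)`!%:R <= expR r^-1 by apply: le_trans H; rewrite lerDr.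
rewrite ler_pdivrMr ?expR_gt0//.
have := ler_wpM2l (mulr_ge0 (ltW f0) (exprn_ge0 2 (ltW r0))) H; apply: le_trans.
rewrite le_eqVlt; apply/orP; left; apply/eqP.
rewrite !exprS; field; rewrite gt_eqF//= gt_eqF//.
Qed.

Lemma flat_derive k x : is_derive x (1 : R) (flat k) (flat k.+2 x - k%:R * flat k.+1 x).
Proof.
have [x0|x0|->] := ltgtP x 0.
- rewrite {2 3}/flat ltNge (ltW x0)/= mulr0 subrr.
  apply: (@near_eq_is_derive R R^o R^o (cst 0) (flat k) x 1 0 _ (is_derive_cst _ _ _)).
  near=> y; rewrite /flat ltNge; case: leP => //= y0; exfalso.
  have : y < 0 by near: y; exact: lt_nbhsl.
  by rewrite ltNge (ltW y0).
- apply: (@near_eq_is_derive R R^o R^o (fun r => r^-1 ^+ k * expR (- r^-1))).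
    near=> y; rewrite /flat ifT//.
    by near: y; exact: lt_nbhsr.
  have xN : x != 0 by rewrite gt_eqF.
  have dV : is_derive x (1 : R) (fun r => r^-1) (- x ^- 2).
    by rewrite -[X in is_derive _ _ _ X]mulr1; apply: is_deriveV.
  have dX := @is_deriveX _ _ _ k _ _ _ dV.
  have dE : is_derive x (1 : R) (fun r => expR (- r^-1)) (expR (- x^-1) * x ^- 2).
    by rewrite -[x ^- 2]opprK; apply: (@is_derive1_comp R expR (fun r => - r^-1)).
    have := is_deriveM dX dE; rewrite /flat x0.
  set u := (X in is_derive _ _ _ X -> _); set v := (X in _ -> is_derive _ _ _ X).
  rewrite (_ : _ * _ = (fun r : R => r^-1 ^+ k * expR (- r^-1))); last first.
    by apply/funext => r; rewrite !fctE.
  suff -> : u = v by [].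
  rewrite /u /v -[_ *: _]/(_ * _) -[X in _ + X]/(_ * _) !fctE.
  rewrite [X in _ + _ * X](_ : _ = (k%:R * x^-1 ^+ k.-1) * (- x ^- 2))//.
  case: k {dX u v} => [|k]; first by rewrite /= !exprS !expr0; field; exact: xN.
  rewrite /= !exprS; field; exact: xN.
- rewrite {2 3}/flat ltxx mulr0 subrr; apply/is_derive_eps => e e0.
  have f0 : 0 < (k.+2)`!%:R :> R by rewrite ltr0n fact_gt0.
  exists (e / (k.+2)`!%:R) => [|h hd]; first exact: divr_gt0.
  rewrite addr0 [h *: 1]mulr1 mulr0 subr0 {2}/flat ltxx subr0 ger0_norm ?flat_ge0//.
  case: (ltP 0 h) => h0; last by rewrite /flat ltNge h0/= mulr_ge0// ltW.
  apply: (le_trans (flat_le _ h0)); rewrite gtr0_norm// expr2 mulrA ler_wpM2r ?(ltW h0)//.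
  by move: hd; rewrite gtr0_norm// ltr_pdivlMr// mulrC => /ltW.
Unshelve. all: by end_near. Qed.

Inductive flat_span : (R -> R) -> Prop :=
| Flat k c : flat_span (fun x => c * flat k x)
| FlatD f g : flat_span f -> flat_span g -> flat_span (fun x => f x + g x).

Lemma smooth1_flat k : smooth1 (flat k).
Proof.
exists flat_span; split.
  by rewrite (_ : flat k = fun x => 1 * flat k x); [exact: Flat|apply/funext => x; rewrite mul1r].
move=> f; elim=> {f}[j c|f g _ [f' Sf' ff'] _ [g' Sg' gg']]; last first.
  by exists (fun x => f' x + g' x) => [|x]; [exact: FlatD|exact: is_deriveD].
exists (fun x => c * flat j.+2 x + (- c * j%:R) * flat j.+1 x) => [|x].
  by apply: (@FlatD (fun x => c * flat j.+2 x) (fun x => (- c * j%:R) * flat j.+1 x)); exact: Flat.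
rewrite (_ : _ + _ = c *: (flat j.+2 x - j%:R * flat j.+1 x)); last by rewrite -[RHS]/(_ * _); ring.
by apply: is_deriveZ; exact: flat_derive.
Qed.

(* Plays the role of the absolute value in the polarization below: vanishing on
   [-1, 1], it keeps the polarization of a test function smooth across the mirror. *)
Definition soft (r : R) : R :=
  if 0 < r then r * expR (- r^-1) else 0.

Definition soft_abs (t : R) : R := soft (t - 1) + soft (- t - 1).

Lemma soft_derive x : is_derive x (1 : R) soft (flat 0 x + flat 1 x).
Proof.
have [x0|x0|->] := ltgtP x 0.
- rewrite /flat ltNge (ltW x0)/= addr0.
  apply: (@near_eq_is_derive R R^o R^o (cst 0) soft x 1 0 _ (is_derive_cst _ _ _)).
  near=> y; rewrite /soft ltNge; case: leP => //= y0; exfalso.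
  have : y < 0 by near: y; exact: lt_nbhsl.
  by rewrite ltNge (ltW y0).
- apply: (@near_eq_is_derive R R^o R^o (fun r => r * expR (- r^-1)) soft).
    near=> y; rewrite /soft ifT//.
    by near: y; exact: lt_nbhsr.
  have xN : x != 0 by rewrite gt_eqF.
  have dV : is_derive x (1 : R) (fun r => r^-1) (- x ^- 2).
    by rewrite -[X in is_derive _ _ _ X]mulr1; apply: is_deriveV.
  have dE : is_derive x (1 : R) (fun r => expR (- r^-1)) (expR (- x^-1) * x ^- 2).
    by rewrite -[x ^- 2]opprK; apply: (@is_derive1_comp R expR (fun r => - r^-1)).
    have := is_deriveM (is_derive_id (x : R^o) (1 : R^o)) dE; rewrite /flat x0.
  set u := (X in is_derive _ _ _ X -> _); set v := (X in _ -> is_derive _ _ _ X).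
  suff -> : u = v by [].
  rewrite /u /v -[X in X + _]/(_ * _) -[X in _ + X]/(_ * _) /= expr0 expr1 !exprS expr0; field.
  exact: xN.
- rewrite /flat ltxx addr0; apply/is_derive_eps => e e0.
  exists e => // h hd.
  rewrite addr0 [h *: 1]mulr1 mulr0 subr0 /soft ltxx subr0.
  case: (ltP 0 h) => h0; last by rewrite normr0 mulr_ge0// ltW.
  move: hd; rewrite gtr0_norm// => hd; rewrite normrM gtr0_norm// mulrC ler_wpM2r ?(ltW h0)//.
  rewrite gtr0_norm ?expR_gt0// expRN; apply: le_trans (ltW hd).
  have := expR_ge1Dx h^-1; rewrite invf_ple ?posrE ?expR_gt0//; apply: le_trans.
  by rewrite lerDr.
Unshelve. all: by end_near. Qed.

Lemma smooth1_soft_abs : smooth1 soft_abs.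
Proof.
have s1 : smooth1 soft.
  by apply: (smooth1_prim soft_derive); apply: smooth1D; exact: smooth1_flat.
apply: smooth1D.
  by have := smooth1_affine 1 1 (-1) s1; under eq_fun do rewrite !mul1r.
by have := smooth1_affine 1 (-1) (-1) s1; under eq_fun do rewrite mul1r mulN1r.
Qed.

Lemma soft_bounds r : 0 <= soft r /\ (0 < r -> r - 1 <= soft r <= r).
Proof.
rewrite /soft; case: ifP => // r0.
split => [|_]; first by rewrite mulr_ge0 ?expR_ge0// ltW.
apply/andP; split; last by rewrite ler_piMr ?(ltW r0)// expR_le1 oppr_le0 invr_ge0 ltW.
have := expR_ge1Dx (- r^-1); rewrite -(ler_pM2l r0) mulrBr mulr1 mulfV ?gt_eqF//.
Qed.

Lemma soft_absN t : soft_abs (- t) = soft_abs t.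
Proof. by rewrite /soft_abs opprK addrC. Qed.

Lemma soft_abs_ge0 t : 0 <= soft_abs t.
Proof. by rewrite addr_ge0//; apply: (soft_bounds _).1. Qed.

Lemma soft_abs_eq0 t : `|t| <= 1 -> soft_abs t = 0.
Proof.
rewrite ler_norml => /andP[t1 t2]; rewrite /soft_abs /soft.
by rewrite !ifF ?addr0//; apply/negbTE; rewrite -leNgt; lra.
Qed.

(** Of the loss 2, the shift of the argument accounts for 1 and the bound r - 1 <= r e^(-1/r) for
    the other 1. *)
Lemma soft_abs_bounds t : `|t| - 2 <= soft_abs t <= `|t|.
Proof.
wlog t0 : t / 0 <= t => [H|].
  by case: (leP 0 t) => [/H//|t0]; rewrite -normrN -soft_absN; apply: H; rewrite oppr_ge0 ltW.
rewrite ger0_norm//; case: (leP t 1) => t1.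
  by rewrite soft_abs_eq0 ?ger0_norm//; lra.
have t1' : 0 < t - 1 by rewrite subr_gt0.
have := (soft_bounds (t - 1)).2 t1'; rewrite /soft_abs [soft (- t - 1)]/soft ifF; last first.
  by apply/negbTE; rewrite -leNgt; lra.
rewrite addr0; lra.
Qed.

(** The slope of [soft] is (1 + 1/r) e^(-1/r), at most 1 because 1 + x <= e^x. The bound 1 is
    essential: composing or polarizing with [soft_abs] must not raise the gradient energy. *)
Lemma soft_abs_derive t : exists2 d, is_derive t (1 : R) soft_abs d & `|d| <= 1.
Proof.
have flat_eq0 k r : r <= 0 -> flat k r = 0 by rewrite /flat leNgt => /negbTE ->.
have fb r : 0 <= flat 0 r + flat 1 r <= 1.
  rewrite addr_ge0 ?flat_ge0//=; case: (leP r 0) => r0; first by rewrite !flat_eq0// addr0.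
  rewrite /flat r0 expr0 expr1 -mulrDl expRN ler_pdivrMr ?expR_gt0// mul1r.
  exact: expR_ge1Dx.
exists ((flat 0 (t - 1) + flat 1 (t - 1)) * 1 + (flat 0 (- t - 1) + flat 1 (- t - 1)) * (-1)).
  apply: is_deriveD.
    apply: (@is_derive1_comp R soft (fun t => t - 1)); first exact: soft_derive.
    by have := is_derive_affine1 1 (-1) t; under eq_fun do rewrite mul1r.
  apply: (@is_derive1_comp R soft (fun t => - t - 1)); first exact: soft_derive.
  by have := is_derive_affine1 (-1) (-1) t; under eq_fun do rewrite mulN1r.
have := fb (t - 1); have := fb (- t - 1); rewrite ler_norml; lra.
Qed.

Lemma soft_abs_lip x y : `|soft_abs x - soft_abs y| <= `|x - y|.
Proof.
have /choice[df dP] := fun t => (let: ex_intro2 d H1 H2 := soft_abs_derive t in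
   ex_intro (fun d => is_derive t (1 : R) soft_abs d /\ `|d| <= 1) d (conj H1 H2)).
have [c _ E] := @MVT_dir R R^o soft_abs (fun t => df (y + t *: 1)) y 1 (x - y) (fun t => (dP _).1).
move: E; rewrite (_ : y + (x - y)%:A = x) => [->|]; last by rewrite -[_%:A]/((x - y) * 1); ring.
by rewrite normrM ler_piMl// (dP _).2.
Qed.

End smooth1.

(** * Functions of class C^k on R^N *)

Section Ck_calculus.
Variables (R : realType) (N : nat).
Implicit Types u v : 'rV[R]_N -> R.

Local Notation e_ := (fun i : 'I_N => delta_mx 0 i : 'rV[R]_N).

Lemma Ck_cont k u : Ck k u -> continuous u.
Proof. by case: k => [|k] // []. Qed.

Arguments Ck_cont [k u] _ x.

Lemma Ck_pred k u : Ck k.+1 u -> Ck k u.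
Proof.
elim: k u => [|k IH] u [cu du Cu] //=; split => // i; exact: IH.
Qed.

Lemma Ck_le k l u : (k <= l)%N -> Ck l u -> Ck k u.
Proof.
move=> /subnK <-; elim: (l - k)%N => [|m IH] //; rewrite addSn => /Ck_pred; exact: IH.
Qed.

Lemma Ck_partial k u i : Ck k.+1 u -> Ck k (partial i u).
Proof. by move=> [_ _]; exact. Qed.

Lemma Ck_derive k u : Ck k.+1 u -> forall i x, is_derive x (e_ i) u (partial i u x).
Proof. by move=> [_ du _] i x; exact/derivableP/du. Qed.

Lemma CkS k u (d : 'I_N -> 'rV[R]_N -> R) : continuous u ->
  (forall i x, is_derive x (e_ i) u (d i x)) -> (forall i, Ck k (d i)) -> Ck k.+1 u.
Proof.
move=> cu du Cd; split; [exact: cu|by move=> i x; exact: (@ex_derive _ _ _ _ _ _ _ (du i x))|move=> i].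
rewrite (_ : partial i u = d i) //; apply/funext => x.
exact: (@derive_val _ _ _ _ _ _ _ (du i x)).
Qed.

Lemma partial_eq u i d : (forall x, is_derive x (e_ i) u (d x)) -> partial i u = d.
Proof. by move=> du; apply/funext => x; exact: (@derive_val _ _ _ _ _ _ _ (du x)). Qed.

Lemma Ck_cst k (c : R) : Ck k (fun _ : 'rV[R]_N => c).
Proof.
elim: k c => [|k IH] c; first by move=> x; exact: cst_continuous.
apply: (@CkS _ _ (fun _ _ => 0)) => [|i]; [exact: cst_continuous|exact: IH].
Qed.

Lemma CkD k u v : Ck k u -> Ck k v -> Ck k (fun x => u x + v x).
Proof.
elim: k u v => [|k IH] u v Cu Cv; first by move=> x; exact: continuousD (Ck_cont Cu x) (Ck_cont Cv x).
apply: (@CkS _ _ (fun i x => partial i u x + partial i v x)) => [x|i x|i].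
- exact: continuousD (Ck_cont Cu x) (Ck_cont Cv x).
- by apply: is_deriveD; [exact: (Ck_derive Cu)|exact: (Ck_derive Cv)].
- by apply: IH; exact: Ck_partial.
Qed.

Lemma CkM k u v : Ck k u -> Ck k v -> Ck k (fun x => u x * v x).
Proof.
elim: k u v => [|k IH] u v Cu Cv; first by move=> x; exact: continuousM (Ck_cont Cu x) (Ck_cont Cv x).
apply: (@CkS _ _ (fun i x => u x * partial i v x + v x * partial i u x)) => [x|i x|i].
- exact: continuousM (Ck_cont Cu x) (Ck_cont Cv x).
- by apply: is_deriveM; [exact: (Ck_derive Cu)|exact: (Ck_derive Cv)].
- by apply: CkD; apply: IH; try exact: Ck_pred; exact: Ck_partial.
Qed.

Lemma CkZ k c u : Ck k u -> Ck k (fun x => c * u x).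
Proof. by move=> Cu; apply: (@CkM k (fun=> c)) => //; exact: Ck_cst. Qed.

Lemma Ck_comp k f u : smooth1 f -> Ck k u -> Ck k (fun x => f (u x)).
Proof.
elim: k f u => [|k IH] f u sf Cu.
  by move=> x; apply: (@continuous_comp _ _ _ u f); [exact: (Ck_cont Cu)|exact: (smooth1_cont sf)].
have [f' sf' ff'] := smooth1_derive sf.
apply: (@CkS _ _ (fun i x => f' (u x) * partial i u x)) => [x|i x|i].
- apply: (@continuous_comp _ _ _ u f); [exact: (Ck_cont Cu)|exact: (smooth1_cont sf)].
- by apply: (@is_derive_comp1 _ _ f u) => //; exact: (Ck_derive Cu).
- by apply: CkM; [apply: IH => //; exact: Ck_pred|exact: Ck_partial].
Qed.

Lemma is_derive_coord (i j : 'I_N) (x : 'rV[R]_N) :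
  is_derive x (e_ i) (fun y : 'rV[R]_N => y 0 j) ((j == i)%:R).
Proof.
apply/is_derive_eps => e e0; exists 1 => // h _.
rewrite !mxE eqxx/= (_ : _ - _ = 0) ?normr0 ?mulr_ge0 ?(ltW e0)//; ring.
Qed.

Lemma Ck_coord k (j : 'I_N) : Ck k (fun y : 'rV[R]_N => y 0 j).
Proof.
case: k => [|k]; first exact: coord_continuous.
apply: (@CkS _ _ (fun i _ => (j == i)%:R)) => [|i x|i].
- exact: coord_continuous.
- exact: is_derive_coord.
- exact: Ck_cst.
Qed.

Lemma Ck_sum k (I : Type) (s : seq I) (F : I -> 'rV[R]_N -> R) :
  (forall i, Ck k (F i)) -> Ck k (fun x => \sum_(i <- s) F i x).
Proof.
move=> CF; elim: s => [|i s IH].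
  by under eq_fun do rewrite big_nil; exact: Ck_cst.
by under eq_fun do rewrite big_cons; exact: CkD.
Qed.

Lemma Ck_prod k (I : Type) (s : seq I) (F : I -> 'rV[R]_N -> R) :
  (forall i, Ck k (F i)) -> Ck k (fun x => \prod_(i <- s) F i x).
Proof.
move=> CF; elim: s => [|i s IH].
  by under eq_fun do rewrite big_nil; exact: Ck_cst.
by under eq_fun do rewrite big_cons; exact: CkM.
Qed.

Definition cgrad u (x : 'rV[R]_N) : 'rV[R]_N := \row_i partial i u x.

Lemma row_deltaE (v : 'rV[R]_N) : v = \sum_(i < N) v 0 i *: e_ i.
Proof.
apply/rowP => j; rewrite summxE (bigD1 j)//= big1 ?addr0 ?mxE ?eqxx ?mulr1//.
by move=> i ij; rewrite !mxE eqxx/= eq_sym (negbTE ij) mulr0.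
Qed.

(** [Ck] speaks of the axes only. The components of v are added one at a time by [is_derive_dirD],
    each new partial derivative being continuous. *)
Lemma Ck1_derive u : Ck 1 u -> forall x v : 'rV[R]_N, is_derive x v u (dot (cgrad u x) v).
Proof.
move=> Cu x v; rewrite {1}(row_deltaE v).
rewrite (_ : dot _ _ = \sum_(i < N) v 0 i * partial i u x); last first.
  by apply: eq_bigr => i _; rewrite mxE mulrC.
move: x; elim: (index_enum _) => [|i s IH] x.
  by rewrite !big_nil; exact: is_derive0.
rewrite !big_cons addrC [X in is_derive _ _ _ X]addrC.
apply: (@is_derive_dirD _ _ u (fun x => \sum_(j <- s) v 0 j * partial j u x)
  (fun x => v 0 i * partial i u x)) => // [y|].
  by apply: is_derive_dirZ; exact: (Ck_derive Cu).
exact: continuousM (@cst_continuous _ _ _ _) (Ck_cont (Ck_partial i Cu) x).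
Qed.

Lemma CkS_1 k u : Ck k.+1 u -> Ck 1 u. Proof. exact: Ck_le. Qed.

(** Serves reflections and dilations alike: A is affine with linear part L, so each partial
    derivative of the composite is a constant combination of composites one order lower. *)
Lemma Ck_precomp k u (A L : 'rV[R]_N -> 'rV[R]_N) : continuous A ->
  (forall h (v x : 'rV[R]_N), A (h *: v + x) = h *: L v + A x) ->
  Ck k u -> Ck k (fun x => u (A x)).
Proof.
move=> cA AL; elim: k u => [|k IH] u Cu.
  by move=> x; exact: (continuous_comp (cA x) (Ck_cont Cu (A x))).
apply: (@CkS _ _ (fun i x => \sum_(j < N) L (e_ i) 0 j * partial j u (A x))) => [x|i x|i].
- exact: (continuous_comp (cA x) (Ck_cont Cu (A x))).
- have /is_derive_eps H := Ck1_derive (CkS_1 Cu) (A x) (L (e_ i)).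
  apply/is_derive_eps => e /H[d d0 dP]; exists d => // h /dP; rewrite AL.
  rewrite (_ : dot _ _ = \sum_(j < N) L (e_ i) 0 j * partial j u (A x))//.
  by apply: eq_bigr => j _; rewrite mxE mulrC.
- by apply: Ck_sum => j; apply: CkZ; apply: IH; exact: Ck_partial.
Qed.

Lemma cgrad_precomp u (A L : 'rV[R]_N -> 'rV[R]_N) (x v : 'rV[R]_N) :
  (forall h (v x : 'rV[R]_N), A (h *: v + x) = h *: L v + A x) ->
  Ck 1 u -> Ck 1 (fun x => u (A x)) ->
  dot (cgrad (fun x => u (A x)) x) v = dot (cgrad u (A x)) (L v).
Proof.
move=> AL Cu CuA; have H1 := Ck1_derive CuA x v.
have /is_derive_eps H2 := Ck1_derive Cu (A x) (L v).
rewrite -(@derive_val _ _ _ _ _ _ _ H1); apply: (@derive_val _ _ _ _ _ _ _).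
apply/is_derive_eps => e /H2[d d0 dP]; exists d => // h /dP; by rewrite AL.
Qed.

Lemma dot_eqP (a b : 'rV[R]_N) : (forall v : 'rV[R]_N, dot a v = dot b v) -> a = b.
Proof.
by move=> ab; apply/eqP; rewrite -subr_eq0 -dot_eq0 dotDl dotNl ab subrr.
Qed.

End Ck_calculus.

Section convergence.
Context d (T : measurableType d) (R : realType) (mu : {measure set T -> \bar R}).
Implicit Types f g : T -> R.

Lemma dominated_cvg_real (f_ : nat -> T -> R) (f : T -> R) (g : T -> \bar R) :
  (forall n, measurable_fun setT (f_ n)) -> measurable_fun setT f ->
  (\forall x \ae mu, f_ n x @[n --> \oo] --> f x) ->
  mu.-integrable setT g ->
  (\forall x \ae mu, forall n, ((`|f_ n x|)%:E <= g x)%E) ->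
  [/\ mu.-integrable setT (EFin \o f),
      (\int[mu]_x (`|f_ n x - f x|)%:E @[n --> \oo] --> 0)%E &
      (\int[mu]_x (f_ n x)%:E @[n --> \oo] --> \int[mu]_x (f x)%:E)%E].
Proof.
move=> mf_ mf cf ig fg.
have c1 : \forall x \ae mu, setT x -> (f_ n x)%:E @[n --> \oo] --> (f x)%:E.
  by apply: filterS cf => x fx _; apply/fine_cvgP; split; [near=> n|].
have c2 : \forall x \ae mu, forall n, setT x -> (`|(f_ n x)%:E| <= g x)%E.
  by apply: filterS fg => x fx n _; exact: fx.
have [H1 H2 H3] := @dominated_convergence _ _ _ mu setT measurableT
  (fun n x => (f_ n x)%:E) (EFin \o f) g
  (fun n => (measurable_EFinP _ _).2 (mf_ n)) ((measurable_EFinP _ _).2 mf) c1 ig c2.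
by split.
Unshelve. all: by end_near. Qed.

Lemma ereal_cvg_cst_eq (a b : \bar R) : a @[n --> \oo] --> b -> a = b.
Proof. by move=> /(cvg_unique _ (cvg_cst a)); apply; exact: ereal_hausdorff. Qed.

End convergence.

(** * Test functions and weak gradients *)

Section test_functions.
Variables (R : realType) (N : nat).
Implicit Types u phi psi : 'rV[R]_N -> R.

Local Notation mu := (lebesgue_rV R N).
Local Notation e_ := (fun i : 'I_N => delta_mx 0 i : 'rV[R]_N).

Definition bsupp u := exists M : R, forall x, M < enorm x -> u x = 0.

Definition smooth u := forall k, Ck k u.

Lemma compact_eball_closure (r : R) : compact [set x : 'rV[R]_N | enorm x <= r].
Proof.
apply: bounded_closed_compact.
  exists r; split; first by rewrite num_real.
  move=> M rM x /= xr; exact: le_trans (norm_le_enorm x) (le_trans xr (ltW rM)).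
have -> : [set x : 'rV[R]_N | enorm x <= r] = @enorm R N @^-1` [set t | t <= r] by [].
by apply: preimage_closed; [move=> x _; exact: continuous_enorm|exact: closed_le].
Qed.

Lemma test_functionP phi : test_function phi <-> smooth phi /\ bsupp phi.
Proof.
split=> -[sphi]; last first.
  move=> [M suppM]; split => //.
  apply: (subclosed_compact _ (@compact_eball_closure M)); first exact: closed_closure.
  have cM := compact_closed_rV (@compact_eball_closure M).
  rewrite [X in _ `<=` X]((closure_id _).1 cM); apply: closureS => y /= py.
  by rewrite leNgt; apply/negP => /suppM /eqP; rewrite (negbTE py).
move=> cpt; split => //; have [M [Mr MP]] := compact_bounded cpt.
exists (N%:R * (`|M| + 1)) => x xM; apply/eqP/negP => /negP px.
have /MP : closure [set x | phi x != 0] x by apply: subset_closure.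
move=> /(_ (`|M| + 1)); rewrite ltr_pwDr// ?ler_norm// => /(_ isT) xle.
move: xM; apply/negP; rewrite -leNgt; apply: le_trans (enorm_le_norm x) _.
by rewrite ler_wpM2l.
Qed.

Lemma test_smooth phi : test_function phi -> smooth phi.
Proof. by move=> /test_functionP[]. Qed.

Lemma test_cont phi : test_function phi -> continuous phi.
Proof. by move=> /test_smooth /(_ 0%N) /Ck_cont. Qed.

Lemma test_meas phi : test_function phi -> measurable_fun setT phi.
Proof. by move=> /test_cont/continuous_measurable_rV. Qed.

Lemma bsuppD u v : bsupp u -> bsupp v -> bsupp (fun x => u x + v x).
Proof.
move=> [M uM] [K vK]; exists (Num.max M K) => x; rewrite gt_max => /andP[xM xK].
by rewrite uM// vK// addr0.
Qed.

Lemma bsuppMl u v : bsupp u -> bsupp (fun x => u x * v x).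
Proof. by move=> [M uM]; exists M => x /uM ->; rewrite mul0r. Qed.

Lemma bsupp_partial u i : bsupp u -> bsupp (partial i u).
Proof.
move=> [M uM]; exists M => x xM; rewrite /partial.
transitivity ('D_(e_ i) (cst 0 : 'rV[R]_N -> R) x); last by rewrite derive_cst.
apply: near_eq_derive.
have /cvgr_gt/(_ _ xM) : enorm y @[y --> x] --> enorm x by exact: continuous_enorm.
by apply: filterS => y; exact: uM.
Qed.

Lemma test_partial phi i : test_function phi -> test_function (partial i phi).
Proof.
move=> /test_functionP[s b]; apply/test_functionP; split; last exact: bsupp_partial.
by move=> k; apply: Ck_partial.
Qed.

Lemma testD phi psi : test_function phi -> test_function psi ->
  test_function (fun x => phi x + psi x).
Proof.
move=> /test_functionP[s b] /test_functionP[s' b']; apply/test_functionP.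
by split; [move=> k; exact: CkD|exact: bsuppD].
Qed.

Lemma testM phi psi : test_function phi -> test_function psi ->
  test_function (fun x => phi x * psi x).
Proof.
move=> /test_functionP[s b] /test_functionP[s' b']; apply/test_functionP.
by split; [move=> k; exact: CkM|exact: bsuppMl].
Qed.

Lemma testZ c phi : test_function phi -> test_function (fun x => c * phi x).
Proof.
move=> /test_functionP[s [M b]]; apply/test_functionP.
by split; [move=> k; exact: CkZ|exists M => x /b ->; rewrite mulr0].
Qed.

Lemma testB phi psi : test_function phi -> test_function psi ->
  test_function (fun x => phi x - psi x).
Proof.
move=> t t'; have := testD t (testZ (-1) t').
by under eq_fun do rewrite mulN1r.
Qed.

Lemma test0 : test_function (fun _ : 'rV[R]_N => 0).
Proof. by apply/test_functionP; split; [move=> k; exact: Ck_cst|exists 0]. Qed.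

Lemma test_comp f phi : smooth1 f -> f 0 = 0 -> test_function phi ->
  test_function (fun x => f (phi x)).
Proof.
move=> sf f0 /test_functionP[s [M b]]; apply/test_functionP.
by split; [move=> k; exact: Ck_comp|exists M => x /b ->].
Qed.

Lemma bsupp_cont_bounded u : continuous u -> bsupp u ->
  exists2 K : R, 0 <= K & forall x, `|u x| <= K.
Proof.
move=> cu [M uM].
have [A cA [L [Lr LP]]] : exists2 A, [set x : 'rV[R]_N | enorm x <= M] = A & bounded_set (u @` A).
  exists [set x : 'rV[R]_N | enorm x <= M] => //.
  apply: compact_bounded; apply: continuous_compact; last exact: compact_eball_closure.
  exact: continuous_subspaceT.
exists (`|L| + 1) => // x; case: (leP (enorm x) M) => xM; last by rewrite uM// normr0.
apply: LP; first by rewrite ltr_pwDr// ler_norm.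
by exists x => //; rewrite -cA.
Qed.

Lemma test_bounded phi : test_function phi -> exists2 K : R, 0 <= K & forall x, `|phi x| <= K.
Proof. by move=> /[dup] /test_cont cp /test_functionP[_ b]; exact: bsupp_cont_bounded. Qed.

Lemma bsupp_integrable u (K : R) : measurable_fun setT u -> bsupp u ->
  (forall x, `|u x| <= K) -> mu.-integrable setT (EFin \o u).
Proof.
move=> mu_ [M uM] uK.
have K0 : 0 <= K by apply: le_trans (uK 0).
pose D : set 'rV[R]_N := cube `|M|.
have mD : measurable D by exact: measurable_cube.
have : mu.-integrable D (EFin \o u).
  apply: measurable_bounded_integrable => //.
  - by rewrite cube_measure// ltry.
  - exact: measurable_funTS.
  - exists K; split; first by rewrite num_real.
    by move=> L KL x _ /=; exact: le_trans (uK x) (ltW KL).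
move/(integrable_mkcond _ mD); apply: eq_integrable => // x _.
rewrite patchE; case: ifPn => // xD /=; rewrite uM//.
rewrite ltNge; apply/negP => xM; move/negP: xD; apply; apply/mem_set/cube_mx_norm => //.
exact: le_trans (norm_le_enorm x) (le_trans xM (ler_norm _)).
Qed.

Lemma bsupp_cont_integrable u : continuous u -> bsupp u -> mu.-integrable setT (EFin \o u).
Proof.
move=> cu bu; have [K _ uK] := bsupp_cont_bounded cu bu.
by apply: bsupp_integrable uK => //; exact: continuous_measurable_rV.
Qed.

Lemma test_integrable phi : test_function phi -> mu.-integrable setT (EFin \o phi).
Proof. by move=> /[dup] /test_cont cp /test_functionP[_ b]; exact: bsupp_cont_integrable. Qed.

Lemma cont_L1loc u : continuous u -> L1loc u.
Proof.
move=> cu; have mu_ := continuous_measurable_rV cu; split => // K cK.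
apply: measurable_bounded_integrable.
- exact: compact_measurable_rV.
- exact: compact_measure_lty.
- exact: measurable_funTS.
- have := compact_bounded (continuous_compact (continuous_subspaceT cu) cK).
  by move=> [M [Mr MP]]; exists M; split => // L ML x Kx; apply: MP ML _ _; exists x.
Qed.

Lemma L1loc_mul_integrable u phi : L1loc u -> test_function phi ->
  mu.-integrable setT (EFin \o (fun x => u x * phi x)).
Proof.
move=> [mu_ iu] tp; have [K K0 pK] := test_bounded tp.
have [_ [M pM]] := (test_functionP _).1 tp.
pose D := [set x : 'rV[R]_N | enorm x <= M].
have cD : compact D := @compact_eball_closure M.
have mD := compact_measurable_rV cD.
have iD : mu.-integrable D (fun x => (u x)%:E) := iu _ cD.
have mp := test_meas tp.
have : mu.-integrable D (fun x => (K%:E * `|(u x)%:E|)%E).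
  by apply: integrableZl => //; exact: integrable_abse.
move/(integrable_mkcond _ mD); apply: le_integrable => //.
  by apply/measurable_EFinP; exact: measurable_funM.
move=> x _; rewrite patchE /=; case: ifPn => [_|xD].
  by rewrite lee_fin !normrM normr_id mulrC (ger0_norm K0) ler_wpM2r.
rewrite pM ?mulr0 ?normr0 ?abse_ge0//.
by rewrite ltNge; apply/negP => xM; move/negP: xD; apply; apply/mem_set.
Qed.

Lemma integral_shift_signed (f : 'rV[R]_N -> \bar R) (a : 'rV[R]_N) :
  measurable_fun setT f ->
  (\int[mu]_x f (x + a)%R = \int[mu]_x f x)%E.
Proof.
move=> mf; rewrite integralE [RHS]integralE; congr (_ - _)%E.
  rewrite -(@integral_shift R N _ a (measurable_funepos mf) (fun t => funepos_ge0 f t)).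
  by apply: eq_integral => x _; rewrite !funeposE.
rewrite -(@integral_shift R N _ a (measurable_funeneg mf) (fun t => funeneg_ge0 f t)).
by apply: eq_integral => x _; rewrite !funenegE.
Qed.

Lemma partial_bounded_lip phi : test_function phi -> exists2 L : R, 0 <= L &
  forall i x (h : R), `|phi (x + h *: e_ i) - phi x| <= L * `|h|.
Proof.
move=> tp; have K_ i : exists K : R, forall x, `|partial i phi x| <= K.
  by have [K _ KP] := test_bounded (test_partial i tp); exists K.
have [K KP] := choice K_.
exists (\sum_i `|K i|) => [|i x h]; first exact: sumr_ge0.
have [c _ ->] := @MVT_dir _ _ phi (fun t => partial i phi (x + t *: e_ i)) x (e_ i) h
  (fun t => Ck_derive (test_smooth tp 1) _ _).
rewrite normrM ler_wpM2r//; apply: le_trans (KP _ _) _; apply: le_trans (ler_norm _) _.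
by rewrite (bigD1 i)//= lerDl sumr_ge0.
Qed.

(** Difference quotients have integral 0 by translation invariance, and they converge to the partial
    derivative under a bound given by the Lipschitz constant on a fixed cube. *)
Lemma integral_partial phi i : test_function phi -> \int[mu]_x partial i phi x = 0.
Proof.
move=> tp; have [L L0 LP] := partial_bounded_lip tp.
have [_ [M pM]] := (test_functionP _).1 tp.
pose q (n : nat) (x : 'rV[R]_N) : R := n.+1%:R * (phi (x + n.+1%:R^-1 *: e_ i) - phi x).
have mphi := test_meas tp.
have mps a : measurable_fun setT (fun x : 'rV[R]_N => phi (x + a)).
  by apply: (measurableT_comp mphi); exact: measurable_rV_add.
have mq n : measurable_fun setT (q n).
  apply: measurable_funM => //; exact: measurable_funB.
have ipa a : mu.-integrable setT (EFin \o (fun x : 'rV[R]_N => phi (x + a))).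
  have [K K0 KP] := test_bounded tp.
  apply: (@bsupp_integrable (fun x : 'rV[R]_N => phi (x + a)) K) => // .
  exists (M + enorm a) => x xM; apply: pM.
  by have := enormD (x + a) (- a); rewrite addrK enormN; move: xM; lra.
have iphi := test_integrable tp.
have q0 n : (\int[mu]_x (q n x)%:E = 0)%E.
  rewrite (_ : (fun x => _) = (fun x => n.+1%:R%:E * ((phi (x + n.+1%:R^-1 *: e_ i))%:E - (phi x)%:E))%E); last first.
    by apply/funext => x.
  rewrite integralZl//; last exact: integrableB (ipa _) iphi.
  rewrite (integralB _ (ipa _) iphi)// (@integral_shift_signed (EFin \o phi))//; last exact/measurable_EFinP.
  rewrite subee ?mule0//; apply: (integrable_fin_num _ iphi) => //.
(* The added 1 covers the increments 1 / (n + 1), so both values in the quotient vanish outside this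
   cube. *)
pose D : set 'rV[R]_N := cube (`|M| + 1).
have mD : measurable D by exact: measurable_cube.
pose g (x : 'rV[R]_N) : \bar R := ((cst L%:E) \_ D) x.
have ig : mu.-integrable setT g.
  apply/(integrable_mkcond _ mD) => //.
  apply: (@measurable_bounded_integrable _ _ _ _ (cst L)) => //.
    by rewrite cube_measure ?ltry// addr_ge0.
  by exists L; split; [rewrite num_real|move=> K LK x _ /=; rewrite ger0_norm// ltW].
have qle n x : (`|(q n x)%:E| <= g x)%E.
  rewrite /g patchE; case: ifPn => [_|xD].
    rewrite lee_fin normrM ger0_norm// -ler_pdivlMl// mulrC.
    by have := LP i x n.+1%:R^-1; rewrite [`|_^-1|]ger0_norm.
  have out (y : 'rV[R]_N) : `|x - y| <= 1 -> phi y = 0.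
    move=> xy; apply: pM; apply: lt_le_trans (norm_le_enorm y).
    have xl : `|M| + 1 < `|x|.
      rewrite ltNge; apply/negP => xl; move/negP: xD; apply; apply/mem_set/cube_mx_norm => //.
    have := ler_normD (x - y) y; rewrite subrK; have := ler_norm M; lra.
  rewrite /q (out x) ?(out (x + _)); first by rewrite subrr mulr0 abse0.
    rewrite opprD addrA subrr add0r normrN normrZ.
    rewrite [`|_^-1|]ger0_norm// ler_pdivrMl// mulr1; apply: (@le_trans _ _ 1); last by rewrite ler1n.
    by apply: rV_norm_le => // j; rewrite mxE eqxx; case: eqP; rewrite ?normr1 ?normr0.
  by rewrite subrr normr0.
have qcvg x : q n x @[n --> \oo] --> partial i phi x.
  have /is_derive_eps H := Ck_derive (test_smooth tp 1) i x.
  apply/cvgrPdist_le => e e0; have [d d0 dP] := H _ e0.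
  have [n0 n0P] : exists n0 : nat, forall n : nat, (n0 <= n)%N -> n.+1%:R^-1 < d.
    exists (Num.truncn d^-1) => n n0n; rewrite invf_plt ?posrE//.
    by apply: (lt_le_trans (truncnS_gt _)); rewrite ler_nat.
  near=> n; have nd : n.+1%:R^-1 < d by apply: n0P; near: n; exact: nbhs_infty_ge.
  have ng : `|n.+1%:R^-1| = n.+1%:R^-1 :> R by rewrite ger0_norm.
  have := dP n.+1%:R^-1; rewrite ng => /(_ nd).
  rewrite -(ler_pM2l (_ : 0 < n.+1%:R :> R))// -[X in X * `|_|]ger0_norm// -normrM.
  rewrite mulrCA mulfV// mulr1 distrC; congr (`| _ | <= _); rewrite /q/= [_ + x]addrC; field.
  by rewrite nat1r pnatr_eq0.
have mpart := test_meas (test_partial i tp).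
have [_ _] := @dominated_cvg_real _ _ _ mu q (partial i phi) g mq mpart
  (aeW _ qcvg) ig (aeW _ (fun x n => qle n x)).
under eq_cvg do rewrite /= q0.
by move=> /ereal_cvg_cst_eq; rewrite /Rintegral => <-.
Unshelve. all: by end_near. Qed.

End test_functions.

(** * Weak gradients and their uniqueness *)

Section weak_gradient.
Variables (R : realType) (N : nat).
Implicit Types u phi psi : 'rV[R]_N -> R.

Local Notation mu := (lebesgue_rV R N).
Local Notation e_ := (fun i : 'I_N => delta_mx 0 i : 'rV[R]_N).

(** Integration by parts, that is [integral_partial] applied to the product of phi with the other
    test function. *)
Lemma weak_gradient_test phi : test_function phi -> is_weak_gradient phi (cgrad phi).
Proof.
move=> tp; split=> [|i|psi i tq].
- exact: cont_L1loc (test_cont tp).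
- by under eq_fun do rewrite mxE; apply: cont_L1loc; exact: test_cont (test_partial i tp).
have tpq := testM tp tq.
have := integral_partial i tpq.
have -> : partial i (fun x => phi x * psi x) =
    (fun x => phi x * partial i psi x + partial i phi x * psi x).
  apply: partial_eq => x; rewrite [X in _ + X]mulrC.
  by apply: is_deriveM; apply: (@Ck_derive _ _ 0); exact: test_smooth.
rewrite RintegralD//; last 2 first.
- exact: (test_integrable (testM tp (test_partial i tq))).
- exact: (test_integrable (testM (test_partial i tp) tq)).
move=> /eqP; rewrite addr_eq0 => /eqP ->; congr (- _).
by apply: eq_Rintegral => x _; rewrite mxE.
Qed.

Definition box (a b : 'rV[R]_N) : set 'rV[R]_N := [set x | forall i, a 0 i < x 0 i < b 0 i].

Lemma measurable_box a b : measurable (box a b).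
Proof.
rewrite (_ : box a b = [set x | forall i, [set` `]a 0 i, b 0 i[] (x 0 i)]).
  exact: (@measurable_rect R N (fun i => [set` `]a 0 i, b 0 i[])).
by apply/seteqP; split => x /= xab i; have := xab i; rewrite in_itv.
Qed.

Lemma box_bounded a b x : box a b x -> enorm x <= N%:R * (`|a| + `|b|).
Proof.
move=> xab; apply: le_trans (enorm_le_norm x) _; rewrite ler_wpM2l//.
apply: rV_norm_le => [|i]; first exact: addr_ge0.
have := xab i => /andP[h1 h2]; have := coord_le_norm a i; have := coord_le_norm b i.
by rewrite !ler_norml => /andP[? ?] /andP[? ?]; apply/andP; split; lra.
Qed.

(** The product of the [flat] factors is positive exactly in the open box. For k tending to infinity
    the values therefore increase to 1 inside and stay 0 outside: the indicator of a box is a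
    bounded limit of test functions. *)
Definition bump (a b : 'rV[R]_N) (k : R) (x : 'rV[R]_N) : R :=
  1 - expR (- k * \prod_(i < N) (flat 0 (x 0 i - a 0 i) * flat 0 (b 0 i - x 0 i))).

Lemma flat0_gt0 (r : R) : (0 < flat 0 r) = (0 < r).
Proof. by rewrite /flat; case: ifP => // r0; rewrite ?ltxx// mulr_gt0 ?expR_gt0. Qed.

Lemma bump_out a b k x : ~ box a b x -> bump a b k x = 0.
Proof.
move=> /existsNP[i xi]; rewrite /bump (bigD1 i)//= (_ : flat 0 _ * flat 0 _ = 0) ?mul0r ?mulr0 ?expR0 ?subrr//.
apply/eqP; rewrite mulf_eq0; apply/negPn/negP; rewrite negb_or => /andP[h1 h2]; apply: xi.
by apply/andP; split; rewrite -subr_gt0 -flat0_gt0 lt_def flat_ge0 andbT.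
Qed.

Lemma prod_flat_ge0 (a b x : 'rV[R]_N) :
  0 <= \prod_(i < N) (flat 0 (x 0 i - a 0 i) * flat 0 (b 0 i - x 0 i)).
Proof. by apply: prodr_ge0 => i _; rewrite mulr_ge0 ?flat_ge0. Qed.

Lemma bump_bound a b k x : 0 <= k -> `|bump a b k x| <= 1.
Proof.
move=> k0; rewrite /bump ger0_norm ?lerBlDr ?lerDl ?expR_ge0//.
by rewrite subr_ge0 expR_le1 mulNr oppr_le0 mulr_ge0// prod_flat_ge0.
Qed.

Lemma bump_test a b k : test_function (bump a b k).
Proof.
apply/test_functionP; split; last first.
  exists (N%:R * (`|a| + `|b|)) => x xM; apply: bump_out => /box_bounded.
  by rewrite leNgt xM.
move=> m; apply: CkD; first exact: Ck_cst.
have s : smooth1 (fun y : R => - expR (- k * y)).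
  have := smooth1_affine (-1) (- k) 0 (smooth1_expR R).
  by under eq_fun do rewrite mulN1r addr0.
apply: (Ck_comp s); apply: Ck_prod => i.
have C1 : Ck m (fun x : 'rV[R]_N => x 0 i - a 0 i) by apply: CkD; [exact: Ck_coord|exact: Ck_cst].
have C2 : Ck m (fun x : 'rV[R]_N => b 0 i - x 0 i).
  apply: CkD; first exact: Ck_cst.
  by under eq_fun do rewrite -mulN1r; apply: CkZ; exact: Ck_coord.
by apply: CkM; [exact: (Ck_comp (smooth1_flat R 0) C1)|exact: (Ck_comp (smooth1_flat R 0) C2)].
Qed.

Lemma bump_cvg a b x : bump a b n%:R x @[n --> \oo] --> (\1_(box a b) x : R).
Proof.
rewrite indicE; case: (boolP (x \in box a b)) => [/set_mem xab|xab]; last first.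
  rewrite (_ : (fun n => _) = cst 0); first exact: cvg_cst.
  by apply/funext => n; apply: bump_out => h; move/negP: xab; apply; exact/mem_set.
have P0 : 0 < \prod_(i < N) (flat 0 (x 0 i - a 0 i) * flat 0 (b 0 i - x 0 i)).
  apply: prodr_gt0 => i _; have /andP[h1 h2] := xab i.
  by rewrite mulr_gt0// flat0_gt0 subr_gt0.
rewrite /bump; move: P0; set P := \prod_(i < N) _ => P0.
apply/cvgrPdist_le => e e0; near=> n.
rewrite opprB addrC subrK ger0_norm ?expR_ge0// mulNr expRN.
have nP : e^-1 <= n%:R * P.
  rewrite -ler_pdivrMr//; near: n; exact: nbhs_infty_ger.
rewrite invf_ple ?posrE ?expR_gt0//; apply: le_trans nP _.
by apply: le_trans (expR_ge1Dx _); rewrite lerDr.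
Unshelve. all: by end_near. Qed.

Lemma integral_box_eq0 g a b : L1loc g ->
  (forall phi, test_function phi -> \int[mu]_x (g x * phi x) = 0) ->
  (\int[mu]_(x in box a b) (g x)%:E = 0)%E.
Proof.
move=> L1g g0; have [mg _] := L1g.
pose M := N%:R * (`|a| + `|b|).
have cD := @compact_eball_closure R N M.
have mD := compact_measurable_rV cD.
have ig : mu.-integrable [set x | enorm x <= M] (EFin \o g) := L1g.2 _ cD.
have igb : mu.-integrable (box a b) (EFin \o g).
  by apply: (integrableS mD _ _ ig); [exact: measurable_box|move=> x /box_bounded].
have mb := measurable_box a b.
pose f x : \bar R := ((EFin \o g) \_ (box a b)) x.
have igf : mu.-integrable setT f by apply/(integrable_mkcond _ mb).
have fn n : (\int[mu]_x (g x * bump a b n%:R x)%:E = 0)%E.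
  have tb := bump_test a b n%:R; have := g0 _ tb.
  rewrite /Rintegral => /eqP; rewrite fine_eq0 => [/eqP//|].
  by apply: integrable_fin_num => //; exact: (L1loc_mul_integrable L1g tb).
have mgf n : measurable_fun setT (fun x => g x * bump a b n%:R x).
  by apply: measurable_funM => //; exact: test_meas (bump_test a b n%:R).
have mgb : measurable_fun setT (fun x => g x * \1_(box a b) x).
  by apply: measurable_funM => //; exact: measurable_indic.
have c1 x : g x * bump a b n%:R x @[n --> \oo] --> g x * \1_(box a b) x.
  by apply: cvgM; [exact: cvg_cst|exact: bump_cvg].
have c2 x n : ((`|g x * bump a b n%:R x|)%:E <= `|f x|)%E.
  rewrite /f patchE; case: ifPn => [_|xab].
    by rewrite lee_fin normrM ler_piMr// bump_bound.
  rewrite bump_out ?mulr0 ?normr0//; first exact: abse_ge0.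
  by move=> h; move/negP: xab; apply; exact/mem_set.
have [] := @dominated_cvg_real _ _ _ mu _ _ _ mgf mgb (aeW _ c1) (integrable_abse igf) (aeW _ c2).
move=> _ _; under eq_cvg do rewrite /= fn.
move=> /ereal_cvg_cst_eq ->; rewrite [in LHS]integral_mkcond.
by apply: eq_integral => x _; rewrite patchE indicE; case: ifP; rewrite ?mulr1// mulr0.
Qed.

Definition boxes : set (set 'rV[R]_N) := [set A | exists a b, A = box a b].

Lemma boxesI : setI_closed boxes.
Proof.
move=> _ _ [a [b ->]] [c [d ->]].
exists (\row_i Num.max (a 0 i) (c 0 i)), (\row_i Num.min (b 0 i) (d 0 i)).
apply/seteqP; split => x /=.
  by move=> [h1 h2] i; rewrite !mxE gt_max lt_min; have /andP[-> ->] := h1 i; have /andP[-> ->] := h2 i.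
by move=> h; split => i; have := h i; rewrite !mxE gt_max lt_min => /andP[/andP[h1 h2] /andP[h3 h4]]; apply/andP.
Qed.

Lemma measurable_boxesE : @measurable _ 'rV[R]_N = <<s boxes >>.
Proof.
apply/seteqP; split; last first.
  apply: smallest_sub; first exact: sigma_algebra_measurable.
  by move=> _ [a [b ->]]; exact: measurable_box.
move=> A mA.
have mid : measurable_fun setT (id : g_sigma_algebraType boxes -> 'rV[R]_N).
  apply: measurable_fun_rV => i; apply: (measurability _ (RGenOpens.measurableE R)).
  move=> _ [_ [x [y ->]] <-]; rewrite setTI.
  (* The slab over an interval of the coordinate i is exhausted by bounded boxes. *)
  rewrite (_ : _ @^-1` _ = \bigcup_k (box (\row_j if j == i then x else - k%:R)
    (\row_j if j == i then y else k%:R))).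
    by apply: bigcup_measurable => k _; apply: sub_gen_smallest; eexists; eexists.
  apply/seteqP; split => z /=; rewrite in_itv/=.
    move=> zi; exists (Num.truncn `|z|).+1 => // j; rewrite !mxE; case: eqP => [->//|_].
    by rewrite -ltr_norml; apply: (le_lt_trans (coord_le_norm z j)); exact: truncnS_gt.
  by move=> [k _ /(_ i)]; rewrite !mxE eqxx.
by have := mid measurableT _ mA; rewrite setTI.
Qed.

(** Boxes form an intersection-stable generator, and the sets A over which g has integral 0 inside a
    fixed box [D k] form a Dynkin class. Working inside [D k] makes g integrable; countably many k
    then give the claim. *)
Lemma fundamental_lemma g : L1loc g ->
  (forall phi, test_function phi -> \int[mu]_x (g x * phi x) = 0) ->
  \forall x \ae mu, g x = 0.
Proof.
move=> L1g g0; have [mg _] := L1g.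
pose D k := box (const_mx (- k%:R)) (const_mx k%:R).
have mD k : measurable (D k) by exact: measurable_box.
have iD k : mu.-integrable (D k) (EFin \o g).
  pose M := N%:R * (`|const_mx (- k%:R) : 'rV[R]_N| + `|const_mx k%:R : 'rV[R]_N|).
  have cD := @compact_eball_closure R N M.
  have mM := compact_measurable_rV cD.
  by apply: (integrableS mM _ _ (L1g.2 _ cD)) => // x /box_bounded.
have key k A : measurable A -> (\int[mu]_(x in A `&` D k) (g x)%:E = 0)%E.
  rewrite measurable_boxesE; apply: (@dynkin_induction _ _ boxes (fun A => (\int[mu]_(x in A `&` D k) (g x)%:E = 0)%E) measurable_boxesE boxesI).
  - by rewrite setTI; exact: integral_box_eq0.
  - move=> B bB; have [c [d ->]] : boxes (B `&` D k) by apply: boxesI => //; eexists; eexists.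
    exact: integral_box_eq0.
  - move=> S mS S0.
    have := @integral_setU _ _ _ mu (S `&` D k) (~` S `&` D k) (EFin \o g).
    rewrite -setIUl setUv setTI S0 add0e => H.
    rewrite -H; [exact: integral_box_eq0|exact: measurableI|apply: measurableI => //; exact: measurableC| |].
      by apply: measurable_funTS; exact/measurable_EFinP.
    by apply/disj_setPS => x [[Sx _] [nSx _]].
  - move=> F mF tF F0; rewrite setI_bigcupl integral_bigcup//.
    + by apply: eseries0 => i _ _; exact: F0.
    + by apply: trivIset_setIr.
    + by move=> i; exact: measurableI.
    + apply: (integrableS (mD k) _ _ (iD k)) => //.
        by apply: bigcup_measurable => i _; exact: measurableI.
      by move=> x [i _ []].
have ae_k k : \forall x \ae mu, D k x -> g x = 0.
  have := @integral_ae_eq _ _ _ mu (D k) (mD k) (cst 0%E) (EFin \o g) (iD k) (measurable_cst _).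
  move=> H; have H0 E : E `<=` D k -> measurable E -> (\int[mu]_(x in E) (EFin \o g) x = \int[mu]_(x in E) cst 0 x)%E.
    by move=> ED mE; rewrite integral0 -(setIidl ED); exact: key.
  by apply: filterS (H H0) => x /= h Dx; case: (h Dx).
have := ae_foralln ae_k; apply: filterS => x /(_ (Num.truncn `|x|).+1); apply => i.
by rewrite !mxE -ltr_norml; apply: (le_lt_trans (coord_le_norm x i)); exact: truncnS_gt.
Qed.

Lemma L1locB (f g : 'rV[R]_N -> R) : L1loc f -> L1loc g -> L1loc (fun x => f x - g x).
Proof.
move=> [mf If] [mg Ig]; split; first exact: measurable_funB.
move=> K cK; have mK := compact_measurable_rV cK.
by have := integrableB mK (If K cK) (Ig K cK); apply: eq_integrable.
Qed.

Lemma weak_gradient_unique u G H : is_weak_gradient u G -> is_weak_gradient u H ->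
  \forall x \ae mu, G x = H x.
Proof.
move=> [_ LG uG] [_ LH uH].
have ae_i i : \forall x \ae mu, G x 0 i - H x 0 i = 0.
  apply: fundamental_lemma => [|phi tp]; first exact: L1locB.
  under eq_Rintegral do rewrite mulrBl.
  rewrite RintegralB//; last 2 first.
  - exact: L1loc_mul_integrable.
  - exact: L1loc_mul_integrable.
  by rewrite -[X in X - _]opprK -uG// -[X in _ - X]opprK -uH// subrr.
have : \forall x \ae mu, forall i, G x 0 i - H x 0 i = 0 by apply: filter_forall.
by apply: filterS => x h; apply/rowP => i; apply/eqP; rewrite -subr_eq0; exact/eqP/h.
Qed.

End weak_gradient.

(** * Polarization of test functions *)

Section reflection_calculus.
Variables (R : realType) (N : nat) (w : 'rV[R]_N) (c : R).
Hypothesis w0 : w != 0.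
Implicit Types u v phi psi : 'rV[R]_N -> R.

Local Notation mu := (lebesgue_rV R N).
Local Notation e_ := (fun i : 'I_N => delta_mx 0 i : 'rV[R]_N).
Local Notation sigma := (refl w c).
Local Notation sigmaL := (refl w 0).

(** For 0 < c the origin lies on the positive side. Polarization moves the larger of two mirrored
    values to this side, hence towards the origin. *)
Definition side (x : 'rV[R]_N) : R := c - dot w x.

Let ww : dot w w != 0. Proof. by rewrite dot_eq0. Qed.

Lemma side_refl x : side (sigma x) = - side x.
Proof. rewrite /side /refl !dotE; field; exact: ww. Qed.

Lemma refl_affine h (x y : 'rV[R]_N) : sigma (h *: y + x) = h *: sigmaL y + sigma x.
Proof.
by apply/rowP => i; rewrite /refl !dotE !mxE; field; exact: ww.
Qed.

Lemma refl_dotC (a b : 'rV[R]_N) : dot (sigmaL a) b = dot a (sigmaL b).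
Proof. rewrite /refl !dotE (dotC a w); ring. Qed.

Lemma refl_isom (a b : 'rV[R]_N) : dot (sigmaL a) (sigmaL b) = dot a b.
Proof. by rewrite refl_dotC reflK. Qed.

Lemma reflE0 (x : 'rV[R]_N) : sigma x = sigmaL x + sigma 0.
Proof. by have := refl_affine 1 0 x; rewrite !scale1r addr0. Qed.

Lemma refl_sub (x y : 'rV[R]_N) : sigma x - sigma y = sigmaL (x - y).
Proof.
have := refl_affine 1 y (x - y); rewrite !scale1r subrK => ->.
by rewrite addrK.
Qed.

Lemma enorm_reflB (x y : 'rV[R]_N) : enorm (sigma x - sigma y) = enorm (x - y).
Proof. by rewrite refl_sub /enorm refl_isom. Qed.

Lemma refl_fix x : side x = 0 -> sigma x = x.
Proof. by rewrite /side /refl -opprB => /eqP; rewrite oppr_eq0 => /eqP ->; rewrite mulr0 mul0r scale0r subr0. Qed.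

Lemma continuous_lin (k : 'rV[R]_N) : continuous (fun x : 'rV[R]_N => dot k x).
Proof. by apply: continuous_dot => x; [exact: cst_continuous|exact: cvg_id]. Qed.

Lemma continuous_side : continuous side.
Proof. by move=> x; exact: (continuousB (@cst_continuous _ _ _ _) (@continuous_lin w x)). Qed.

Lemma continuous_refl : continuous sigma.
Proof.
move=> x; apply/(@cvgrPdist_le R 'rV[R]_N _ (nbhs x)) => e e0; near=> y.
apply: le_trans (norm_le_enorm _) _; rewrite enorm_reflB; apply: le_trans (enorm_le_norm _) _.
have N1 : 0 < N%:R + 1 :> R by rewrite ltr_wpDl.
apply: (@le_trans _ _ ((N%:R + 1) * `|x - y|)); first by rewrite ler_wpM2r// lerDl.
rewrite -ler_pdivlMl//; near: y; apply: (@cvgr_dist_le _ _ _ (nbhs x) _ id x).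
  exact: cvg_id.
by rewrite mulr_gt0// invr_gt0.
Unshelve. all: by end_near. Qed.

Lemma measurable_side : measurable_fun setT side.
Proof. exact: continuous_measurable_rV continuous_side. Qed.

Lemma bsupp_refl u : bsupp u -> bsupp (u \o sigma).
Proof.
move=> [M uM]; exists (M + enorm (sigma 0)) => x xM; apply: uM.
have : enorm (sigmaL x) = enorm x by rewrite /enorm refl_isom.
have := enormD (sigma x) (- sigma 0); rewrite enormN [in enorm (sigma x - _)]reflE0 addrK.
by move: xM; lra.
Qed.

Lemma Ck_refl k u : Ck k u -> Ck k (u \o sigma).
Proof. by apply: Ck_precomp => [|h v x]; [exact: continuous_refl|exact: refl_affine]. Qed.

Lemma test_refl phi : test_function phi -> test_function (phi \o sigma).
Proof.
move=> /test_functionP[s b]; apply/test_functionP; split; last exact: bsupp_refl.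
by move=> k; exact: Ck_refl.
Qed.

Lemma cgrad_refl phi x : test_function phi ->
  cgrad (phi \o sigma) x = sigmaL (cgrad phi (sigma x)).
Proof.
move=> tp; apply: dot_eqP => v; rewrite refl_dotC.
apply: cgrad_precomp => [h a y||]; first exact: refl_affine.
- exact: test_smooth.
- by apply: Ck_refl; exact: test_smooth.
Qed.

Definition sgs (x : 'rV[R]_N) : R := Num.sg (side x).

Lemma sgs_refl x : sgs (sigma x) = - sgs x.
Proof. by rewrite /sgs side_refl sgrN. Qed.

Lemma measurable_sgs : measurable_fun setT sgs.
Proof.
rewrite (_ : sgs = fun x => (if side x < 0 then -1 else if 0 < side x then 1 else 0)); last first.
  by apply/funext => x; rewrite /sgs; case: sgrP; rewrite ?ltxx// => h; rewrite ?h ?(lt_gtF h).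
apply: measurable_fun_ifT => //.
- exact: measurable_fun_ltr measurable_side _.
- apply: measurable_fun_ifT => //; exact: (measurable_fun_ltr _ measurable_side).
Qed.

Lemma sgs_near x : side x != 0 -> \forall y \near x, sgs y = sgs x.
Proof.
rewrite neq_lt => /orP[sx|sx].
- have /cvgr_lt/(_ _ sx) : side y @[y --> x] --> side x by exact: continuous_side.
  by apply: filterS => y sy; rewrite /sgs !ltr0_sg.
- have /cvgr_gt/(_ _ sx) : side y @[y --> x] --> side x by exact: continuous_side.
  by apply: filterS => y sy; rewrite /sgs !gtr0_sg.
Qed.

Lemma near_eq_cont (f g : 'rV[R]_N -> R) x : (\forall y \near x, f y = g y) ->
  {for x, continuous g} -> {for x, continuous f}.
Proof.
move=> fg cg; rewrite /prop_for /continuous_at (nbhs_singleton fg); apply: cvg_trans cg.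
apply: (@near_eq_cvg _ _ (nbhs x) (nbhs_filter x)).
exact: (filterS (fun y (h : f y = g y) => esym h) fg).
Qed.

Lemma sgs_derive u d i x : (forall y, is_derive y (e_ i) u (d y)) ->
  (side x = 0 -> \forall y \near x, u y = 0) ->
  is_derive x (e_ i) (fun y => sgs y * u y) (sgs x * d x).
Proof.
move=> du u0; have [s0|s0] := eqVneq (side x) 0.
  rewrite {2}/sgs s0 sgr0 mul0r.
  apply: (@near_eq_is_derive _ _ _ (cst 0) _ x (e_ i) 0 _ (is_derive_cst _ _ _)).
  by apply: filterS (u0 s0) => y ->; rewrite mulr0.
apply: (@near_eq_is_derive _ _ _ (fun y => sgs x * u y)).
  by apply: filterS (sgs_near s0) => y ->.
Qed.

(** The sign is locally constant away from the mirror, while near the mirror the product is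
    identically 0. *)
Lemma Ck_sgs k u : Ck k u -> (forall x, side x = 0 -> \forall y \near x, u y = 0) ->
  Ck k (fun x => sgs x * u x).
Proof.
have c0 v : continuous v -> (forall x, side x = 0 -> \forall y \near x, v y = 0) ->
    continuous (fun x => sgs x * v x).
  move=> cv v0 x; have [s0|s0] := eqVneq (side x) 0.
    apply: (@near_eq_cont _ (cst 0)); last exact: cst_continuous.
    by apply: filterS (v0 _ s0) => y ->; rewrite mulr0.
  apply: (@near_eq_cont _ (fun y => sgs x * v y)).
    by apply: filterS (sgs_near s0) => y ->.
  by exact: (continuousM (@cst_continuous _ _ _ _) (cv x)).
elim: k u => [|k IH] u Cu u0; first exact: c0.
apply: (@CkS _ _ _ _ (fun i x => sgs x * partial i u x)) => [|i x|i].
- by apply: c0 => //; exact: Ck_cont Cu.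
- by apply: sgs_derive => [y|]; [exact: (Ck_derive Cu)|exact: u0].
- apply: IH => [|x s0]; first exact: Ck_partial.
  have /nbhs_interior := u0 _ s0; apply: filterS => y uy.
  by rewrite /partial (@near_eq_derive _ _ _ u (cst 0))// derive_cst.
Qed.

Section pol.
Variable del : R.
Hypothesis del0 : 0 < del.

(** The scaling by [del] inside and outside keeps the slope bound 1 and reduces the distance to the
    absolute value to 2 del. *)
Definition softd t := del * soft_abs (del^-1 * t).

Lemma smooth1_softd : smooth1 softd.
Proof.
have := smooth1_affine del del^-1 0 (smooth1_soft_abs R).
by under eq_fun do rewrite addr0.
Qed.

Lemma softdN t : softd (- t) = softd t.
Proof. by rewrite /softd mulrN soft_absN. Qed.

Lemma softd_eq0 t : `|t| <= del -> softd t = 0.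
Proof.
move=> td; rewrite /softd soft_abs_eq0 ?mulr0// normrM gtr0_norm ?invr_gt0//.
by rewrite ler_pdivrMl// mulr1.
Qed.

Lemma softd_ge0 t : 0 <= softd t.
Proof. by rewrite mulr_ge0 ?soft_abs_ge0// ltW. Qed.

Lemma softd_bounds t : `|t| - 2 * del <= softd t <= `|t|.
Proof.
have := soft_abs_bounds (del^-1 * t); rewrite normrM gtr0_norm ?invr_gt0//.
rewrite -(ler_pM2l del0) -[X in _ && X -> _](ler_pM2l del0) mulrBr mulrA mulfV ?gt_eqF// mul1r.
by rewrite [del * 2]mulrC.
Qed.

Lemma softd_lip s t : `|softd s - softd t| <= `|s - t|.
Proof.
rewrite /softd -mulrBr normrM gtr0_norm// -ler_pdivlMl//.
apply: le_trans (soft_abs_lip _ _) _.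
by rewrite -mulrBr normrM gtr0_norm ?invr_gt0.
Qed.

Lemma softd_derive t : exists2 d, is_derive t (1 : R) softd d & `|d| <= 1.
Proof.
have [d dd d1] := soft_abs_derive (del^-1 * t).
exists d => //; rewrite (_ : d = del *: (d * del^-1)); last first.
  by rewrite -[RHS]/(_ * _) mulrCA mulfV ?mulr1// gt_eqF.
apply: is_deriveZ; apply: (@is_derive1_comp R (@soft_abs R) (fun t => del^-1 * t)) => //.
by have := is_derive_affine1 del^-1 0 t; under eq_fun do rewrite addr0.
Qed.

(* Smooth two-point rearrangement with respect to the half-space [0 < side]. *)
Definition pol phi (x : 'rV[R]_N) : R :=
  2^-1 * (phi x + phi (sigma x)) + sgs x * (2^-1 * softd (phi x - phi (sigma x))).

Lemma pol_refl phi x : pol phi (sigma x) =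
  2^-1 * (phi x + phi (sigma x)) + sgs x * (- 2^-1 * softd (phi x - phi (sigma x))).
Proof.
rewrite /pol sgs_refl reflK// -[phi (sigma x) - _]opprB softdN [phi _ + phi x]addrC.
by rewrite mulNr [in RHS]mulNr mulrN.
Qed.

Let diff_near0 phi : continuous phi -> forall x, side x = 0 ->
  \forall y \near x, softd (phi y - phi (sigma y)) = 0.
Proof.
move=> cp x s0.
have cd : (fun y => phi y - phi (sigma y)) y @[y --> x] --> phi x - phi (sigma x).
  apply: (continuousB (cp x)).
  by apply: (@continuous_comp _ _ _ sigma phi); [exact: continuous_refl|exact: cp].
move/cvgrPdist_le : cd => /(_ _ del0); apply: filterS => y.
rewrite [in X in X - _](refl_fix s0) subrr sub0r normrN; exact: softd_eq0.
Qed.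

Lemma pol_test phi : test_function phi -> test_function (pol phi).
Proof.
move=> tp; have ts := test_refl tp; have /test_functionP[sp [M pM]] := tp.
have /test_functionP[ss [K pK]] := ts.
apply/test_functionP; split; last first.
  exists (Num.max M K) => x; rewrite gt_max => /andP[xM xK]; rewrite /pol pM//.
  have /= -> := pK x xK.
  by rewrite subrr softd_eq0 ?normr0 ?(ltW del0)// !(mulr0, addr0).
move=> k; apply: CkD; first by apply: CkZ; apply: CkD => //; exact: ss.
apply: Ck_sgs => [|x s0]; last first.
  by apply: filterS (diff_near0 (test_cont tp) s0) => y ->; rewrite mulr0.
apply: CkZ; apply: (Ck_comp smooth1_softd); apply: CkD; first exact: sp.
by under eq_fun do rewrite -mulN1r; apply: CkZ; exact: ss.
Qed.

(** The number t is the sign of the side times the slope of [softd]; it depends on x but not on the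
    factor l. Thus one t serves both [pol phi] (l = 1/2) and its reflection (l = - 1/2). *)
Let pol_grad_gen phi (k : R) : test_function phi -> forall x, exists2 t,
  `|t| <= 1 & cgrad (fun x => 2^-1 * (phi x + phi (sigma x)) + sgs x * (k * softd (phi x - phi (sigma x)))) x =
   (2^-1 + k * t) *: cgrad phi x + (2^-1 - k * t) *: cgrad (phi \o sigma) x /\
   forall (l : R), cgrad (fun x => 2^-1 * (phi x + phi (sigma x)) + sgs x * (l * softd (phi x - phi (sigma x)))) x =
   (2^-1 + l * t) *: cgrad phi x + (2^-1 - l * t) *: cgrad (phi \o sigma) x.
Proof.
move=> tp x; have ts := test_refl tp.
have /choice[df dP] := fun t => (let: ex_intro2 d H1 H2 := softd_derive t in
   ex_intro (fun d => is_derive t (1 : R) softd d /\ `|d| <= 1) d (conj H1 H2)).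
pose t := sgs x * df (phi x - phi (sigma x)).
have H l : cgrad (fun x => 2^-1 * (phi x + phi (sigma x)) + sgs x * (l * softd (phi x - phi (sigma x)))) x =
   (2^-1 + l * t) *: cgrad phi x + (2^-1 - l * t) *: cgrad (phi \o sigma) x.
  apply/rowP => i; rewrite !mxE.
  have dp y : is_derive y (e_ i) phi (partial i phi y).
    by apply: (@Ck_derive _ _ 0); exact: test_smooth.
  have ds y : is_derive y (e_ i) (phi \o sigma) (partial i (phi \o sigma) y).
    by apply: (@Ck_derive _ _ 0); exact: test_smooth.
  pose D y := l * (df (phi y - phi (sigma y)) * (partial i phi y - partial i (phi \o sigma) y)).
  have H1 y : is_derive y (e_ i) (fun y => l * softd (phi y - phi (sigma y))) (D y).
    apply: is_deriveZ.
    apply: (@is_derive_comp1 _ _ softd (fun y => phi y - phi (sigma y))); exact: (dP _).1.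
  have H2 : is_derive x (e_ i) (fun y => sgs y * (l * softd (phi y - phi (sigma y)))) (sgs x * D x).
    apply: sgs_derive => // s0.
    by apply: filterS (diff_near0 (test_cont tp) s0) => y ->; rewrite mulr0.
  have H3 : is_derive x (e_ i) (fun y => 2^-1 * (phi y + phi (sigma y)))
      (2^-1 * (partial i phi x + partial i (phi \o sigma) x)).
    by apply: is_deriveZ; exact: is_deriveD.
  have H4 := is_deriveD H3 H2.
  rewrite /partial (@derive_val _ _ _ _ _ _ _ H4) /D /t -!/(partial _ _ _); ring.
exists t; last by split.
rewrite /t normrM; apply: mulr_ile1 => //; last exact: (dP _).2.
by rewrite /sgs normr_sg; case: (_ != 0).
Qed.

(** The two convex combinations have exchanged weights. Summing a convex function over both
    therefore gives at most its sum over the two original gradients. *)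
Lemma pol_grad phi x : test_function phi -> exists2 t : R, 0 <= t <= 1 &
  cgrad (pol phi) x = t *: cgrad phi x + (1 - t) *: cgrad (phi \o sigma) x /\
  cgrad (pol phi \o sigma) x = (1 - t) *: cgrad phi x + t *: cgrad (phi \o sigma) x.
Proof.
move=> tp; have [t t1 [_ H]] := pol_grad_gen 1 tp x.
exists (2^-1 + 2^-1 * t); first by move: t1; rewrite ler_norml; lra.
split; first by rewrite (H 2^-1); congr (_ *: _ + _ *: _); lra.
have -> : pol phi \o sigma = (fun x => 2^-1 * (phi x + phi (sigma x)) +
    sgs x * (- 2^-1 * softd (phi x - phi (sigma x)))).
  by apply/funext => y /=; exact: pol_refl.
by rewrite (H (- 2^-1)); congr (_ *: _ + _ *: _); lra.
Qed.

End pol.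

End reflection_calculus.

(** * Interpolation and Gagliardo-Nirenberg estimates *)

Section series_of_integrals.
Context d (T : measurableType d) (R : realType) (mu : {measure set T -> \bar R}).

Lemma nneseries_geometric_le (a z : R) : 0 <= a -> 0 < z < 1 ->
  (\sum_(n <oo) (a * z ^+ n)%:E <= (a / (1 - z))%:E)%E.
Proof.
move=> a0 /andP[z0 z1]; apply: lime_le.
  by apply: is_cvg_nneseries => n _ _; rewrite lee_fin mulr_ge0// exprn_ge0// ltW.
apply: nearW => n; rewrite sumEFin lee_fin; apply: (@geometric_le_lim R n a z) => //.
by rewrite ger0_norm// ltW.
Qed.

Lemma integral_nneseries_le (h : nat -> T -> \bar R) (a z : R) : 0 <= a -> 0 < z < 1 ->
  (forall n, measurable_fun setT (h n)) -> (forall n x, (0 <= h n x)%E) ->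
  (forall n, (\int[mu]_x h n x <= (a * z ^+ n)%:E)%E) ->
  (\int[mu]_x (\sum_(n <oo) h n x) <= (a / (1 - z))%:E)%E.
Proof.
move=> a0 z01 mh h0 hle; rewrite integral_nneseries//.
apply: (le_trans _ (nneseries_geometric_le a0 z01)).
by apply: lee_nneseries => n *; [exact: integral_ge0|exact: hle].
Qed.

Lemma nneseries_term_le (u : nat -> \bar R) k : (forall n, (0 <= u n)%E) ->
  (u k <= \sum_(n <oo) u n)%E.
Proof.
move=> u0; apply: le_trans (nneseries_lim_ge (P := xpredT) k.+1 (fun n _ _ => u0 n)).
by rewrite big_nat_recr//= leeDr// sume_ge0.
Qed.

(** The sum of the series is an integrable majorant of the whole sequence, and its almost everywhere
    finiteness makes the terms tend to 0. Fast decay of the integrals thus replaces the extraction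
    of a subsequence. *)
Lemma fast_majorant (h : nat -> T -> R) :
  (forall n, measurable_fun setT (h n)) -> (forall n x, 0 <= h n x) ->
  (forall n, (\int[mu]_x (h n x)%:E <= (2^-1 ^+ n)%:E)%E) ->
  exists S : T -> \bar R, [/\ mu.-integrable setT S,
    forall n x, ((h n x)%:E <= S x)%E &
    \forall x \ae mu, h n x @[n --> \oo] --> (0 : R)].
Proof.
move=> mh h0 hle.
have mh' n : measurable_fun setT (EFin \o h n) by exact/measurable_EFinP.
have h0' n x : (0 <= (EFin \o h n) x)%E by rewrite lee_fin.
exists (fun x => \sum_(n <oo) (h n x)%:E)%E.
have iS : mu.-integrable setT (fun x => \sum_(n <oo) (h n x)%:E)%E.
  apply/integrableP; split.
    apply: (@ge0_emeasurable_sum _ _ _ setT (fun n => EFin \o h n) xpredT) => //.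
  under eq_integral => x _ do (rewrite gee0_abs; last by apply: nneseries_ge0 => n _ _; exact: h0').
  apply: le_lt_trans (@integral_nneseries_le (fun n => EFin \o h n) 1 2^-1 _ _ _ _ _) _ => //.
  - by lra.
  - by move=> n; rewrite mul1r; exact: hle.
  - exact: ltry.
split => //.
  by move=> n x; exact: (nneseries_term_le n (h0'^~ x)).
have := integrable_ae measurableT iS; apply: filterS => x /(_ I) Sfin.
have Sx : (\sum_(n <oo) (h n x)%:E < +oo)%E by rewrite ltey_eq Sfin.
have T0 := nneseries_tail_cvg Sx (fun k _ => h0' k x).
suff /fine_cvgP[] : ((h n x)%:E @[n --> \oo] --> (0 : R)%:E)%E by [].
apply: (squeeze_cvge _ (cvg_cst _) T0); apply: nearW => n /=.
rewrite (h0' n x)/=.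
have := @nneseries_lim_ge R (fun n => (h n x)%:E) xpredT n n.+1 (fun k _ _ => h0' k x).
by rewrite big_nat1.
Qed.

End series_of_integrals.

Section weak_type.
Context d (T : measurableType d) (R : realType) (mu : {measure set T -> \bar R}).

Lemma dyadic_lower (K y : R) : 0 < K -> 0 < y -> y <= K ->
  exists j : nat, 2^-1 ^+ j.+1 * K < y <= 2^-1 ^+ j * K.
Proof.
move=> K0 y0 yK.
have [j jP] : exists j : nat, 2^-1 ^+ j.+1 * K < y.
  have [j jP] : exists j : nat, y^-1 * K < 2 ^+ j.+1.
    exists (Num.truncn (y^-1 * K)); apply: lt_le_trans (truncnS_gt _) _.
    by rewrite -natrX ler_nat ltnW// ltn_expl.
  by exists j; move: jP; rewrite ltr_pdivrMl// exprVn ltr_pdivrMl ?exprn_gt0// mulrC.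
have := ex_minnP (ex_intro (fun j => 2^-1 ^+ j.+1 * K < y) j jP) => -[m mP mmin].
exists m; rewrite mP/=; case: m mP mmin => [|m] mP mmin; first by rewrite expr0 mul1r.
by rewrite leNgt; apply/negP => /mmin; rewrite ltnn.
Qed.

Lemma dyadic_upper (K y : R) : 0 < K -> K < y ->
  exists j : nat, 2 ^+ j * K < y <= 2 ^+ j.+1 * K.
Proof.
move=> K0 yK.
have [j jP] : exists j : nat, y <= 2 ^+ j.+1 * K.
  exists (Num.truncn (y / K)); rewrite -ler_pdivrMr//; apply/ltW/(lt_le_trans (truncnS_gt _)).
  by rewrite -natrX ler_nat ltnW// ltn_expl.
have := ex_minnP (ex_intro (fun j => y <= 2 ^+ j.+1 * K) j jP) => -[m mP mmin].
exists m; rewrite mP andbT; case: m mP mmin => [|m] mP mmin; first by rewrite expr0 mul1r.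
by rewrite ltNge; apply/negP => /mmin; rewrite ltnn.
Qed.

(* Layer-cake summation over dyadic levels: the levels below K are summed with
   the exponent 2, the levels above K with the exponent r. *)
Lemma weak_type_interpolation (p r : R) : 2 < p -> p < r -> exists2 C : R, 0 < C &
  forall (f : T -> R) (a A K : R), measurable_fun setT f -> (forall x, 0 <= f x) ->
    0 <= a -> 0 <= A -> 0 < K ->
    (forall l : R, 0 < l -> (mu [set x | (l < f x)%R] <= (a * l ^- 2)%:E)%E) ->
    (forall l : R, 0 < l -> (mu [set x | (l < f x)%R] <= (A * l `^ (- r))%:E)%E) ->
    (\int[mu]_x (f x `^ p)%:E <= (C * (a * K `^ (p - 2) + A * K `^ (p - r)))%:E)%E.
Proof.
(* Ratios of the two geometric series; both are below 1 because 2 < p < r. *)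
move=> p2 pr; pose z1 : R := 2 `^ (p - r); pose z2 : R := 2 `^ (2 - p).
have zlt (s : R) : s < 0 -> 0 < (2 : R) `^ s < 1.
  by move=> s0; rewrite powR_gt0//= /powR pnatr_eq0/= expR_lt1 nmulr_rlt0// ln_gt0// ltr1n.
have z1P : 0 < z1 < 1 by apply: zlt; lra.
have z2P : 0 < z2 < 1 by apply: zlt; lra.
have t0 : 0 < 2 `^ p :> R by rewrite powR_gt0.
(* The ends of a dyadic level differ by a factor 2. It enters as 2^p through the value of f above K,
   and as 4 = 2^2 through the level bound below K. *)
exists (2 `^ p / (1 - z1) + 4 / (1 - z2)) => [|f a A K mf f0 a0 A0 K0 fa fA].
  by move: z1P z2P => /andP[_ ?] /andP[_ ?]; rewrite addr_gt0// divr_gt0// subr_gt0.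
have ml (l : R) : measurable [set x | l < f x].
  rewrite -[X in measurable X]setTI.
  have := mf measurableT `]l, +oo[%classic (measurable_itv _).
  by congr (measurable (_ `&` _)); apply/seteqP; split => x /=; rewrite in_itv/= andbT.
pose g c l x : \bar R := ((c : R)%:E * (\1_[set x | ((l : R) < f x)%R] x)%:E)%E.
have mg (c l : R) : measurable_fun setT (g c l).
  apply/measurable_EFinP; apply: measurable_funM => //.
have g0 (c l : R) x : 0 <= c -> (0 <= g c l x)%E by move=> c0; rewrite mule_ge0 ?lee_fin.
have ig (c l : R) : 0 <= c -> (\int[mu]_x g c l x = c%:E * mu [set x | (l < f x)%R])%E.
  move=> c0; rewrite ge0_integralZl_EFin//.
    by rewrite integral_indic// setIT.
  by apply/measurable_EFinP; exact: measurable_indic.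
have gE (c l : R) x : l < f x -> g c l x = c%:E.
  by move=> lf; rewrite /g indicE mem_set// mule1.
pose u n x := g ((2 ^+ n.+1 * K) `^ p) (2 ^+ n * K) x.
pose v n x := g ((2^-1 ^+ n * K) `^ p) (2^-1 ^+ n.+1 * K) x.
have u0 n x : (0 <= u n x)%E by rewrite g0 ?powR_ge0.
have v0 n x : (0 <= v n x)%E by rewrite g0 ?powR_ge0.
have mser (h : nat -> T -> \bar R) : (forall n, measurable_fun setT (h n)) -> (forall n (x : T), (0 <= h n x)%E) ->
    measurable_fun setT (fun x => \sum_(n <oo) h n x)%E.
  by move=> mh h0; exact: (@ge0_emeasurable_sum _ _ _ setT h xpredT).
apply: (@le_trans _ _ (\int[mu]_x (\sum_(n <oo) u n x + \sum_(n <oo) v n x))%E).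
  apply: ge0_le_integral => //.
  - by move=> x _; rewrite lee_fin powR_ge0.
  - by apply/measurable_EFinP; exact: measurableT_comp (measurable_powR _ ) mf.
  - by apply: emeasurable_funD; apply: mser => // n; exact: mg.
  move=> x _; have [fx0|fx0] := eqVneq (f x) 0.
    rewrite fx0 powR0; first by rewrite adde_ge0// nneseries_ge0.
    by rewrite gt_eqF//; lra.
  have {}fx0 : 0 < f x by rewrite lt_def fx0 f0.
  have [fK|fK] := leP (f x) K.
    have [j /andP[j1 j2]] := dyadic_lower K0 fx0 fK.
    apply: le_trans _ (leeDr _ _); last by rewrite nneseries_ge0.
    apply: le_trans (nneseries_term_le j (v0^~ x)); rewrite /v gE// lee_fin.
    by rewrite ge0_ler_powR ?nnegrE ?mulr_ge0 ?exprn_ge0 ?(ltW K0) ?(ltW fx0)//; lra.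
  have [j /andP[j1 j2]] := dyadic_upper K0 fK.
  apply: le_trans _ (leeDl _ _); last by rewrite nneseries_ge0.
  apply: le_trans (nneseries_term_le j (u0^~ x)); rewrite /u gE// lee_fin.
  by rewrite ge0_ler_powR ?nnegrE ?mulr_ge0 ?exprn_ge0 ?(ltW K0) ?(ltW fx0)//; lra.
rewrite ge0_integralD//; first last.
- by apply: mser => // n; exact: mg.
- by move=> x _; rewrite nneseries_ge0.
- by apply: mser => // n; exact: mg.
- by move=> x _; rewrite nneseries_ge0.
have powX (x s : R) n : 0 <= x -> (x ^+ n) `^ s = (x `^ s) ^+ n.
  by move=> x0; rewrite -(powR_mulrn n x0) -(powR_mulrn n (powR_ge0 _ _)) -!powRrM mulrC.
have pn (x : R) n : 0 < x -> 0 < x ^+ n by exact: exprn_gt0.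
have Kn0 (s : R) : K `^ s != 0 by rewrite gt_eqF// powR_gt0.
have H1 : (\int[mu]_x (\sum_(n <oo) u n x) <= ((2 `^ p * (A * K `^ (p - r))) / (1 - z1))%:E)%E.
  apply: integral_nneseries_le => //.
  - by rewrite !mulr_ge0 ?powR_ge0.
  - by move=> n; exact: mg.
  move=> n; rewrite ig ?powR_ge0//.
  have l0 : 0 < 2 ^+ n * K by rewrite mulr_gt0 ?pn.
  apply: (@le_trans _ _ (((2 ^+ n.+1 * K) `^ p)%:E * (A * (2 ^+ n * K) `^ (- r))%:E)%E).
    by rewrite lee_wpmul2l ?lee_fin ?powR_ge0 ?fA.
  rewrite -EFinM lee_fin le_eqVlt; apply/orP; left; apply/eqP.
  rewrite !powRM ?exprn_ge0 ?(ltW K0)// exprS powRM ?exprn_ge0// !powX//.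
  rewrite /z1 !powRD ?(gt_eqF K0) ?implybT// ?pnatr_eq0 ?implybT// exprMn; ring.
have H2 : (\int[mu]_x (\sum_(n <oo) v n x) <= ((4 * (a * K `^ (p - 2))) / (1 - z2))%:E)%E.
  apply: integral_nneseries_le => //.
  - by rewrite !mulr_ge0 ?powR_ge0.
  - by move=> n; exact: mg.
  move=> n; rewrite ig ?powR_ge0//.
  have l0 : 0 < 2^-1 ^+ n.+1 * K by rewrite mulr_gt0 ?pn// invr_gt0.
  apply: (@le_trans _ _ (((2^-1 ^+ n * K) `^ p)%:E * (a * (2^-1 ^+ n.+1 * K) ^- 2)%:E)%E).
    by rewrite lee_wpmul2l ?lee_fin ?powR_ge0 ?fa.
  rewrite -EFinM lee_fin le_eqVlt; apply/orP; left; apply/eqP.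
  rewrite !powRM ?exprn_ge0 ?invr_ge0 ?(ltW K0)// !powX ?invr_ge0//.
  have K2 : K `^ 2 = K ^+ 2 by rewrite -[2]/(2%:R) powR_mulrn// ltW.
  have two2 : (2 : R) `^ 2 = 2 ^+ 2 by rewrite -[X in _ `^ X]/(2%:R) powR_mulrn.
  have tn : (2 : R) ^+ n != 0 by rewrite gt_eqF// pn.
  have K0' : K != 0 by rewrite gt_eqF.
  rewrite /z2 (@powRD _ 2 2 (- p)) ?pnatr_eq0 ?implybT// (@powRD _ K p (- 2)) ?K0' ?implybT//.
  rewrite two2 (powRN K 2) K2 (_ : 2^-1 `^ p = 2 `^ (- p)); last by rewrite -powR_inv1// -powRrM mulN1r.
  rewrite (exprS _ n) (exprMn n) (exprAC 2 2 n) exprVn.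
  by field; rewrite tn K0'.
apply: le_trans (leeD H1 H2) _; rewrite -EFinD lee_fin.
have X0 : 0 <= A * K `^ (p - r) by rewrite mulr_ge0 ?powR_ge0.
have Y0 : 0 <= a * K `^ (p - 2) by rewrite mulr_ge0 ?powR_ge0.
have c1 : 0 < 2 `^ p / (1 - z1) by move: z1P => /andP[_ ?]; rewrite divr_gt0// subr_gt0.
have c2 : 0 < 4 / (1 - z2) by move: z2P => /andP[_ ?]; rewrite divr_gt0// subr_gt0.
rewrite [2 `^ p * _ / _]mulrAC [4 * _ / _]mulrAC mulrDl !mulrDr.
by have := mulr_ge0 (ltW c1) Y0; have := mulr_ge0 (ltW c2) X0; lra.
Qed.

End weak_type.

Section gagliardo_nirenberg.
Variables (R : realType) (N : nat).
Implicit Types u phi psi : 'rV[R]_N -> R.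

Local Notation mu := (lebesgue_rV R N).

Lemma sum_sqr_le n (a : 'I_n -> R) : (\sum_i a i) ^+ 2 <= n%:R * \sum_i a i ^+ 2.
Proof.
have := dot_cauchy (const_mx 1 : 'rV[R]_n) (\row_i a i); rewrite /dot.
under eq_bigr do rewrite !mxE mul1r.
under [in X in _ <= X * _]eq_bigr do rewrite !mxE mul1r.
under [in X in _ <= _ * X]eq_bigr do rewrite !mxE -expr2.
by rewrite sumr_const card_ord.
Qed.

Lemma measurable_sqr (d : measure_display) (T : measurableType d) (f : T -> R) : measurable_fun setT f ->
  measurable_fun setT (fun x => (f x ^+ 2)%:E).
Proof. by move=> mf; apply/measurable_EFinP; exact: measurable_funX. Qed.

Lemma measurable_cgrad phi : test_function phi -> measurable_fun setT (cgrad phi).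
Proof.
move=> tp; apply/measurable_rV_row => i; under eq_fun do rewrite mxE.
exact: test_meas (test_partial i tp).
Qed.

Lemma cgrad_bounded phi : test_function phi ->
  exists2 K : R, 0 <= K & forall x, enorm (cgrad phi x) <= K.
Proof.
move=> tp; have K_ i : exists K : R, forall x, `|partial i phi x| <= K.
  by have [K _ KP] := test_bounded (test_partial i tp); exists K.
have /choice[K KP] := K_.
exists (N%:R * \sum_i `|K i|) => [|x]; first by rewrite mulr_ge0// sumr_ge0.
apply: le_trans (enorm_le_norm _) _; rewrite ler_wpM2l//.
apply: rV_norm_le => [|i]; first exact: sumr_ge0.
rewrite mxE (le_trans (KP i x))// (bigD1 i)//= (le_trans (ler_norm _))// lerDl.
by rewrite sumr_ge0.
Qed.

Lemma cgrad_out phi (M : R) x : (forall x, M < enorm x -> phi x = 0) -> M < enorm x ->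
  cgrad phi x = 0.
Proof.
move=> pM xM; apply/rowP => i; rewrite !mxE /partial.
transitivity ('D_(delta_mx 0 i) (cst 0 : 'rV[R]_N -> R) x); last by rewrite derive_cst.
apply: near_eq_derive.
have /cvgr_gt/(_ _ xM) : enorm y @[y --> x] --> enorm x by exact: continuous_enorm.
by apply: filterS => y; exact: pM.
Qed.

Lemma measurable_translate phi (y : 'rV[R]_N) : measurable_fun setT phi ->
  measurable_fun setT (fun x : 'rV[R]_N => phi (x + y)).
Proof. by move=> mp; apply: (measurableT_comp mp); exact: measurable_rV_add. Qed.

(** Travel y in n + 1 equal steps. Cauchy-Schwarz on the telescoping sum costs a factor n + 1, and
    the n + 1 summands have equal integrals by translation invariance. *)
Let step phi (y : 'rV[R]_N) : test_function phi -> forall n : nat,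
  (\int[mu]_x ((phi (x + y) - phi x) ^+ 2)%:E <=
   \int[mu]_x ((n.+1%:R * (phi (x + n.+1%:R^-1 *: y) - phi x)) ^+ 2)%:E)%E.
Proof.
move=> tp n; have mp := test_meas tp; set m := n.+1.
pose D x := phi (x + m%:R^-1 *: y) - phi x.
have mD : measurable_fun setT D by apply: measurable_funB => //; exact: measurable_translate.
have DE x : phi (x + y) - phi x = \sum_(k < m) D (x + (k%:R / m%:R) *: y).
  rewrite -(big_mkord xpredT (fun k => D (x + (k%:R / m%:R) *: y))).
  rewrite (@telescope_sumr_eq _ 0 m (fun k : nat => phi (x + (k%:R / m%:R) *: y)))// => [|k _].
    by rewrite divff ?pnatr_eq0// scale1r mul0r scale0r addr0.
  rewrite /D -addrA -scalerDl; congr (phi (_ + _ *: _) - _).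
  by rewrite -natr1 mulrDl mul1r.
apply: (@le_trans _ _ (\int[mu]_x \sum_(k < m) (m%:R * D (x + (k%:R / m%:R) *: y) ^+ 2)%:E)%E).
  apply: ge0_le_integral => //.
  - by move=> x _; rewrite lee_fin sqr_ge0.
  - by apply: measurable_sqr; apply: measurable_funB => //; exact: measurable_translate.
  - apply: emeasurable_sum => k; apply/measurable_EFinP; apply: measurable_funM => //.
    by apply: measurable_funX; exact: measurable_translate.
  - by move=> x _; rewrite DE sumEFin lee_fin -mulr_sumr; exact: sum_sqr_le.
rewrite ge0_integral_sum//; first last.
- by move=> k x _; rewrite lee_fin mulr_ge0// sqr_ge0.
- move=> k; apply/measurable_EFinP; apply: measurable_funM => //.
  by apply: measurable_funX; exact: measurable_translate.
have E k : (\int[mu]_x (m%:R * D (x + (k%:R / m%:R) *: y) ^+ 2)%:E = m%:R%:E * \int[mu]_x (D x ^+ 2)%:E)%E.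
  rewrite -(@integral_shift R N (fun x => (D x ^+ 2)%:E) ((k%:R / m%:R) *: y)); first last.
  - by move=> x; rewrite lee_fin sqr_ge0.
  - exact: measurable_sqr.
  under eq_integral do rewrite EFinM; rewrite ge0_integralZl_EFin//.
  - by move=> x _; rewrite lee_fin sqr_ge0.
  - by apply: measurable_sqr; exact: measurable_translate.
under eq_bigr do rewrite E.
rewrite -(ge0_integralZl_EFin mu measurableT); first last.
- exact: ler0n.
- exact: measurable_sqr.
- by move=> x _; rewrite lee_fin sqr_ge0.
rewrite -ge0_integral_sum//; first last.
- by move=> k x _; rewrite -EFinM lee_fin mulr_ge0// sqr_ge0.
- move=> k; under eq_fun do rewrite -EFinM.
  by apply/measurable_EFinP; apply: measurable_funM => //; exact: measurable_funX.
rewrite le_eqVlt; apply/orP; left; apply/eqP; apply: eq_integral => x _.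
under eq_bigr do rewrite -EFinM.
rewrite sumEFin sumr_const card_ord -[phi _ - _]/(D x); congr (_%:E).
by rewrite -[LHS]mulr_natl mulrA -expr2 -exprMn.
Qed.

(** The right-hand sides of [step] are squared difference quotients; they converge, dominated by a
    constant on a ball, to the squared derivative along y, and Cauchy-Schwarz concludes. *)
Lemma translation_estimate phi (y : 'rV[R]_N) : test_function phi ->
  (\int[mu]_x ((phi (x + y) - phi x) ^+ 2)%:E <=
   (dot y y)%:E * \int[mu]_x (dot (cgrad phi x) (cgrad phi x))%:E)%E.
Proof.
move=> tp; have mp := test_meas tp.
have [K K0 KP] := cgrad_bounded tp; have [_ [M pM]] := (test_functionP _).1 tp.
pose q n x := (n.+1%:R * (phi (x + n.+1%:R^-1 *: y) - phi x)) ^+ 2.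
pose f x := dot (cgrad phi x) y ^+ 2.
have mg := measurable_cgrad tp.
have mq n : measurable_fun setT (q n).
  apply: measurable_funX; apply: measurable_funM => //; apply: measurable_funB => //.
  exact: measurable_translate.
have mf : measurable_fun setT f by apply: measurable_funX; exact: measurable_dot.
have dphi x (t : R) : is_derive (x + t *: y) y phi (dot (cgrad phi (x + t *: y)) y).
  by apply: Ck1_derive; exact: test_smooth.
have C0 : 0 <= (K * enorm y) ^+ 2 by rewrite sqr_ge0.
pose D : set 'rV[R]_N := eball (`|M| + enorm y + 1).
have mD : measurable D by exact: measurable_eball.
pose g (x : 'rV[R]_N) : \bar R := ((cst ((K * enorm y) ^+ 2)%:E) \_ D) x.
have ig : mu.-integrable setT g.
  apply/(integrable_mkcond _ mD) => //.
  apply: (@measurable_bounded_integrable _ _ _ _ (cst ((K * enorm y) ^+ 2))) => //.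
    exact: eball_measure_lty.
  by exists ((K * enorm y) ^+ 2); split; [rewrite num_real|move=> L LK x _ /=; rewrite ger0_norm// ltW].
have qle n x : (`|(q n x)%:E| <= g x)%E.
  rewrite /g patchE; case: ifPn => [_|xD]; last first.
    have {}xD : `|M| + enorm y + 1 <= enorm x.
      by rewrite leNgt; apply/negP => h; move/negP: xD; apply; apply/mem_set.
    have xM : M < enorm x by have := ler_norm M; have := enorm_ge0 y; lra.
    rewrite /q pM ?pM ?subrr ?mulr0 ?expr0n ?abse0//.
    have := enormD (x + n.+1%:R^-1 *: y) (- (n.+1%:R^-1 *: y)); rewrite addrK enormN enormZ.
    have : `|n.+1%:R^-1| * enorm y <= enorm y.
      by rewrite ler_piMl ?enorm_ge0// ger0_norm// invf_le1// ler1n.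
    have := ler_norm M; lra.
  rewrite lee_fin ger0_norm ?sqr_ge0// /q.
  have [c _ ->] := @MVT_dir R _ phi _ x y n.+1%:R^-1 (dphi x).
  rewrite mulrCA mulfV// mulr1 -real_normK ?num_real// ler_sqr ?nnegrE ?mulr_ge0 ?enorm_ge0//.
  by apply: le_trans (norm_dot_le _ _) _; rewrite ler_wpM2r ?enorm_ge0.
have qcvg x : q n x @[n --> \oo] --> f x.
  suff H : (n.+1%:R * (phi (x + n.+1%:R^-1 *: y) - phi x)) @[n --> \oo] --> dot (cgrad phi x) y.
    by have := cvgM H H; apply.
  have /is_derive_eps H := @Ck1_derive _ _ phi (test_smooth tp 1) x y.
  apply/cvgrPdist_le => e e0; have [d d0 dP] := H _ e0.
  have [n0 n0P] : exists n0 : nat, forall n : nat, (n0 <= n)%N -> n.+1%:R^-1 < d.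
    exists (Num.truncn d^-1) => n n0n; rewrite invf_plt ?posrE//.
    by apply: (lt_le_trans (truncnS_gt _)); rewrite ler_nat.
  near=> n; have nd : n.+1%:R^-1 < d by apply: n0P; near: n; exact: nbhs_infty_ge.
  have ng : `|n.+1%:R^-1| = n.+1%:R^-1 :> R by rewrite ger0_norm.
  have := dP n.+1%:R^-1; rewrite ng => /(_ nd).
  rewrite -(ler_pM2l (_ : 0 < n.+1%:R :> R))// -[X in X * `|_|]ger0_norm// -normrM.
  rewrite mulrCA mulfV// mulr1 distrC; congr (`| _ | <= _); rewrite [_ + x]addrC; field.
  by rewrite nat1r pnatr_eq0.
have [If _ cI] := @dominated_cvg_real _ _ _ mu q f g mq mf
  (aeW _ qcvg) ig (aeW _ (fun x n => qle n x)).
apply: (@le_trans _ _ (\int[mu]_x (f x)%:E)%E).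
  by apply: (cvge_to_ge cI); apply: nearW => n; exact: step.
rewrite -(ge0_integralZl_EFin mu measurableT); first last.
- exact: dot_ge0.
- by apply/measurable_EFinP; exact: measurable_dot.
- by move=> x _; rewrite lee_fin dot_ge0.
apply: ge0_le_integral => //.
- by move=> x _; rewrite lee_fin sqr_ge0.
- exact/measurable_EFinP.
- by under eq_fun do rewrite -EFinM; apply/measurable_EFinP; apply: measurable_funM => //; exact: measurable_dot.
- by move=> x _; rewrite -EFinM lee_fin mulrC; exact: dot_cauchy.
Unshelve. all: by end_near. Qed.

(* Averaging phi over the cube [0,h]^N, with h chosen such that the square of
   l/2 integrates over this cube to the bound on the L^2 norm. *)
Lemma weak_type_gradient phi (rho M l : R) : (0 < N)%N -> test_function phi -> 0 < rho ->
  (\int[mu]_x (phi x ^+ 2)%:E <= (rho ^+ 2)%:E)%E ->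
  (\int[mu]_x (dot (cgrad phi x) (cgrad phi x))%:E <= M%:E)%E -> 0 < l ->
  (mu [set x | (l < `|phi x|)%R] <=
   (4 * N%:R * (2 * rho) `^ (4 / N%:R) * M * l `^ (- (2 + 4 / N%:R)))%:E)%E.
Proof.
move=> N0 tp r0 ip ig l0; have mp := test_meas tp.
have Nr : 0 < N%:R :> R by rewrite ltr0n.
pose h : R := (2 * rho / l) `^ (2 / N%:R).
have rl0 : 0 < 2 * rho / l by rewrite divr_gt0// mulr_gt0.
have h0 : 0 < h by rewrite powR_gt0.
have hN : h ^+ N = 4 * rho ^+ 2 / l ^+ 2.
  rewrite -powR_mulrn ?(ltW h0)// /h -powRrM mulrVK ?unitfE ?gt_eqF//.
  rewrite (powR_mulrn 2) ?(ltW rl0)// !exprMn exprVn; congr (_ * _ / _); ring.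
pose Q : set 'rV[R]_N := [set x | forall i, x 0 i \in `[0, h]].
have mQ : measurable Q by exact: (@measurable_rect R N (fun=> [set` `[0, h]])).
have muQ : mu Q = (h ^+ N)%:E.
  have := @lebesgue_rV_box R N (const_mx 0) (const_mx h).
  rewrite (_ : (fun x => _) = Q); last first.
    by apply/seteqP; split => x /= Qx i; have := Qx i; rewrite !mxE.
  move=> ->; last by move=> i; rewrite !mxE ltW.
  by under eq_bigr do rewrite !mxE subr0; rewrite prodr_const card_ord.
have iQ : (\int[mu]_y (\1_Q y)%:E = (h ^+ N)%:E)%E by rewrite integral_indic// setIT muQ.
have m1Q : measurable_fun setT (\1_Q : 'rV[R]_N -> R) by exact: measurable_indic.
pose F (z : 'rV[R]_N * 'rV[R]_N) : \bar R := ((phi (z.1 + z.2) - phi z.1) ^+ 2 * \1_Q z.2)%:E.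
have mF : measurable_fun setT F.
  apply/measurable_EFinP; apply: measurable_funM; last exact: measurableT_comp.
  apply: measurable_funX; apply: measurable_funB; last exact: measurableT_comp.
  apply: (measurableT_comp mp); exact: measurable_rV_add.
have F0 z : (0 <= F z)%E by rewrite lee_fin mulr_ge0// sqr_ge0.
set E := [set x | _].
have mE : measurable E.
  rewrite -[X in measurable X]setTI.
  have mn : measurable_fun setT (fun x => `|phi x|) by exact: measurableT_comp.
  have := mn measurableT `]l, +oo[%classic (measurable_itv _).
  by congr (measurable (_ `&` _)); apply/seteqP; split => x /=; rewrite in_itv/= andbT.
have low x : E x -> ((rho ^+ 2)%:E <= \int[mu]_y F (x, y))%E.
  move=> Ex.
  have mFx : measurable_fun setT (fun y => F (x, y)).
    by apply: (measurableT_comp mF); exact: measurable_pairT.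
  (* The inequality phi(x)^2 / 2 <= (phi(x+y) - phi(x))^2 + phi(x+y)^2 is integrated over y in the
     cube; the last term contributes at most rho^2. *)
  have H : ((2^-1 * phi x ^+ 2 * h ^+ N)%:E <= \int[mu]_y F (x, y) + (rho ^+ 2)%:E)%E.
    apply: (@le_trans _ _ (\int[mu]_y F (x, y) + \int[mu]_y (phi (y + x) ^+ 2)%:E)%E); last first.
      rewrite leeD2l// (@integral_shift R N (fun y => (phi y ^+ 2)%:E))//.
      - exact: measurable_sqr.
      - by move=> t; rewrite lee_fin sqr_ge0.
    rewrite EFinM -iQ -ge0_integralZl_EFin//; last 2 first.
    - exact/measurable_EFinP.
    - by rewrite mulr_ge0 ?sqr_ge0// invr_ge0.
    rewrite -ge0_integralD//; last 2 first.
    - by move=> y _; rewrite lee_fin sqr_ge0.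
    - by apply: measurable_sqr; exact: measurable_translate.
    apply: ge0_le_integral => //.
    - by move=> y _; rewrite -EFinM lee_fin mulr_ge0// mulr_ge0 ?sqr_ge0// invr_ge0.
    - by under eq_fun do rewrite -EFinM; apply/measurable_EFinP; exact: measurable_funM.
    - apply: emeasurable_funD => //.
      by apply: measurable_sqr; exact: measurable_translate.
    move=> y _; rewrite -EFinM -EFinD lee_fin /F/= [y + x]addrC.
    have [Qy|Qy] := boolP (y \in Q); rewrite indicE ?Qy ?(negbTE Qy) ?mulr1 ?mulr0 ?add0r ?sqr_ge0//.
    have := sqr_ge0 (phi x - 2 * phi (x + y)); rewrite !sqrrB exprMn; lra.
  (* Here the side h enters, since h^N = 4 rho^2 / l^2. Large values of phi must thus differ from
     their translates, with mean square at least rho^2 in total. *)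
  have H2 : 2 * rho ^+ 2 <= 2^-1 * phi x ^+ 2 * h ^+ N.
    have lx : l ^+ 2 <= phi x ^+ 2 by rewrite -[leRHS]real_normK ?num_real// ler_sqr ?nnegrE ?(ltW l0) ?(ltW Ex).
    rewrite hN [leRHS]mulrA ler_pdivlMr ?exprn_gt0//.
    rewrite [leRHS](_ : _ = 2 * rho ^+ 2 * phi x ^+ 2); last by field.
    by rewrite ler_wpM2l// mulr_ge0 ?sqr_ge0.
  have H3 : ((2 * rho ^+ 2)%:E <= \int[mu]_y F (x, y) + (rho ^+ 2)%:E)%E.
    by apply: le_trans H; rewrite lee_fin.
  rewrite -(leeD2rE _ _ (x := (rho ^+ 2)%:E))//; apply: le_trans H3.
  by rewrite -EFinD lee_fin; lra.
(* Integrate in x first: [translation_estimate] applies to each y in the cube, where |y|^2 <= N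
   h^2. *)
have up : (\int[mu]_x \int[mu]_y F (x, y) <= (N%:R * h ^+ 2 * M * h ^+ N)%:E)%E.
  rewrite (@tonelli R _ _ (@leb R N) N F mF F0).
  have M0 : 0 <= M.
    rewrite -lee_fin; apply: le_trans ig; apply: integral_ge0 => x _.
    by rewrite lee_fin dot_ge0.
  apply: (@le_trans _ _ (\int[mu]_y ((N%:R * h ^+ 2 * M)%:E * (\1_Q y)%:E))%E); last first.
    rewrite ge0_integralZl_EFin ?iQ//; first exact/measurable_EFinP.
    by rewrite mulr_ge0// mulr_ge0// ltW// exprn_gt0.
  apply: ge0_le_integral => //.
  - by move=> y _; exact: integral_ge0.
  - exact: (@measurable_tonelli2 R _ 'rV[R]_N N F mF F0).
  - by under eq_fun do rewrite -EFinM; apply/measurable_EFinP; exact: measurable_funM.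
  move=> y _; rewrite /F/=; under eq_integral do rewrite EFinM muleC.
  rewrite ge0_integralZl_EFin//; first last.
  - by apply: measurable_sqr; apply: measurable_funB => //; exact: measurable_translate.
  - by move=> x _; rewrite lee_fin sqr_ge0.
  rewrite [leRHS]muleC; have [Qy|Qy] := boolP (y \in Q); last by rewrite indicE (negbTE Qy) !mul0e.
  rewrite indicE Qy !mul1e; apply: le_trans (translation_estimate y tp) _.
  apply: (@le_trans _ _ ((dot y y)%:E * M%:E)%E); first by rewrite lee_wpmul2l// lee_fin dot_ge0.
  rewrite -EFinM lee_fin ler_wpM2r//; apply: le_trans (dot_le_norm y) _.
  rewrite ler_wpM2l// ler_sqr ?nnegrE ?(ltW h0)//.
  apply: rV_norm_le => [|i]; first exact: ltW.
  by move/set_mem : Qy => /(_ i); rewrite in_itv/= => /andP[? ?]; rewrite ger0_norm.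
have H : ((rho ^+ 2)%:E * mu E <= (N%:R * h ^+ 2 * M * h ^+ N)%:E)%E.
  apply: le_trans up; rewrite -(setIT E) -integral_indic// -ge0_integralZl_EFin ?sqr_ge0//; last first.
    by apply/measurable_EFinP; exact: measurable_indic.
  apply: ge0_le_integral => //.
  - by move=> x _; rewrite -EFinM lee_fin mulr_ge0 ?sqr_ge0.
  - by under eq_fun do rewrite -EFinM; apply/measurable_EFinP; apply: measurable_funM => //; exact: measurable_indic.
  - exact: (@measurable_tonelli1 R _ _ (@leb R N) N F mF F0).
  move=> x _; rewrite indicE; have [Ex|Ex] := boolP (x \in E); last by rewrite mule0 integral_ge0.
  by rewrite mule1; apply: low; exact/set_mem.
have h2 : h ^+ 2 = (2 * rho) `^ (4 / N%:R) * l `^ (- (4 / N%:R)).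
  rewrite -powR_mulrn ?(ltW h0)// /h -powRrM powRM ?invr_ge0 ?(ltW l0) ?mulr_ge0 ?(ltW r0)//.
  rewrite -(powR_inv1 (ltW l0)) -powRrM mulN1r.
  by have -> : 2 / N%:R * 2%:R = 4 / N%:R :> R by field; rewrite gt_eqF.
have rr : rho != 0 by rewrite gt_eqF. have ll : l != 0 by rewrite gt_eqF.
rewrite -(@lee_pmul2l _ (rho ^+ 2)%:E)// ?lte_fin ?exprn_gt0//.
apply: le_trans H _; rewrite -EFinM lee_fin hN h2 opprD powRD ?ll ?implybT//.
rewrite (powRN l 2) (powR_mulrn 2) ?(ltW l0)// le_eqVlt; apply/orP; left; apply/eqP.
by field; rewrite ll.
Qed.

End gagliardo_nirenberg.

(** * The relaxed gradient energy *)

Section square_integrals.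
Context d (T : measurableType d) (R : realType) (mu : {measure set T -> \bar R}).
Implicit Types f g h : T -> R.

(** Convexity of the square applied to s (f / s) + (1 - s) (g / (1 - s)). As s tends to 1 the factor
    of a tends to 1, a sharpness needed to stay inside the ball of radius rho. *)
Lemma integral_sqrD_weighted f g (s a b : R) : 0 < s < 1 ->
  measurable_fun setT f -> measurable_fun setT g ->
  (\int[mu]_x (f x ^+ 2)%:E <= a%:E)%E -> (\int[mu]_x (g x ^+ 2)%:E <= b%:E)%E ->
  (\int[mu]_x ((f x + g x) ^+ 2)%:E <= (s^-1 * a + (1 - s)^-1 * b)%:E)%E.
Proof.
move=> /andP[s0 s1] mf mg fa gb; have s1' : 0 < 1 - s by rewrite subr_gt0.
have mZ (k : R) h : measurable_fun setT h -> measurable_fun setT (fun x => k%:E * (h x ^+ 2)%:E)%E.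
  move=> mh; under eq_fun do rewrite -EFinM; apply/measurable_EFinP.
  by apply: measurable_funM => //; exact: measurable_funX.
have Z0 (k : R) h x : 0 < k -> (0 <= k%:E * (h x ^+ 2)%:E)%E.
  by move=> k0; rewrite -EFinM lee_fin mulr_ge0 ?(ltW k0)// sqr_ge0.
have k0 : 0 < s^-1 by rewrite invr_gt0. have k1 : 0 < (1 - s)^-1 by rewrite invr_gt0.
apply: (@le_trans _ _ (\int[mu]_x ((s^-1)%:E * (f x ^+ 2)%:E + ((1 - s)^-1)%:E * (g x ^+ 2)%:E))%E).
  apply: ge0_le_integral => //.
  - by move=> x _; rewrite lee_fin sqr_ge0.
  - by apply: measurable_sqr; exact: measurable_funD.
  - by apply: emeasurable_funD; exact: mZ.
  move=> x _; rewrite -!EFinM -EFinD lee_fin -subr_ge0.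
  rewrite [leRHS](_ : _ = ((1 - s) * f x - s * g x) ^+ 2 / (s * (1 - s))).
    by rewrite divr_ge0 ?sqr_ge0// ltW// mulr_gt0.
  by field; rewrite !gt_eqF.
rewrite ge0_integralD//; first last.
- exact: mZ.
- by move=> x _; exact: Z0.
- exact: mZ.
- by move=> x _; exact: Z0.
rewrite !ge0_integralZl_EFin ?(ltW k0) ?(ltW k1)//; first last.
- exact: measurable_sqr.
- by move=> x _; rewrite lee_fin sqr_ge0.
- exact: measurable_sqr.
- by move=> x _; rewrite lee_fin sqr_ge0.
by rewrite EFinD [(s^-1 * a)%:E]EFinM [((1 - s)^-1 * b)%:E]EFinM leeD// lee_wpmul2l// lee_fin ltW.
Qed.

Lemma integral_sqrD_le f g (a b : R) : measurable_fun setT f -> measurable_fun setT g ->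
  (\int[mu]_x (f x ^+ 2)%:E <= a%:E)%E -> (\int[mu]_x (g x ^+ 2)%:E <= b%:E)%E ->
  (\int[mu]_x ((f x + g x) ^+ 2)%:E <= (2 * a + 2 * b)%:E)%E.
Proof.
move=> mf mg fa gb; have s2 : 0 < (2^-1 : R) < 1 by lra.
have := integral_sqrD_weighted s2 mf mg fa gb.
by rewrite (_ : 1 - 2^-1 = 2^-1 :> R) ?invrK//; lra.
Qed.

Lemma integral_sqr_triangle f g h (a b : R) :
  measurable_fun setT f -> measurable_fun setT g -> measurable_fun setT h ->
  (\int[mu]_x ((f x - g x) ^+ 2)%:E <= a%:E)%E -> (\int[mu]_x ((g x - h x) ^+ 2)%:E <= b%:E)%E ->
  (\int[mu]_x ((f x - h x) ^+ 2)%:E <= (2 * a + 2 * b)%:E)%E.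
Proof.
move=> mf mg mh fg gh.
have := integral_sqrD_le (measurable_funB mf mg) (measurable_funB mg mh) fg gh.
by under eq_integral do rewrite addrA subrK.
Qed.

Lemma integral_sqr_le f g : measurable_fun setT f -> measurable_fun setT g ->
  (forall x, `|f x| <= `|g x|) ->
  (\int[mu]_x (f x ^+ 2)%:E <= \int[mu]_x (g x ^+ 2)%:E)%E.
Proof.
move=> mf mg fg; apply: ge0_le_integral => //; [|exact: measurable_sqr|exact: measurable_sqr|].
- by move=> x _; rewrite lee_fin sqr_ge0.
- by move=> x _; rewrite lee_fin -[f x ^+ 2]real_normK ?num_real// -[g x ^+ 2]real_normK ?num_real// ler_sqr ?nnegrE.
Qed.

End square_integrals.

(** What the minimization uses of the primitive B of b. The bound 2 <= q is derived from the growth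
    and monotonicity of b in [growth_exponent]; monotonicity also covers negative arguments, where
    the primitive is 0. *)
Record profile (R : realType) (B : R -> R) (q c1 c2 : R) : Prop := Profile {
  profile_q : 2 <= q;
  profile_c1 : 0 < c1;
  profile0 : B 0 = 0;
  profile_le : forall s t, s <= t -> B s <= B t;
  profile_convex : forall t x y, 0 <= t <= 1 -> 0 <= x -> 0 <= y ->
    B (t * x + (1 - t) * y) <= t * B x + (1 - t) * B y;
  profile_bounds : forall s, c1 * (s ^+ 2 + `|s| `^ q) <= B (s ^+ 2) <= c2 * (s ^+ 2 + `|s| `^ q)
}.

Section relaxed_energy.
Variables (R : realType) (N : nat) (B : R -> R) (q c1 c2 : R).
Hypothesis HB : profile B q c1 c2.
Implicit Types (u v phi psi : 'rV[R]_N -> R) (a b x y : 'rV[R]_N).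

Local Notation mu := (lebesgue_rV R N).

Definition Phi (xi : 'rV[R]_N) : R := B (dot xi xi).

Lemma profile_ge0 s : 0 <= s -> 0 <= B s.
Proof. by move=> s0; rewrite -(profile0 HB); exact: profile_le HB _ _ s0. Qed.

Lemma Phi_ge0 xi : 0 <= Phi xi.
Proof. exact/profile_ge0/dot_ge0. Qed.

Lemma Phi0 : Phi 0 = 0.
Proof. by rewrite /Phi dot0 (profile0 HB). Qed.

(** An increasing convex function of the convex function |.|^2, whose convexity defect is t (1 - t)
    |a - b|^2. *)
Lemma Phi_convex t a b : 0 <= t <= 1 ->
  Phi (t *: a + (1 - t) *: b) <= t * Phi a + (1 - t) * Phi b.
Proof.
move=> t01; apply: le_trans _ (profile_convex HB t01 (dot_ge0 a) (dot_ge0 b)).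
apply: profile_le HB _ _ _; rewrite -subr_ge0 [leRHS](_ : _ = t * (1 - t) * dot (a - b) (a - b)).
  by rewrite mulr_ge0 ?dot_ge0//; move: t01 => /andP[? ?]; rewrite mulr_ge0// subr_ge0.
by rewrite !dotE (dotC b a); ring.
Qed.

Lemma Phi_contract t a : `|t| <= 1 -> Phi (t *: a) <= `|t| * Phi a.
Proof.
move=> t1; have := @Phi_convex `|t| a 0; rewrite normr_ge0 t1 Phi0 mulr0 addr0 scaler0 addr0 => /(_ isT).
by rewrite /Phi !dotE !mulrA -!expr2 real_normK// num_real.
Qed.

Lemma Phi_le t a : `|t| <= 1 -> Phi (t *: a) <= Phi a.
Proof. by move=> t1; apply: le_trans (Phi_contract a t1) _; rewrite ler_piMl// Phi_ge0. Qed.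

Lemma profile_superadditive (s t : R) : 0 <= s -> 0 <= t -> B s + B t <= B (s + t).
Proof.
move=> s0 t0; have [st|st] := eqVneq (s + t) 0.
  have [-> ->] : s = 0 /\ t = 0 by split; lra.
  by rewrite addr0 (profile0 HB) addr0.
have st0 : 0 < s + t by rewrite lt_def st addr_ge0.
have H (u : R) : 0 <= u -> u <= s + t -> B u <= u / (s + t) * B (s + t).
  move=> u0 ust; have := @profile_convex _ _ _ _ _ HB (u / (s + t)) (s + t) 0.
  rewrite (profile0 HB) !mulr0 !addr0 mulfVK//; apply => //; last exact: ltW.
  by rewrite divr_ge0 ?(ltW st0)//= ler_pdivrMr// mul1r.
apply: le_trans (lerD (H s _ _) (H t _ _)) _ => //; rewrite ?lerDl ?lerDr//.
by rewrite -mulrDl -mulrDl divff// mul1r.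
Qed.

(** Superadditivity of B merges the left-hand side into one value, the parallelogram identity
    evaluates its argument as (|a|^2 + |b|^2) / 2, and convexity of B finishes. *)
Lemma clarkson a b :
  Phi (2^-1 *: (a + b)) + Phi (2^-1 *: (a - b)) <= 2^-1 * (Phi a + Phi b).
Proof.
apply: le_trans (profile_superadditive (dot_ge0 _) (dot_ge0 _)) _.
have := @profile_convex _ _ _ _ _ HB 2^-1 _ _ _ (dot_ge0 a) (dot_ge0 b).
have -> : 1 - 2^-1 = 2^-1 :> R by lra.
rewrite -!mulrDr => H; apply: le_trans _ (H _); last by lra.
rewrite le_eqVlt; apply/orP; left; apply/eqP; congr B.
by rewrite !dotE (dotC b a); field.
Qed.

Lemma Phi_lower xi : c1 * dot xi xi <= Phi xi.
Proof.
rewrite -enormE /Phi -enormE; have /andP[+ _] := profile_bounds HB (enorm xi).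
by apply: le_trans; rewrite ler_pM2l ?(profile_c1 HB)// lerDl powR_ge0.
Qed.

Lemma Phi_lower_q xi : c1 * enorm xi `^ q <= Phi xi.
Proof.
rewrite /Phi -enormE; have /andP[+ _] := profile_bounds HB (enorm xi).
apply: le_trans; rewrite ler_pM2l ?(profile_c1 HB)// ger0_norm ?enorm_ge0//.
by rewrite lerDr sqr_ge0.
Qed.

Lemma Phi_upper xi : Phi xi <= c2 * (dot xi xi + enorm xi `^ q).
Proof.
rewrite /Phi -!enormE; have /andP[_] := profile_bounds HB (enorm xi).
by rewrite (ger0_norm (enorm_ge0 xi)).
Qed.

Lemma profile_c2 : 0 < c2.
Proof.
have /andP[h1 h2] := profile_bounds HB 1; move: (le_trans h1 h2).
rewrite normr1 powR1 expr1n => h; have := profile_c1 HB; lra.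
Qed.

(** The Delta_2 condition, from the two-sided growth bounds. It makes smallness of the integral of
    [Phi] a linear notion of convergence. Since q >= 2, both terms of the growth scale by at most
    2^q. *)
Lemma Phi_double : exists2 C : R, 0 < C & forall xi, Phi (2 *: xi) <= C * Phi xi.
Proof.
have q2 := profile_q HB; have c20 := profile_c2; have c10 := profile_c1 HB.
have q4 : 4 <= 2 `^ q :> R.
  have -> : 4 = 2 `^ 2%:R :> R by rewrite powR_mulrn// expr2; lra.
  by rewrite ler_powR// ler1n.
have pq : 0 < 2 `^ q :> R by rewrite powR_gt0.
exists (c2 * 2 `^ q / c1) => [|xi]; first by rewrite divr_gt0// mulr_gt0.
apply: le_trans (Phi_upper _) _; rewrite enormZ !dotE ger0_norm// powRM ?enorm_ge0//.
have /andP[H _] := profile_bounds HB (enorm xi).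
have h : 2 `^ q * (dot xi xi + enorm xi `^ q) <= 2 `^ q / c1 * Phi xi.
  rewrite -mulrA ler_pM2l// ler_pdivlMl// /Phi -enormE.
  by move: H; rewrite (ger0_norm (enorm_ge0 xi)).
rewrite (_ : c2 * _ / c1 * _ = c2 * (2 `^ q / c1 * Phi xi)); last by rewrite !mulrA.
rewrite ler_pM2l//; apply: le_trans h.
have h1 := dot_ge0 xi; rewrite mulrDr lerD2r mulrA ler_wpM2r//; lra.
Qed.

Lemma measurable_Phi d (T : measurableType d) (f : T -> 'rV[R]_N) : measurable_fun setT f ->
  measurable_fun setT (fun x : T => Phi (f x)).
Proof.
move=> mf; apply: (measurableT_comp _ (measurable_dot mf mf)).
by apply: nondecreasing_measurable => // s t; exact: profile_le HB s t.
Qed.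

Definition genergy phi : \bar R := (\int[mu]_x (Phi (cgrad phi x))%:E)%E.

Lemma genergy_ge0 phi : (0 <= genergy phi)%E.
Proof. by apply: integral_ge0 => x _; rewrite lee_fin Phi_ge0. Qed.

Lemma measurable_Phi_cgrad phi : test_function phi ->
  measurable_fun setT (fun x => (Phi (cgrad phi x))%:E).
Proof. by move=> tp; apply/measurable_EFinP; apply: measurable_Phi; exact: measurable_cgrad. Qed.

Lemma genergy_fin phi : test_function phi -> genergy phi \is a fin_num.
Proof.
move=> tp; have [K K0 KP] := cgrad_bounded tp; have [_ [M pM]] := (test_functionP _).1 tp.
apply: (@integrable_fin_num _ _ _ _ _ measurableT).
apply: (@bsupp_integrable R N (fun x => Phi (cgrad phi x)) (B (K ^+ 2))).
- by apply/measurable_EFinP; exact: measurable_Phi_cgrad.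
- by exists M => x xM; rewrite (cgrad_out pM xM) Phi0.
- move=> x; rewrite ger0_norm ?Phi_ge0//; apply: profile_le HB _ _ _.
  by rewrite -enormE ler_sqr ?nnegrE ?enorm_ge0.
Qed.

Lemma genergy_comp (f : R -> R) phi : smooth1 f -> f 0 = 0 ->
  (forall t : R, exists2 d : R, is_derive t (1 : R) f d & `|d| <= 1) -> test_function phi ->
  (genergy (fun x => f (phi x)) <= genergy phi)%E.
Proof.
move=> sf f0 df tp; have tf := test_comp sf f0 tp.
apply: ge0_le_integral => //; [|exact: measurable_Phi_cgrad|exact: measurable_Phi_cgrad|].
  by move=> x _; rewrite lee_fin Phi_ge0.
move=> x _; rewrite lee_fin; have [c dc c1'] := df (phi x).
rewrite (_ : cgrad _ x = c *: cgrad phi x); first exact: Phi_le.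
apply/rowP => i; rewrite !mxE /partial; apply: derive_val.
apply: (@is_derive_comp1 _ _ f phi).
by apply: (@Ck_derive _ _ 0); exact: test_smooth.
Qed.

(* [relaxed v E] states that the lower semicontinuous envelope in L^2 of the
   gradient energy is at most E at v. *)
Definition relaxed v (E : R) := forall e : R, 0 < e -> exists phi,
  [/\ test_function phi, (\int[mu]_x ((phi x - v x) ^+ 2)%:E <= e%:E)%E &
      (genergy phi <= (E + e)%:E)%E].

(** Lower semicontinuity of the envelope, by a diagonal choice: approximate v by u, then u by a test
    function, with quarter tolerances because the triangle inequality for squared norms doubles. *)
Lemma relaxed_closed v (E : R) : measurable_fun setT v ->
  (forall e : R, 0 < e -> exists u,
    [/\ measurable_fun setT u, (\int[mu]_x ((u x - v x) ^+ 2)%:E <= e%:E)%E & relaxed u (E + e)]) ->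
  relaxed v E.
Proof.
move=> mv H e e0; have e4 : 0 < e / 4 by lra.
have [u [mu_ uv /(_ _ e4)[phi [tp pu pE]]]] := H _ e4.
exists phi; split => //.
  apply: le_trans (integral_sqr_triangle (test_meas tp) mu_ mv pu uv) _.
  by rewrite lee_fin; lra.
by apply: le_trans pE _; rewrite lee_fin; lra.
Qed.

Lemma relaxed_softd v (E del : R) : 0 < del -> measurable_fun setT v ->
  relaxed v E -> relaxed (fun x => softd del (v x)) E.
Proof.
move=> d0 mv H e e0; have [phi [tp pv pE]] := H _ e0.
have s0 : softd del 0 = 0 by rewrite softd_eq0// normr0 ltW.
have ms : measurable_fun setT (softd del).
  by apply: continuous_measurable_fun; exact: smooth1_cont (smooth1_softd del).
exists (fun x => softd del (phi x)); split.
- by apply: test_comp => //; exact: smooth1_softd.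
- apply: le_trans _ pv; apply: integral_sqr_le.
  + by apply: measurable_funB; apply: measurableT_comp => //; exact: test_meas.
  + by apply: measurable_funB => //; exact: test_meas.
  + by move=> x; exact: softd_lip.
- apply: le_trans _ pE; apply: genergy_comp => //; first exact: smooth1_softd.
  by move=> t; exact: softd_derive.
Qed.

Lemma integral_sqr_bounded_le u (K M : R) : measurable_fun setT u -> 0 <= K ->
  (forall x, M < enorm x -> u x = 0) -> (forall x, `|u x| <= K) ->
  (\int[mu]_x (u x ^+ 2)%:E <= (K ^+ 2)%:E * mu (eball (`|M| + 1)))%E.
Proof.
move=> mu_ K0 uM uK; have mD : measurable (@eball R N (`|M| + 1)) by exact: measurable_eball.
rewrite -(setIT (eball _)) -integral_indic// -ge0_integralZl_EFin ?sqr_ge0//; last first.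
  by apply/measurable_EFinP; exact: measurable_indic.
apply: ge0_le_integral => //.
- by move=> x _; rewrite lee_fin sqr_ge0.
- exact: measurable_sqr.
- by under eq_fun do rewrite -EFinM; apply/measurable_EFinP; apply: measurable_funM => //; exact: measurable_indic.
move=> x _; rewrite -EFinM lee_fin indicE; case: (boolP (x \in _)) => [_|xD].
  by rewrite mulr1 -real_normK ?num_real// ler_sqr ?nnegrE.
rewrite uM ?expr0n ?mulr0//; rewrite ltNge; apply/negP => xM.
by move/negP: xD; apply; apply/mem_set; rewrite /eball/=; have := ler_norm M; lra.
Qed.

Lemma small_sqr_integral (M e : R) : 0 < e -> exists2 del : R, 0 < del &
  ((del ^+ 2)%:E * mu (eball (`|M| + 1)) <= e%:E)%E.
Proof.
move=> e0; have mf : mu (eball (`|M| + 1)) \is a fin_num.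
  by rewrite ge0_fin_numE// eball_measure_lty.
have m0 : 0 <= fine (mu (eball (`|M| + 1))) by exact: fine_ge0.
rewrite -(fineK mf); move: (fine _) m0 => m m0.
exists (Num.min 1 (e / (m + 1))); first by rewrite lt_min ltr01 divr_gt0//; lra.
rewrite -EFinM lee_fin.
have m1 : 0 < m + 1 by lra.
have d0 : 0 < Num.min 1 (e / (m + 1)) by rewrite lt_min ltr01 divr_gt0.
have h1 : Num.min 1 (e / (m + 1)) <= 1 by rewrite ge_min lexx.
have h2 : Num.min 1 (e / (m + 1)) * (m + 1) <= e by rewrite -ler_pdivlMr// ge_min lexx orbT.
move: (Num.min _ _) d0 h1 h2 => k k0 k1 k2; rewrite expr2.
have : k * k * m <= k * m by apply: ler_wpM2r => //; rewrite ler_piMl// ltW.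
lra.
Qed.

(** [softd (del / 2)] applied to phi differs from |phi| by at most del, on the bounded support only,
    hence little in L^2; its slope bound keeps the gradient energy below that of phi. *)
Lemma relaxed_abs phi (E : R) : test_function phi -> (genergy phi <= E%:E)%E ->
  relaxed (fun x => `|phi x|) E.
Proof.
move=> tp pE e e0; have [_ [M pM]] := (test_functionP _).1 tp.
have [del d0 dP] := @small_sqr_integral M e e0.
have d20 : 0 < del / 2 by lra.
have s0 : softd (del / 2) 0 = 0 by rewrite softd_eq0// normr0 ltW.
have tf := test_comp (smooth1_softd (del / 2)) s0 tp.
exists (fun x => softd (del / 2) (phi x)); split => //.
- apply: le_trans _ dP; apply: integral_sqr_bounded_le => //.
  + apply: measurable_funB; first exact: test_meas.
    by apply: measurableT_comp => //; exact: test_meas.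
  + exact: ltW.
  + by move=> x /pM ->; rewrite s0 normr0 subrr.
  + move=> x; have := softd_bounds d20 (phi x); rewrite ler_norml; lra.
- apply: le_trans (_ : genergy phi <= _)%E; last by apply: le_trans pE _; rewrite lee_fin; lra.
  apply: genergy_comp => //; first exact: smooth1_softd.
  by move=> t; exact: softd_derive.
Qed.

End relaxed_energy.

(** * Polarization and the relaxed energy *)

Section polarization.
Variables (R : realType) (N : nat) (w : 'rV[R]_N) (c : R).
Hypothesis w0 : w != 0.
Implicit Types (u v phi psi : 'rV[R]_N -> R).

Local Notation mu := (lebesgue_rV R N).
Local Notation sigma := (refl w c).
Local Notation sd := (side w c).

(** The exact two-point rearrangement, written in the same form as [pol] with the absolute value in
    place of [softd], so that the two differ uniformly by at most del. *)
Definition polar v (x : 'rV[R]_N) : R :=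
  2^-1 * (v x + v (sigma x)) + sgs w c x * (2^-1 * `|v x - v (sigma x)|).

Lemma polarE v x : polar v x =
  if 0 <= sd x then Num.max (v x) (v (sigma x)) else Num.min (v x) (v (sigma x)).
Proof.
rewrite /polar /sgs; case: sgrP => s0.
- by rewrite (refl_fix s0) mul0r addr0 maxxx; lra.
- by rewrite mul1r; case: (lerP (v x) (v (sigma x))) => h; lra.
- by rewrite mulN1r; case: (lerP (v x) (v (sigma x))) => h; lra.
Qed.

Lemma polar_refl v x : polar v (sigma x) = v x + v (sigma x) - polar v x.
Proof.
by rewrite /polar sgs_refl// reflK// distrC; lra.
Qed.

(** On a mirrored pair of points polarization at most swaps the two values. Averaging an integral
    with its reflection then shows that integrals of functions of v are preserved. *)
Lemma polar_pair (F : R -> \bar R) v x :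
  (F (polar v x) + F (polar v (sigma x)) = F (v x) + F (v (sigma x)))%E.
Proof.
rewrite polar_refl polarE; case: ifP => _; case: (lerP (v x)) => _.
- by rewrite addrK addeC.
- by rewrite addrAC subrr add0r.
- by rewrite addrAC subrr add0r.
- by rewrite addrK addeC.
Qed.

Lemma measurable_polar v : measurable_fun setT v -> measurable_fun setT (polar v).
Proof.
move=> mv.
have mvs : measurable_fun setT (v \o sigma) by exact: measurableT_comp mv (measurable_refl w c).
apply: measurable_funD; first by apply: measurable_funM => //; exact: measurable_funD.
apply: measurable_funM; first exact: measurable_sgs.
apply: measurable_funM => //; apply: measurableT_comp => //; exact: measurable_funB.
Qed.

Lemma refl_average (f : 'rV[R]_N -> \bar R) : measurable_fun setT f ->
  (forall x, (0 <= f x)%E) ->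
  (2%:E * \int[mu]_x f x = \int[mu]_x (f x + f (sigma x)))%E.
Proof.
move=> mf f0; rewrite ge0_integralD//; last exact: measurableT_comp mf (measurable_refl w c).
by rewrite integral_refl// mule_natl.
Qed.

Lemma eq_half (a b : \bar R) : (2%:E * a = 2%:E * b)%E -> a = b.
Proof.
have H (z : \bar R) : (z = 2^-1%:E * (2%:E * z))%E by rewrite muleA -EFinM mulVf// mul1e.
by move=> ab; rewrite (H a) (H b) ab.
Qed.

Lemma integral_polar (F : R -> R) v : measurable_fun setT F -> (forall t, 0 <= F t) ->
  measurable_fun setT v ->
  (\int[mu]_x (F (polar v x))%:E = \int[mu]_x (F (v x))%:E)%E.
Proof.
move=> mF F0 mv; have mp := measurable_polar mv.
have m1 : measurable_fun setT (fun x => (F (polar v x))%:E).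
  by apply/measurable_EFinP; exact: measurableT_comp.
have m2 : measurable_fun setT (fun x => (F (v x))%:E).
  by apply/measurable_EFinP; exact: measurableT_comp.
apply: eq_half; rewrite !refl_average//; try by move=> x; rewrite lee_fin.
apply: eq_integral => x _; exact: (polar_pair (fun t => (F t)%:E)).
Qed.

(** The squared distances differ by 4 times the product of the two [side] values over |w|^2:
    reflecting one of two points on opposite sides brings them closer. *)
Lemma refl_cross x y : sd x * sd y <= 0 -> enorm (sigma x - y) <= enorm (x - y).
Proof.
move=> xy; have ww : 0 < dot w w by rewrite dot_gt0.
rewrite -(@ler_pXn2r _ 2) ?nnegrE ?enorm_ge0// !enormE -subr_ge0.
rewrite [leRHS](_ : _ = - (4 * (sd x * sd y) / dot w w)).
  by rewrite oppr_ge0 pmulr_lle0 ?invr_gt0// pmulr_rle0.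
by rewrite /refl !dotE (dotC x w) (dotC y w) (dotC y x) /side; field; rewrite gt_eqF.
Qed.

(** On the same side both values are maxima or both are minima over mirrored pairs. On opposite
    sides, [refl_cross] bounds all four distances between the pairs by |x - y|, so the combination
    chosen does not matter. *)
Lemma polar_lip (L : R) v : 0 <= L -> (forall x y : 'rV[R]_N, `|v x - v y| <= L * enorm (x - y)) ->
  forall x y : 'rV[R]_N, `|polar v x - polar v y| <= L * enorm (x - y).
Proof.
move=> L0 vL x y.
have h1 := vL x y; have := vL (sigma x) (sigma y); rewrite enorm_reflB// => h2.
have [xy|xy] := leP (sd x * sd y) 0.
  have h3 : `|v (sigma x) - v y| <= L * enorm (x - y).
    by apply: le_trans (vL _ _) _; rewrite ler_wpM2l// refl_cross.
  have h4 : `|v x - v (sigma y)| <= L * enorm (x - y).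
    apply: le_trans (vL _ _) _; rewrite ler_wpM2l//.
    by rewrite -(enorm_reflB c w0) reflK//; exact: refl_cross.
  have E z : Num.min (v z) (v (sigma z)) <= polar v z <= Num.max (v z) (v (sigma z)).
    by rewrite polarE; case: ifP; rewrite lexx ?andbT//=; case: (lerP (v z)) => //; lra.
  move: (E x) (E y); move: h1 h2 h3 h4; rewrite !ler_norml.
  by case: (lerP (v x)) => ?; case: (lerP (v y)) => ?; lra.
have -> : polar v x - polar v y = (if 0 <= sd x then Num.max (v x) (v (sigma x)) else Num.min (v x) (v (sigma x)))
  - (if 0 <= sd x then Num.max (v y) (v (sigma y)) else Num.min (v y) (v (sigma y))).
  rewrite !polarE; congr (_ - _).
  have -> : (0 <= sd y) = (0 <= sd x) => //.
  by apply/idP/idP => h; rewrite leNgt; apply/negP => h'; nra.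
move: h1 h2; rewrite !ler_norml.
by case: ifP => _; case: (lerP (v x)) => ?; case: (lerP (v y)) => ?; lra.
Qed.

Lemma polar_ge0 v : (forall x, 0 <= v x) -> forall x, 0 <= polar v x.
Proof.
by move=> v_ge0 x; rewrite polarE; case: ifP => _; case: (lerP (v x)).
Qed.

Lemma refl_enorm x : enorm (sigma x) ^+ 2 = enorm x ^+ 2 + 4 * c * sd x / dot w w.
Proof.
have ww : 0 < dot w w by rewrite dot_gt0.
by rewrite !enormE /refl !dotE (dotC x w) /side; field; rewrite gt_eqF.
Qed.

Lemma polar_supp v (M : R) : 0 < c -> (forall x, 0 <= v x) ->
  (forall x, M <= enorm x -> v x = 0) -> forall x, M <= enorm x -> polar v x = 0.
Proof.
move=> c0 v_ge0 vM x xM; have ww : 0 < dot w w by rewrite dot_gt0.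
rewrite polarE (vM x xM); case: ifP => [sx|_]; last by case: (lerP 0) => //; have := v_ge0 (sigma x); lra.
rewrite (vM (sigma x)) ?maxxx//; apply: le_trans xM _.
rewrite -(@ler_pXn2r _ 2) ?nnegrE ?enorm_ge0// refl_enorm lerDl.
by rewrite divr_ge0 ?(ltW ww)// !mulr_ge0// ltW.
Qed.

(** The rearrangement inequality for two terms: for 0 < c the point on the positive side is the one
    nearer to the origin by [refl_enorm], and it receives the larger value. *)
Lemma polar_moment v x : 0 < c -> (forall x, 0 <= v x) ->
  polar v x * enorm x ^+ 2 + polar v (sigma x) * enorm (sigma x) ^+ 2 <=
  v x * enorm x ^+ 2 + v (sigma x) * enorm (sigma x) ^+ 2.
Proof.
move=> c0 v_ge0; have ww : 0 < dot w w by rewrite dot_gt0.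
rewrite polar_refl polarE refl_enorm; set e := enorm x ^+ 2.
have [sx|sx] := leP 0 (sd x).
  have k0 : 0 <= 4 * c * sd x / dot w w by rewrite divr_ge0 ?(ltW ww)// !mulr_ge0// ltW.
  by move: (_ / _) k0 => k k0; case: (lerP (v x)) => h; nra.
have k0 : 4 * c * sd x / dot w w <= 0.
  by rewrite pmulr_lle0 ?invr_gt0// pmulr_rle0 ?(ltW sx)// mulr_gt0.
by move: (_ / _) k0 => k k0; case: (lerP (v x)) => h; nra.
Qed.

Lemma polar_sub_le (u v : 'rV[R]_N -> R) x :
  `|polar u x - polar v x| <= `|u x - v x| + `|u (sigma x) - v (sigma x)|.
Proof.
have := normr_ge0 (u x - v x); have := normr_ge0 (u (sigma x) - v (sigma x)).
have := ler_norm (u x - v x); have := ler_norm (u (sigma x) - v (sigma x)).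
have := ler_norm (- (u x - v x)); have := ler_norm (- (u (sigma x) - v (sigma x))).
rewrite !normrN; move: `|u x - v x| `|u (sigma x) - v (sigma x)| => a b.
rewrite ler_norml !polarE => h1 h2 h3 h4 h5 h6; apply/andP.
by case: ifP => _; case: (lerP (u x)) => ?; case: (lerP (v x)) => ?; split; lra.
Qed.

Lemma pol_polar del phi x : 0 < del -> `|pol w c del phi x - polar phi x| <= del.
Proof.
move=> d0; rewrite /pol /polar opprD addrACA subrr add0r -mulrBr -mulrBr normrM.
have s1 : `|sgs w c x| <= 1 by rewrite /sgs normr_sg; case: (_ != 0).
apply: (@le_trans _ _ (1 * del)); last by rewrite mul1r.
apply: ler_pM => //; have := softd_bounds d0 (phi x - phi (sigma x)).
rewrite normrM ger0_norm// => h.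
by rewrite ler_pdivrMl// ler_norml; lra.
Qed.

Section energy.
Variables (B : R -> R) (q c1 c2 : R).
Hypothesis HB : profile B q c1 c2.

Local Notation Ge := (@genergy R N B).

(** Twice each energy is the integral of its density over mirrored pairs of points. There [pol_grad]
    and convexity of [Phi] compare the densities pointwise; finiteness of both energies allows
    halving. *)
Lemma genergy_pol del phi : 0 < del -> test_function phi ->
  (Ge (pol w c del phi) <= Ge phi)%E.
Proof.
move=> d0 tp; have tP := pol_test c w0 d0 tp.
have tPs := test_refl c w0 tP; have ts := test_refl c w0 tp.
have gs psi : test_function psi -> Ge (psi \o sigma) = Ge psi.
  move=> tq; rewrite /genergy.
  rewrite -(@integral_refl _ _ w c (fun x => (Phi B (cgrad psi x))%:E)).
  - apply: eq_integral => x _; rewrite cgrad_refl// /Phi.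
    by rewrite refl_isom.
  - exact: measurable_Phi_cgrad HB _ tq.
  - by move=> x; rewrite lee_fin (Phi_ge0 HB).
have aux (r s r' s' k l : \bar R) : r \is a fin_num -> s \is a fin_num -> r' = r -> s' = s ->
    (r + r' = k)%E -> (s + s' = l)%E -> (k <= l)%E -> (r <= s)%E.
  by case: r s => [r| |] [s| |]// _ _ -> -> <- <-; rewrite -!EFinD !lee_fin; lra.
have Dm psi : test_function psi -> (Ge psi + Ge (psi \o sigma) =
    \int[mu]_x ((Phi B (cgrad psi x))%:E + (Phi B (cgrad (psi \o sigma) x))%:E))%E.
  move=> tq; have tqs := test_refl c w0 tq.
  rewrite /genergy -ge0_integralD//.
  - by move=> x _; rewrite lee_fin (Phi_ge0 HB).
  - exact: measurable_Phi_cgrad HB _ tq.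
  - by move=> x _; rewrite lee_fin (Phi_ge0 HB).
  - exact: measurable_Phi_cgrad HB _ tqs.
apply: (aux _ _ _ _ _ _ (genergy_fin HB tP) (genergy_fin HB tp) (gs _ tP) (gs _ tp) (Dm _ tP) (Dm _ tp)).
apply: ge0_le_integral => //.
- by move=> x _; rewrite adde_ge0// lee_fin (Phi_ge0 HB).
- by apply: emeasurable_funD; [exact: measurable_Phi_cgrad HB _ tP|exact: measurable_Phi_cgrad HB _ tPs].
- by apply: emeasurable_funD; [exact: measurable_Phi_cgrad HB _ tp|exact: measurable_Phi_cgrad HB _ ts].
move=> x _; have [t t01 [-> ->]] := pol_grad c w0 d0 x tp.
have t01' : 0 <= 1 - t <= 1 by lra.
have h1 := Phi_convex HB (cgrad phi x) (cgrad (phi \o sigma) x) t01.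
have := Phi_convex HB (cgrad phi x) (cgrad (phi \o sigma) x) t01'.
have -> : 1 - (1 - t) = t by lra.
by move=> h2; rewrite -!EFinD lee_fin; lra.
Qed.

(** Two approximations are chained: v by a test function phi, with polarization continuous in L^2,
    and then [polar phi] by the test function [pol phi], uniformly close and of bounded support. *)
Lemma relaxed_polar v (E : R) : measurable_fun setT v -> relaxed B v E -> relaxed B (polar v) E.
Proof.
move=> mv H; apply: (relaxed_closed (measurable_polar mv)) => e e0.
have e4 : 0 < e / 4 by lra.
have [phi [tp pv pE]] := H _ e4.
have mp := test_meas tp.
exists (polar phi); split; first exact: measurable_polar.
  have mps : measurable_fun setT (fun x => phi (sigma x) - v (sigma x)).
    by apply: measurable_funB; apply: measurableT_comp => //; exact: measurable_refl.
  apply: (@le_trans _ _ (\int[mu]_x ((`|phi x - v x| + `|phi (sigma x) - v (sigma x)|) ^+ 2)%:E)%E).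
    apply: integral_sqr_le; first by apply: measurable_funB; exact: measurable_polar.
      by apply: measurable_funD; apply: measurableT_comp => //; exact: measurable_funB.
    by move=> x; apply: le_trans (polar_sub_le _ _ _) _; exact: ler_norm.
  have i1 : (\int[mu]_x (`|phi x - v x| ^+ 2)%:E <= (e / 4)%:E)%E.
    by under eq_integral do rewrite real_normK ?num_real//.
  have i2 : (\int[mu]_x (`|phi (sigma x) - v (sigma x)| ^+ 2)%:E <= (e / 4)%:E)%E.
    rewrite (@integral_refl _ _ w c (fun x => (`|phi x - v x| ^+ 2)%:E))//.
    by apply: measurable_sqr; apply: measurableT_comp => //; exact: measurable_funB.
  apply: le_trans (integral_sqrD_le _ _ i1 i2) _.
  - by apply: measurableT_comp => //; exact: measurable_funB.
  - by apply: measurableT_comp => //.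
  - by rewrite lee_fin; lra.
move=> e' e'0; have [_ [M pM]] := (test_functionP _).1 tp.
have [_ [M' pM']] := (test_functionP _).1 (test_refl c w0 tp).
have [del d0 dP] := @small_sqr_integral R N (`|M| + `|M'|) e' e'0.
have tP := pol_test c w0 d0 tp.
exists (pol w c del phi); split => //.
- apply: le_trans _ dP; apply: integral_sqr_bounded_le.
  + by apply: measurable_funB; [exact: test_meas|exact: measurable_polar].
  + exact: ltW.
  + move=> x xM; have xM1 : M < enorm x by have := ler_norm M; have := normr_ge0 M'; lra.
    have xM2 : M' < enorm x by have := ler_norm M'; have := normr_ge0 M; lra.
    rewrite /pol /polar pM//; have /= -> := pM' _ xM2.
    by rewrite subrr normr0 softd_eq0 ?normr0 ?(ltW d0)// subrr.
  + by move=> x; exact: pol_polar.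
- apply: le_trans (genergy_pol d0 tp) _; apply: le_trans pE _.
  by rewrite lee_fin; lra.
Qed.

End energy.
End polarization.

(** * Symmetrization *)

Section extraction.
Variable R : realType.

(** A cluster point given by Tychonoff's theorem on an arbitrary index set. Closeness on finite sets
    suffices to pass to u every inequality between finitely many values, such as Lipschitz bounds
    and monotonicity. *)
Lemma pointwise_cluster (I : eqType) (f : nat -> I -> R) (C : I -> R) :
  (forall n i, `|f n i| <= C i) ->
  exists u : I -> R, forall (r : seq I) (e : R) (j : nat), 0 < e ->
    exists2 n, (j <= n)%N & forall i, i \in r -> `|f n i - u i| < e.
Proof.
move=> fC.
pose A (i : I) : set R := `[- C i, C i]%classic.
have cA : compact [set g : prod_topology (fun _ : I => R) | forall i, A i (g i)].
  by apply: (@tychonoff I (fun=> R) A) => i; exact: segment_compact.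
have [|u [_ clu]] := cA ((fun n => f n : prod_topology (fun _ : I => R)) @ \oo) _.
  by exists 0%N => // n _ i; rewrite /A /= in_itv/= -ler_norml.
exists u => r e j e0.
have nb : nbhs (u : prod_topology (fun _ : I => R)) [set g | forall i, i \in r -> `|g i - u i| < e].
  have Fu := nbhs_filter (u : prod_topology (fun _ : I => R)).
  elim: r => [|i r IH].
    by apply: (@filterS _ _ Fu setT) (@filterT _ _ Fu) => g _ i; rewrite in_nil.
  have : nbhs (u : prod_topology (fun _ : I => R)) [set g | `|g i - u i| < e].
    have /cvgrPdist_lt/(_ _ e0) := @proj_continuous I (fun=> R) i u.
    by apply: (@filterS _ _ Fu) => g; rewrite distrC.
  move=> h; apply: (@filterS _ _ Fu) (@filterI _ _ Fu _ _ h IH) => g [gi gr] k.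
  by rewrite in_cons => /orP[/eqP ->|/gr].
have nj : \forall n \near \oo, ((fun n => f n : prod_topology (fun _ : I => R)) @` [set n | (j <= n)%N]) (f n).
  by exists j => // n jn; exists n.
by have [_ [[n jn <-] nP]] := clu _ _ nj nb; exists n.
Qed.

(** The index s n is chosen close to u, within 1 / (n + 1), at the first n + 1 points of [pt]. The
    subsequence converges only on these countably many points, so finite approximability elsewhere
    is kept as a separate clause. *)
Lemma pointwise_extraction (I : eqType) (f : nat -> I -> R) (C : I -> R) (pt : nat -> I) :
  (forall n i, `|f n i| <= C i) ->
  exists u : I -> R, exists s : nat -> nat,
  [/\ forall n, (n <= s n)%N,
      forall (r : seq I) (e : R), 0 < e -> exists n, forall i, i \in r -> `|f n i - u i| < e &
      forall k, f (s n) (pt k) @[n --> \oo] --> u (pt k)].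
Proof.
move=> /pointwise_cluster[u uP].
have H j : exists n, (j <= n)%N /\ forall i, i \in [seq pt k | k <- iota 0 j.+1] -> `|f n i - u i| < j.+1%:R^-1.
  by have [n jn nP] := uP [seq pt k | k <- iota 0 j.+1] j.+1%:R^-1 j (ltac:(by rewrite invr_gt0 ltr0n)); exists n.
have [s sP] := choice H; exists u, s; split => [n|r e e0|k].
- exact: (sP n).1.
- by have [n _ nP] := uP r e 0%N e0; exists n.
apply/cvgrPdist_lt => e e0.
have [n0 n0P] : exists n0 : nat, forall n : nat, (n0 <= n)%N -> n.+1%:R^-1 < e.
  exists (Num.truncn e^-1) => n n0n; rewrite invf_plt ?posrE//.
  by apply: (lt_le_trans (truncnS_gt _)); rewrite ler_nat.
near=> n; rewrite distrC; apply: lt_trans (n0P n _); last by near: n; exact: nbhs_infty_ge.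
apply: (sP n).2; apply: map_f; rewrite mem_iota add0n/= ltnS.
by near: n; exact: nbhs_infty_ge.
Unshelve. all: by end_near. Qed.

Definition rat_point (N k : nat) : 'rV[R]_N :=
  if unpickle k is Some r then map_mx ratr (r : 'rV[rat]_N) else 0.

Lemma rat_point_dense N (x : 'rV[R]_N) (e : R) : 0 < e ->
  exists k, enorm (x - rat_point N k) < e.
Proof.
move=> e0; have N1 : 0 < N%:R + 1 :> R by rewrite ltr_wpDl.
have d0 : 0 < e / (N%:R + 1) by rewrite divr_gt0.
have H i : exists r : rat, ratr r \in `](x 0 i), (x 0 i + e / (N%:R + 1))[.
  by have [|r rP] := @rat_in_itvoo R (x 0 i) (x 0 i + e / (N%:R + 1)); [rewrite ltrDl|exists r].
have [r rP] := choice H.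
exists (pickle (\row_i r i)); rewrite /rat_point pickleK.
apply: le_lt_trans (enorm_le_norm _) _.
have : `|x - map_mx ratr (\row_i r i)| <= e / (N%:R + 1).
  apply: rV_norm_le => [|i]; first exact: ltW.
  rewrite !mxE; have := rP i; rewrite in_itv/= => /andP[h1 h2].
  rewrite distrC ger0_norm; lra.
move=> h; apply: (@le_lt_trans _ _ (N%:R * (e / (N%:R + 1)))); first exact: ler_wpM2l.
by rewrite mulrA ltr_pdivrMr// mulrC ltr_pM2l// ltrDl.
Qed.

(** Pointwise Arzela-Ascoli: convergence at the rational points spreads to all points through the
    common Lipschitz constant, which u inherits. *)
Lemma lipschitz_extraction N (v : nat -> 'rV[R]_N -> R) (L K : R) : 0 <= L ->
  (forall n x, `|v n x| <= K) ->
  (forall n (x y : 'rV[R]_N), `|v n x - v n y| <= L * enorm (x - y)) ->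
  exists u : 'rV[R]_N -> R, exists s : nat -> nat, (forall n, (n <= s n)%N) /\
    forall x, v (s n) x @[n --> \oo] --> u x.
Proof.
move=> L0 vK vL; have [u [s [sn uf us]]] := @pointwise_extraction _ v (cst K) (rat_point N) vK.
exists u, s; split => // x; apply/cvgrPdist_le => e e0.
have uL (a b : 'rV[R]_N) : `|u a - u b| <= L * enorm (a - b).
  apply/ler_addgt0Pr => d d0; have d2 : 0 < d / 2 by lra.
  have [n nP] := uf [:: a; b] _ d2.
  have := nP a; rewrite mem_head => /(_ isT); have := nP b; rewrite !inE eqxx orbT => /(_ isT).
  by have := vL n a b; rewrite !ler_norml !ltr_norml; lra.
have e4 : 0 < e / (4 * (L + 1)) by rewrite divr_gt0// mulr_gt0//; lra.
have [k kP] := rat_point_dense x e4.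
have Lk : L * enorm (x - rat_point N k) <= e / 4.
  apply: (@le_trans _ _ (L * (e / (4 * (L + 1))))); first by rewrite ler_wpM2l// ltW.
  have L1 : 0 < L + 1 by lra.
  rewrite mulrA ler_pdivrMr ?mulr_gt0//; last by lra.
have e2 : 0 < e / 2 by lra.
have /cvgrPdist_le/(_ _ e2) := us k; apply: filterS => n h.
move: h Lk (uL x (rat_point N k)) (vL (s n) x (rat_point N k)); rewrite !ler_norml; lra.
Qed.

End extraction.

Section continuous_integrals.
Variables (R : realType) (N : nat).
Hypothesis N0 : (0 < N)%N.

Local Notation mu := (lebesgue_rV R N).

Lemma lip_continuous (v : 'rV[R]_N -> R) (L : R) :
  (forall x y : 'rV[R]_N, `|v x - v y| <= L * enorm (x - y)) -> continuous v.
Proof.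
move=> vL x; apply/(@cvgrPdist_le R R _ (nbhs x)) => e e0.
have L1 : 0 < (`|L| + 1) * (N%:R + 1) by rewrite mulr_gt0// ltr_wpDl.
have d0 : 0 < e / ((`|L| + 1) * (N%:R + 1)) by rewrite divr_gt0.
have := @cvg_id _ (nbhs x) => /(@cvgrPdist_le R 'rV[R]_N _ (nbhs x))/(_ _ d0).
apply: filterS => y /= xy; apply: le_trans (vL x y) _.
apply: (@le_trans _ _ ((`|L| + 1) * enorm (x - y))).
  by rewrite ler_wpM2r ?enorm_ge0//; have := ler_norm L; lra.
have h : enorm (x - y) <= (N%:R + 1) * (e / ((`|L| + 1) * (N%:R + 1))).
  apply: le_trans (enorm_le_norm _) _; apply: le_trans (_ : (N%:R + 1) * `|x - y| <= _).
    by rewrite ler_wpM2r// lerDl.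
  by rewrite ler_wpM2l// addr_ge0.
apply: (@le_trans _ _ ((`|L| + 1) * ((N%:R + 1) * (e / ((`|L| + 1) * (N%:R + 1)))))).
  by rewrite ler_wpM2l// addr_ge0.
rewrite le_eqVlt; apply/orP; left; apply/eqP; field.
by rewrite !gt_eqF// ltr_wpDl.
Qed.

Lemma continuous_integral_gt0 (h : 'rV[R]_N -> R) x : continuous h ->
  (forall y, 0 <= h y) -> 0 < h x -> (0 < \int[mu]_y (h y)%:E)%E.
Proof.
move=> ch h0 hx; have mh := continuous_measurable_rV ch.
have hx2 : 0 < h x / 2 by lra.
have /(@cvgrPdist_le R R _ (nbhs x))/(_ _ hx2) := ch x.
move=> /nbhs_ballP[r /= r0 rP].
pose A : set 'rV[R]_N := [set y | enorm (y - x) < r].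
have mA : measurable A.
  rewrite -[X in measurable X]setTI.
  have mf : measurable_fun setT (fun y : 'rV[R]_N => enorm (y - x)).
    by apply: measurable_enorm; exact: measurable_rV_add.
  have := mf measurableT `]-oo, r[%classic (measurable_itv _).
  by congr (measurable (_ `&` _)); apply/seteqP; split => y /=; rewrite in_itv/=.
have muA : mu A = mu (eball r).
  rewrite -[in LHS](setIT A) -[in RHS](setIT (eball r)) -!integral_indic//; last exact: measurable_eball.
  rewrite -(@integral_shift R N (fun y => (\1_(eball r) y)%:E) (- x)).
  - by apply: eq_integral => y _; rewrite !indicE; congr ((nat_of_bool _)%:R%:E); apply/idP/idP => /set_mem ?; exact/mem_set.
  - by apply/measurable_EFinP; apply: measurable_indic; exact: measurable_eball.
  - by move=> t; rewrite lee_fin.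
have low : ((h x / 2)%:E * mu A <= \int[mu]_y (h y)%:E)%E.
  rewrite -(setIT A) -integral_indic// -ge0_integralZl_EFin ?(ltW hx2)//; last first.
    by apply/measurable_EFinP; exact: measurable_indic.
  apply: ge0_le_integral => //.
  - by move=> y _; rewrite -EFinM lee_fin mulr_ge0// ltW.
  - by under eq_fun do rewrite -EFinM; apply/measurable_EFinP; apply: measurable_funM => //; exact: measurable_indic.
  - exact/measurable_EFinP.
  move=> y _; rewrite -EFinM lee_fin indicE; case: (boolP (y \in A)) => [/set_mem Ay|_]; last by rewrite mulr0.
  have : ball x r y.
    rewrite -ball_normE /=; apply: le_lt_trans (norm_le_enorm _) _.
    by rewrite -enormN opprB.
  by move/rP; rewrite mulr1 ler_norml; lra.
apply: lt_le_trans low; rewrite mule_gt0 ?lte_fin//.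
rewrite muA; apply: lt_le_trans (eball_measure_ge N0 r0).
by rewrite lte_fin exprn_gt0// divr_gt0// ltr0n.
Qed.

Lemma bounded_convergence (h_ : nat -> 'rV[R]_N -> R) (h : 'rV[R]_N -> R) (M C : R) :
  (forall n, measurable_fun setT (h_ n)) -> measurable_fun setT h ->
  (forall n x, `|h_ n x| <= C) -> (forall n x, M <= enorm x -> h_ n x = 0) ->
  (forall x, h_ n x @[n --> \oo] --> h x) ->
  [/\ mu.-integrable setT (EFin \o h),
      (\int[mu]_x (`|h_ n x - h x|)%:E @[n --> \oo] --> 0)%E &
      (\int[mu]_x (h_ n x)%:E @[n --> \oo] --> \int[mu]_x (h x)%:E)%E].
Proof.
move=> mh_ mh hC hM hc.
have C0 : 0 <= C by apply: le_trans (hC 0%N 0).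
pose D : set 'rV[R]_N := eball M.
have mD : measurable D by exact: measurable_eball.
apply: (@dominated_cvg_real _ _ _ mu h_ h ((cst C%:E) \_ D)) => //.
- exact: aeW.
- apply/(integrable_mkcond _ mD) => //.
  apply: (@measurable_bounded_integrable _ _ _ _ (cst C)) => //.
    exact: eball_measure_lty.
  by exists C; split; [rewrite num_real|move=> l lC x _ /=; rewrite ger0_norm// ltW].
- apply: aeW => x n; rewrite patchE; case: ifPn => [_|xD]; first by rewrite lee_fin.
  rewrite hM ?normr0// leNgt; apply/negP => h'; move/negP: xD; apply; exact/mem_set.
Qed.

End continuous_integrals.

Section abs_power.
Variable R : realType.

Lemma abs_powR2 (p t : R) : 2 < p -> `|t| `^ p = `|t| `^ (p - 2) * t ^+ 2.
Proof.
move=> p2; rewrite -real_normK ?num_real// -powR_mulrn// -powRD; first by congr (_ `^ _); lra.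
by rewrite (_ : p - 2 + 2%:R == 0 = false)//; apply/negbTE/eqP; lra.
Qed.

Lemma is_derive_abs_powR (p t : R) : 2 < p ->
  is_derive t (1 : R) (fun t => `|t| `^ p) (p * (`|t| `^ (p - 2) * t)).
Proof.
move=> p2.
have pos (s : R) : 0 < s -> is_derive s (1 : R) (fun t => `|t| `^ p) (p * (`|s| `^ (p - 2) * s)).
  move=> s0; have -> : `|s| `^ (p - 2) * s = s `^ (p - 1).
    rewrite ger0_norm ?(ltW s0)// -[X in _ * X](powRr1 (ltW s0)) -powRD ?(gt_eqF s0) ?implybT//.
    by congr (_ `^ _); lra.
  have D := is_derive1_powR p s0.
  apply: (@near_eq_is_derive _ _ _ (fun t : R => t `^ p) _ s 1 _ _ D).
  have /cvgr_gt/(_ _ s0) : z @[z --> s] --> s by exact: cvg_id.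
  by apply: filterS => z z0; rewrite gtr0_norm.
have [t0|t0|->] := ltgtP t 0; [|exact: pos|].
- have nt : 0 < - t by rewrite oppr_gt0.
  have /is_derive_eps H := pos _ nt; apply/is_derive_eps => e e0; have [d d0 dP] := H e e0.
  exists d => // h hd; have := dP (- h); rewrite normrN => /(_ hd); congr (`| _ | <= _).
  have -> : (- h) *: (1 : R) + - t = - (h *: (1 : R) + t) by rewrite scaleNr opprD.
  by rewrite !normrN; ring.
apply/is_derive_eps => e e0; exists (Num.min 1 e) => [|h]; first by rewrite lt_min ltr01.
rewrite lt_min => /andP[h1 he].
have -> : h *: (1 : R) + 0 = h by rewrite addr0 [LHS]mulr1.
rewrite normr0 !(mulr0, subr0) powR0; last by rewrite gt_eqF//; lra.
rewrite subr0 ger0_norm ?powR_ge0// abs_powR2//.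
have h2 : `|h| `^ (p - 2) <= 1.
  rewrite [leRHS](_ : 1 = 1 `^ (p - 2)); last by rewrite powR1.
  rewrite ge0_ler_powR ?nnegrE ?ler01 ?(ltW h1)//; lra.
rewrite -real_normK ?num_real// expr2 mulrA ler_wpM2r//.
by apply: le_trans (ltW he); rewrite ler_piMl.
Qed.

Lemma continuous_abs_powR (p : R) : 2 < p -> continuous (fun t : R => `|t| `^ p).
Proof. by move=> p2 t; apply: is_derive_cont1; exact: is_derive_abs_powR. Qed.

End abs_power.

Section symmetrization.
Variables (R : realType) (N : nat) (B : R -> R) (q c1 c2 p : R).
Hypothesis HB : profile B q c1 c2.
Hypothesis N0 : (0 < N)%N.
Hypothesis p2 : 2 < p.
Implicit Types (u v phi psi : 'rV[R]_N -> R).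

Local Notation mu := (lebesgue_rV R N).

(** To the data that must be preserved are added a common bound, Lipschitz constant and support
    radius. These survive polarization and make the class compact under pointwise convergence, so
    that a minimizer of the second moment exists. *)
Record admissible (L M K E : R) (A Ap : \bar R) v : Prop := Admissible {
  adm_ge0 : forall x, 0 <= v x;
  adm_le : forall x, v x <= K;
  adm_lip : forall x y : 'rV[R]_N, `|v x - v y| <= L * enorm (x - y);
  adm_supp : forall x, M <= enorm x -> v x = 0;
  adm_2 : (\int[mu]_x (v x ^+ 2)%:E = A)%E;
  adm_p : (\int[mu]_x (`|v x| `^ p)%:E = Ap)%E;
  adm_relaxed : relaxed B v E
}.

Lemma adm_cont L M K E A Ap v : admissible L M K E A Ap v -> continuous v.
Proof. by move=> /adm_lip; exact: lip_continuous. Qed.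

Lemma adm_meas L M K E A Ap v : admissible L M K E A Ap v -> measurable_fun setT v.
Proof. by move=> /adm_cont; exact: continuous_measurable_rV. Qed.

Lemma test_lip phi : test_function phi -> exists2 L : R, 0 <= L &
  forall x y : 'rV[R]_N, `|phi x - phi y| <= L * enorm (x - y).
Proof.
move=> tp; have [L L0 LP] := cgrad_bounded tp; exists L => // x y.
have d t : is_derive (y + t *: (x - y)) (x - y) phi (dot (cgrad phi (y + t *: (x - y))) (x - y)).
  by apply: Ck1_derive; exact: test_smooth.
have [c _] := @MVT_dir R _ phi _ y (x - y) 1 d.
have -> : y + 1 *: (x - y) = x by rewrite scale1r addrC subrK.
rewrite mulr1 => ->.
by apply: le_trans (norm_dot_le _ _) _; rewrite ler_wpM2r ?enorm_ge0.
Qed.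

Lemma admissible_abs phi (E : R) : test_function phi -> (genergy B phi <= E%:E)%E ->
  exists L M K, [/\ 0 <= L, 0 <= K & admissible L M K E (\int[mu]_x (phi x ^+ 2)%:E)
    (\int[mu]_x (`|phi x| `^ p)%:E) (fun x => `|phi x|)].
Proof.
move=> tp pE; have [L L0 LP] := test_lip tp; have [K K0 KP] := test_bounded tp.
have [_ [M pM]] := (test_functionP _).1 tp.
exists L, (M + 1), K; split; [exact: L0|exact: K0|]; split.
- by move=> x; exact: normr_ge0.
- exact: KP.
- by move=> x y; apply: le_trans (LP x y); exact: ler_dist_dist.
- by move=> x xM; rewrite pM ?normr0//; lra.
- by apply: eq_integral => x _; rewrite real_normK// num_real.
- by apply: eq_integral => x _; rewrite normr_id.
- exact: relaxed_abs HB _ _ _ _.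
Qed.

Lemma measurable_abs_powR : measurable_fun setT (fun t : R => `|t| `^ p).
Proof. exact: continuous_measurable_fun (continuous_abs_powR p2). Qed.

Lemma admissible_polar L M K E A Ap v (w : 'rV[R]_N) (c : R) : 0 <= L -> w != 0 -> 0 < c ->
  admissible L M K E A Ap v -> admissible L M K E A Ap (polar w c v).
Proof.
move=> L0 w0 c0 av; have mv := adm_meas av; split.
- by apply: polar_ge0; exact: adm_ge0 av.
- move=> x; rewrite polarE//; have h1 := adm_le av x; have h2 := adm_le av (refl w c x).
  by case: ifP => _; rewrite ?ge_max ?ge_min h1 ?h2.
- by apply: polar_lip => //; exact: adm_lip av.
- by apply: polar_supp => //; [exact: adm_ge0 av|exact: adm_supp av].
- rewrite -(adm_2 av) (@integral_polar R N w c w0 (fun t => t ^+ 2))//.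
  by move=> t; exact: sqr_ge0.
- rewrite -(adm_p av) (@integral_polar R N w c w0 (fun t => `|t| `^ p))//.
  exact: measurable_abs_powR.
- exact: relaxed_polar HB _ _ mv (adm_relaxed av).
Qed.

(** The weight is strictly increasing in the distance to the origin, so a polarization that moves
    something towards the origin lowers this quantity strictly. *)
Definition moment v : \bar R := (\int[mu]_x (v x * enorm x ^+ 2)%:E)%E.

Lemma adm_moment_bound L M K E A Ap v : admissible L M K E A Ap v -> forall x,
  `|v x * enorm x ^+ 2| <= K * M ^+ 2.
Proof.
move=> av x; have v0 := adm_ge0 av x; have vK := adm_le av x.
rewrite ger0_norm; last by rewrite mulr_ge0// sqr_ge0.
have [xM|xM] := leP M (enorm x).
  by rewrite (adm_supp av xM) mul0r mulr_ge0 ?sqr_ge0// (le_trans v0).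
have M0 : 0 <= M by apply: le_trans (enorm_ge0 x) (ltW xM).
have h : enorm x ^+ 2 <= M ^+ 2 by rewrite ler_sqr ?nnegrE ?enorm_ge0// ltW.
by apply: ler_pM => //; exact: sqr_ge0.
Qed.

Lemma measurable_moment v : measurable_fun setT v ->
  measurable_fun setT (fun x => v x * enorm x ^+ 2).
Proof.
by move=> mv; apply: measurable_funM => //; apply: measurable_funX; exact: measurable_enorm.
Qed.

Lemma admissible_limit L M K E A Ap (v_ : nat -> 'rV[R]_N -> R) u :
  (forall n, admissible L M K E A Ap (v_ n)) ->
  (forall x, v_ n x @[n --> \oo] --> u x) ->
  admissible L M K E A Ap u /\ (moment (v_ n) @[n --> \oo] --> moment u)%E.
Proof.
move=> av vu.
have uL x y : `|u x - u y| <= L * enorm (x - y).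
  have h : `|v_ n x - v_ n y| @[n --> \oo] --> `|u x - u y|.
    by apply: cvg_norm; apply: cvgB.
  by apply: (cvgr_to_le h); apply: nearW => n; exact: adm_lip (av n) x y.
have mv n := adm_meas (av n).
have cu : continuous u by exact: lip_continuous uL.
have mu_ : measurable_fun setT u by exact: continuous_measurable_rV.
have u0 x : 0 <= u x by apply: (cvgr_to_ge (vu x)); apply: nearW => n; exact: adm_ge0 (av n) x.
have uM x : M <= enorm x -> u x = 0.
  move=> xM; apply: (cvg_unique _ (vu x)); first exact: Rhausdorff.
  rewrite (_ : (fun n => _) = cst 0); first exact: cvg_cst.
  by apply/funext => n; exact: adm_supp (av n) x xM.
have uK x : u x <= K by apply: (cvgr_to_le (vu x)); apply: nearW => n; exact: adm_le (av n) x.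
have K0 : 0 <= K by apply: le_trans (u0 0) (uK 0).
have vK n x : `|v_ n x| <= K by rewrite ger0_norm ?(adm_ge0 (av n))// (adm_le (av n)).
have cvg_const (F : R -> R) (a : \bar R) : F 0 = 0 -> continuous F ->
    (exists C : R, forall t : R, `|t| <= K -> `|F t| <= C) ->
    (forall n, (\int[mu]_x (F (v_ n x))%:E = a)%E) -> (\int[mu]_x (F (u x))%:E = a)%E.
  move=> F0 cF [C FC] Fa; have mF := continuous_measurable_fun cF.
  have [|||||_ _] := @bounded_convergence R N (fun n x => F (v_ n x)) (fun x => F (u x)) M C.
  - by move=> n; exact: measurableT_comp.
  - exact: measurableT_comp.
  - by move=> n x; exact: FC.
  - by move=> n x xM; rewrite (adm_supp (av n) xM).
  - by move=> x; apply: (cvg_comp _ _ (vu x)); exact: cF.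
  by under eq_cvg do rewrite Fa; move=> /ereal_cvg_cst_eq.
split; last first.
  have [|||||_ _] := @bounded_convergence R N (fun n x => v_ n x * enorm x ^+ 2)
     (fun x => u x * enorm x ^+ 2) M (K * M ^+ 2) => //.
  - by move=> n; exact: measurable_moment.
  - exact: measurable_moment.
  - by move=> n x; exact: adm_moment_bound (av n) x.
  - by move=> n x xM; rewrite (adm_supp (av n) xM) mul0r.
  - by move=> x; apply: cvgMl; exact: vu.
split => //.
- apply: (cvg_const (fun t => t ^+ 2)) => [|t||n]; last exact: adm_2 (av n).
  + by rewrite expr0n.
  + exact: exprn_continuous.
  + by exists (K ^+ 2) => t tK; rewrite normrX ler_sqr ?nnegrE.
- apply: (cvg_const (fun t => `|t| `^ p)) => [|||n]; last exact: adm_p (av n).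
  + by rewrite normr0 powR0//; apply: contraTneq p2 => ->; rewrite -leNgt.
  + exact: continuous_abs_powR.
  + by exists (K `^ p) => t tK; rewrite ger0_norm ?powR_ge0// ge0_ler_powR ?nnegrE// ltW// (lt_trans _ p2).
- apply: (relaxed_closed mu_) => e e0.
  have [|||||_ _ H] := @bounded_convergence R N (fun n x => (v_ n x - u x) ^+ 2) (cst 0) M ((2 * K) ^+ 2).
  + by move=> n; apply: measurable_funX; exact: measurable_funB.
  + exact: measurable_cst.
  + move=> n x; rewrite normrX ler_sqr ?nnegrE ?mulr_ge0//.
    apply: le_trans (ler_normB _ _) _; have := vK n x.
    by rewrite (ger0_norm (u0 x)); have := uK x; lra.
  + by move=> n x xM; rewrite (adm_supp (av n) xM) uM// subrr expr0n.
  + move=> x /=; have h : v_ n x - u x @[n --> \oo] --> u x - u x by apply: cvgB => //; exact: cvg_cst.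
    by have := cvgM h h; rewrite subrr mulr0; apply.
  move: H; rewrite /= integral0 => /fine_cvgP[Hf /cvgrPdist_le/(_ _ e0) He].
  near \oo => n; exists (v_ n); split => //.
    have nf : (\int[mu]_x ((v_ n x - u x) ^+ 2)%:E \is a fin_num)%E by near: n.
    rewrite -(fineK nf) lee_fin.
    have : `|0 - fine (\int[mu]_x ((v_ n x - u x) ^+ 2)%:E)%E| <= e by near: n.
    by rewrite sub0r normrN; apply: le_trans; exact: ler_norm.
  move=> e' e'0; have [phi [tp h1 h2]] := adm_relaxed (av n) e'0.
  by exists phi; split => //; apply: le_trans h2 _; rewrite lee_fin; lra.
Unshelve. all: by end_near. Qed.

Lemma moment_fin L M K E A Ap v : admissible L M K E A Ap v -> moment v \is a fin_num.
Proof.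
move=> av; have mv := adm_meas av; apply: (@integrable_fin_num _ _ _ _ _ measurableT).
apply: (@bsupp_integrable R N (fun x => v x * enorm x ^+ 2) (K * M ^+ 2)).
- exact: measurable_moment.
- by exists M => x /ltW xM; rewrite (adm_supp av xM) mul0r.
- exact: adm_moment_bound av.
Qed.

Lemma admissible_minimizer L M K E A Ap v : 0 <= L -> 0 <= K -> admissible L M K E A Ap v ->
  exists2 u, admissible L M K E A Ap u &
    forall u', admissible L M K E A Ap u' -> (moment u <= moment u')%E.
Proof.
move=> L0 K0 av; pose S := [set r : R | exists2 u, admissible L M K E A Ap u & moment u = r%:E].
have m0 u : admissible L M K E A Ap u -> (0 <= moment u)%E.
  by move=> au; apply: integral_ge0 => x _; rewrite lee_fin mulr_ge0 ?sqr_ge0// (adm_ge0 au).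
have hS : has_inf S.
  split; first by exists (fine (moment v)); exists v => //; rewrite fineK// (moment_fin av).
  by exists 0 => r [u au ur]; rewrite -lee_fin -ur m0.
have H n : exists u, admissible L M K E A Ap u /\ (moment u <= (inf S + n.+1%:R^-1)%:E)%E.
  have n1 : 0 < n.+1%:R^-1 :> R by rewrite invr_gt0.
  have [r [u au ur] rlt] := inf_adherent n1 hS.
  by exists u; split => //; rewrite ur lee_fin ltW.
have [v_ vP] := choice H; have av_ n := (vP n).1.
have [||u [s [sn us]]] := @lipschitz_extraction R N v_ L K L0.
- by move=> n x; rewrite ger0_norm ?(adm_ge0 (av_ n))// (adm_le (av_ n)).
- by move=> n x y; exact: adm_lip (av_ n) x y.
have [au mu_] := admissible_limit (fun n => av_ (s n)) us.
exists u => // u' au'.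
apply: (@le_trans _ _ (inf S)%:E); last first.
  rewrite -(fineK (moment_fin au')) lee_fin; apply: ge_inf; first exact: hS.2.
  by exists u' => //; rewrite fineK// (moment_fin au').
apply/lee_addgt0Pr => e e0.
have [n0 n0P] : exists n0 : nat, forall n : nat, (n0 <= n)%N -> n.+1%:R^-1 < e.
  exists (Num.truncn e^-1) => n n0n; rewrite invf_plt ?posrE//.
  by apply: (lt_le_trans (truncnS_gt _)); rewrite ler_nat.
apply: (cvge_to_le mu_); exists n0 => // n n0n /=.
apply: le_trans (vP (s n)).2 _; rewrite -EFinD lee_fin lerD2l ltW// n0P//.
exact: leq_trans n0n (sn n).
Qed.

Lemma symmetrization phi (E : R) : test_function phi -> (genergy B phi <= E%:E)%E ->
  exists v, [/\ forall x, 0 <= v x, continuous v,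
    forall x y : 'rV[R]_N, enorm x <= enorm y -> v y <= v x,
    (\int[mu]_x (v x ^+ 2)%:E = \int[mu]_x (phi x ^+ 2)%:E)%E /\
    (\int[mu]_x (`|v x| `^ p)%:E = \int[mu]_x (`|phi x| `^ p)%:E)%E &
    relaxed B v E].
Proof.
move=> tp pE; have [L [M [K [L0 K0 aphi]]]] := admissible_abs tp pE.
have [v av vmin] := admissible_minimizer L0 K0 aphi.
have cv := adm_cont av; have mv := adm_meas av.
exists v; split; [exact: adm_ge0 av|exact: cv| |by split; [exact: adm_2 av|exact: adm_p av]|exact: adm_relaxed av].
have strict (x y : 'rV[R]_N) : enorm x < enorm y -> v y <= v x.
  move=> xy; rewrite leNgt; apply/negP => vxy.
  have xy2 : 0 < enorm y ^+ 2 - enorm x ^+ 2.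
    by rewrite subr_gt0 ltr_sqr ?nnegrE ?enorm_ge0.
  (* The perpendicular bisector of x and y: the reflection exchanges them, and 0 < c because x is
     nearer to the origin. *)
  pose w := y - x; pose c := (enorm y ^+ 2 - enorm x ^+ 2) / 2.
  have w0 : w != 0 by rewrite subr_eq0; apply: contraTneq xy => ->; rewrite ltxx.
  have ww : 0 < dot w w by rewrite dot_gt0.
  have c0 : 0 < c by rewrite divr_gt0.
  have sx : side w c x = dot w w / 2.
    by rewrite /side /c !enormE /w !dotE (dotC y x); field.
  have rx : refl w c x = y.
    have -> : refl w c x = x + (2 * side w c x / dot w w) *: w.
      by rewrite /refl -scaleNr; congr (_ + _ *: _); rewrite -mulNr -mulrN opprB.
    by rewrite sx mulrCA mulfV// mulr1 mulfV ?gt_eqF// scale1r /w addrC subrK.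
  have ap := admissible_polar L0 w0 c0 av.
  pose f (u : 'rV[R]_N -> R) z := u z * enorm z ^+ 2 + u (refl w c z) * enorm (refl w c z) ^+ 2.
  have fg z : f (polar w c v) z <= f v z by apply: polar_moment => //; exact: adm_ge0 av.
  have cf u : continuous u -> continuous (f u).
    move=> cu; have cm : continuous (fun z => u z * enorm z ^+ 2).
      move=> z; have ce : {for z, continuous (fun z : 'rV[R]_N => enorm z ^+ 2)}.
        by apply: (@continuous_comp _ _ _ (@enorm R N) (fun t => t ^+ 2));
          [exact: continuous_enorm|exact: exprn_continuous].
      exact: (continuousM (cu z) ce).
    move=> z; have ce : {for z, continuous (fun z => u (refl w c z) * enorm (refl w c z) ^+ 2)}.
      by apply: (@continuous_comp _ _ _ (refl w c) (fun z => u z * enorm z ^+ 2));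
        [exact: continuous_refl|exact: cm].
    exact: (continuousD (cm z) ce).
  have f0 u z : (forall z, 0 <= u z) -> 0 <= f u z.
    by move=> u0; rewrite addr_ge0// mulr_ge0 ?sqr_ge0.
  have fint u : (forall z, 0 <= u z) -> measurable_fun setT u ->
      (\int[mu]_z (f u z)%:E = 2%:E * moment u)%E.
    move=> u0 mu_; rewrite /moment (refl_average w c).
    - by apply: eq_integral => z _; rewrite -EFinD.
    - by apply/measurable_EFinP; exact: measurable_moment.
    - by move=> z; rewrite lee_fin mulr_ge0 ?sqr_ge0.
  pose h z := f v z - f (polar w c v) z.
  have ch : continuous h by move=> z; apply: continuousB; apply: cf; [exact: cv|exact: adm_cont ap].
  have hx : 0 < h x.
    have s0 : 0 <= side w c x by rewrite sx divr_ge0// ltW.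
    rewrite /h /f polar_refl// rx polarE// s0 rx max_r ?(ltW vxy)//.
    (* At x the polarization swaps the values v x < v y, and the moment density over the pair drops
       by exactly this product. By continuity the integral drops too, against minimality. *)
    rewrite [ltRHS](_ : _ = (v y - v x) * (enorm y ^+ 2 - enorm x ^+ 2)); last by ring.
    by rewrite mulr_gt0// subr_gt0.
  have := continuous_integral_gt0 N0 ch (fun z => (_ : 0 <= h z)) hx.
  have h0 z : 0 <= h z by rewrite subr_ge0.
  move=> /(_ h0); apply/negP; rewrite -leNgt.
  have E1 : (\int[mu]_z (f v z)%:E = \int[mu]_z (f (polar w c v) z)%:E + \int[mu]_z (h z)%:E)%E.
    rewrite -ge0_integralD//.
    - by apply: eq_integral => z _; rewrite -EFinD /h addrC subrK.
    - by move=> z _; rewrite lee_fin f0// => z'; exact: adm_ge0 ap z'.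
    - by apply/measurable_EFinP; apply: continuous_measurable_rV; apply: cf; exact: adm_cont ap.
    - by move=> z _; rewrite lee_fin h0.
    - by apply/measurable_EFinP; exact: continuous_measurable_rV.
  move: E1; rewrite (fint v (adm_ge0 av) mv) (fint _ (adm_ge0 ap) (adm_meas ap)).
  have := vmin _ ap; have := moment_fin av; have := moment_fin ap.
  case: (moment v) => [a| |]//; case: (moment _) => [b| |]// _ _; rewrite lee_fin => ab.
  case: (integral _ _ _) => [r| |]//.
  by rewrite -!EFinM -EFinD => -[]; rewrite lee_fin; lra.
(* On a common sphere no bisector with 0 < c is available; the strict case is applied to x and (1 +
   t) y, and the Lipschitz bound lets t tend to 0. *)
move=> x y; rewrite le_eqVlt => /orP[/eqP xy|]; last exact: strict.
have [y0|y0] := eqVneq y 0.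
  by move: xy; rewrite y0 enorm0 => /eqP; rewrite enorm_eq0 => /eqP ->.
have ey : 0 < enorm y by rewrite enorm_gt0.
apply/ler_addgt0Pr => e e0.
have t0 : 0 < e / ((L + 1) * enorm y) by rewrite divr_gt0// mulr_gt0//; lra.
set t := e / _ in t0.
have h1 : v ((1 + t) *: y) <= v x.
  apply: strict; rewrite xy enormZ ger0_norm; last by lra.
  by rewrite ltr_pMl//; lra.
have h2 : `|v y - v ((1 + t) *: y)| <= e.
  apply: le_trans (adm_lip av _ _) _; rewrite -[X in X - _]scale1r -scalerBl enormZ.
  have -> : `|1 - (1 + t)| = t by rewrite opprD addNKr normrN ger0_norm// ltW.
  rewrite /t; apply: (@le_trans _ _ ((L + 1) * (e / ((L + 1) * enorm y) * enorm y))).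
    by rewrite ler_wpM2r//; [rewrite mulr_ge0 ?enorm_ge0 ?(ltW t0)|lra].
  rewrite le_eqVlt; apply/orP; left; apply/eqP; field.
  by rewrite gt_eqF//= gt_eqF//; lra.
move: h2; rewrite ler_norml; lra.
Qed.

End symmetrization.

(** * Minimization over test functions in the ball *)

Section chebyshev.
Context d (T : measurableType d) (R : realType) (mu : {measure set T -> \bar R}).

Lemma abs_powRD_le (p a b : R) : 0 <= p -> `|a + b| `^ p <= 2 `^ p * (`|a| `^ p + `|b| `^ p).
Proof.
move=> p0; have H (x y : R) : `|x| <= `|y| -> `|x + y| `^ p <= 2 `^ p * (`|x| `^ p + `|y| `^ p).
  move=> xy; apply: (@le_trans _ _ ((2 * `|y|) `^ p)).
    rewrite ge0_ler_powR ?nnegrE ?mulr_ge0//.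
    by apply: le_trans (ler_normD _ _) _; lra.
  by rewrite powRM// ler_wpM2l ?powR_ge0// lerDr powR_ge0.
have [ab|ab] := leP `|a| `|b|; first exact: H.
by rewrite addrC [X in _ <= _ * X]addrC; apply: H; exact: ltW.
Qed.

Lemma measurable_superlevel (f : T -> R) (l : R) : measurable_fun setT f -> measurable [set x | l < f x].
Proof.
move=> mf; rewrite -[X in measurable X]setTI.
have := mf measurableT `]l, +oo[%classic (measurable_itv _).
by congr (measurable (_ `&` _)); apply/seteqP; split => x /=; rewrite in_itv/= andbT.
Qed.

Lemma chebyshev2 (f : T -> R) (a l : R) : measurable_fun setT f -> 0 < l ->
  (\int[mu]_x (f x ^+ 2)%:E <= a%:E)%E -> (mu [set x | (l < `|f x|)%R] <= (a * l ^- 2)%:E)%E.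
Proof.
move=> mf l0 fa; set E := [set x | _].
have mE : measurable E by apply: measurable_superlevel; exact: measurableT_comp.
rewrite mulrC EFinM lee_pdivlMl ?exprn_gt0//.
apply: le_trans fa; rewrite -(setIT E) -integral_indic// -ge0_integralZl_EFin ?sqr_ge0//; last first.
  by apply/measurable_EFinP; exact: measurable_indic.
apply: ge0_le_integral => //.
- by move=> x _; rewrite -EFinM lee_fin mulr_ge0 ?sqr_ge0.
- by under eq_fun do rewrite -EFinM; apply/measurable_EFinP; apply: measurable_funM => //; exact: measurable_indic.
- exact: measurable_sqr.
move=> x _; rewrite -EFinM lee_fin indicE; case: (boolP (x \in E)) => [/set_mem Ex|_]; last by rewrite mulr0 sqr_ge0.
by rewrite mulr1 -[f x ^+ 2]real_normK ?num_real// ler_sqr ?nnegrE ?(ltW l0) ?(ltW Ex).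
Qed.

End chebyshev.

(** * L^p estimates for L^2 limits of test functions with bounded gradients *)

Section h1_limits.
Variables (R : realType) (N : nat).
Hypothesis N0 : (0 < N)%N.
Implicit Types (u v phi psi : 'rV[R]_N -> R).

Local Notation mu := (lebesgue_rV R N).
Local Notation r := (2 + 4 / N%:R : R).

(** Membership in a bounded set of H^1 expressed without a gradient of u, so that it applies to
    functions known only as limits. *)
Definition h1_limit (rho M : R) u := forall e : R, 0 < e -> exists psi,
  [/\ test_function psi, (\int[mu]_x ((psi x - u x) ^+ 2)%:E <= e%:E)%E,
      (\int[mu]_x (psi x ^+ 2)%:E <= (rho ^+ 2)%:E)%E &
      (\int[mu]_x (dot (cgrad psi x) (cgrad psi x))%:E <= M%:E)%E].

Lemma h1_limit_test rho M psi : test_function psi ->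
  (\int[mu]_x (psi x ^+ 2)%:E <= (rho ^+ 2)%:E)%E ->
  (\int[mu]_x (dot (cgrad psi x) (cgrad psi x))%:E <= M%:E)%E -> h1_limit rho M psi.
Proof.
move=> tp h1 h2 e e0; exists psi; split => //.
by under eq_integral do rewrite subrr expr0n/=; rewrite integral0 lee_fin ltW.
Qed.

(** Where |u| > l, either |psi| or |psi - u| exceeds l / 2. The second set is as small as desired by
    Chebyshev's inequality; the halved level in the first yields the factor 2^r. *)
Lemma weak_type_limit rho M u (l : R) : 0 < rho -> measurable_fun setT u -> h1_limit rho M u -> 0 < l ->
  (mu [set x | (l < `|u x|)%R] <=
   (4 * N%:R * (2 * rho) `^ (4 / N%:R) * 2 `^ r * M * l `^ (- r))%:E)%E.
Proof.
move=> r0 mu_ Hu l0; apply/lee_addgt0Pr => e e0.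
have l2 : 0 < l / 2 by lra.
have d0 : 0 < e * (l / 2) ^+ 2 by rewrite mulr_gt0// exprn_gt0.
have [psi [tp pu p2 pM]] := Hu _ d0.
have mp := test_meas tp.
have mA : measurable [set x | l / 2 < `|psi x|].
  by apply: measurable_superlevel; exact: measurableT_comp.
have mB : measurable [set x | l / 2 < `|psi x - u x|].
  by apply: measurable_superlevel; apply: measurableT_comp => //; exact: measurable_funB.
have mC : measurable [set x | l < `|u x|].
  by apply: measurable_superlevel; exact: measurableT_comp.
apply: (@le_trans _ _ (mu [set x | (l / 2 < `|psi x|)%R] + mu [set x | (l / 2 < `|psi x - u x|)%R])%E).
  apply: le_trans (measureU2 _ mA mB); apply: le_measure; rewrite ?inE//.
    exact: measurableU.
  move=> x /= lx; have [h|h] := ltP (l / 2) `|psi x|; [by left|right].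
  have := ler_normB (psi x) (psi x - u x); rewrite opprB addrC subrK; lra.
apply: leeD; last first.
  apply: le_trans (chebyshev2 _ l2 pu) _; first exact: measurable_funB.
  by rewrite lee_fin mulfK// gt_eqF// exprn_gt0.
apply: le_trans (weak_type_gradient N0 tp r0 p2 pM l2) _.
rewrite lee_fin le_eqVlt; apply/orP; left; apply/eqP.
rewrite (@powRM _ l 2^-1) ?invr_ge0 ?(ltW l0)// -(@powR_inv1 _ 2)// -powRrM mulN1r opprK; ring.
Qed.

(** The threshold K stays free. A large K makes the coefficient of the gradient bound M small, which
    yields coercivity; once K is fixed, a small L^2 norm makes the rest small, which yields
    continuity. *)
Lemma lp_bound (p rho : R) : 2 < p -> p < r -> 0 < rho -> exists2 C : R, 0 < C &
  forall u (a M K : R), measurable_fun setT u -> h1_limit rho M u ->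
    (\int[mu]_x (u x ^+ 2)%:E <= a%:E)%E -> 0 < K ->
    (\int[mu]_x (`|u x| `^ p)%:E <= (C * (a * K `^ (p - 2) + M * K `^ (p - r)))%:E)%E.
Proof.
move=> p2 pr r0; have [C C0 CP] := @weak_type_interpolation _ _ R mu p r p2 pr.
pose A := 4 * N%:R * (2 * rho) `^ (4 / N%:R) * 2 `^ r : R.
have A0 : 0 <= A by rewrite !mulr_ge0 ?powR_ge0.
exists (C * (1 + A)) => [|u a M K mu_ Hu ua K0]; first by rewrite mulr_gt0// ltr_wpDr.
have a0 : 0 <= a.
  by rewrite -lee_fin; apply: le_trans ua; apply: integral_ge0 => x _; rewrite lee_fin sqr_ge0.
have M0 : 0 <= M.
  have [psi [_ _ _ h]] := Hu 1 ltr01; rewrite -lee_fin; apply: le_trans h.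
  by apply: integral_ge0 => x _; rewrite lee_fin dot_ge0.
apply: le_trans (CP (fun x => `|u x|) a (A * M) K _ _ a0 _ K0 _ _) _ => //.
- exact: measurableT_comp.
- exact: mulr_ge0.
- by move=> l l0; exact: chebyshev2.
- by move=> l l0; exact: weak_type_limit.
rewrite lee_fin -[leRHS]mulrA ler_wpM2l ?(ltW C0)// -(mulrA A M).
have X0 : 0 <= a * K `^ (p - 2) by rewrite mulr_ge0 ?powR_ge0.
have Y0 : 0 <= M * K `^ (p - r) by rewrite mulr_ge0 ?powR_ge0.
move: (a * _) (M * _) X0 Y0 => X Y X0 Y0; have := mulr_ge0 A0 X0; lra.
Qed.

Lemma integral_dotB_le phi psi (a b : R) : test_function phi -> test_function psi ->
  (\int[mu]_x (dot (cgrad phi x) (cgrad phi x))%:E <= a%:E)%E ->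
  (\int[mu]_x (dot (cgrad psi x) (cgrad psi x))%:E <= b%:E)%E ->
  (\int[mu]_x (dot (cgrad (fun x => phi x - psi x) x) (cgrad (fun x => phi x - psi x) x))%:E
    <= (2 * a + 2 * b)%:E)%E.
Proof.
move=> tp tq pa qb; have td := testB tp tq.
have mp := measurable_cgrad tp; have mq := measurable_cgrad tq; have md := measurable_cgrad td.
have mdp : measurable_fun setT (fun x => dot (cgrad phi x) (cgrad phi x)) by exact: measurable_dot.
have mdq : measurable_fun setT (fun x => dot (cgrad psi x) (cgrad psi x)) by exact: measurable_dot.
apply: (@le_trans _ _ (\int[mu]_x (2%:E * (dot (cgrad phi x) (cgrad phi x))%:E +
   2%:E * (dot (cgrad psi x) (cgrad psi x))%:E))%E).
  apply: ge0_le_integral => //.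
  - by move=> x _; rewrite lee_fin dot_ge0.
  - by apply/measurable_EFinP; exact: measurable_dot.
  - by apply: emeasurable_funD; under eq_fun do rewrite -EFinM; apply/measurable_EFinP;
      apply: measurable_funM.
  move=> x _; rewrite -!EFinM -EFinD lee_fin.
  have -> : cgrad (fun x => phi x - psi x) x = cgrad phi x - cgrad psi x.
    apply/rowP => i; rewrite !mxE /partial; apply: derive_val.
    by apply: is_deriveB; apply: (@Ck_derive _ _ 0); exact: test_smooth.
  rewrite -subr_ge0 [leRHS](_ : _ = dot (cgrad phi x + cgrad psi x) (cgrad phi x + cgrad psi x)) ?dot_ge0//.
  by rewrite !dotE (dotC (cgrad psi x)); ring.
rewrite ge0_integralD//; first last.
- by under eq_fun do rewrite -EFinM; apply/measurable_EFinP; apply: measurable_funM.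
- by move=> x _; rewrite -EFinM lee_fin mulr_ge0// dot_ge0.
- by under eq_fun do rewrite -EFinM; apply/measurable_EFinP; apply: measurable_funM.
- by move=> x _; rewrite -EFinM lee_fin mulr_ge0// dot_ge0.
rewrite !ge0_integralZl_EFin//; first last.
- exact/measurable_EFinP.
- by move=> x _; rewrite lee_fin dot_ge0.
- exact/measurable_EFinP.
- by move=> x _; rewrite lee_fin dot_ge0.
have -> : (2 * a + 2 * b)%:E = (2%:E * a%:E + 2%:E * b%:E)%E by [].
by rewrite leeD// lee_wpmul2l.
Qed.

Lemma h1_limitB rho M phi v : test_function phi -> measurable_fun setT v ->
  (\int[mu]_x (phi x ^+ 2)%:E <= (rho ^+ 2)%:E)%E ->
  (\int[mu]_x (dot (cgrad phi x) (cgrad phi x))%:E <= M%:E)%E ->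
  h1_limit rho M v -> h1_limit (2 * rho) (4 * M) (fun x => phi x - v x).
Proof.
move=> tp mv p2 pM Hv e e0; have [psi [tq qv q2 qM]] := Hv _ e0.
exists (fun x => phi x - psi x); split; first exact: testB.
- have E x : (phi x - psi x - (phi x - v x)) ^+ 2 = (psi x - v x) ^+ 2 by ring.
  by under eq_integral do rewrite E.
- have := @integral_sqrD_le _ _ R mu phi (fun x => - psi x) (rho ^+ 2) (rho ^+ 2) (test_meas tp).
  move=> /(_ _ p2) H; apply: le_trans (H _ _) _.
  + by apply: measurableT_comp => //; exact: test_meas.
  + by under eq_integral do rewrite sqrrN.
  + by rewrite lee_fin exprMn; lra.
- apply: le_trans (integral_dotB_le tp tq pM qM) _; rewrite lee_fin; lra.
Qed.

Lemma lp_small (p rho M : R) v : 2 < p -> p < r -> 0 < rho -> 0 <= M -> measurable_fun setT v ->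
  h1_limit rho M v -> forall e : R, 0 < e -> exists2 del : R, 0 < del &
  forall psi, test_function psi -> (\int[mu]_x (psi x ^+ 2)%:E <= (rho ^+ 2)%:E)%E ->
    (\int[mu]_x (dot (cgrad psi x) (cgrad psi x))%:E <= M%:E)%E ->
    (\int[mu]_x ((psi x - v x) ^+ 2)%:E <= del%:E)%E ->
    (\int[mu]_x (`|psi x - v x| `^ p)%:E <= e%:E)%E.
Proof.
move=> p2 pr r0 M0 mv Hv e e0; have r20 : 0 < 2 * rho by lra.
have [C C0 CP] := lp_bound p2 pr r20.
have pr0 : 0 < r - p by lra.
(* With K^(p - r) = 1 / m the gradient term is at most e / 2; the choice of [del] below makes the
   other term e / 2. The bound 4 M comes from [h1_limitB]. *)
pose m := 2 * C * (4 * M + 1) / e.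
have m0 : 0 < m by rewrite divr_gt0// !mulr_gt0//; lra.
pose K := m `^ (r - p)^-1.
have K0 : 0 < K by rewrite powR_gt0.
have KE : K `^ (p - r) = m^-1.
  rewrite /K -powRrM (_ : _ * _ = -1) ?powR_inv1 ?(ltW m0)//.
  have -> : p - r = - (r - p) by rewrite opprB.
  by rewrite mulrN mulVf// gt_eqF.
have Kp : 0 < K `^ (p - 2) by rewrite powR_gt0.
exists (e / (2 * C * K `^ (p - 2))) => [|psi tp h2 hM hd]; first by rewrite divr_gt0// !mulr_gt0.
have mp := test_meas tp.
apply: le_trans (CP (fun x => psi x - v x) _ (4 * M) K _ _ hd K0) _.
- exact: measurable_funB.
- exact: h1_limitB.
rewrite lee_fin KE /m invf_div.
have h : 4 * M / (4 * M + 1) <= 1 by rewrite ler_pdivrMr; lra.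
rewrite [leLHS](_ : _ = e / 2 + e / 2 * (4 * M / (4 * M + 1))).
  have := ler_wpM2l (ltW (divr_gt0 e0 (ltr0n _ 2))) h; rewrite mulr1; lra.
field; rewrite !gt_eqF//; lra.
Qed.

(** By contradiction: counterexamples can be chosen with the integrals of |psi_n - v|^p below
    2^(-n). Then [fast_majorant] provides a dominating function and almost everywhere convergence,
    hence convergence of the p-th powers. *)
Lemma lp_continuous (p rho M : R) v : 2 < p -> p < r -> 0 < rho -> 0 <= M -> measurable_fun setT v ->
  h1_limit rho M v ->
  (\int[mu]_x (`|v x| `^ p)%:E \is a fin_num)%E /\
  forall e : R, 0 < e -> exists2 del : R, 0 < del &
  forall psi, test_function psi -> (\int[mu]_x (psi x ^+ 2)%:E <= (rho ^+ 2)%:E)%E ->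
    (\int[mu]_x (dot (cgrad psi x) (cgrad psi x))%:E <= M%:E)%E ->
    (\int[mu]_x ((psi x - v x) ^+ 2)%:E <= del%:E)%E ->
    `|fine (\int[mu]_x (`|psi x| `^ p)%:E)%E - fine (\int[mu]_x (`|v x| `^ p)%:E)%E| <= e.
Proof.
move=> p2 pr r0 M0 mv Hv; have p0 : 0 < p by lra.
have mpow (f : 'rV[R]_N -> R) : measurable_fun setT f -> measurable_fun setT (fun x => `|f x| `^ p).
  by move=> mf; exact: (measurableT_comp (measurable_abs_powR p2) mf).
have iv : mu.-integrable setT (fun x => (`|v x| `^ p)%:E).
  apply/integrableP; split; first by apply/measurable_EFinP; exact: mpow.
  under eq_integral do rewrite gee0_abs ?lee_fin ?powR_ge0//.
  have [C C0 CP] := lp_bound p2 pr r0; have [psi [tp h1 h2 _]] := Hv 1 ltr01.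
  apply: le_lt_trans (CP v (2 * 1 + 2 * rho ^+ 2) M 1 mv Hv _ ltr01) (ltry _).
  have h : (\int[mu]_x ((v x - psi x) ^+ 2)%:E <= 1%:E)%E by under eq_integral do rewrite -sqrrN opprB.
  have := integral_sqrD_le (measurable_funB mv (test_meas tp)) (test_meas tp) h h2.
  by under eq_integral do rewrite subrK.
split; first exact: integrable_fin_num.
move=> e e0; apply: contrapT => /forall2NP Hc.
have H n : exists psi, [/\ test_function psi,
    (\int[mu]_x (`|psi x - v x| `^ p)%:E <= (2^-1 ^+ n)%:E)%E &
    ~ `|fine (\int[mu]_x (`|psi x| `^ p)%:E)%E - fine (\int[mu]_x (`|v x| `^ p)%:E)%E| <= e].
  have n0 : 0 < 2^-1 ^+ n :> R by rewrite exprn_gt0.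
  have [del d0 dP] := lp_small p2 pr r0 M0 mv Hv n0.
  have [//|] := Hc del.
  move=> /existsNP[psi /not_implyP[tp /not_implyP[h1 /not_implyP[h2 /not_implyP[h3 h4]]]]].
  by exists psi; split => //; exact: dP.
have [psi psiP] := choice H.
have tp n : test_function (psi n) by have [] := psiP n.
have mp n := test_meas (tp n).
have [||n|S [iS hS cS]] := @fast_majorant _ _ R mu (fun n x => `|psi n x - v x| `^ p).
- by move=> n; apply: mpow; exact: measurable_funB.
- by move=> n x; exact: powR_ge0.
- by have [] := psiP n.
have cpsi : \forall x \ae mu, `|psi n x| `^ p @[n --> \oo] --> `|v x| `^ p.
  apply: filterS cS => x cx.
  suff h : psi n x @[n --> \oo] --> v x by exact: (@cvg_comp _ _ _ (fun n => psi n x) (fun t : R => `|t| `^ p) _ _ _ h (@continuous_abs_powR R p p2 (v x))).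
  apply/cvgrPdist_lt => d d0; have dp : 0 < d `^ p by rewrite powR_gt0.
  move/cvgrPdist_lt : cx => /(_ _ dp); apply: filterS => n.
  rewrite sub0r normrN ger0_norm ?powR_ge0// distrC => h; rewrite ltNge; apply/negP => h'.
  by move: h; rewrite ltNge => /negP; apply; rewrite ge0_ler_powR ?nnegrE ?(ltW d0) ?(ltW p0).
have [] := @dominated_cvg_real _ _ R mu (fun n x => `|psi n x| `^ p) (fun x => `|v x| `^ p)
  (fun x => (2 `^ p)%:E * ((`|v x| `^ p)%:E + S x))%E.
- by move=> n; exact: mpow.
- exact: mpow.
- exact: cpsi.
- by apply: integrableZl => //; exact: integrableD.
- apply: aeW => x n; rewrite ger0_norm ?powR_ge0//.
  have -> : psi n x = v x + (psi n x - v x) by rewrite addrC subrK.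
  apply: (@le_trans _ _ (2 `^ p * (`|v x| `^ p + `|psi n x - v x| `^ p))%:E).
    by rewrite lee_fin abs_powRD_le// ltW.
  by rewrite EFinM lee_wpmul2l// ?lee_fin ?powR_ge0// EFinD leeD2l// (hS n x).
move=> _ _; rewrite -[X in _ --> X](fineK (integrable_fin_num measurableT iv)).
move=> /fine_cvgP[_ /cvgrPdist_le/(_ _ e0)] [n _ /(_ n (leqnn n))] /= h.
by have [_ _ []] := psiP n; rewrite distrC.
Qed.

End h1_limits.

(** * The minimization problem in the ball *)

Section ball_minimization.
Variables (R : realType) (N : nat) (B : R -> R) (q c1 c2 p rho : R).
Hypothesis HB : profile B q c1 c2.
Hypothesis N0 : (0 < N)%N.
Hypothesis p2 : 2 < p.
Hypothesis pr : p < 2 + 4 / N%:R.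
Hypothesis r0 : 0 < rho.
Implicit Types (u v phi psi : 'rV[R]_N -> R).

Local Notation mu := (lebesgue_rV R N).
Local Notation Ge := (@genergy R N B).

Definition power u : \bar R := (\int[mu]_x (`|u x| `^ p)%:E)%E.

Definition test_energy psi : R := fine (Ge psi) / 2 - fine (power psi) / p.

Definition test_ball psi := test_function psi /\ (\int[mu]_x (psi x ^+ 2)%:E <= (rho ^+ 2)%:E)%E.

Definition m0 : R := inf [set e | exists2 psi, test_ball psi & test_energy psi = e].

Let p0 : 0 < p. Proof. exact: lt_trans p2. Qed.
Let c10 : 0 < c1. Proof. exact: profile_c1 HB. Qed.

Lemma power_ge0 u : (0 <= power u)%E.
Proof. by apply: integral_ge0 => x _; rewrite lee_fin powR_ge0. Qed.

Lemma measurable_power u : measurable_fun setT u -> measurable_fun setT (fun x => `|u x| `^ p).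
Proof. by move=> mu_; exact: (measurableT_comp (measurable_abs_powR p2) mu_). Qed.

Lemma power_fin psi : test_function psi -> power psi \is a fin_num.
Proof.
move=> tp; have [K K0 KP] := test_bounded tp; have [_ [M pM]] := (test_functionP _).1 tp.
apply: (@integrable_fin_num _ _ _ _ _ measurableT).
apply: (@bsupp_integrable R N (fun x => `|psi x| `^ p) (K `^ p)).
- by apply: measurable_power; exact: test_meas.
- by exists M => x xM; rewrite pM// normr0 powR0// gt_eqF.
- by move=> x; rewrite ger0_norm ?powR_ge0// ge0_ler_powR ?nnegrE// ltW.
Qed.

Lemma integral_grad_le psi (E : R) : test_function psi -> (Ge psi <= E%:E)%E ->
  (\int[mu]_x (dot (cgrad psi x) (cgrad psi x))%:E <= (E / c1)%:E)%E.
Proof.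
move=> tp pE; have mg := measurable_cgrad tp.
rewrite mulrC EFinM lee_pdivlMl//; apply: le_trans pE.
rewrite -ge0_integralZl_EFin ?(ltW c10)//; first last.
- by apply/measurable_EFinP; exact: measurable_dot.
- by move=> x _; rewrite lee_fin dot_ge0.
apply: ge0_le_integral => //.
- by move=> x _; rewrite -EFinM lee_fin mulr_ge0 ?(ltW c10)// dot_ge0.
- by under eq_fun do rewrite -EFinM; apply/measurable_EFinP; apply: measurable_funM => //; exact: measurable_dot.
- exact: measurable_Phi_cgrad HB _ tp.
- by move=> x _; rewrite -EFinM lee_fin (Phi_lower HB).
Qed.

Lemma genergy_fine psi : test_function psi -> Ge psi = (fine (Ge psi))%:E.
Proof. by move=> tp; rewrite fineK// (genergy_fin HB). Qed.

Lemma test_energy_coercive : exists K0 : R, forall psi, test_ball psi ->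
  fine (Ge psi) / 4 - K0 <= test_energy psi.
Proof.
have [C C0 CP] := lp_bound N0 p2 pr r0.
have pr0 : 0 < 2 + 4 / N%:R - p by rewrite subr_gt0.
(* Tuned so that the gradient term in the bound of |psi|_p^p / p is exactly a quarter of the
   gradient energy, leaving another quarter for coercivity. *)
pose m := 4 * C / (p * c1).
have m_gt0 : 0 < m by rewrite divr_gt0// mulr_gt0.
pose K := m `^ (2 + 4 / N%:R - p)^-1.
have K0 : 0 < K by rewrite powR_gt0.
have KE : K `^ (p - (2 + 4 / N%:R)) = m^-1.
  rewrite /K -powRrM (_ : _ * _ = -1) ?powR_inv1 ?(ltW m_gt0)//.
  have -> : p - (2 + 4 / N%:R) = - (2 + 4 / N%:R - p) by rewrite opprB.
  by rewrite mulrN mulVf// gt_eqF.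
exists (C * (rho ^+ 2 * K `^ (p - 2)) / p) => psi [tp ip].
have hg := integral_grad_le tp (_ : _ <= (fine (Ge psi))%:E)%E.
rewrite -genergy_fine// lexx in hg.
have := CP psi _ _ K (test_meas tp) (h1_limit_test tp ip (hg isT)) ip K0.
rewrite -/(power psi) -(fineK (power_fin tp)) lee_fin KE => h.
rewrite /test_energy.
have : fine (power psi) / p <= C * (rho ^+ 2 * K `^ (p - 2)) / p + fine (Ge psi) / 4.
  rewrite ler_pdivrMr//; apply: le_trans h _; rewrite le_eqVlt; apply/orP; left; apply/eqP.
  by rewrite /m; field; rewrite !gt_eqF.
lra.
Qed.

Lemma test_ball0 : test_ball (cst 0).
Proof.
split; first exact: test0.
by under eq_integral do rewrite /= expr0n/=; rewrite integral0 lee_fin sqr_ge0.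
Qed.

Lemma has_inf_test_energy : has_inf [set e | exists2 psi, test_ball psi & test_energy psi = e].
Proof.
split; first by exists (test_energy (cst 0)); exists (cst 0) => //; exact: test_ball0.
have [K0 K0P] := test_energy_coercive; exists (- K0) => _ [psi bp <-].
apply: le_trans (K0P psi bp); rewrite lerDr divr_ge0//; apply: fine_ge0.
exact: genergy_ge0 HB _.
Qed.

Lemma m0_le psi : test_ball psi -> m0 <= test_energy psi.
Proof. by move=> bp; apply: ge_inf; [exact: has_inf_test_energy.2|exists psi]. Qed.

Lemma cgradZ (s : R) phi x : test_function phi -> cgrad (fun x => s * phi x) x = s *: cgrad phi x.
Proof.
move=> tp; apply/rowP => i; rewrite !mxE /partial; apply: derive_val.
by apply: is_deriveZ; apply: (@Ck_derive _ _ 0); exact: test_smooth.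
Qed.

Lemma fine_le_mul (x y : \bar R) (k : R) : x \is a fin_num -> y \is a fin_num ->
  (x <= k%:E * y)%E -> fine x <= k * fine y.
Proof. by case: x y => [x| |] [y| |]//= _ _; rewrite -EFinM lee_fin. Qed.

Lemma genergyZ (s : R) phi : 0 <= s <= 1 -> test_function phi ->
  fine (Ge (fun x => s * phi x)) <= s * fine (Ge phi).
Proof.
move=> /andP[s0 s1] tp; have ts := testZ s tp.
apply: fine_le_mul (genergy_fin HB ts) (genergy_fin HB tp) _.
rewrite /genergy -ge0_integralZl_EFin//; first last.
- exact: measurable_Phi_cgrad HB _ tp.
- by move=> x _; rewrite lee_fin (Phi_ge0 HB).
apply: ge0_le_integral => //.
- by move=> x _; rewrite lee_fin (Phi_ge0 HB).
- exact: measurable_Phi_cgrad HB _ ts.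
- under eq_fun do rewrite -EFinM; apply/measurable_EFinP; apply: measurable_funM => //.
  by apply/measurable_EFinP; exact: measurable_Phi_cgrad HB _ tp.
move=> x _; rewrite cgradZ// -EFinM lee_fin.
by have := Phi_contract HB (cgrad phi x) (t := s); rewrite ger0_norm//; exact.
Qed.

Lemma powerZ (s : R) u : 0 <= s -> measurable_fun setT u ->
  power (fun x => s * u x) = ((s `^ p)%:E * power u)%E.
Proof.
move=> s0 mu_; rewrite /power -ge0_integralZl_EFin ?powR_ge0//; first last.
- by apply/measurable_EFinP; exact: measurable_power.
apply: eq_integral => x _; rewrite -EFinM normrM (ger0_norm s0) powRM//.
Qed.

Lemma integral_sqrZ (s : R) u : measurable_fun setT u ->
  (\int[mu]_x ((s * u x) ^+ 2)%:E = (s ^+ 2)%:E * \int[mu]_x (u x ^+ 2)%:E)%E.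
Proof.
move=> mu_; rewrite -ge0_integralZl_EFin ?sqr_ge0//; first last.
- exact: measurable_sqr.
- by move=> x _; rewrite lee_fin sqr_ge0.
by apply: eq_integral => x _; rewrite -EFinM exprMn.
Qed.

Section dilation.
Variable t : R.
Hypothesis t0 : 0 < t.

Definition dilate phi (x : 'rV[R]_N) : R := phi (t^-1 *: x).

Let affine h (v x : 'rV[R]_N) : t^-1 *: (h *: v + x) = h *: (t^-1 *: v) + t^-1 *: x.
Proof. by rewrite scalerDr !scalerA mulrC. Qed.

Lemma dilate_test phi : test_function phi -> test_function (dilate phi).
Proof.
move=> tp; have [sp [M pM]] := (test_functionP _).1 tp; apply/test_functionP; split.
  move=> k; apply: (@Ck_precomp R N k phi (fun x => t^-1 *: x) (fun x => t^-1 *: x)) => //.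
  by move=> x; exact: scaler_continuous.
exists (t * M) => x xM; apply: pM; rewrite enormZ ger0_norm ?invr_ge0 ?(ltW t0)//.
by rewrite ltr_pdivlMl.
Qed.

Lemma cgrad_dilate phi x : test_function phi ->
  cgrad (dilate phi) x = t^-1 *: cgrad phi (t^-1 *: x).
Proof.
move=> tp; apply: dot_eqP => v; rewrite dotZl -dotZr.
by apply: (@cgrad_precomp R N phi (fun x => t^-1 *: x) (fun x => t^-1 *: x)) => //;
  apply: test_smooth => //; exact: dilate_test.
Qed.

Lemma integral_dilate (f : 'rV[R]_N -> \bar R) : measurable_fun setT f -> (forall x, (0 <= f x)%E) ->
  (\int[mu]_x f (t^-1 *: x)%R = (t ^+ N)%:E * \int[mu]_x f x)%E.
Proof.
move=> mf f0; have ti : 0 < t^-1 by rewrite invr_gt0.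
have := @integral_affine R N f t^-1 0 ti mf f0; rewrite invrK => <-.
by apply: eq_integral => x _; rewrite addr0.
Qed.

Lemma power_dilate phi : test_function phi -> power (dilate phi) = ((t ^+ N)%:E * power phi)%E.
Proof.
move=> tp; rewrite /power -(@integral_dilate (fun x => (`|phi x| `^ p)%:E))//.
by apply/measurable_EFinP; apply: measurable_power; exact: test_meas.
Qed.

Lemma integral_sqr_dilate phi : test_function phi ->
  (\int[mu]_x (dilate phi x ^+ 2)%:E = (t ^+ N)%:E * \int[mu]_x (phi x ^+ 2)%:E)%E.
Proof.
move=> tp; rewrite -(@integral_dilate (fun x => (phi x ^+ 2)%:E))//.
- by apply: measurable_sqr; exact: test_meas.
- by move=> x; rewrite lee_fin sqr_ge0.
Qed.

Lemma genergy_dilate (s k : R) phi : 0 <= k -> test_function phi ->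
  (forall xi : 'rV[R]_N, Phi B ((s / t) *: xi) <= k * Phi B xi) ->
  fine (Ge (fun x => s * dilate phi x)) <= t ^+ N * k * fine (Ge phi).
Proof.
move=> k0 tp H; have td := dilate_test tp; have ts := testZ s td.
apply: fine_le_mul (genergy_fin HB ts) (genergy_fin HB tp) _.
rewrite EFinM -muleA /genergy -(ge0_integralZl_EFin _ measurableT _ _ k0)//; first last.
- exact: measurable_Phi_cgrad HB _ tp.
- by move=> x _; rewrite lee_fin (Phi_ge0 HB).
rewrite -integral_dilate; first last.
- by move=> x; rewrite -EFinM lee_fin mulr_ge0// (Phi_ge0 HB).
- under eq_fun do rewrite -EFinM; apply/measurable_EFinP; apply: measurable_funM => //.
  by apply/measurable_EFinP; exact: measurable_Phi_cgrad HB _ tp.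
apply: ge0_le_integral => //.
- by move=> x _; rewrite lee_fin (Phi_ge0 HB).
- exact: measurable_Phi_cgrad HB _ ts.
- under eq_fun do rewrite -EFinM; apply/measurable_EFinP; apply: measurable_funM => //.
  apply: (@measurableT_comp _ _ _ _ _ _ (fun x => Phi B (cgrad phi x))).
    by apply/measurable_EFinP; exact: measurable_Phi_cgrad HB _ tp.
  by have := @measurable_affine R N t^-1 0; under eq_fun do rewrite addr0.
by move=> x _; rewrite cgradZ// cgrad_dilate// scalerA -EFinM lee_fin.
Qed.

End dilation.

(** Since q >= 2, the quadratic part governs small multiples. The factor k^2, against the linear one
    given by convexity, is needed for the scaling argument of [m0_lt0]. *)
Lemma Phi_scale (k : R) (xi : 'rV[R]_N) : 0 <= k <= 1 -> Phi B (k *: xi) <= k ^+ 2 * (c2 / c1) * Phi B xi.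
Proof.
move=> /andP[k0 k1]; have q2 := profile_q HB.
apply: le_trans (Phi_upper HB _) _; rewrite enormZ !dotE (ger0_norm k0) powRM ?enorm_ge0//.
have kq : k `^ q <= k ^+ 2.
  have [->|k'] := eqVneq k 0; first by rewrite powR0 ?expr0n// gt_eqF//; lra.
  have k'0 : 0 < k by rewrite lt_def k' k0.
  rewrite -powR_mulrn// (_ : q = 2%:R + (q - 2)); last by rewrite addrC subrK.
  rewrite powRD ?k' ?implybT// ler_piMr ?powR_ge0//.
  rewrite [leRHS](_ : 1 = 1 `^ (q - 2)); last by rewrite powR1.
  rewrite ge0_ler_powR ?nnegrE//; lra.
have h1 : k * (k * dot xi xi) + k `^ q * enorm xi `^ q <= k ^+ 2 * (dot xi xi + enorm xi `^ q).
  by rewrite mulrDr mulrA -expr2 lerD2l ler_wpM2r// powR_ge0.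
have h2 : dot xi xi + enorm xi `^ q <= Phi B xi / c1.
  rewrite ler_pdivlMr// mulrC.
  have /andP[H _] := profile_bounds HB (enorm xi).
  by move: H; rewrite (ger0_norm (enorm_ge0 xi)) enormE.
have c20 := profile_c2 HB.
apply: (@le_trans _ _ (c2 * (k ^+ 2 * (Phi B xi / c1)))).
  rewrite ler_pM2l//; apply: le_trans h1 _; rewrite ler_wpM2l ?sqr_ge0//.
rewrite le_eqVlt; apply/orP; left; apply/eqP; field; rewrite gt_eqF//.
Qed.

Lemma bump_nontrivial : exists2 phi, test_function phi & (0 < power phi)%E.
Proof.
pose phi := @bump R N (const_mx (-1)) (const_mx 1) 1.
have tp : test_function phi by exact: bump_test.
exists phi => //.
apply: (continuous_integral_gt0 N0 (x := 0)) => [x|x|].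
- apply: (@continuous_comp _ _ _ phi (fun t : R => `|t| `^ p)); first exact: test_cont.
  exact: continuous_abs_powR.
- exact: powR_ge0.
rewrite powR_gt0// normr_gt0 /phi /bump gt_eqF// subr_gt0 expR_lt1 mulN1r oppr_lt0.
apply: prodr_gt0 => i _; rewrite !mxE.
by rewrite sub0r opprK subr0 mulr_gt0// lt_neqAle flat_ge0 andbT eq_sym gt_eqF// flat0_gt0.
Qed.

Lemma m0_lt0 : m0 < 0.
Proof.
have [phi tp d0] := bump_nontrivial.
have A0 : (0 <= \int[mu]_x (phi x ^+ 2)%:E)%E by apply: integral_ge0 => x _; rewrite lee_fin sqr_ge0.
have [K K0 KP] := test_bounded tp; have [_ [M pM]] := (test_functionP _).1 tp.
have Af : (\int[mu]_x (phi x ^+ 2)%:E)%E \is a fin_num.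
  rewrite ge0_fin_numE//; apply: le_lt_trans (integral_sqr_bounded_le (test_meas tp) K0 pM KP) _.
  by rewrite lte_mul_pinfty// ?lee_fin ?sqr_ge0// eball_measure_lty.
pose A := fine (\int[mu]_x (phi x ^+ 2)%:E)%E; have A_ge0 : 0 <= A by exact: fine_ge0.
pose d := fine (power phi) / p.
have d_gt0 : 0 < d by rewrite divr_gt0// fine_gt0// d0 ltey_eq power_fin.
pose a := c2 / c1 * fine (Ge phi) / 2.
have c20 := profile_c2 HB.
have a_ge0 : 0 <= a.
  by rewrite divr_ge0// mulr_ge0 ?divr_ge0 ?(ltW c10) ?(ltW c20)//; apply: fine_ge0; exact: genergy_ge0 HB _.
(* Amplitude that puts sig phi into the ball; A + 1 in place of A keeps the division meaningful and
   only decreases the norm. *)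
pose sig := rho / Num.sqrt (A + 1).
have A1 : 0 < Num.sqrt (A + 1) by rewrite sqrtr_gt0 ltr_wpDl.
have sig0 : 0 < sig by rewrite divr_gt0.
have Nr : 0 < N%:R :> R by rewrite ltr0n.
(* For psi = s phi(x / t) with s = sig t^(-N/2) the L^2 norm is fixed, the gradient part is of order
   t^(-2) and the power part of order t^(-N (p - 2) / 2). Their quotient gains t^th, and 0 < th
   amounts to p < 2 + 4/N. *)
pose th := 2 - N%:R * (p - 2) / 2.
have th0 : 0 < th.
  have : (p - 2) * N%:R < 4 by rewrite -ltr_pdivlMr// ltrBlDl.
  by rewrite /th; lra.
(* The value that t^th must reach for the power part to prevail; the added 1 makes the inequality
   strict. *)
pose X := a / (sig `^ (p - 2) * d) + 1.
have sp0 : 0 < sig `^ (p - 2) by rewrite powR_gt0.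
have X0 : 0 < X by rewrite ltr_wpDl// divr_ge0// ltW// mulr_gt0.
(* The bound t >= sig, with t >= 1, ensures s / t <= 1, the range of [Phi_scale]. *)
pose t := Num.max (Num.max 1 sig) (X `^ th^-1).
have t1 : 1 <= t by rewrite !le_max lexx.
have tsig : sig <= t by rewrite !le_max lexx orbT.
have t0 : 0 < t by apply: lt_le_trans t1.
have tX : X <= t `^ th.
  rewrite [leLHS](_ : X = (X `^ th^-1) `^ th); last by rewrite -powRrM mulVf ?gt_eqF// powRr1// ltW.
  by rewrite ge0_ler_powR ?nnegrE ?powR_ge0 ?(ltW t0) ?(ltW th0)// le_max lexx orbT.
pose s := sig * t `^ (- (N%:R / 2)).
have s0 : 0 < s by rewrite mulr_gt0// powR_gt0.
have tN1 : t `^ (- (N%:R / 2)) <= 1.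
  rewrite powRN invf_le1 ?powR_gt0//.
  rewrite [leLHS](_ : 1 = 1 `^ (N%:R / 2)); last by rewrite powR1.
  by rewrite ge0_ler_powR ?nnegrE ?(ltW t0)// divr_ge0// ltW.
have st : s <= t by apply: le_trans tsig; rewrite ler_piMr// ltW.
have s2 : s ^+ 2 * t ^+ N = sig ^+ 2.
  rewrite exprMn -mulrA -[X in _ * (X * _)]powR_mulrn ?powR_ge0// -powRrM -[X in _ * (_ * X)]powR_mulrn ?(ltW t0)//.
  by rewrite -powRD ?(gt_eqF t0) ?implybT// (_ : _ + _ = 0) ?powRr0 ?mulr1//; field.
pose psi x := s * dilate t phi x.
have td := dilate_test t0 tp; have ts := testZ s td.
have bp : test_ball psi.
  split => //; rewrite /psi integral_sqrZ; last exact: test_meas.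
  rewrite integral_sqr_dilate// -(fineK Af) -/A -!EFinM lee_fin mulrA s2 /sig expr_div_n.
  rewrite sqr_sqrtr; last by rewrite addr_ge0.
  rewrite mulrAC ler_pdivrMr ?ltr_wpDl// ler_wpM2l ?sqr_ge0//; lra.
apply: le_lt_trans (m0_le bp) _.
have k01 : 0 <= s / t <= 1 by rewrite divr_ge0 ?(ltW s0) ?(ltW t0)//= ler_pdivrMr// mul1r.
have kk : 0 <= (s / t) ^+ 2 * (c2 / c1).
  by rewrite mulr_ge0 ?sqr_ge0// divr_ge0// ltW.
have G1 := @genergy_dilate t t0 s _ phi kk tp (fun xi => Phi_scale xi k01).
have P1 : fine (power psi) = s `^ p * (t ^+ N * fine (power phi)).
  rewrite /psi powerZ ?(ltW s0)//; last exact: test_meas.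
  by rewrite power_dilate// -(fineK (power_fin tp)).
rewrite /test_energy P1 subr_lt0.
apply: (@le_lt_trans _ _ (t ^+ N * ((s / t) ^+ 2 * a))).
  rewrite ler_pdivrMr//; apply: le_trans G1 _; rewrite le_eqVlt; apply/orP; left; apply/eqP.
  by rewrite /a; field; rewrite !gt_eqF.
rewrite [ltRHS](_ : _ = t ^+ N * (s `^ p * d)); last by rewrite /d !mulrA [s `^ p * _]mulrC.
rewrite ltr_pM2l ?exprn_gt0//.
have sE : s `^ p = s `^ (p - 2) * s ^+ 2.
  by have := abs_powR2 s p2; rewrite gtr0_norm.
have tn0 : t != 0 by rewrite gt_eqF.
rewrite (_ : (s / t) ^+ 2 * a = s ^+ 2 * (a / t ^+ 2)); last by field.
rewrite (_ : s `^ p * d = s ^+ 2 * (s `^ (p - 2) * d)); last by rewrite sE; ring.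
rewrite ltr_pM2l ?exprn_gt0// ltr_pdivrMr ?exprn_gt0//.
have -> : s `^ (p - 2) * d * t ^+ 2 = sig `^ (p - 2) * d * t `^ th.
  rewrite /s powRM ?powR_ge0 ?(ltW sig0)// -powRrM -[X in _ * X = _]powR_mulrn ?(ltW t0)//.
  have -> : th = 2%:R + - (N%:R / 2) * (p - 2) by rewrite /th; field.
  have -> : t `^ (2%:R + - (N%:R / 2) * (p - 2)) = t `^ 2%:R * t `^ (- (N%:R / 2) * (p - 2)).
    by rewrite powRD// (gt_eqF t0) implybT.
  ring.
have : a < sig `^ (p - 2) * d * X.
  have k0 : 0 < sig `^ (p - 2) * d by rewrite mulr_gt0.
  by rewrite /X mulrDr mulr1 mulrC mulfVK ?gt_eqF// ltrDl.
by move/lt_le_trans; apply; rewrite ler_wpM2l// ltW// mulr_gt0.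
Qed.

Lemma test_near_ball psi v : measurable_fun setT v ->
  (\int[mu]_x (v x ^+ 2)%:E <= (rho ^+ 2)%:E)%E -> test_function psi ->
  (\int[mu]_x ((psi x - v x) ^+ 2)%:E <= (rho ^+ 2)%:E)%E ->
  (\int[mu]_x (psi x ^+ 2)%:E <= ((2 * rho) ^+ 2)%:E)%E.
Proof.
move=> mv v2 tp pv; have := integral_sqrD_le (measurable_funB (test_meas tp) mv) mv pv v2.
under [X in (X <= _)%E -> _]eq_integral do rewrite subrK.
by move/le_trans; apply; rewrite lee_fin exprMn; lra.
Qed.

Lemma relaxed_h1_limit v (E' E : R) : measurable_fun setT v ->
  (\int[mu]_x (v x ^+ 2)%:E <= (rho ^+ 2)%:E)%E -> relaxed B v E' -> E' < E ->
  h1_limit (2 * rho) (E / c1) v.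
Proof.
move=> mv v2 rv EE' e e0.
have m_gt0 : 0 < Num.min e (Num.min (rho ^+ 2) (E - E')).
  by rewrite !lt_min e0 exprn_gt0//= subr_gt0.
have [psi [tp h1 h2]] := rv _ m_gt0; exists psi; split => //.
- by apply: le_trans h1 _; rewrite lee_fin ge_min lexx.
- by apply: (test_near_ball mv v2) => //; apply: le_trans h1 _; rewrite lee_fin !ge_min lexx orbT.
- apply: integral_grad_le => //; apply: le_trans h2 _; rewrite lee_fin.
  by rewrite -lerBrDl !ge_min lexx !orbT.
Qed.

Let energy_lower_arith (m s eta e P g g' w : R) : 0 < eta -> eta <= 2^-1 -> 0 < e -> eta * P <= e * p / 4 ->
  s * g <= g -> g' <= s * g -> m <= g' / 2 - (1 - eta) * w / p ->
  `|w - P| <= e * p / 4 -> 2 * (m + P / p) - e <= g.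
Proof.
move=> eta0 eta2 e0 etaP h1 h2 h3; rewrite ler_distl => /andP[h4 _].
have h5 : (1 - eta) * (P - e * p / 4) <= (1 - eta) * w by apply: ler_wpM2l => //; lra.
have h6 : 0 <= eta * (e * p / 4) by rewrite mulr_ge0 ?(ltW eta0)// divr_ge0// mulr_ge0 ?ltW.
have h7 : P - e * p / 2 <= (1 - eta) * w.
  by move: h5; rewrite mulrBl mul1r mulrBr; lra.
have h8 : P / p - e / 2 <= (1 - eta) * w / p.
  by rewrite ler_pdivlMr// mulrBl mulfVK ?gt_eqF// mulrAC.
lra.
Qed.

(** A test function close to v in L^2 may lie slightly outside the ball. Shrunk by a factor s just
    below 1 it is inside, where [m0] bounds its energy; the shrinking costs little, as the p-powers
    are continuous. *)
Lemma energy_lower v (E : R) : measurable_fun setT v ->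
  (\int[mu]_x (v x ^+ 2)%:E <= (rho ^+ 2)%:E)%E ->
  (exists2 E', E' < E & relaxed B v E') ->
  power v \is a fin_num /\
  forall e : R, 0 < e -> exists2 del : R, 0 < del &
    forall psi, test_function psi -> fine (Ge psi) <= E ->
      (\int[mu]_x ((psi x - v x) ^+ 2)%:E <= del%:E)%E ->
      `|fine (power psi) - fine (power v)| <= e /\
      2 * (m0 + fine (power v) / p) - e <= fine (Ge psi).
Proof.
move=> mv v2 [E' EE' rv].
have near_ball := fun psi => @test_near_ball psi v mv v2.
have Hv := relaxed_h1_limit mv v2 rv EE'.
have E0 : 0 <= E / c1.
  have [psi [_ _ _ h]] := Hv 1 ltr01; rewrite -lee_fin; apply: le_trans h.
  by apply: integral_ge0 => x _; rewrite lee_fin dot_ge0.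
have r20 : 0 < 2 * rho by rewrite mulr_gt0.
have [vf vc] := lp_continuous N0 p2 pr r20 E0 mv Hv.
split; [exact: vf|move=> e e0]; set P := fine (power v); have P0 : 0 <= P by exact/fine_ge0/power_ge0.
have e4 : 0 < Num.min e (e * p / 4) by rewrite lt_min e0 divr_gt0// mulr_gt0.
have [d1 d10 d1P] := vc _ e4.
(* The relative loss of the p-power, s^p = 1 - eta below. It is chosen so that the loss eta P stays
   under e p / 4. *)
pose eta := Num.min (2^-1) (e * p / (4 * (P + 1))).
have eta0 : 0 < eta by rewrite lt_min invr_gt0 ltr0n/= divr_gt0// mulr_gt0//; lra.
have eta2 : eta <= 2^-1 by rewrite ge_min lexx.
have etaP : eta * P <= e * p / 4.
  have h : eta * (P + 1) <= e * p / 4.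
    rewrite -ler_pdivlMr; last by lra.
    by rewrite -[leRHS]mulrA -invfM ge_min lexx orbT.
  by apply: le_trans h; rewrite ler_pM2l// lerDl.
pose s := (1 - eta) `^ p^-1.
have s_gt0 : 0 < s by rewrite powR_gt0// subr_gt0; lra.
have sp : s `^ p = 1 - eta by rewrite /s -powRrM mulVf ?gt_eqF// powRr1//; lra.
have s_lt1 : s < 1.
  rewrite ltNge; apply/negP => s1; have : 1 <= s `^ p.
    rewrite [leLHS](_ : 1 = 1 `^ p); last by rewrite powR1.
    by rewrite ge0_ler_powR ?nnegrE ?(ltW s_gt0) ?(ltW p0).
  by rewrite sp; lra.
have s01 : 0 < s < 1 by rewrite s_gt0.
(* The last bound absorbs the excess over the ball: with weights s and 1 - s, the squared norm of s
   psi is at most (s + s^2 (1 - s)) rho^2 <= rho^2. *)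
exists (Num.min d1 (Num.min (rho ^+ 2) ((1 - s) ^+ 2 * rho ^+ 2))) => [|psi tp gE pd].
  by rewrite !lt_min d10 !mulr_gt0 ?exprn_gt0 ?subr_gt0.
have pd1 : (\int[mu]_x ((psi x - v x) ^+ 2)%:E <= d1%:E)%E.
  by apply: le_trans pd _; rewrite lee_fin ge_min lexx.
have pd2 : (\int[mu]_x ((psi x - v x) ^+ 2)%:E <= (rho ^+ 2)%:E)%E.
  by apply: le_trans pd _; rewrite lee_fin !ge_min lexx orbT.
have pd3 : (\int[mu]_x ((psi x - v x) ^+ 2)%:E <= ((1 - s) ^+ 2 * rho ^+ 2)%:E)%E.
  by apply: le_trans pd _; rewrite lee_fin !ge_min lexx !orbT.
have gE' : (\int[mu]_x (dot (cgrad psi x) (cgrad psi x))%:E <= (E / c1)%:E)%E.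
  by apply: integral_grad_le => //; rewrite genergy_fine// lee_fin.
have hp : `|fine (power psi) - P| <= Num.min e (e * p / 4) := d1P psi tp (near_ball psi tp pd2) gE' pd1.
have hp1 : `|fine (power psi) - P| <= e by apply: le_trans hp _; rewrite ge_min lexx.
have hp2 : `|fine (power psi) - P| <= e * p / 4 by apply: le_trans hp _; rewrite ge_min lexx orbT.
split => //.
have bs : test_ball (fun x => s * psi x).
  split; first exact: testZ.
  rewrite integral_sqrZ; last exact: test_meas.
  have := integral_sqrD_weighted s01 mv (measurable_funB (test_meas tp) mv) v2 pd3.
  under [X in (X <= _)%E -> _]eq_integral do rewrite addrC subrK.
  move=> h; apply: (@le_trans _ _ ((s ^+ 2)%:E * (s^-1 * rho ^+ 2 + (1 - s)^-1 * ((1 - s) ^+ 2 * rho ^+ 2))%:E)%E).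
    by rewrite lee_wpmul2l// lee_fin sqr_ge0.
  rewrite -EFinM lee_fin [leLHS](_ : _ = (s + s ^+ 2 * (1 - s)) * rho ^+ 2); last first.
    by field; rewrite !gt_eqF// subr_gt0.
  rewrite ler_piMl ?sqr_ge0//.
  have : s ^+ 2 * (1 - s) <= 1 - s by rewrite ler_piMl ?subr_ge0 ?(ltW s_lt1)// exprn_ile1// ltW.
  lra.
have h3 := m0_le bs; rewrite /test_energy powerZ ?(ltW s_gt0)// in h3; last exact: test_meas.
rewrite -(fineK (power_fin tp)) -EFinM /= sp in h3.
have s01' : 0 <= s <= 1 by rewrite !ltW.
have h2 := genergyZ s01' tp.
have g0 : 0 <= fine (Ge psi) by apply: fine_ge0; exact: genergy_ge0 HB _.
have h1 := ler_piMl g0 (ltW s_lt1).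
exact: (energy_lower_arith eta0 eta2 e0 etaP h1 h2 h3 hp2).
Qed.

End ball_minimization.

(** * Radial minimizing sequences *)

Section fatou_cvg.
Context d (T : measurableType d) (R : realType) (mu : {measure set T -> \bar R}).

Lemma fatou_cvg (f_ : nat -> T -> R) (f : T -> R) (C : \bar R) :
  (forall n, measurable_fun setT (f_ n)) -> measurable_fun setT f ->
  (forall n x, 0 <= f_ n x) -> (forall x, 0 <= f x) ->
  (\forall x \ae mu, f_ n x @[n --> \oo] --> f x) ->
  (forall n, \int[mu]_x (f_ n x)%:E <= C)%E -> (\int[mu]_x (f x)%:E <= C)%E.
Proof.
move=> mf_ mf f_0 f0 cf fC.
have mE n : measurable_fun setT (fun x => (f_ n x)%:E) by exact/measurable_EFinP.
have linf (u : nat -> \bar R) (a : \bar R) : (forall n, u n <= a)%E -> (limn_einf u <= a)%E.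
  move=> ua; rewrite limn_einf_lim; apply: lime_le; first exact: is_cvg_einfs.
  by apply: nearW => n; apply: le_trans (ua n); apply: ereal_inf_lbound; exists n => /=.
apply: le_trans (linf _ _ fC).
apply: le_trans (@fatou _ _ _ mu setT measurableT (fun n x => (f_ n x)%:E) mE _); last first.
  by move=> n x _; rewrite lee_fin.
apply: ae_ge0_le_integral => //.
- by move=> x _; rewrite lee_fin.
- exact/measurable_EFinP.
- move=> x _; rewrite limn_einf_lim; apply: lime_ge; first exact: is_cvg_einfs.
  apply: nearW => n; apply: le_ereal_inf_tmp => _ [k /= _ <-]; by rewrite lee_fin.
- under eq_fun do rewrite -[limn_einf _]oppeK -limn_esupN.
  apply: measurableT_comp => //; apply: measurable_fun_limn_esup => n.
  exact: measurableT_comp.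
apply: filterS cf => x fx _.
have h : (f_ n x)%:E @[n --> \oo] --> (f x)%:E by apply/fine_cvgP; split; [exact: nearW|].
by rewrite is_cvg_limn_einfE; [rewrite (cvg_lim _ h)|apply: cvgP h].
Qed.

End fatou_cvg.

Section radial_bounds.
Variables (R : realType) (N : nat).
Hypothesis N0 : (0 < N)%N.
Implicit Types (u v : 'rV[R]_N -> R).

Local Notation mu := (lebesgue_rV R N).

(** The level at which the weak-type bound A l^(-s) equals half of the lower bound (|x| / N)^N for
    the volume of the ball of radius |x|. *)
Definition radial_majorant (A s : R) (x : 'rV[R]_N) : R :=
  (2 * A * N%:R ^+ N / enorm x ^+ N) `^ s^-1.

Let NN : 0 < N%:R ^+ N :> R. Proof. by rewrite exprn_gt0// ltr0n. Qed.

(** If v exceeded the majorant at x, monotonicity would make it do so on the whole ball of radius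
    |x|, whose volume is too large for the weak-type bound. *)
Lemma radial_bound v (A s : R) : 0 < s -> 0 < A ->
  (forall x y : 'rV[R]_N, enorm x <= enorm y -> v y <= v x) -> measurable_fun setT v ->
  (forall l : R, 0 < l -> (mu [set x | (l < `|v x|)%R] <= (A * l `^ (- s))%:E)%E) ->
  forall x, x != 0 -> v x <= radial_majorant A s x.
Proof.
move=> s0 A0 vdec mv vA x x0; rewrite leNgt; apply/negP => bx.
have ex : 0 < enorm x by rewrite enorm_gt0.
have exN : 0 < enorm x ^+ N by rewrite exprn_gt0.
have Z0 : 0 < 2 * A * N%:R ^+ N / enorm x ^+ N by rewrite divr_gt0// !mulr_gt0.
have b0 : 0 < radial_majorant A s x by rewrite powR_gt0.
have bs : radial_majorant A s x `^ (- s) = (2 * A * N%:R ^+ N / enorm x ^+ N)^-1.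
  by rewrite /radial_majorant -powRrM mulrN mulVf ?gt_eqF// powR_inv1// ltW.
have := le_trans (eball_measure_ge N0 ex) (le_trans _ (vA _ b0)).
have sub : (mu (eball (enorm x)) <= mu [set y | (radial_majorant A s x < `|v y|)%R])%E.
  apply: le_measure; rewrite ?inE.
  - exact: measurable_eball.
  - by apply: measurable_superlevel; exact: measurableT_comp.
  move=> y /= /ltW yx; apply: lt_le_trans bx _; apply: le_trans (vdec y x yx) _.
  exact: ler_norm.
move=> /(_ sub); rewrite lee_fin bs exprMn exprVn leNgt => /negP; apply.
rewrite [ltLHS](_ : _ = enorm x ^+ N / N%:R ^+ N / 2).
  by rewrite ltr_pdivrMr// ltr_pMr ?ltr1n// divr_gt0.
by field; rewrite !gt_eqF// ltr0n.
Qed.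

Lemma radial_majorant_ge0 A s x : 0 <= radial_majorant A s x.
Proof. exact: powR_ge0. Qed.

Lemma measurable_radial_majorant A s : measurable_fun setT (radial_majorant A s).
Proof.
rewrite (_ : radial_majorant A s = fun x =>
    (2 * A * N%:R ^+ N * (enorm x ^+ N) `^ (- 1)) `^ s^-1); last first.
  by apply/funext => x; rewrite powR_inv1// exprn_ge0// enorm_ge0.
apply: (@measurableT_comp _ _ _ _ _ _ (fun t : R => t `^ s^-1)); first exact: measurable_powR.
apply: measurable_funM => //.
apply: (@measurableT_comp _ _ _ _ _ _ (fun t : R => t `^ (- 1))); first exact: measurable_powR.
by apply: measurable_funX; exact: measurable_enorm.
Qed.

(** Conversely, the majorant obeys a weak-type bound of the same exponent s, so weak-type
    interpolation applies to the majorants themselves. *)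
Lemma radial_majorant_level (A s l : R) : 0 < s -> 0 < A -> 0 < l ->
  (mu [set x | (l < radial_majorant A s x)%R] <= (2 ^+ N * (2 * A * N%:R ^+ N) * l `^ (- s))%:E)%E.
Proof.
move=> s0 A0 l0; set Z := 2 * A * _.
have Z0 : 0 < Z by rewrite !mulr_gt0.
have ls : 0 < l `^ (- s) by rewrite powR_gt0.
pose r := (Z * l `^ (- s)) `^ N%:R^-1.
have r0 : 0 < r by rewrite powR_gt0// mulr_gt0.
have rN : r ^+ N = Z * l `^ (- s).
  by rewrite -powR_mulrn ?(ltW r0)// /r -powRrM mulVf ?pnatr_eq0 -?lt0n// powRr1// ltW// mulr_gt0.
apply: (@le_trans _ _ (mu (cube r))); last first.
  by rewrite cube_measure ?(ltW r0)// exprMn rN mulrA.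
apply: le_measure; rewrite ?inE.
- by apply: measurable_superlevel; exact: measurable_radial_majorant.
- exact: measurable_cube.
move=> x /= lx; apply: (eball_sub_cube r0); rewrite /eball/=.
have x0 : 0 < enorm x.
  rewrite lt_def enorm_ge0 andbT; apply: contraTneq lx => e0.
  rewrite /radial_majorant e0 expr0n -[(N == 0)%N]negbK -lt0n N0/= invr0 mulr0 powR0 ?invr_eq0 ?gt_eqF//.
  by rewrite -leNgt ltW.
have xN : 0 < enorm x ^+ N by rewrite exprn_gt0.
rewrite -(@ltr_pXn2r _ N) ?nnegrE ?(ltW x0) ?(ltW r0)// rN.
have h : l `^ s < Z / enorm x ^+ N.
  have -> : Z / enorm x ^+ N = radial_majorant A s x `^ s.
    by rewrite /radial_majorant -powRrM mulVf ?gt_eqF// powRr1// ltW// divr_gt0.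
  by rewrite gt0_ltr_powR ?nnegrE ?radial_majorant_ge0 ?(ltW l0).
by rewrite powRN ltr_pdivlMr ?powR_gt0// mulrC -ltr_pdivlMr.
Qed.

End radial_bounds.

(** * Helly's selection theorem for radial functions *)

Section helly.
Variables (R : realType) (N : nat).
Hypothesis N0 : (0 < N)%N.
Implicit Types (u v : 'rV[R]_N -> R).

Local Notation mu := (lebesgue_rV R N).
Let e1 : 'rV[R]_N := delta_mx 0 (Ordinal N0).

Definition radially_nonincreasing u :=
  forall x y : 'rV[R]_N, x != 0 -> enorm x <= enorm y -> u y <= u x.

Let enorm_e1 (t : R) : 0 <= t -> enorm (t *: e1) = t.
Proof.
move=> t0; rewrite enormZ ger0_norm// (_ : enorm e1 = 1) ?mulr1//.
rewrite /enorm /dot (bigD1 (Ordinal N0))//= big1 ?addr0 ?mxE ?eqxx ?mulr1 ?sqrtr1// => i iN.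
by rewrite !mxE (negbTE iN) mul0r.
Qed.

Let e1_neq0 (t : R) : 0 < t -> t *: e1 != 0.
Proof. by move=> t0; rewrite -enorm_gt0 enorm_e1// ltW. Qed.

Lemma radial_profile u : radially_nonincreasing u -> forall x, x != 0 -> u x = u (enorm x *: e1).
Proof.
move=> ur x x0; have ex : 0 < enorm x by rewrite enorm_gt0.
by apply/eqP; rewrite eq_le; apply/andP; split; apply: ur;
  rewrite ?enorm_e1 ?enorm_ge0// e1_neq0.
Qed.

Lemma radially_nonincreasing_decreasing u : radially_nonincreasing u -> radially_decreasing u.
Proof.
move=> ur; exists (fun t => u (t *: e1)); split => [r s r0 rs|x x0]; last exact: radial_profile.
by apply: ur; [exact: e1_neq0|rewrite !enorm_e1// ltW// (lt_le_trans r0)].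
Qed.

Lemma measurable_radial u : radially_nonincreasing u -> u 0 = 0 -> measurable_fun setT u.
Proof.
move=> ur u0; pose h (t : R) := - u (expR t *: e1).
have mh : measurable_fun setT h.
  apply: nondecreasing_measurable => // s t st; rewrite lerN2; apply: ur.
    by rewrite e1_neq0// expR_gt0.
  by rewrite !enorm_e1 ?expR_ge0// ler_expR.
have men : measurable_fun setT (@enorm R N) by exact: measurable_enorm.
rewrite (_ : u = fun x => if enorm x == 0 then 0 else - h (ln (enorm x))).
  apply: measurable_fun_ifT => //; first exact: measurable_fun_eqr.
  apply: measurableT_comp => //; apply: measurableT_comp => //.
  exact: (measurableT_comp (@measurable_ln R) men).
apply/funext => x; rewrite enorm_eq0; case: eqVneq => [->//|x0].
by rewrite /h opprK lnK ?posrE ?enorm_gt0//; exact: radial_profile.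
Qed.

Lemma negligible_sphere (r : R) : mu.-negligible [set x : 'rV[R]_N | enorm x = r].
Proof.
exists [set x : 'rV[R]_N | enorm x = r]; split => //; last exact: sphere_null.
have := @measurable_enorm R _ _ N _ (@measurable_id _ 'rV[R]_N setT) measurableT [set r] (measurable_set1 r).
by rewrite setTI.
Qed.

Lemma ae_neq0 : \forall x \ae mu, x != 0.
Proof.
apply: negligibleS (negligible_sphere 0) => x /= /negP; rewrite negbK => /eqP ->.
exact: enorm0.
Qed.

(** The cluster function u is defined everywhere, and convergence holds at rational radii. At
    another radius monotonicity squeezes the sequence between neighbouring rational radii unless the
    profile of u jumps there; jumps occupy countably many spheres. *)
Lemma helly (v : nat -> 'rV[R]_N -> R) (D : 'rV[R]_N -> R) :
  (forall n x, 0 <= v n x) -> (forall n, radially_nonincreasing (v n)) ->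
  (forall n x, x != 0 -> v n x <= D x) ->
  exists u : 'rV[R]_N -> R, exists s : nat -> nat,
    [/\ forall n, (n <= s n)%N, forall x, 0 <= u x /\ (x != 0 -> u x <= D x),
        radially_nonincreasing u, u 0 = 0 &
        \forall x \ae mu, v (s n) x @[n --> \oo] --> u x].
Proof.
move=> v0 vr vD.
(* At the origin [D] gives no bound, so the value there is set to 0. *)
pose f n (x : 'rV[R]_N) := if x == 0 then 0 else v n x.
pose rad (k : nat) : R := if unpickle k is Some r then (if 0 < ratr r :> R then ratr r else 1) else 1.
have rad0 k : 0 < rad k by rewrite /rad; case: unpickle => // r; case: ifP.
have radE (s t : R) : 0 <= s -> s < t -> exists k, s < rad k < t.
  move=> s0 st; have [r] := rat_in_itvoo st; rewrite in_itv/= => /andP[h1 h2].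
  by exists (pickle r); rewrite /rad pickleK (le_lt_trans s0 h1) h1.
have [|u [s [sn uf us]]] := @pointwise_extraction _ _ f (fun x => `|D x|) (fun k => rad k *: e1).
  move=> n x; rewrite /f; case: eqVneq => [_|x0]; first by rewrite normr0.
  by rewrite ger0_norm//; apply: le_trans (vD n x x0) _; exact: ler_norm.
have u00 : u 0 = 0.
  apply/eqP; rewrite -normr_eq0 eq_le normr_ge0 andbT; apply/ler_addgt0Pr => e e0.
  have [n nP] := uf [:: 0] e e0; have := nP 0; rewrite mem_head => /(_ isT).
  by rewrite /f eqxx sub0r normrN add0r => /ltW.
have ge0 x : 0 <= u x.
  apply/ler_addgt0Pr => e e0; have [n nP] := uf [:: x] e e0.
  have := nP x; rewrite mem_head => /(_ isT); rewrite ltr_norml /f.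
  by case: eqVneq => [_|x0]; [|have := v0 n x]; lra.
have uD x : x != 0 -> u x <= D x.
  move=> x0; apply/ler_addgt0Pr => e e0; have [n nP] := uf [:: x] e e0.
  have := nP x; rewrite mem_head => /(_ isT); rewrite ltr_norml /f (negbTE x0).
  by have := vD n x x0; lra.
have ur : radially_nonincreasing u.
  move=> x y x0 xy; have y0 : y != 0.
    by rewrite -enorm_gt0; apply: lt_le_trans xy; rewrite enorm_gt0.
  apply/ler_addgt0Pr => e e0; have e2 : 0 < e / 2 by lra.
  have [n nP] := uf [:: x; y] _ e2.
  have := nP x; rewrite mem_head => /(_ isT); have := nP y; rewrite !inE eqxx orbT => /(_ isT).
  rewrite /f (negbTE x0) (negbTE y0) !ltr_norml; have := vr n x y x0 xy; lra.
exists u, s; split => //; first by move=> x; split; [exact: ge0|exact: uD].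
(* The points whose radius separates the values of u above c from those below c. A rational radius
   between two such radii would be contradictory, so [E c] lies in one sphere; every jump contains a
   rational c. *)
pose E (c : R) : set 'rV[R]_N := [set x | forall k,
  (rad k < enorm x -> c < u (rad k *: e1)) /\ (enorm x < rad k -> u (rad k *: e1) < c)].
have Esphere c : mu.-negligible (E c).
  have [->|/set0P[x Ex]] := eqVneq (E c) set0; first exact: negligible_set0.
  apply: negligibleS (negligible_sphere (enorm x)) => y Ey /=.
  have H (a b : 'rV[R]_N) : E c a -> E c b -> ~ enorm a < enorm b.
    move=> Ea Eb ab; have [k /andP[h1 h2]] := radE _ _ (enorm_ge0 a) ab.
    by have := (Ea k).2 h1; have := (Eb k).1 h2; lra.
  by apply/eqP; rewrite eq_le !leNgt; apply/andP; split; apply/negP; exact: H.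
pose q (k : nat) : R := if unpickle k is Some r then ratr r else 0.
apply: negligibleS (negligibleU (negligible_sphere 0) (negligible_bigcup (fun k => Esphere (q k)))).
move=> x /=; apply: contra_notP => /not_orP[x0 nE].
have {}x0 : x != 0 by rewrite -enorm_eq0; apply/eqP.
have ex : 0 < enorm x by rewrite enorm_gt0.
have nEq (r : rat) : ~ E (ratr r) x.
  by move=> Er; apply: nE; exists (pickle r) => //; rewrite /q pickleK.
apply/cvgrPdist_le => e e0; have e2 : 0 < e / 2 by lra.
have [k [kx kP]] : exists k, rad k < enorm x /\ u (rad k *: e1) < u x + e / 2.
  apply: contrapT => /forallNP H.
  have [r] : exists r : rat, ratr r \in `]u x, u x + e / 2[ by apply: rat_in_itvoo; rewrite ltrDl.
  rewrite in_itv/= => /andP[r1 r2]; apply: (nEq r) => k; split => kx.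
    apply: lt_le_trans r2 _; rewrite leNgt; apply/negP => h; exact: (H k).
  apply: le_lt_trans r1; apply: ur => //; rewrite enorm_e1; last exact: ltW (rad0 k).
  exact: ltW.
have [l [lx lP]] : exists k, enorm x < rad k /\ u x - e / 2 < u (rad k *: e1).
  apply: contrapT => /forallNP H.
  have [r] : exists r : rat, ratr r \in `]u x - e / 2, u x[ by apply: rat_in_itvoo; rewrite ltrBlDr ltrDl.
  rewrite in_itv/= => /andP[r1 r2]; apply: (nEq r) => l; split => lx.
    apply: lt_le_trans r2 _; apply: ur; first exact: e1_neq0.
    by rewrite enorm_e1 ltW.
  by apply: le_lt_trans r1; rewrite leNgt; apply/negP => h; exact: (H l).
move/cvgrPdist_le : (us k) => /(_ _ e2) Hk; move/cvgrPdist_le : (us l) => /(_ _ e2) Hl.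
apply: filterS2 Hk Hl => n.
have h1 := vr (s n) (rad k *: e1) x (e1_neq0 (rad0 k)).
have h2 := vr (s n) x (rad l *: e1) x0.
rewrite /f (negbTE (e1_neq0 (rad0 k))) (negbTE (e1_neq0 (rad0 l))) !ler_norml.
move: h1 h2; rewrite !enorm_e1 ?(ltW (rad0 _))// => /(_ (ltW kx)) h1 /(_ (ltW lx)) h2; lra.
Qed.

End helly.

Section radial_minimizing_sequence.
Variables (R : realType) (N : nat) (B : R -> R) (q c1 c2 p rho : R).
Hypothesis HB : profile B q c1 c2.
Hypothesis N0 : (0 < N)%N.
Hypothesis p2 : 2 < p.
Hypothesis pr : p < 2 + 4 / N%:R.
Hypothesis r0 : 0 < rho.
Implicit Types (u v phi psi : 'rV[R]_N -> R).

Local Notation mu := (lebesgue_rV R N).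
Local Notation Ge := (@genergy R N B).
Local Notation r := (2 + 4 / N%:R : R).
Local Notation m0 := (@m0 R N B p rho).
Local Notation power := (@power R N p).
Local Notation test_energy := (@test_energy R N B p).

Lemma ge0_integrable_le (f : 'rV[R]_N -> R) (C : R) : measurable_fun setT f ->
  (forall x, 0 <= f x) -> (\int[mu]_x (f x)%:E <= C%:E)%E -> mu.-integrable setT (EFin \o f).
Proof.
move=> mf f0 fC; apply/integrableP; split; first exact/measurable_EFinP.
under eq_integral do rewrite gee0_abs ?lee_fin ?f0//.
by apply: le_lt_trans fC _; exact: ltry.
Qed.

Lemma cvge_near_le (f : nat -> \bar R) (e : R) : 0 < e -> f n @[n --> \oo] --> 0%E ->
  \forall n \near \oo, (f n <= e%:E)%E.
Proof.
move=> e0 /fine_cvgP[Hf /cvgrPdist_le/(_ _ e0)]; apply: filterS2 Hf => n fn.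
rewrite sub0r normrN => h; rewrite -(fineK fn) lee_fin; exact: le_trans (ler_norm _) h.
Qed.

(** The minimum of the two majorants obeys both weak-type bounds, of exponents 2 and r, and 2 < p <
    r. The interpolation threshold is 1. *)
Lemma radial_majorant_power (A1 A2 : R) : 0 < A1 -> 0 < A2 ->
  mu.-integrable setT (fun x => (Num.min (radial_majorant A2 2 x) (radial_majorant A1 r x) `^ p)%:E).
Proof.
move=> A10 A20; set D := fun x : 'rV[R]_N => Num.min (radial_majorant A2 2 x) (radial_majorant A1 r x).
have r_gt0 : 0 < r by rewrite addr_gt0// divr_gt0// ltr0n.
have mD : measurable_fun setT D.
  by apply: measurable_minr; exact: measurable_radial_majorant.
have D0 x : 0 <= D x by rewrite le_min !radial_majorant_ge0.
have [C C0 CP] := @weak_type_interpolation _ _ R mu p r p2 pr.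
have NN : 0 <= N%:R ^+ N :> R by rewrite exprn_ge0.
have lev (A s l : R) : 0 < s -> 0 < A -> 0 < l -> (forall x, D x <= radial_majorant A s x) ->
    (mu [set x | (l < D x)%R] <= (2 ^+ N * (2 * A * N%:R ^+ N) * l `^ (- s))%:E)%E.
  move=> s0 A0 l0 Ds; apply: le_trans (radial_majorant_level N0 s0 A0 l0).
  apply: le_measure; rewrite ?inE.
  - exact: measurable_superlevel.
  - by apply: measurable_superlevel; exact: measurable_radial_majorant.
  - by move=> x /= h; apply: lt_le_trans h _.
apply: (@ge0_integrable_le (fun x => D x `^ p)); last apply: (CP D
   (2 ^+ N * (2 * A2 * N%:R ^+ N)) (2 ^+ N * (2 * A1 * N%:R ^+ N)) 1 mD D0).
- by apply: (@measurableT_comp _ _ _ _ _ _ (fun t : R => t `^ p)) mD; exact: measurable_powR.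
- by move=> x; exact: powR_ge0.
- by rewrite !mulr_ge0// ?exprn_ge0// ltW.
- by rewrite !mulr_ge0// ?exprn_ge0// ltW.
- exact: ltr01.
- move=> l l0; have := lev A2 2 l _ A20 l0; rewrite powRN -[X in _ `^ X]/(2%:R) powR_mulrn ?(ltW l0)//.
  by apply => // x; rewrite ge_min lexx.
- by move=> l l0; apply: lev => // x; rewrite ge_min lexx orbT.
Qed.

Lemma powR_neg2 (l : R) : 0 <= l -> l `^ (- 2) = l ^- 2.
Proof. by move=> l0; rewrite powRN -[X in _ `^ X]/(2%:R) powR_mulrn. Qed.

(** The majorant decays like |x|^(-N/2) and is not square integrable at infinity. Once the values
    below [del] are removed, squares are controlled by p-th powers, which are integrable. *)
Lemma softd_level_le (del a D : R) : 0 < del -> 0 <= a -> a <= D ->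
  softd del a ^+ 2 <= del `^ (2 - p) * D `^ p.
Proof.
move=> d0 a0 aD; have [ad|ad] := leP a del.
  by rewrite softd_eq0 ?ger0_norm// expr0n/= mulr_ge0 ?powR_ge0.
have a_gt0 : 0 < a by apply: lt_trans ad.
apply: (@le_trans _ _ (a ^+ 2)).
  have /andP[_ h] := softd_bounds d0 a; rewrite ger0_norm// in h.
  by rewrite ler_sqr ?nnegrE// softd_ge0.
have p0 : 0 < p by apply: lt_trans p2.
apply: (@le_trans _ _ (del `^ (2 - p) * a `^ p)); last first.
  by rewrite ler_wpM2l ?powR_ge0// ge0_ler_powR ?nnegrE ?(ltW p0)// (le_trans a0).
have := abs_powR2 a p2; rewrite gtr0_norm// => ->.
rewrite mulrA ler_peMl ?sqr_ge0//.
rewrite -opprB powRN -ler_pdivrMl ?invr_gt0 ?powR_gt0// invrK mulr1.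
by rewrite ge0_ler_powR ?nnegrE ?subr_ge0 ?(ltW p2) ?(ltW d0)// ltW.
Qed.

Lemma gradient_part_le (m g P P' t e : R) : `|P - P'| <= e * p / 4 -> t < e / 4 ->
  g / 2 - P' / p < m + t -> g <= 2 * (m + P / p) + e.
Proof.
have p0 : 0 < p by apply: lt_trans p2.
rewrite ler_distl => /andP[h _] te hg.
have : P' / p <= P / p + e / 4.
  by rewrite ler_pdivrMr// mulrDl mulfVK ?gt_eqF// mulrAC -lerBlDr.
lra.
Qed.

(** The symmetrized sequence converges only almost everywhere and may lose L^2 mass at infinity, so
    the relaxed bound is passed to the limit after applying [softd k0], where L^2 convergence is
    dominated; letting k0 shrink then recovers u. *)
Lemma radial_minimizer : exists u, exists A : R,
  [/\ forall x, 0 <= u x, radially_nonincreasing u /\ measurable_fun setT u,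
      0 < A /\ forall x : 'rV[R]_N, x != 0 -> u x <= radial_majorant A 2 x,
      (\int[mu]_x (u x ^+ 2)%:E <= (rho ^+ 2)%:E)%E &
      relaxed B u (2 * (m0 + fine (power u) / p))].
Proof.
have p0 : 0 < p by apply: lt_trans p2.
have hinf := has_inf_test_energy HB N0 p2 pr r0.
have Hphi n : exists phi, test_ball rho phi /\ test_energy phi < m0 + n.+1%:R^-1.
  have n1 : 0 < n.+1%:R^-1 :> R by rewrite invr_gt0.
  by have [e [psi bp <-] h] := inf_adherent n1 hinf; exists psi.
have [phi phiP] := choice Hphi.
have bphi n := (phiP n).1; have tphi n := (bphi n).1.
have Hv n : exists v, [/\ forall x, 0 <= v x, continuous v,
    forall x y : 'rV[R]_N, enorm x <= enorm y -> v y <= v x,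
    (\int[mu]_x (v x ^+ 2)%:E = \int[mu]_x (phi n x ^+ 2)%:E)%E /\ power v = power (phi n) &
    relaxed B v (fine (Ge (phi n)))].
  apply: (symmetrization HB N0 p2 (tphi n)).
  by rewrite fineK// (genergy_fin HB).
have [v vP] := choice Hv.
have v0 n x : 0 <= v n x by have [] := vP n.
have mv n : measurable_fun setT (v n) by have [_ h _ _ _] := vP n; exact: continuous_measurable_rV.
have vdec n (x y : 'rV[R]_N) : enorm x <= enorm y -> v n y <= v n x by have [_ _ h _ _] := vP n; exact: h.
have v2 n : (\int[mu]_x (v n x ^+ 2)%:E <= (rho ^+ 2)%:E)%E.
  by have [_ _ _ [-> _] _] := vP n; exact: (bphi n).2.
have vpow n : power (v n) = power (phi n) by have [_ _ _ [_ ->] _] := vP n.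
have vrel n : relaxed B (v n) (fine (Ge (phi n))) by have [] := vP n.
have [K0 K0P] := test_energy_coercive HB N0 p2 pr r0.
(* Uniform bound of the gradient energies: coercivity gives a quarter of the energy minus [K0], and
   the energies stay below m0 + 1. *)
pose Em := 4 * (m0 + 1 + K0).
have EmP n : fine (Ge (phi n)) <= Em.
  have := K0P _ (bphi n); have := (phiP n).2.
  have : n.+1%:R^-1 <= 1 :> R by rewrite invf_le1// ler1n.
  rewrite /Em; move: (n.+1%:R^-1) => z; lra.
have Hh n : h1_limit (2 * rho) ((Em + 1) / c1) (v n).
  apply: relaxed_h1_limit (v2 n) (vrel n) _ => //; first exact: HB.
  by apply: le_lt_trans (EmP n) _; rewrite ltrDl.
have Em0 : 0 <= Em by apply: le_trans (EmP 0%N); apply: fine_ge0; exact: genergy_ge0 HB _.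
have r20 : 0 < 2 * rho by rewrite mulr_gt0.
(* The constant of [weak_type_limit] for the doubled radius 2 rho of [relaxed_h1_limit]; the final 1
   makes it positive. *)
pose A1 := 4 * N%:R * (2 * (2 * rho)) `^ (4 / N%:R) * 2 `^ r * ((Em + 1) / c1) + 1.
have A10 : 0 < A1.
  rewrite ltr_wpDl// !mulr_ge0 ?powR_ge0// ?invr_ge0 ?(ltW (profile_c1 HB))// addr_ge0//.
pose A2 := rho ^+ 2; have A20 : 0 < A2 by rewrite exprn_gt0.
pose D (x : 'rV[R]_N) : R := Num.min (radial_majorant A2 2 x) (radial_majorant A1 r x).
have r_gt0 : 0 < r by rewrite addr_gt0// divr_gt0// ltr0n.
have vD n (x : 'rV[R]_N) : x != 0 -> v n x <= D x.
  move=> x0; rewrite le_min; apply/andP; split.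
    apply: radial_bound => //; [exact: vdec|move=> l l0].
    rewrite powR_neg2 ?(ltW l0)//; exact: chebyshev2.
  apply: radial_bound => //; [exact: vdec|move=> l l0].
  apply: le_trans (weak_type_limit N0 r20 (mv n) (Hh n) l0) _.
  by rewrite lee_fin ler_wpM2r ?powR_ge0// lerDl.
have [u [s [sn uP ur u0 us]]] := helly N0 v0 (fun n x y _ => @vdec n x y) vD.
have mu_ := measurable_radial N0 ur u0.
have iD := radial_majorant_power A10 A20.
have p_cvg : (power (v (s n)) @[n --> \oo] --> power u)%E.
  have [] := @dominated_cvg_real _ _ R mu (fun n x => `|v (s n) x| `^ p) (fun x => `|u x| `^ p)
    (fun x => (D x `^ p)%:E).
  - by move=> n; exact: measurable_power.
  - exact: measurable_power.
  - apply: filterS us => x h.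
    exact: (@cvg_comp _ _ _ (fun n => v (s n) x) (fun t : R => `|t| `^ p) _ _ _ h (@continuous_abs_powR R p p2 (u x))).
  - exact: iD.
  - apply: filterS (@ae_neq0 R N N0) => x x0 n; rewrite lee_fin ger0_norm ?powR_ge0//.
    have Dx : v (s n) x <= D x by exact: vD.
    by rewrite ger0_norm// ge0_ler_powR ?nnegrE ?(ltW p0)// (le_trans _ Dx).
  by [].
have pf : power u \is a fin_num.
  apply: (@integrable_fin_num _ _ _ _ _ measurableT).
  have [] := @dominated_cvg_real _ _ R mu (fun n x => `|u x| `^ p) (fun x => `|u x| `^ p)
    (fun x => (D x `^ p)%:E) => //.
  - by move=> n; exact: measurable_power.
  - exact: measurable_power.
  - by apply: aeW => x; exact: cvg_cst.
  - apply: filterS (@ae_neq0 R N N0) => x x0 n; rewrite lee_fin ger0_norm ?powR_ge0//.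
    have Dx := (uP x).2 x0.
    by rewrite ger0_norm ?(uP x).1// ge0_ler_powR ?nnegrE ?(ltW p0) ?(uP x).1// (le_trans _ Dx) ?(uP x).1.
have u2 : (\int[mu]_x (u x ^+ 2)%:E <= (rho ^+ 2)%:E)%E.
  apply: (@fatou_cvg _ _ R mu (fun n x => v (s n) x ^+ 2)).
  - by move=> n; exact: measurable_funX.
  - exact: measurable_funX.
  - by move=> n x; exact: sqr_ge0.
  - by move=> x; exact: sqr_ge0.
  - by apply: filterS us => x h; have := cvgM h h; apply.
  - by move=> n; exact: v2.
exists u, A2; split => //.
- by move=> x; exact: (uP x).1.
- by split => // x x0; have := (uP x).2 x0; rewrite le_min => /andP[].
apply: (relaxed_closed mu_) => e e0.
(* Unlike the sequence, u itself is a fixed square integrable function, so softening it converges in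
   L^2 as the threshold tends to 0. *)
have [k0 [d0 kP]] : exists d : R, 0 < d /\ (\int[mu]_x ((softd d (u x) - u x) ^+ 2)%:E <= e%:E)%E.
  have ms (d : R) : measurable_fun setT (fun x => softd d (u x)).
    apply: (measurableT_comp _ mu_); apply: continuous_measurable_fun.
    exact: smooth1_cont (smooth1_softd d).
  pose d (n : nat) : R := n.+1%:R^-1.
  have d0 n : 0 < d n by rewrite invr_gt0.
  have [|||||_ _] := @dominated_cvg_real _ _ R mu (fun n x => (softd (d n) (u x) - u x) ^+ 2) (cst 0)
    (fun x => (u x ^+ 2)%:E).
  - by move=> n; apply: measurable_funX; exact: measurable_funB.
  - exact: measurable_cst.
  - apply: aeW => x /=.
    have h : softd (d n) (u x) - u x @[n --> \oo] --> (0 : R).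
      apply/cvgrPdist_le => e' e'0.
      have [n0 n0P] : exists n0 : nat, forall n : nat, (n0 <= n)%N -> n.+1%:R^-1 < e' / 2.
        exists (Num.truncn (e' / 2)^-1) => n n0n; rewrite invf_plt ?posrE ?divr_gt0//.
        by apply: (lt_le_trans (truncnS_gt _)); rewrite ler_nat.
      exists n0 => // n /= /n0P; rewrite -/(d n) => hn.
      have := softd_bounds (d0 n) (u x); rewrite (ger0_norm (uP x).1) sub0r normrN ler_norml; lra.
    by have := cvgM h h; rewrite mulr0; apply.
  - apply: (@ge0_integrable_le (fun x => u x ^+ 2) (rho ^+ 2)) => //.
      exact: measurable_funX.
    by move=> x; exact: sqr_ge0.
  - apply: aeW => x n; rewrite lee_fin ger0_norm ?sqr_ge0//.
    have := softd_bounds (d0 n) (u x); have := softd_ge0 (d0 n) (u x); rewrite (ger0_norm (uP x).1) => h1 h2.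
    by rewrite -sqrrN ler_sqr ?nnegrE ?(uP x).1//; lra.
  rewrite /= integral0 => /(cvge_near_le e0)[n _ /(_ n (leqnn n))] /= h.
  by exists (d n).
have sm : measurable_fun setT (softd k0).
  by apply: continuous_measurable_fun; exact: smooth1_cont (smooth1_softd k0).
exists (fun x => softd k0 (u x)); split => //; first exact: measurableT_comp.
apply: relaxed_closed; first exact: measurableT_comp.
move=> e' e'0.
have H1 : \forall n \near \oo,
    (\int[mu]_x ((softd k0 (v (s n) x) - softd k0 (u x)) ^+ 2)%:E <= e'%:E)%E.
  apply: cvge_near_le => //.
  have [|||||_ _] := @dominated_cvg_real _ _ R mu (fun n x => (softd k0 (v (s n) x) - softd k0 (u x)) ^+ 2)
    (cst 0) (fun x => (k0 `^ (2 - p))%:E * (D x `^ p)%:E)%E.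
  - by move=> n; apply: measurable_funX; apply: measurable_funB; exact: measurableT_comp.
  - exact: measurable_cst.
  - apply: filterS us => x h /=.
    have h' : softd k0 (v (s n) x) - softd k0 (u x) @[n --> \oo] --> (0 : R).
      apply/cvgrPdist_le => d dd; move/cvgrPdist_le : h => /(_ _ dd); apply: filterS => n hn.
      by rewrite sub0r normrN; apply: le_trans (softd_lip d0 _ _) _; rewrite distrC.
    by have := cvgM h' h'; rewrite mulr0; apply.
  - by apply: integrableZl => //; exact: iD.
  - apply: filterS (@ae_neq0 R N N0) => x x0 n; rewrite -EFinM lee_fin ger0_norm ?sqr_ge0//.
    have h1 := softd_level_le d0 (v0 (s n) x) (vD (s n) x x0).
    have h2 := softd_level_le d0 (uP x).1 ((uP x).2 x0).
    have h3 := softd_ge0 d0 (v (s n) x); have h4 := softd_ge0 d0 (u x).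
    rewrite sqrrB; have := mulr_ge0 h3 h4; rewrite -mulr_natl.
    have [h|h] := leP (softd k0 (u x)) (softd k0 (v (s n) x)).
      have := ler_wpM2l h4 h; rewrite -expr2; lra.
    have := ler_wpM2l h3 (ltW h); rewrite -expr2 mulrC; lra.
  by rewrite /= integral0.
(* Along a minimizing sequence half the gradient energy is about m0 plus the power part, and the
   power parts converge. *)
have H2 : \forall n \near \oo, fine (Ge (phi (s n))) <= 2 * (m0 + fine (power u) / p) + e + e'.
  have ep : 0 < e' * p / 4 by rewrite divr_gt0// mulr_gt0.
  have e'4 : 0 < e' / 4 by rewrite divr_gt0.
  have Hp : \forall n \near \oo, `|fine (power u) - fine (power (v (s n)))| <= e' * p / 4.
    move: p_cvg; rewrite -(fineK pf) => /fine_cvgP[_ /cvgrPdist_le/(_ _ ep)].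
    by apply: filterS => n.
  have Hn : \forall n \near \oo, n.+1%:R^-1 < e' / 4 :> R.
    exists (Num.truncn (e' / 4)^-1) => // n /= n0n; rewrite invf_plt ?posrE//.
    by apply: (lt_le_trans (truncnS_gt _)); rewrite ler_nat.
  apply: filterS2 Hp Hn => n; rewrite vpow => h1 h2.
  have h3 : (s n).+1%:R^-1 <= n.+1%:R^-1 :> R by rewrite lef_pV2 ?posrE// ler_nat ltnS.
  have h4 := (phiP (s n)).2; rewrite /test_energy in h4.
  apply: le_trans (gradient_part_le h1 (le_lt_trans h3 h2) h4) _.
  by rewrite lerD2r lerDl ltW.
near \oo => n.
exists (fun x => softd k0 (v (s n) x)); split; first exact: measurableT_comp.
  by near: n.
have h2 : fine (Ge (phi (s n))) <= 2 * (m0 + fine (power u) / p) + e + e' by near: n.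
move=> d' d'0; have [psi [tp g1 g2]] := relaxed_softd HB d0 (mv (s n)) (vrel (s n)) d'0.
by exists psi; split => //; apply: le_trans g2 _; rewrite lee_fin lerD2r.
Unshelve. all: by end_near. Qed.

End radial_minimizing_sequence.

(** * The Sobolev space *)

Section integral_bounds.
Context d (T : measurableType d) (R : realType) (mu : {measure set T -> \bar R}).

Lemma integral_lin_le (f g h : T -> R) (k l a b : R) : 0 <= k -> 0 <= l ->
  measurable_fun setT f -> measurable_fun setT g -> measurable_fun setT h ->
  (forall x, 0 <= f x) -> (forall x, 0 <= g x) -> (forall x, 0 <= h x) ->
  (forall x, h x <= k * f x + l * g x) ->
  (\int[mu]_x (f x)%:E <= a%:E)%E -> (\int[mu]_x (g x)%:E <= b%:E)%E ->
  (\int[mu]_x (h x)%:E <= (k * a + l * b)%:E)%E.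
Proof.
move=> k0 l0 mf mg mh f0 g0 h0 hfg fa gb.
have mZ (c : R) (u : T -> R) : measurable_fun setT u -> measurable_fun setT (fun x => c%:E * (u x)%:E)%E.
  by move=> mu_; under eq_fun do rewrite -EFinM; apply/measurable_EFinP; exact: measurable_funM.
apply: (@le_trans _ _ (\int[mu]_x (k%:E * (f x)%:E + l%:E * (g x)%:E))%E).
  apply: ge0_le_integral => //.
  - by move=> x _; rewrite lee_fin.
  - exact/measurable_EFinP.
  - by apply: emeasurable_funD; exact: mZ.
  - by move=> x _; rewrite -!EFinM -EFinD lee_fin.
rewrite ge0_integralD//; first last.
- exact: mZ.
- by move=> x _; rewrite -EFinM lee_fin mulr_ge0.
- exact: mZ.
- by move=> x _; rewrite -EFinM lee_fin mulr_ge0.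
rewrite !ge0_integralZl_EFin//; first last.
- exact/measurable_EFinP.
- by move=> x _; rewrite lee_fin.
- exact/measurable_EFinP.
- by move=> x _; rewrite lee_fin.
by rewrite EFinD [(k * a)%:E]EFinM [(l * b)%:E]EFinM leeD// lee_wpmul2l.
Qed.

Lemma integrable_mul_sqr (f g : T -> R) (a b : R) : measurable_fun setT f -> measurable_fun setT g ->
  (\int[mu]_x (f x ^+ 2)%:E <= a%:E)%E -> (\int[mu]_x (g x ^+ 2)%:E <= b%:E)%E ->
  mu.-integrable setT (EFin \o (fun x => f x * g x)).
Proof.
move=> mf mg fa gb; apply/integrableP; split.
  by apply/measurable_EFinP; exact: measurable_funM.
apply: (@le_lt_trans _ _ ((2^-1 * a + 2^-1 * b)%:E)); last exact: ltry.
apply: (@integral_lin_le (fun x => f x ^+ 2) (fun x => g x ^+ 2)) => //.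
- exact: measurable_funX.
- exact: measurable_funX.
- by apply: measurableT_comp => //; exact: measurable_funM.
- by move=> x; rewrite sqr_ge0.
- by move=> x; rewrite sqr_ge0.
move=> x; rewrite normrM -[f x ^+ 2]real_normK ?num_real// -[g x ^+ 2]real_normK ?num_real//.
by have := sqr_ge0 (`|f x| - `|g x|); rewrite sqrrB; lra.
Qed.

Lemma pairing_le (f g : T -> R) (e b : R) : 0 < e -> measurable_fun setT f -> measurable_fun setT g ->
  (\int[mu]_x (f x ^+ 2)%:E <= (e ^+ 2)%:E)%E -> (\int[mu]_x (g x ^+ 2)%:E <= b%:E)%E ->
  `|\int[mu]_x (f x * g x)| <= e * (1 + b) / 2.
Proof.
move=> e0 mf mg fa gb; have ifg := integrable_mul_sqr mf mg fa gb.
apply: le_trans (le_normr_Rintegral measurableT ifg) _.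
rewrite -lee_fin /Rintegral fineK; last first.
  by apply: integrable_fin_num => //; exact: integrable_norm.
have -> : e * (1 + b) / 2 = (2 * e)^-1 * e ^+ 2 + e / 2 * b by field; rewrite gt_eqF.
apply: (@integral_lin_le (fun x => f x ^+ 2) (fun x => g x ^+ 2)) => //.
- by rewrite invr_ge0 mulr_ge0// ltW.
- by rewrite divr_ge0// ltW.
- exact: measurable_funX.
- exact: measurable_funX.
- by apply: measurableT_comp => //; exact: measurable_funM.
- by move=> x; rewrite sqr_ge0.
- by move=> x; rewrite sqr_ge0.
move=> x; rewrite normrM -[f x ^+ 2]real_normK ?num_real// -[g x ^+ 2]real_normK ?num_real//.
rewrite -subr_ge0 (_ : _ - _ = (`|f x| - e * `|g x|) ^+ 2 / (2 * e)).
  by rewrite divr_ge0 ?sqr_ge0// mulr_ge0// ltW.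
by field; rewrite gt_eqF.
Qed.

End integral_bounds.

Section gradient_closure.
Variables (R : realType) (N : nat) (B : R -> R) (q c1 c2 : R).
Hypothesis HB : profile B q c1 c2.
Implicit Types (u v w phi psi : 'rV[R]_N -> R) (a b xi : 'rV[R]_N).
Implicit Types (G H : 'rV[R]_N -> 'rV[R]_N).

Local Notation mu := (lebesgue_rV R N).
Local Notation Ge := (@genergy R N B).
Local Notation Phi := (@Phi R N B).

Lemma PhiN xi : Phi (- xi) = Phi xi.
Proof. by congr B; rewrite !dotE opprK. Qed.

Lemma Phi_scale_le (k : R) : exists2 C : R, 0 <= C & forall xi, Phi (k *: xi) <= C * Phi xi.
Proof.
have [C C0 dbl] := Phi_double N HB.
have pow n xi : Phi (2 ^+ n *: xi) <= C ^+ n * Phi xi.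
  elim: n => [|n IH]; first by rewrite !expr0 scale1r mul1r.
  rewrite exprS -scalerA exprS -mulrA; apply: le_trans (dbl _) _.
  by rewrite ler_pM2l.
pose n := (Num.truncn `|k|).+1; exists (C ^+ n) => [|xi]; first by rewrite exprn_ge0// ltW.
have n2 : 0 < 2 ^+ n :> R by rewrite exprn_gt0.
rewrite -[k](mulfVK (lt0r_neq0 n2)) -scalerA; apply: le_trans (Phi_le HB _ _) (pow n xi).
rewrite normrM normfV (gtr0_norm n2) ler_pdivrMr// mul1r; apply: ltW.
apply: lt_le_trans (truncnS_gt _) _; rewrite -/n -natrX ler_nat; apply: ltnW; exact: ltn_expl.
Qed.

(** Write a + b as a convex combination of (1 + th) a and a large multiple of b, and (1 + th) a as
    one of 2 a and a. The Delta_2 constant multiplies only th, so the factor of [Phi a] is as close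
    to 1 as desired. *)
Lemma Phi_perturb (e : R) : 0 < e -> exists2 C : R, 0 <= C &
  forall a b, Phi (a + b) <= (1 + e) * Phi a + C * Phi b.
Proof.
move=> e0; have [C C0 dbl] := Phi_double N HB.
pose th := Num.min 1 (e / C).
have th0 : 0 < th by rewrite lt_min ltr01 divr_gt0.
have th1 : th <= 1 by rewrite ge_min lexx.
have thC : th * C <= e by rewrite -ler_pdivlMr// ge_min lexx orbT.
have t1 : 0 < 1 + th by lra.
pose t := (1 + th)^-1; have t01 : 0 < t < 1.
  by rewrite invr_gt0 t1/= invf_lt1//; lra.
have [D D0 DP] := Phi_scale_le (1 - t)^-1.
exists D => // a b; move: t01 => /andP[t0 lt1].
have -> : a + b = t *: ((1 + th) *: a) + (1 - t) *: ((1 - t)^-1 *: b).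
  by rewrite !scalerA mulVf ?gt_eqF// divff ?scale1r//; lra.
apply: le_trans (Phi_convex HB _ _ _) _; first by rewrite !ltW.
have ha : Phi ((1 + th) *: a) <= (1 + e) * Phi a.
  have -> : (1 + th) *: a = th *: (2 *: a) + (1 - th) *: a.
    by rewrite scalerA -scalerDl; congr (_ *: _); ring.
  apply: le_trans (Phi_convex HB _ _ _) _; first by rewrite ltW.
  have h1 := dbl a; have h2 := Phi_ge0 HB a.
  apply: le_trans (_ : th * (C * Phi a) + (1 - th) * Phi a <= _).
    by rewrite lerD2r ler_pM2l.
  rewrite mulrA -mulrDl ler_wpM2r//; lra.
apply: lerD.
  by apply: le_trans ha; apply: ler_piMl (ltW _); first exact: (Phi_ge0 HB).
by apply: le_trans (DP b); apply: ler_piMl; [exact: (Phi_ge0 HB)|lra].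
Qed.

Lemma Phi_add : exists2 K : R, 0 <= K & forall a b, Phi (a + b) <= K * Phi a + K * Phi b.
Proof.
have [C C0 CP] := Phi_perturb ltr01; exists (2 + C) => [|a b]; first by lra.
apply: le_trans (CP a b) _; have ha := Phi_ge0 HB a; have hb := Phi_ge0 HB b.
by apply: lerD; apply: ler_wpM2r => //; lra.
Qed.

(* By the growth of [Phi], this modular closure of the test functions is
   [spaceX q], see [sobolev_spaceX] and [spaceX_sobolev]. *)
Definition sobolev u G := [/\ measurable_fun setT u, measurable_fun setT G &
  forall e : R, 0 < e -> exists phi, [/\ test_function phi,
    (\int[mu]_x ((phi x - u x) ^+ 2)%:E <= e%:E)%E &
    (\int[mu]_x (Phi (cgrad phi x - G x))%:E <= e%:E)%E]].

Lemma measurable_rV_sub d (T : measurableType d) (f g : T -> 'rV[R]_N) :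
  measurable_fun setT f -> measurable_fun setT g -> measurable_fun setT (fun x => f x - g x).
Proof. by move=> mf mg; apply: measurable_rV_add => //; exact: measurable_rV_opp. Qed.

Lemma sobolev_test phi : test_function phi -> sobolev phi (cgrad phi).
Proof.
move=> tp; split; [exact: test_meas|exact: measurable_cgrad|move=> e e0].
exists phi; split => //.
  by under eq_integral do rewrite subrr expr0n/=; rewrite integral0 lee_fin ltW.
by under eq_integral do rewrite subrr (Phi0 N HB); rewrite integral0 lee_fin ltW.
Qed.

Lemma cgradD phi psi x : test_function phi -> test_function psi ->
  cgrad (fun y => phi y + psi y) x = cgrad phi x + cgrad psi x.
Proof.
move=> tp tq; apply/rowP => i; rewrite !mxE /partial; apply: derive_val.
by apply: is_deriveD; apply: (@Ck_derive _ _ 0); exact: test_smooth.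
Qed.

Lemma sobolevD u v G H : sobolev u G -> sobolev v H ->
  sobolev (fun x => u x + v x) (fun x => G x + H x).
Proof.
move=> [mu_ mG uG] [mv mH vH]; split; [exact: measurable_funD|exact: measurable_rV_add|].
have [K K0 KP] := Phi_add; move=> e e0; pose d := Num.min (e / 4) (e / (2 * K + 1)).
have K1 : 0 < 2 * K + 1 by lra.
have d0 : 0 < d by rewrite lt_min !divr_gt0.
have d4 : d <= e / 4 by rewrite ge_min lexx.
have dK : d * (2 * K + 1) <= e by rewrite -ler_pdivlMr// ge_min lexx orbT.
have [phi [tp pu pG]] := uG _ d0; have [psi [tq qv qH]] := vH _ d0.
have := measurable_cgrad tp; have := measurable_cgrad tq => mq mp.
exists (fun x => phi x + psi x); split; first exact: testD.
- apply: le_trans (_ : (2 * d + 2 * d)%:E <= _)%E; last by rewrite lee_fin; lra.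
  under eq_integral do rewrite opprD addrACA.
  apply: integral_sqrD_le => //; apply: measurable_funB => //; exact: test_meas.
- apply: le_trans (_ : (K * d + K * d)%:E <= _)%E; last by rewrite lee_fin; lra.
  apply: (@integral_lin_le _ _ _ mu (fun x => Phi (cgrad phi x - G x))
    (fun x => Phi (cgrad psi x - H x)) _ K K) => //.
  + by apply: (measurable_Phi HB); exact: measurable_rV_sub.
  + by apply: (measurable_Phi HB); exact: measurable_rV_sub.
  + apply: (measurable_Phi HB); apply: measurable_rV_sub; last exact: measurable_rV_add.
    by apply: measurable_cgrad; exact: testD.
  + by move=> x; exact: (Phi_ge0 HB).
  + by move=> x; exact: (Phi_ge0 HB).
  + by move=> x; exact: (Phi_ge0 HB).
  + by move=> x; rewrite cgradD// opprD addrACA; exact: KP.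
Qed.

Lemma sobolevZ (k : R) u G : sobolev u G -> sobolev (fun x => k * u x) (fun x => k *: G x).
Proof.
move=> [mu_ mG uG]; split; [exact: measurable_funM|exact: measurable_rV_scale|].
have [K K0 KP] := Phi_scale_le k; move=> e e0.
pose M := K + k ^+ 2 + 1; have M0 : 0 < M by have := sqr_ge0 k; rewrite /M; lra.
pose d := e / M; have d0 : 0 < d by rewrite divr_gt0.
have dM : d * M = e by rewrite /d mulfVK// gt_eqF.
have [phi [tp pu pG]] := uG _ d0; have mp := measurable_cgrad tp.
have mD : measurable_fun setT (fun x => phi x - u x) by apply: measurable_funB => //; exact: test_meas.
have h1 : k ^+ 2 * d <= e by rewrite -dM mulrC ler_wpM2l ?(ltW d0)// /M; lra.
have h2 : K * d <= e by rewrite -dM mulrC ler_wpM2l ?(ltW d0)// /M; have := sqr_ge0 k; lra.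
exists (fun x => k * phi x); split; first exact: testZ.
- apply: le_trans (_ : (k ^+ 2 * d + 0 * d)%:E <= _)%E; last by rewrite mul0r addr0 lee_fin.
  apply: (@integral_lin_le _ _ _ mu (fun x => (phi x - u x) ^+ 2) (fun x => (phi x - u x) ^+ 2)) => //.
  + exact: sqr_ge0.
  + exact: measurable_funX.
  + exact: measurable_funX.
  + by apply: measurable_funX; apply: measurable_funB; apply: measurable_funM => //; exact: test_meas.
  + by move=> x; exact: sqr_ge0.
  + by move=> x; exact: sqr_ge0.
  + by move=> x; exact: sqr_ge0.
  + by move=> x; rewrite -mulrBr exprMn mul0r addr0.
- apply: le_trans (_ : (K * d + 0 * d)%:E <= _)%E; last by rewrite mul0r addr0 lee_fin.
  apply: (@integral_lin_le _ _ _ mu (fun x => Phi (cgrad phi x - G x)) (fun x => Phi (cgrad phi x - G x))) => //.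
  + by apply: (measurable_Phi HB); exact: measurable_rV_sub.
  + by apply: (measurable_Phi HB); exact: measurable_rV_sub.
  + apply: (measurable_Phi HB); apply: measurable_rV_sub; last exact: measurable_rV_scale.
    by apply: measurable_cgrad; exact: testZ.
  + by move=> x; exact: (Phi_ge0 HB).
  + by move=> x; exact: (Phi_ge0 HB).
  + by move=> x; exact: (Phi_ge0 HB).
  + by move=> x; rewrite cgradZ// -scalerBr mul0r addr0; exact: KP.
Qed.

Lemma sobolev_sqr_fin u G : sobolev u G -> exists2 A : R, 0 <= A & (\int[mu]_x (u x ^+ 2)%:E <= A%:E)%E.
Proof.
move=> [mu_ _ uG]; have [phi [tp pu _]] := uG 1 ltr01.
have mp := test_meas tp; have tpp := testM tp tp.
have pf : (\int[mu]_x (phi x ^+ 2)%:E)%E \is a fin_num.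
  apply: (@integrable_fin_num _ _ _ _ _ measurableT); have := test_integrable tpp.
  by apply: eq_integrable => // x _; rewrite /= expr2.
have H : (\int[mu]_x (u x ^+ 2)%:E <= (2 * 1 + 2 * fine (\int[mu]_x (phi x ^+ 2)%:E))%:E)%E.
  have := @integral_sqrD_le _ _ R mu (fun x => u x - phi x) phi 1 (fine (\int[mu]_x (phi x ^+ 2)%:E)%E).
  under [X in _ -> _ -> _ -> _ -> (X <= _)%E]eq_integral do rewrite subrK.
  apply => //; [exact: measurable_funB| |by rewrite fineK].
  apply: le_trans _ pu; rewrite le_eqVlt; apply/orP; left; apply/eqP.
  by apply: eq_integral => x _; rewrite -sqrrN opprB.
by eexists; [|exact: H]; rewrite -lee_fin; apply: le_trans H; apply: integral_ge0 => x _; rewrite lee_fin sqr_ge0.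
Qed.

Lemma sobolev_Phi_fin u G : sobolev u G ->
  exists2 A : R, 0 <= A & (\int[mu]_x (Phi (G x))%:E <= A%:E)%E.
Proof.
move=> [_ mG uG]; have [phi [tp _ pG]] := uG 1 ltr01; have [K K0 KP] := Phi_add.
have mp := measurable_cgrad tp.
have H : (\int[mu]_x (Phi (G x))%:E <= (K * fine (Ge phi) + K * 1)%:E)%E.
  apply: (@integral_lin_le _ _ _ mu (fun x => Phi (cgrad phi x)) (fun x => Phi (cgrad phi x - G x))) => //.
  - exact: (measurable_Phi HB).
  - by apply: (measurable_Phi HB); exact: measurable_rV_sub.
  - exact: (measurable_Phi HB).
  - by move=> x; exact: (Phi_ge0 HB).
  - by move=> x; exact: (Phi_ge0 HB).
  - by move=> x; exact: (Phi_ge0 HB).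
  - by move=> x; rewrite -[Phi (cgrad phi x - _)]PhiN opprB; apply: le_trans (KP _ _); rewrite addrC subrK.
  - by rewrite -(genergy_fine HB tp).
by eexists; [|exact: H]; rewrite -lee_fin; apply: le_trans H; apply: integral_ge0 => x _; rewrite lee_fin (Phi_ge0 HB).
Qed.

(** The test functions approximating u in the modular sense serve as witnesses. [Phi_perturb] with a
    factor 1 + th, where th E <= e / 2, bounds their energies. *)
Lemma sobolev_relaxed u G (E : R) : sobolev u G -> (\int[mu]_x (Phi (G x))%:E <= E%:E)%E -> relaxed B u E.
Proof.
move=> [mu_ mG uG] GE e e0.
have E0 : 0 <= E by rewrite -lee_fin; apply: le_trans GE; apply: integral_ge0 => x _; rewrite lee_fin (Phi_ge0 HB).
pose th := e / (2 * (E + 1)); have E1 : 0 < 2 * (E + 1) by lra.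
have th0 : 0 < th by rewrite divr_gt0.
have thE : th * E <= e / 2.
  have h : th * (E + 1) = e / 2.
    by rewrite /th invfM mulrA mulfVK// gt_eqF// ltr_wpDl.
  by rewrite -h ler_pM2l//; lra.
have [C C0 CP] := Phi_perturb th0; have C1 : 0 < 2 * (C + 1) by lra.
have d0 : 0 < Num.min e (e / (2 * (C + 1))) by rewrite lt_min e0 divr_gt0.
have [phi [tp pu pG]] := uG _ d0; have mp := measurable_cgrad tp.
exists phi; split => //; first by apply: le_trans pu _; rewrite lee_fin ge_min lexx.
apply: (@le_trans _ _ ((1 + th) * E + C * (e / (2 * (C + 1))))%:E).
  apply: (@integral_lin_le _ _ _ mu (fun x => Phi (G x)) (fun x => Phi (cgrad phi x - G x))) => //.
  - lra.
  - exact: (measurable_Phi HB).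
  - by apply: (measurable_Phi HB); exact: measurable_rV_sub.
  - exact: (measurable_Phi HB).
  - by move=> x; exact: (Phi_ge0 HB).
  - by move=> x; exact: (Phi_ge0 HB).
  - by move=> x; exact: (Phi_ge0 HB).
  - by move=> x; apply: le_trans (CP _ _); rewrite addrC subrK.
  - by apply: le_trans pG _; rewrite lee_fin ge_min lexx orbT.
rewrite lee_fin (_ : C * (e / _) = e / 2 * (C / (C + 1))); last first.
  by rewrite invfM [C * _]mulrC !mulrA mulrAC.
have h : C / (C + 1) <= 1 by rewrite ler_pdivrMr; lra.
have : e / 2 * (C / (C + 1)) <= e / 2 * 1 by apply: ler_wpM2l => //; lra.
lra.
Qed.

End gradient_closure.

Section weak_gradients.
Variables (R : realType) (N : nat).
Implicit Types (u v w phi psi : 'rV[R]_N -> R) (G H : 'rV[R]_N -> 'rV[R]_N).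

Local Notation mu := (lebesgue_rV R N).

Lemma sqr_L1loc u (A : R) : measurable_fun setT u -> (\int[mu]_x (u x ^+ 2)%:E <= A%:E)%E -> L1loc u.
Proof.
move=> mu_ uA; split => // K cK; have mK := compact_measurable_rV cK.
have fK : mu K \is a fin_num by rewrite ge0_fin_numE ?compact_measure_lty.
have m1 : measurable_fun setT (\1_K : 'rV[R]_N -> R) by exact: measurable_indic.
have K1 : (\int[mu]_x ((\1_K x : R) ^+ 2)%:E <= (fine (mu K))%:E)%E.
  rewrite fineK// -(setIT K) -integral_indic//.
  rewrite le_eqVlt; apply/orP; left; apply/eqP; apply: eq_integral => x _.
  by rewrite !indicE setIT; case: (_ \in _); rewrite ?expr1n ?expr0n.
apply/(integrable_mkcond _ mK); have := integrable_mul_sqr mu_ m1 uA K1.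
apply: eq_integrable => // x _; rewrite patchE /= indicE; case: (_ \in _).
  by rewrite mulr1.
by rewrite mulr0.
Qed.

Lemma weak_gradientB u v G H : is_weak_gradient u G -> is_weak_gradient v H ->
  is_weak_gradient (fun x => u x - v x) (fun x => G x - H x).
Proof.
move=> [Lu LG uG] [Lv LH vH]; split; first exact: L1locB.
  by move=> i; under eq_fun do rewrite !mxE; exact: L1locB.
move=> phi i tp; have tpi := test_partial i tp.
under eq_Rintegral do rewrite mulrBl.
rewrite RintegralB//; [|exact: L1loc_mul_integrable|exact: L1loc_mul_integrable].
under [in RHS]eq_Rintegral do rewrite !mxE mulrBl.
rewrite RintegralB//; [|exact: L1loc_mul_integrable|exact: L1loc_mul_integrable].
by rewrite uG// vH// opprB addrC opprK.
Qed.

Lemma grad_weak_gradient u : weakly_differentiable u -> is_weak_gradient u (grad u).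
Proof. by move=> [G uG]; exact: (xgetI (cst 0) uG). Qed.

Lemma grad_ae u G : is_weak_gradient u G -> \forall x \ae mu, grad u x = G x.
Proof.
by move=> uG; apply: (weak_gradient_unique _ uG); apply: grad_weak_gradient; exists G.
Qed.

Lemma weak_gradient_measurable u G : is_weak_gradient u G -> measurable_fun setT G.
Proof. by move=> [_ LG _]; apply: measurable_fun_rV => i; have [] := LG i. Qed.

Lemma measurable_entry i G : measurable_fun setT G -> measurable_fun setT (fun x => G x 0 i).
Proof. by move=> mG; exact: (measurableT_comp (measurable_coord i) mG). Qed.

Lemma coord_sqr_le i (x : 'rV[R]_N) : x 0 i ^+ 2 <= dot x x.
Proof.
by rewrite -enormE -real_normK ?num_real// ler_sqr ?nnegrE ?enorm_ge0// coord_le_enorm.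
Qed.

End weak_gradients.

Section spaceX_closure.
Variables (R : realType) (N : nat) (B : R -> R) (q c1 c2 : R).
Hypothesis HB : profile B q c1 c2.
Implicit Types (u v w phi psi : 'rV[R]_N -> R) (G H : 'rV[R]_N -> 'rV[R]_N).

Local Notation mu := (lebesgue_rV R N).
Local Notation Phi := (@Phi R N B).
Local Notation sobolev := (@sobolev R N B).

Lemma integral_dot_le G (a : R) : measurable_fun setT G -> (\int[mu]_x (Phi (G x))%:E <= a%:E)%E ->
  (\int[mu]_x (dot (G x) (G x))%:E <= (c1^-1 * a)%:E)%E.
Proof.
move=> mG Ga; rewrite -[_ * a]addr0 -(mul0r a); have c10 := profile_c1 HB.
apply: (@integral_lin_le _ _ _ mu (fun x => Phi (G x)) (fun x => Phi (G x))) => //.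
- by rewrite invr_ge0 ltW.
- exact: (measurable_Phi HB).
- exact: (measurable_Phi HB).
- exact: measurable_dot.
- by move=> x; exact: (Phi_ge0 HB).
- by move=> x; exact: (Phi_ge0 HB).
- by move=> x; exact: dot_ge0.
- by move=> x; rewrite mul0r addr0 ler_pdivlMl//; exact: Phi_lower HB _.
Qed.

Lemma integral_enorm_le G (a : R) : measurable_fun setT G -> (\int[mu]_x (Phi (G x))%:E <= a%:E)%E ->
  (\int[mu]_x (enorm (G x) `^ q)%:E <= (c1^-1 * a)%:E)%E.
Proof.
move=> mG Ga; rewrite -[_ * a]addr0 -(mul0r a); have c10 := profile_c1 HB.
have mP : measurable_fun setT (fun x => Phi (G x)) by exact: (measurable_Phi HB).
apply: (@integral_lin_le _ _ _ mu (fun x => Phi (G x)) (fun x => Phi (G x))) => //.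
- by rewrite invr_ge0 ltW.
- by apply: (measurableT_comp (measurable_powR q)); exact: measurable_enorm.
- by move=> x; exact: (Phi_ge0 HB).
- by move=> x; exact: (Phi_ge0 HB).
- by move=> x; exact: powR_ge0.
- by move=> x; rewrite mul0r addr0 ler_pdivlMl//; exact: Phi_lower_q HB _.
Qed.

Lemma integral_Phi_le G (a b : R) : measurable_fun setT G ->
  (\int[mu]_x (dot (G x) (G x))%:E <= a%:E)%E -> (\int[mu]_x (enorm (G x) `^ q)%:E <= b%:E)%E ->
  (\int[mu]_x (Phi (G x))%:E <= (c2 * a + c2 * b)%:E)%E.
Proof.
move=> mG Ga Gb; have c20 := profile_c2 HB.
apply: (@integral_lin_le _ _ _ mu (fun x => dot (G x) (G x)) (fun x => enorm (G x) `^ q)) => //.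
- exact: ltW.
- exact: ltW.
- exact: measurable_dot.
- by apply: (measurableT_comp (measurable_powR q)); exact: measurable_enorm.
- exact: (measurable_Phi HB).
- by move=> x; exact: dot_ge0.
- by move=> x; exact: powR_ge0.
- by move=> x; exact: (Phi_ge0 HB).
- by move=> x; rewrite -mulrDr; exact: Phi_upper HB _.
Qed.

Lemma integral_coord_le i G (a : R) : measurable_fun setT G -> (\int[mu]_x (Phi (G x))%:E <= a%:E)%E ->
  (\int[mu]_x ((G x 0 i) ^+ 2)%:E <= (c1^-1 * a)%:E)%E.
Proof.
move=> mG Ga; apply: le_trans (integral_dot_le mG Ga); apply: ge0_le_integral => //.
- by move=> x _; rewrite lee_fin sqr_ge0.
- by apply: measurable_sqr; exact: measurable_entry.
- by apply/measurable_EFinP; exact: measurable_dot.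
- by move=> x _; rewrite lee_fin coord_sqr_le.
Qed.

(** The integration by parts formula passes to the limit from test functions: both errors are L^2
    pairings with fixed functions, bounded by [pairing_le] with an arbitrarily small factor. *)
Lemma sobolev_weak_gradient u G : sobolev u G -> is_weak_gradient u G.
Proof.
move=> uG; have c10 := profile_c1 HB.
have [A _ uA] := sobolev_sqr_fin uG; have [E _ GE] := sobolev_Phi_fin HB uG.
have [mu_ mG uGe] := uG; have Lu := sqr_L1loc mu_ uA.
have LG i : L1loc (fun x => G x 0 i).
  by apply: (sqr_L1loc (measurable_entry i mG)); exact: (integral_coord_le i mG GE).
split => // psi i tp; have tpi := test_partial i tp.
have sqr_fin phi : test_function phi -> exists b : R, (\int[mu]_x (phi x ^+ 2)%:E <= b%:E)%E.
  by move=> tq; have [b _ bP] := sobolev_sqr_fin (sobolev_test HB tq); exists b.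
have [b1 b1P] := sqr_fin _ tpi; have [b2 b2P] := sqr_fin _ tp.
apply/eqP; rewrite -subr_eq0 opprK -normr_eq0; apply/eqP/le_anti; rewrite normr_ge0 andbT.
apply/ler_addgt0Pl => e e0; rewrite addr0.
set X := (X in `|X|).
pose M := `|1 + b1| + `|1 + b2| + 1.
have M0 : 0 < M by have := normr_ge0 (1 + b1); have := normr_ge0 (1 + b2); rewrite /M; lra.
pose d := e / M; have d0 : 0 < d by rewrite divr_gt0.
have m0 : 0 < Num.min (d ^+ 2) (c1 * d ^+ 2) by rewrite lt_min exprn_gt0// mulr_gt0// exprn_gt0.
have [phi [tq pu pG]] := uGe _ m0.
have mph := test_meas tq; have mcg := measurable_cgrad tq.
have [Lp Lc pw] := weak_gradient_test tq.
have E1 : \int[mu]_x ((u x - phi x) * partial i psi x) =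
    \int[mu]_x (u x * partial i psi x) - \int[mu]_x (phi x * partial i psi x).
  under eq_Rintegral do rewrite mulrBl.
  by rewrite RintegralB//; exact: L1loc_mul_integrable.
have E2 : \int[mu]_x ((G x - cgrad phi x) 0 i * psi x) =
    \int[mu]_x (G x 0 i * psi x) - \int[mu]_x (cgrad phi x 0 i * psi x).
  under eq_Rintegral do rewrite mxE [X in _ + X]mxE mulrBl.
  by rewrite RintegralB//; exact: L1loc_mul_integrable.
have -> : X = \int[mu]_x ((u x - phi x) * partial i psi x) + \int[mu]_x ((G x - cgrad phi x) 0 i * psi x).
  rewrite E1 E2 pw// /X; ring.
have h1 : `|\int[mu]_x ((u x - phi x) * partial i psi x)| <= d * (1 + b1) / 2.
  apply: pairing_le => //; [exact: measurable_funB|exact: test_meas|].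
  apply: (@le_trans _ _ (\int[mu]_x ((phi x - u x) ^+ 2)%:E)%E).
    by rewrite le_eqVlt; apply/orP; left; apply/eqP; apply: eq_integral => x _; rewrite -sqrrN opprB.
  by apply: le_trans pu _; rewrite lee_fin ge_min lexx.
have h2 : `|\int[mu]_x ((G x - cgrad phi x) 0 i * psi x)| <= d * (1 + b2) / 2.
  apply: pairing_le => //.
  - by apply: measurable_entry; exact: measurable_rV_sub.
  - exact: test_meas.
  have -> : d ^+ 2 = c1^-1 * (c1 * d ^+ 2) by rewrite mulKf// gt_eqF.
  apply: integral_coord_le; first exact: measurable_rV_sub.
  apply: (@le_trans _ _ (\int[mu]_x (Phi (cgrad phi x - G x))%:E)%E).
    by rewrite le_eqVlt; apply/orP; left; apply/eqP; apply: eq_integral => x _; rewrite -PhiN opprB.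
  by apply: le_trans pG _; rewrite lee_fin ge_min lexx orbT.
apply: le_trans (ler_normD _ _) _.
have hM : d * M = e by rewrite /d mulfVK// gt_eqF.
have n1 : d * (1 + b1) <= d * `|1 + b1| by rewrite ler_pM2l// ler_norm.
have n2 : d * (1 + b2) <= d * `|1 + b2| by rewrite ler_pM2l// ler_norm.
have p1 : 0 <= d * `|1 + b1| by rewrite mulr_ge0// ltW.
have p2 : 0 <= d * `|1 + b2| by rewrite mulr_ge0// ltW.
move: (`|\int[mu]_x _|) (`|\int[mu]_x _|) h1 h2 => I1 I2 h1 h2.
move: hM; rewrite /M; clear -h1 h2 n1 n2 p1 p2 d0 => hM; lra.
Qed.

Lemma sobolev_grad u G : sobolev u G -> \forall x \ae mu, grad u x = G x.
Proof. by move=> uG; apply: grad_ae; exact: sobolev_weak_gradient. Qed.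

Lemma sqr_poweR (x : \bar R) : (0 <= x -> x ^+ 2 = x `^ 2)%E.
Proof.
case: x => [r|//|//] r0; last by rewrite poweRyr// expe2 mulyy.
by rewrite poweR_EFin powR_mulrn// -EFin_expe.
Qed.

Lemma Lnorm_sqr w : ('N[mu]_(2%:E) [EFin \o w] ^+ 2 = \int[mu]_x (w x ^+ 2)%:E)%E.
Proof.
rewrite sqr_poweR ?Lnorm_ge0// poweR_Lnorm//; apply: eq_integral => x _ /=.
by rewrite powR_mulrn// real_normK// num_real.
Qed.

Lemma normXE w : normX q w = ((\int[mu]_x (dot (grad w x) (grad w x))%:E + \int[mu]_x (w x ^+ 2)%:E
  + (\int[mu]_x (enorm (grad w x) `^ q)%:E) `^ (2 / q)) `^ 2^-1)%E.
Proof.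
have q0 : q != 0 by have := profile_q HB; case: eqP => // ->; lra.
rewrite /normX !Lnorm_sqr.
have -> : ('N[mu]_(q%:E) [EFin \o (@enorm R N \o grad w)] ^+ 2 =
    (\int[mu]_x (enorm (grad w x) `^ q)%:E) `^ (2 / q))%E.
  rewrite sqr_poweR ?Lnorm_ge0// [2 / q]mulrC.
  have -> : (\int[mu]_x (enorm (grad w x) `^ q)%:E = 'N[mu]_(q%:E) [EFin \o (@enorm R N \o grad w)] `^ q)%E.
    rewrite (poweR_Lnorm mu (EFin \o (@enorm R N \o grad w)) q0).
    by apply: eq_integral => x _; rewrite /= ger0_norm// enorm_ge0.
  by rewrite -poweRrM mulrA mulfV// mul1r.
congr (_ `^ _)%E; congr (_ + _ + _)%E; apply: eq_integral => x _ /=.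
by rewrite enormE.
Qed.

Let powe_le (x y : \bar R) (r : R) : 0 <= r -> (0 <= x -> x <= y -> x `^ r <= y `^ r)%E.
Proof.
move=> r0 x0 xy; apply: gt0_ler_poweR => //; rewrite in_itv/= leey andbT//.
exact: le_trans xy.
Qed.

Lemma normX_small (e : R) : 0 < e -> exists2 t : R, 0 < t & forall w H, is_weak_gradient w H ->
  (\int[mu]_x (w x ^+ 2)%:E <= t%:E)%E -> (\int[mu]_x (Phi (H x))%:E <= t%:E)%E ->
  (normX q w <= e%:E)%E.
Proof.
move=> e0; have c10 := profile_c1 HB; have q2 := profile_q HB; have q0 : 0 < q by lra.
(* Each of the three squared terms of the norm receives a third of e^2. The last one carries the
   power 2 / q, whence the threshold k^(q/2). *)
pose k := e ^+ 2 / 3; have k0 : 0 < k by rewrite divr_gt0// exprn_gt0.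
exists (Num.min k (Num.min (c1 * k) (c1 * k `^ (q / 2)))) => [|w H wH w2 wP].
  by rewrite !lt_min k0 !mulr_gt0// powR_gt0.
have mH := weak_gradient_measurable wH; have gH := grad_ae wH.
have mg : measurable_fun setT (grad w).
  by apply: (@weak_gradient_measurable _ _ w); apply: grad_weak_gradient; exists H.
have gP : (\int[mu]_x (Phi (grad w x))%:E = \int[mu]_x (Phi (H x))%:E)%E.
  apply: ge0_ae_eq_integral => //.
  - by apply/measurable_EFinP; exact: (measurable_Phi HB).
  - by apply/measurable_EFinP; exact: (measurable_Phi HB).
  - by move=> x _; rewrite lee_fin (Phi_ge0 HB).
  - by move=> x _; rewrite lee_fin (Phi_ge0 HB).
  - by apply: filterS gH => x -> _.
rewrite -gP in wP.
have hA : (\int[mu]_x (dot (grad w x) (grad w x))%:E <= k%:E)%E.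
  rewrite [k](_ : _ = c1^-1 * (c1 * k)); last by rewrite mulKf// gt_eqF.
  by apply: integral_dot_le => //; apply: le_trans wP _; rewrite lee_fin !ge_min lexx orbT.
have hC : (\int[mu]_x (enorm (grad w x) `^ q)%:E <= (k `^ (q / 2))%:E)%E.
  rewrite [k `^ _](_ : _ = c1^-1 * (c1 * k `^ (q / 2))); last by rewrite mulKf// gt_eqF.
  by apply: integral_enorm_le => //; apply: le_trans wP _; rewrite lee_fin !ge_min lexx !orbT.
have hB : (\int[mu]_x (w x ^+ 2)%:E <= k%:E)%E by apply: le_trans w2 _; rewrite lee_fin ge_min lexx.
have hD : ((\int[mu]_x (enorm (grad w x) `^ q)%:E) `^ (2 / q) <= k%:E)%E.
  apply: le_trans (powe_le _ _ hC) _.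
  - by rewrite divr_ge0// ltW.
  - by apply: integral_ge0 => x _; rewrite lee_fin powR_ge0.
  rewrite poweR_EFin -powRrM (_ : q / 2 * (2 / q) = 1) ?powRr1 ?(ltW k0)//.
  by field; rewrite gt_eqF.
rewrite normXE; apply: le_trans (powe_le _ _ (leeD (leeD hA hB) hD)) _.
- by rewrite invr_ge0.
- apply: adde_ge0; last exact: poweR_ge0.
  by apply: adde_ge0; apply: integral_ge0 => x _; rewrite lee_fin ?sqr_ge0 ?dot_ge0.
rewrite -!EFinD (_ : k + k + k = e ^+ 2); last by rewrite /k; field.
by rewrite poweR_EFin -powR_mulrn ?(ltW e0)// -powRrM mulfV// powRr1// ltW.
Qed.

Lemma normX_large (t : R) : 0 < t -> exists2 e : R, 0 < e & forall w, weakly_differentiable w ->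
  (normX q w <= e%:E)%E ->
  (\int[mu]_x (w x ^+ 2)%:E <= t%:E)%E /\ (\int[mu]_x (Phi (grad w x))%:E <= t%:E)%E.
Proof.
move=> t0; have c20 := profile_c2 HB; have q2 := profile_q HB; have q0 : 0 < q by lra.
have M0 : 0 < 2 * c2 + 1 by lra.
pose k := Num.min 1 (t / (2 * c2 + 1)); have k0 : 0 < k by rewrite lt_min ltr01 divr_gt0.
have k1 : k <= 1 by rewrite ge_min lexx.
have kt : k * (2 * c2 + 1) <= t by rewrite -ler_pdivlMr// ge_min lexx orbT.
have kc : 0 < k * c2 by rewrite mulr_gt0.
exists (k `^ 2^-1) => [|w dw wn]; first by rewrite powR_gt0.
have mg : measurable_fun setT (grad w).
  by apply: (@weak_gradient_measurable _ _ w); exact: grad_weak_gradient.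
have A0 : (0 <= \int[mu]_x (dot (grad w x) (grad w x))%:E)%E.
  by apply: integral_ge0 => x _; rewrite lee_fin dot_ge0.
have B0 : (0 <= \int[mu]_x (w x ^+ 2)%:E)%E by apply: integral_ge0 => x _; rewrite lee_fin sqr_ge0.
have C0 : (0 <= \int[mu]_x (enorm (grad w x) `^ q)%:E)%E.
  by apply: integral_ge0 => x _; rewrite lee_fin powR_ge0.
have D0 := poweR_ge0 (\int[mu]_x (enorm (grad w x) `^ q)%:E)%E (2 / q).
have S : (\int[mu]_x (dot (grad w x) (grad w x))%:E + \int[mu]_x (w x ^+ 2)%:E
  + (\int[mu]_x (enorm (grad w x) `^ q)%:E) `^ (2 / q) <= k%:E)%E.
  have kE : ((k `^ 2^-1)%:E `^ 2 = k%:E)%E by rewrite poweR_EFin -powRrM mulVf// powRr1// ltW.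
  have n0 : (0 <= normX q w)%E by exact: poweR_ge0.
  have := @powe_le _ _ 2 (ltW (ltr0Sn _ 1)) n0 wn; rewrite kE normXE.
  rewrite -poweRrM mulVf// poweRe1//.
  by apply: adde_ge0 D0; exact: adde_ge0.
have hA : (\int[mu]_x (dot (grad w x) (grad w x))%:E <= k%:E)%E.
  by apply: le_trans S; rewrite -addeA leeDl// adde_ge0.
have hB : (\int[mu]_x (w x ^+ 2)%:E <= k%:E)%E.
  by apply: le_trans S; rewrite addeAC leeDr// adde_ge0.
have hD : ((\int[mu]_x (enorm (grad w x) `^ q)%:E) `^ (2 / q) <= k%:E)%E.
  by apply: le_trans S; rewrite leeDr// adde_ge0.
have hC : (\int[mu]_x (enorm (grad w x) `^ q)%:E <= k%:E)%E.
  have := @powe_le _ _ (q / 2) (divr_ge0 (ltW q0) (ltW (ltr0Sn _ 1))) D0 hD.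
  rewrite -poweRrM (_ : 2 / q * (q / 2) = 1); last by field; rewrite gt_eqF.
  rewrite poweRe1// poweR_EFin => /le_trans; apply; rewrite lee_fin.
  rewrite -[leRHS](powRr1 (ltW k0)) ger_powR ?k0//.
  by rewrite ler_pdivlMr// mul1r.
split.
  by apply: le_trans hB _; rewrite lee_fin; move: kt; rewrite mulrDr mulr1 mulrCA; lra.
apply: le_trans (integral_Phi_le mg hA hC) _; rewrite lee_fin.
by move: kt; rewrite mulrDr mulr1 mulrCA [c2 * k]mulrC; lra.
Qed.

Lemma sobolev_spaceX u G : sobolev u G -> spaceX q u.
Proof.
move=> uG; split; first by exists G; exact: sobolev_weak_gradient.
have H n : exists phi, test_function phi /\ (normX q (fun x => (u x - phi x)%R) <= (n.+1%:R^-1)%:E)%E.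
  have e0 : 0 < n.+1%:R^-1 :> R by rewrite invr_gt0 ltr0n.
  have [t t0 tP] := normX_small e0; have [mu_ mG uGe] := uG.
  have [phi [tp pu pG]] := uGe _ t0; exists phi; split => //.
  apply: (tP _ (fun x => G x - cgrad phi x)).
  - by apply: weak_gradientB; [exact: sobolev_weak_gradient|exact: weak_gradient_test].
  - apply: le_trans _ pu; rewrite le_eqVlt; apply/orP; left; apply/eqP.
    by apply: eq_integral => x _; rewrite -sqrrN opprB.
  - apply: le_trans _ pG; rewrite le_eqVlt; apply/orP; left; apply/eqP.
    by apply: eq_integral => x _; rewrite -PhiN opprB.
exists (fun n => projT1 (cid (H n))); split; first by move=> n; case: (cid (H n)) => phi [].
apply: (@squeeze_cvge _ _ _ _ (cst 0%E) _ (fun n => (n.+1%:R^-1)%:E)).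
- by apply: nearW => n; rewrite poweR_ge0/=; case: (cid (H n)) => phi [].
- exact: cvg_cst.
- by apply: cvg_EFin; [exact: nearW|exact: cvg_harmonic].
Qed.

Lemma spaceX_sobolev u : spaceX q u -> sobolev u (grad u).
Proof.
move=> [du [phi [tp pu]]]; have ug := grad_weak_gradient du.
split; [by case: ug => -[]|exact: (weak_gradient_measurable ug)|move=> e e0].
have [d d0 dP] := normX_large e0.
have [n _ /(_ n (leqnn n)) nP] := @cvge_near_le R _ _ d0 pu.
have wg := weak_gradientB ug (weak_gradient_test (tp n)).
have [|h1 h2] := dP _ _ nP; first by eexists; exact: wg.
exists (phi n); split => //.
- apply: le_trans _ h1; rewrite le_eqVlt; apply/orP; left; apply/eqP.
  by apply: eq_integral => x _; rewrite -sqrrN opprB.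
- apply: le_trans _ h2; rewrite le_eqVlt; apply/orP; left; apply/eqP.
  have mg := weak_gradient_measurable ug; have mc := measurable_cgrad (tp n).
  have mw := weak_gradient_measurable (grad_weak_gradient (ex_intro _ _ wg)).
  apply: ge0_ae_eq_integral => //.
  - by apply/measurable_EFinP; apply: (measurable_Phi HB); exact: measurable_rV_sub.
  - by apply/measurable_EFinP; exact: (measurable_Phi HB).
  - by move=> x _; rewrite lee_fin (Phi_ge0 HB).
  - by move=> x _; rewrite lee_fin (Phi_ge0 HB).
  - by apply: filterS (grad_ae wg) => x -> _; rewrite -PhiN opprB.
Qed.

End spaceX_closure.

(** * Strong convergence of gradients *)

Section gradient_completeness.
Variables (R : realType) (N : nat) (B : R -> R) (q c1 c2 : R).
Hypothesis HB : profile B q c1 c2.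
Implicit Types (u v phi : 'rV[R]_N -> R) (G H : 'rV[R]_N -> 'rV[R]_N).

Local Notation mu := (lebesgue_rV R N).
Local Notation Phi := (@Phi R N B).

Lemma geometric_cvg (a : nat -> R) (s : R) : 0 <= s ->
  (forall n, (a n.+1 - a n) ^+ 2 <= s * 4^-1 ^+ n) -> cvgn a.
Proof.
move=> s0 H; have -> : a = (fun n => a 0%N + series (telescope a) n).
  by apply/funext => n; rewrite -eq_sum_telescope.
apply: is_cvgD; first exact: is_cvg_cst.
apply: normed_cvg; apply: (@series_le_cvg _ _ (geometric (Num.sqrt s) (2^-1 : R))).
- by move=> n; exact: normr_ge0.
- by move=> n; rewrite /= mulr_ge0 ?sqrtr_ge0// exprn_ge0// invr_ge0.
- move=> n; rewrite /telescope /= -ler_sqr ?nnegrE ?mulr_ge0 ?sqrtr_ge0 ?exprn_ge0 ?invr_ge0//.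
  rewrite real_normK ?num_real// exprMn sqr_sqrtr// -exprM mulnC exprM.
  by apply: le_trans (H n) _; rewrite (_ : 2^-1 ^+ 2 = 4^-1 :> R)// expr2; field.
- by apply: is_cvg_geometric_series; rewrite ger0_norm ?invr_ge0// invf_lt1 ?ltr1n.
Qed.

Lemma cvg_rV (a : nat -> 'rV[R]_N) (l : 'rV[R]_N) :
  (forall i, a n 0 i @[n --> \oo] --> l 0 i) -> a n @[n --> \oo] --> l.
Proof.
move=> H; apply/cvgrPdist_lt => e e0.
have : \forall n \near \oo, forall i, `|l 0 i - a n 0 i| < e.
  by apply: filter_forall => i; have /cvgrPdist_lt/(_ _ e0) := H i.
by apply: filterS => n h; apply: rV_norm_lt => // i; rewrite !mxE.
Qed.

Lemma continuous_enorm_powR : 2 <= q -> continuous (fun x : 'rV[R]_N => enorm x `^ q).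
Proof.
rewrite le_eqVlt => /orP[/eqP <-|q2] x.
  have -> : (fun x : 'rV[R]_N => enorm x `^ 2) = (fun x => dot x x).
    by apply/funext => y; rewrite powR_mulrn ?enorm_ge0// enormE.
  by apply: continuous_dot => y; exact: cvg_id.
have -> : (fun x : 'rV[R]_N => enorm x `^ q) = (fun t : R => `|t| `^ q) \o (@enorm R N).
  by apply/funext => y /=; rewrite ger0_norm ?enorm_ge0.
by apply: continuous_comp; [exact: continuous_enorm|exact: continuous_abs_powR].
Qed.

(** A Riesz-Fischer argument: the gradients converge almost everywhere, and Fatou's lemma, applied
    to the quadratic and the q-power parts separately, bounds the distance to the limit; hence the
    factor 2 c2. *)
Lemma gradient_complete (psi : nat -> 'rV[R]_N -> R) : (forall n, test_function (psi n)) ->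
  (forall n m, (n <= m)%N ->
    (\int[mu]_x (Phi (cgrad (psi n) x - cgrad (psi m) x))%:E <= (c1 * 8^-1 ^+ n)%:E)%E) ->
  exists G, measurable_fun setT G /\
    forall n, (\int[mu]_x (Phi (cgrad (psi n) x - G x))%:E <= (2 * c2 * 8^-1 ^+ n)%:E)%E.
Proof.
move=> tp H; have c10 := profile_c1 HB; have mc n := measurable_cgrad (tp n).
pose D n x := cgrad (psi n) x - cgrad (psi n.+1) x.
have mD n : measurable_fun setT (D n) by exact: measurable_rV_sub.
(* The weight 4^n against 8^(-n) leaves integrals below 2^(-n). A finite majorant S of all [h n] at
   x then forces increments of size at most sqrt(S) 2^(-n). *)
pose h n x := 4 ^+ n * dot (D n x) (D n x).
have dh n : (\int[mu]_x (dot (D n x) (D n x))%:E <= (8^-1 ^+ n)%:E)%E.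
  rewrite -[8^-1 ^+ n](mulKf (lt0r_neq0 c10)).
  by apply: (integral_dot_le HB) => //; exact: H.
have [|n x|n|S [iS hS _]] := @fast_majorant _ _ _ mu h.
- by move=> n; apply: measurable_funM => //; exact: measurable_dot.
- by rewrite mulr_ge0 ?dot_ge0// exprn_ge0.
- under eq_integral do rewrite EFinM.
  rewrite ge0_integralZl_EFin//; first last.
  + by apply/measurable_EFinP; exact: measurable_dot.
  + by move=> x _; rewrite lee_fin dot_ge0.
  rewrite (_ : 2^-1 ^+ n = 4 ^+ n * 8^-1 ^+ n); last by rewrite -exprMn; congr (_ ^+ _); field.
  by rewrite EFinM lee_wpmul2l// lee_fin exprn_ge0.
(* Multiplying by the indicator of [E] makes the limits exist at every point, so the limit field is
   measurable. *)
pose E := [set x | S x \is a fin_num].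
have mE : measurable E.
  have [mS _] := integrableP _ _ _ iS.
  by rewrite -[E]setTI; apply: emeasurable_fin_num.
have aE : \forall x \ae mu, E x by apply: filterS (integrable_ae measurableT iS) => x; exact.
have cE x i : cvgn (fun n => cgrad (psi n) x 0 i * \1_E x).
  rewrite indicE; case: (boolP (x \in E)) => [/set_mem Ex|_]; last first.
    by under eq_fun do rewrite mulr0; exact: is_cvg_cst.
  have S0 : 0 <= fine (S x).
    by apply: fine_ge0; apply: le_trans (hS 0%N x); rewrite lee_fin mulr_ge0 ?dot_ge0// exprn_ge0.
  apply: (geometric_cvg S0) => n; rewrite !mulr1.
  have := hS n x; rewrite -(fineK Ex) lee_fin /h => hn.
  rewrite exprVn -[_ / _]mulrC ler_pdivlMl ?exprn_gt0//.
  apply: le_trans hn; rewrite ler_pM2l ?exprn_gt0//.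
  apply: le_trans (coord_sqr_le i (D n x)).
  by rewrite /D !mxE -sqrrN opprB.
pose G x := \row_i limn (fun n => cgrad (psi n) x 0 i * \1_E x) : 'rV[R]_N.
have mG : measurable_fun setT G.
  apply: measurable_fun_rV => i; under eq_fun do rewrite mxE.
  apply: (@measurable_fun_cvg _ _ _ _ (fun n x => cgrad (psi n) x 0 i * \1_E x)) => [n|x _].
    by apply: measurable_funM; [exact: measurable_entry|exact: measurable_indic].
  exact: cE.
exists G; split => // n.
have cG x : E x -> forall n, cgrad (psi n) x - cgrad (psi (m + n)%N) x @[m --> \oo] --> cgrad (psi n) x - G x.
  move=> Ex k; apply: cvgB; first exact: cvg_cst.
  apply: cvg_rV => i; rewrite (cvg_shiftn k (fun m => cgrad (psi m) x 0 i)).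
  have e1 : (fun m => cgrad (psi m) x 0 i * \1_E x) = (fun m => cgrad (psi m) x 0 i).
    by apply/funext => m; rewrite indicE mem_set// mulr1.
  have := cE x i; rewrite e1 => c; have -> : G x 0 i = limn (fun m => cgrad (psi m) x 0 i) by rewrite mxE e1.
  exact: c.
have B8 m : (\int[mu]_x (Phi (cgrad (psi n) x - cgrad (psi (m + n)%N) x))%:E <= (c1 * 8^-1 ^+ n)%:E)%E.
  by apply: H; rewrite leq_addl.
have k8 : c1^-1 * (c1 * 8^-1 ^+ n) = 8^-1 ^+ n by rewrite mulKf// gt_eqF.
have mB m : measurable_fun setT (fun x => cgrad (psi n) x - cgrad (psi (m + n)%N) x).
  exact: measurable_rV_sub.
have mBG : measurable_fun setT (fun x => cgrad (psi n) x - G x) by exact: measurable_rV_sub.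
rewrite (_ : 2 * c2 * _ = c2 * 8^-1 ^+ n + c2 * 8^-1 ^+ n); last by ring.
apply: (integral_Phi_le HB) => //.
- apply: (@fatou_cvg _ _ _ mu (fun m x => dot (cgrad (psi n) x - cgrad (psi (m + n)%N) x) (cgrad (psi n) x - cgrad (psi (m + n)%N) x))).
  + by move=> m; exact: measurable_dot.
  + exact: measurable_dot.
  + by move=> m x; exact: dot_ge0.
  + by move=> x; exact: dot_ge0.
  + apply: filterS aE => x Ex.
    apply: (@cvg_comp _ _ _ (fun m => cgrad (psi n) x - cgrad (psi (m + n)%N) x) (fun a : 'rV[R]_N => dot a a) _ _ _ (cG x Ex n)).
    by apply: (@continuous_dot R N (fun a => a) (fun a => a)) => y; exact: cvg_id.
  + by move=> m; rewrite -k8; exact: (integral_dot_le HB).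
- apply: (@fatou_cvg _ _ _ mu (fun m x => enorm (cgrad (psi n) x - cgrad (psi (m + n)%N) x) `^ q)).
  + by move=> m; apply: (measurableT_comp (measurable_powR q)); exact: measurable_enorm.
  + by apply: (measurableT_comp (measurable_powR q)); exact: measurable_enorm.
  + by move=> m x; exact: powR_ge0.
  + by move=> x; exact: powR_ge0.
  + apply: filterS aE => x Ex.
    apply: (@cvg_comp _ _ _ (fun m => cgrad (psi n) x - cgrad (psi (m + n)%N) x) (fun a : 'rV[R]_N => enorm a `^ q) _ _ _ (cG x Ex n)).
    by apply: continuous_enorm_powR; exact: profile_q HB.
  + by move=> m; rewrite -k8; exact: (integral_enorm_le HB).
Qed.

End gradient_completeness.

(** * Attainment of the infimum and saturation of the constraint *)

Section minimizer.
Variables (R : realType) (N : nat) (B : R -> R) (q c1 c2 p rho : R).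
Hypothesis HB : profile B q c1 c2.
Hypothesis N0 : (0 < N)%N.
Hypothesis p2 : 2 < p.
Hypothesis pr : p < 2 + 4 / N%:R.
Hypothesis r0 : 0 < rho.
Implicit Types (u v phi psi : 'rV[R]_N -> R) (G H : 'rV[R]_N -> 'rV[R]_N).

Local Notation mu := (lebesgue_rV R N).
Local Notation Phi := (@Phi R N B).
Local Notation Ge := (@genergy R N B).
Local Notation m0 := (@m0 R N B p rho).
Local Notation power := (@power R N p).
Local Notation test_energy := (@test_energy R N B p).
Local Notation level v := (2 * (m0 + fine (power v) / p)).

Lemma fine_genergy_le psi (E : R) : test_function psi -> (Ge psi <= E%:E)%E -> fine (Ge psi) <= E.
Proof. by move=> tp; rewrite -lee_fin -(genergy_fine HB tp). Qed.

(** The bound from below by [m0], extended from test functions to every function of the ball with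
    finite relaxed energy: [energy_lower] is applied to approximating test functions and the
    tolerance tends to 0. *)
Lemma relaxed_energy_ge v (E : R) : measurable_fun setT v ->
  (\int[mu]_x (v x ^+ 2)%:E <= (rho ^+ 2)%:E)%E -> relaxed B v E ->
  power v \is a fin_num /\ level v <= E.
Proof.
move=> mv v2 rv; have EE : E < E + 1 by rewrite ltrDl.
have [vf H] := energy_lower HB N0 p2 pr r0 mv v2 (ex_intro2 _ _ E EE rv).
split => //; apply/ler_addgt0Pl => e e0; have e2 : 0 < e / 2 by rewrite divr_gt0.
have [del d0 dP] := H _ e2.
have s0 : 0 < Num.min del (Num.min 1 (e / 2)) by rewrite !lt_min d0 ltr01.
have [psi [tp pv pE]] := rv _ s0.
have h1 := fine_genergy_le tp pE.
have k1 : Num.min del (Num.min 1 (e / 2)) <= 1 by rewrite !ge_min lexx !orbT.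
have k2 : Num.min del (Num.min 1 (e / 2)) <= e / 2 by rewrite !ge_min lexx !orbT.
have [||_ h2] := dP psi tp.
- by apply: le_trans h1 _; rewrite lerD2l.
- by apply: le_trans pv _; rewrite lee_fin ge_min lexx.
by lra.
Qed.

Lemma genergy_mid psi psi' (a : R) : test_function psi -> test_function psi' ->
  (Ge psi <= a%:E)%E -> (Ge psi' <= a%:E)%E ->
  (Ge (fun x => (2^-1 * (psi x + psi' x))%R)
   + \int[mu]_x (Phi (2^-1 *: (cgrad psi x - cgrad psi' x)))%:E <= a%:E)%E.
Proof.
move=> tp tp' pa pa'; have mc := measurable_cgrad tp; have mc' := measurable_cgrad tp'.
have ts := testD tp tp'; have tm := testZ 2^-1 ts.
have gm x : cgrad (fun x => 2^-1 * (psi x + psi' x)) x = 2^-1 *: (cgrad psi x + cgrad psi' x).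
  by rewrite cgradZ// cgradD.
have md : measurable_fun setT (fun x => 2^-1 *: (cgrad psi x - cgrad psi' x)).
  by apply: measurable_rV_scale => //; exact: measurable_rV_sub.
rewrite /genergy -ge0_integralD//; first last.
- by apply/measurable_EFinP; exact: (measurable_Phi HB).
- by move=> x _; rewrite lee_fin (Phi_ge0 HB).
- exact: (measurable_Phi_cgrad HB tm).
- by move=> x _; rewrite lee_fin (Phi_ge0 HB).
under eq_integral do rewrite -EFinD gm.
have -> : a = 2^-1 * a + 2^-1 * a by field.
have h0 : 0 <= 2^-1 :> R by rewrite invr_ge0.
have m1 : measurable_fun setT (fun x => Phi (2^-1 *: (cgrad psi x + cgrad psi' x))).
  by apply: (measurable_Phi HB); apply: measurable_rV_scale => //; exact: measurable_rV_add.
have m2 : measurable_fun setT (fun x => Phi (2^-1 *: (cgrad psi x - cgrad psi' x))) by exact: (measurable_Phi HB).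
apply: (integral_lin_le h0 h0 (measurable_Phi HB mc) (measurable_Phi HB mc') (measurable_funD m1 m2) _ _ _ _ pa pa').
- by move=> x; exact: (Phi_ge0 HB).
- by move=> x; exact: (Phi_ge0 HB).
- by move=> x; apply: addr_ge0; exact: (Phi_ge0 HB).
- by move=> x; rewrite -mulrDr; exact: (clarkson HB).
Qed.

Lemma sqr_mid psi psi' v (a : R) : test_function psi -> test_function psi' -> measurable_fun setT v ->
  (\int[mu]_x ((psi x - v x) ^+ 2)%:E <= a%:E)%E -> (\int[mu]_x ((psi' x - v x) ^+ 2)%:E <= a%:E)%E ->
  (\int[mu]_x ((2^-1 * (psi x + psi' x) - v x) ^+ 2)%:E <= a%:E)%E.
Proof.
move=> tp tp' mv pa pa'; have mp := test_meas tp; have mp' := test_meas tp'.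
have -> : a = 2^-1 * a + 2^-1 * a by field.
apply: (@integral_lin_le _ _ _ mu (fun x => (psi x - v x) ^+ 2) (fun x => (psi' x - v x) ^+ 2)) => //.
- by apply: measurable_funX; exact: measurable_funB.
- by apply: measurable_funX; exact: measurable_funB.
- apply: measurable_funX; apply: measurable_funB => //; apply: measurable_funM => //.
  exact: measurable_funD.
- by move=> x; exact: sqr_ge0.
- by move=> x; exact: sqr_ge0.
- by move=> x; exact: sqr_ge0.
move=> x; rewrite -subr_ge0 [leRHS](_ : _ = (2^-1 * (psi x - psi' x)) ^+ 2) ?sqr_ge0//.
by field.
Qed.

(** The midpoint of two almost optimal test functions near v is again near v, so its energy is at
    least [level v] up to a small error. Clarkson's inequality leaves only this error, plus d, for
    the half difference of the gradients. *)
Lemma gradient_cauchy v : measurable_fun setT v ->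
  (\int[mu]_x (v x ^+ 2)%:E <= (rho ^+ 2)%:E)%E -> relaxed B v (level v) ->
  forall e : R, 0 < e -> exists2 d : R, 0 < d & forall psi psi',
    test_function psi -> test_function psi' ->
    (\int[mu]_x ((psi x - v x) ^+ 2)%:E <= d%:E)%E -> (\int[mu]_x ((psi' x - v x) ^+ 2)%:E <= d%:E)%E ->
    (Ge psi <= (level v + d)%:E)%E -> (Ge psi' <= (level v + d)%:E)%E ->
    (\int[mu]_x (Phi (cgrad psi x - cgrad psi' x))%:E <= e%:E)%E.
Proof.
move=> mv v2 rv e e0; have [K K0 KP] := Phi_scale_le N HB 2.
have EE : level v < level v + 1 by rewrite ltrDl.
have [_ H] := energy_lower HB N0 p2 pr r0 mv v2 (ex_intro2 _ _ (level v) EE rv).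
have K1 : 0 < 2 * (K + 1) by rewrite mulr_gt0// ltr_wpDl.
pose e' := e / (2 * (K + 1)); have e'0 : 0 < e' by rewrite divr_gt0.
have eK : e' * (2 * (K + 1)) = e by rewrite /e' mulfVK// gt_eqF.
have [del d0 dP] := H _ e'0; pose d := Num.min del (Num.min 1 e').
have dd : d <= del by rewrite ge_min lexx.
have d1 : d <= 1 by rewrite !ge_min lexx !orbT.
have de : d <= e' by rewrite !ge_min lexx !orbT.
exists d => [|psi psi' tp tp' pv pv' pE pE']; first by rewrite !lt_min d0 ltr01.
move: (level v) dP pE pE' => E dP pE pE'.
have S := genergy_mid tp tp' pE pE'; have ts := testD tp tp'; have tm := testZ 2^-1 ts.
have I0 : (0 <= \int[mu]_x (Phi (2^-1 *: (cgrad psi x - cgrad psi' x)))%:E)%E.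
  by apply: integral_ge0 => x _; rewrite lee_fin (Phi_ge0 HB).
have S1 : (Ge (fun x => (2^-1 * (psi x + psi' x))%R) <= (E + d)%:E)%E.
  by apply: le_trans S; rewrite leeDl.
have h1 := fine_genergy_le tm S1.
have [||_ h2] := dP _ tm.
- by apply: le_trans h1 _; rewrite lerD2l.
- by apply: le_trans (sqr_mid tp tp' mv pv pv') _; rewrite lee_fin.
have I2 : (\int[mu]_x (Phi (2^-1 *: (cgrad psi x - cgrad psi' x)))%:E <= (2 * e')%:E)%E.
  move: S; rewrite (genergy_fine HB tm); move: I0 h2.
  move: (fine (Ge _)) (\int[mu]_x _)%E => g; case=> [i|//|//]; rewrite !lee_fin => _ h2 S.
  by lra.
have md : measurable_fun setT (fun x => cgrad psi x - cgrad psi' x).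
  by apply: measurable_rV_sub; exact: measurable_cgrad.
apply: le_trans (_ : (K * (2 * e') + 0 * (2 * e'))%:E <= _)%E; last first.
  rewrite lee_fin mul0r addr0 mulrA -eK mulrC ler_pM2l//.
  by lra.
apply: (@integral_lin_le _ _ _ mu (fun x => Phi (2^-1 *: (cgrad psi x - cgrad psi' x)))
  (fun x => Phi (2^-1 *: (cgrad psi x - cgrad psi' x)))) => //.
- by apply: (measurable_Phi HB); exact: measurable_rV_scale.
- by apply: (measurable_Phi HB); exact: measurable_rV_scale.
- exact: (measurable_Phi HB).
- by move=> x; exact: (Phi_ge0 HB).
- by move=> x; exact: (Phi_ge0 HB).
- by move=> x; exact: (Phi_ge0 HB).
move=> x; rewrite mul0r addr0; apply: le_trans (KP _).
by rewrite scalerA divff// scale1r.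
Qed.

(** Running minima of the Cauchy thresholds: a test function chosen at a late stage then also meets
    all earlier thresholds. *)
Lemma antitone_minorant (d : nat -> R) : (forall n, 0 < d n) ->
  exists dm : nat -> R, (forall n, 0 < dm n) /\ forall n m, (n <= m)%N -> dm m <= d n.
Proof.
move=> d0; pose dm := fix f n := if n is k.+1 then Num.min (f k) (d k.+1) else d 0%N.
have dmS n : dm n.+1 = Num.min (dm n) (d n.+1) by [].
exists dm; split; first by elim=> [|n IH]; [exact: d0|rewrite dmS lt_min IH d0].
move=> n; elim=> [|m IH]; first by rewrite leqn0 => /eqP ->.
rewrite leq_eqVlt => /orP[/eqP ->|]; first by rewrite dmS ge_min lexx orbT.
by rewrite ltnS => /IH h; rewrite dmS ge_min h.
Qed.

Lemma inv8_small (M e : R) : 0 <= M -> 0 < e -> exists n, M * 8^-1 ^+ n <= e.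
Proof.
move=> M0 e0; exists (Num.truncn (M / e)).+1; rewrite exprVn ler_pdivrMr ?exprn_gt0//.
rewrite -ler_pdivrMl// mulrC; apply: ltW; apply: lt_trans (truncnS_gt _) _.
by rewrite -natrX ltr_nat ltn_expl.
Qed.

(** Test functions realizing the relaxed energy have Cauchy gradients by [gradient_cauchy];
    completeness supplies G, and the optimal relaxed bound becomes an equality for the integral of
    [Phi (G x)]. *)
Lemma relaxed_sobolev v : measurable_fun setT v ->
  (\int[mu]_x (v x ^+ 2)%:E <= (rho ^+ 2)%:E)%E -> relaxed B v (level v) ->
  exists G, sobolev B v G /\ (\int[mu]_x (Phi (G x))%:E = (level v)%:E)%E.
Proof.
move=> mv v2 rv; have c10 := profile_c1 HB; have c20 := profile_c2 HB.
have e8 n : 0 < 8^-1 ^+ n :> R by rewrite exprn_gt0// invr_gt0.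
have Hd n : exists d : R, 0 < d /\ forall psi psi',
    test_function psi -> test_function psi' ->
    (\int[mu]_x ((psi x - v x) ^+ 2)%:E <= d%:E)%E -> (\int[mu]_x ((psi' x - v x) ^+ 2)%:E <= d%:E)%E ->
    (Ge psi <= (level v + d)%:E)%E -> (Ge psi' <= (level v + d)%:E)%E ->
    (\int[mu]_x (Phi (cgrad psi x - cgrad psi' x))%:E <= (c1 * 8^-1 ^+ n)%:E)%E.
  have [d d0 dP] := gradient_cauchy mv v2 rv (mulr_gt0 c10 (e8 n)).
  by exists d.
have [d dP] := choice Hd.
have [|dm [dm0 dmP]] := @antitone_minorant (fun n => Num.min (d n) (8^-1 ^+ n)).
  by move=> n; rewrite lt_min (dP n).1 e8.
have dmd n m : (n <= m)%N -> dm m <= d n.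
  by move=> nm; apply: le_trans (dmP n m nm) _; rewrite ge_min lexx.
have dm8 n : dm n <= 8^-1 ^+ n by apply: le_trans (dmP n n (leqnn n)) _; rewrite ge_min lexx orbT.
have Hpsi n := rv _ (dm0 n).
have [psi psiP] := choice Hpsi.
have tp n : test_function (psi n) by have [] := psiP n.
have pv n m : (n <= m)%N -> (\int[mu]_x ((psi m x - v x) ^+ 2)%:E <= (d n)%:E)%E.
  by move=> nm; have [_ h _] := psiP m; apply: le_trans h _; rewrite lee_fin dmd.
have pE n m : (n <= m)%N -> (Ge (psi m) <= (level v + d n)%:E)%E.
  by move=> nm; have [_ _ h] := psiP m; apply: le_trans h _; rewrite lee_fin lerD2l dmd.
have [G [mG GP]] : exists G, measurable_fun setT G /\
    forall n, (\int[mu]_x (Phi (cgrad (psi n) x - G x))%:E <= (2 * c2 * 8^-1 ^+ n)%:E)%E.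
  apply: (gradient_complete HB tp) => n m nm.
  have [_ h] := dP n; apply: h => //; [exact: pv|exact: pv|exact: pE|exact: pE].
have sG : sobolev B v G.
  split => // e e0; have [|n nP] := @inv8_small (2 * c2 + 1) e _ e0; first by lra.
  exists (psi n); split => //.
    have [_ h _] := psiP n; apply: le_trans h _; rewrite lee_fin; apply: le_trans (dm8 n) _.
    by apply: le_trans nP; rewrite ler_peMl ?(ltW (e8 n))//; lra.
  by apply: le_trans (GP n) _; rewrite lee_fin; apply: le_trans nP; rewrite ler_pM2r//; lra.
(* One inequality holds because G makes its own energy a relaxed bound, hence at least [level v];
   the other by perturbing the energies of the approximating gradients. *)
exists G; split => //; apply/le_anti/andP; split; last first.
  have [A A0 AP] := sobolev_Phi_fin HB sG.
  have I0 : (0 <= \int[mu]_x (Phi (G x))%:E)%E.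
    by apply: integral_ge0 => x _; rewrite lee_fin (Phi_ge0 HB).
  have If : (\int[mu]_x (Phi (G x))%:E)%E \is a fin_num.
    by rewrite ge0_fin_numE//; apply: le_lt_trans AP _; exact: ltry.
  rewrite -(fineK If) lee_fin.
  have rG : relaxed B v (fine (\int[mu]_x (Phi (G x))%:E)) by apply: (sobolev_relaxed HB sG); rewrite fineK.
  by have [] := relaxed_energy_ge mv v2 rG.
have E0 : 0 <= level v.
  rewrite -lee_fin; apply/lee_addgt0Pr => e e0; have [phi [_ _ h]] := rv _ e0.
  by rewrite -EFinD; apply: le_trans h; exact: (genergy_ge0 HB).
move: (level v) rv dP pE psiP E0 => E _ _ _ psiP E0.
apply/lee_addgt0Pr => e e0; rewrite -EFinD.
pose th := e / (3 * (E + 1)); have E1 : 0 < 3 * (E + 1) by lra.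
have th0 : 0 < th by rewrite divr_gt0.
have thE : th * (3 * (E + 1)) = e by rewrite /th mulfVK// gt_eqF.
have [C C0 CP] := Phi_perturb N HB th0.
pose M := 3 + 3 * th + 3 * (C * (2 * c2)).
have C2 : 0 <= C * (2 * c2) by rewrite mulr_ge0// mulr_ge0// ltW.
have M0 : 0 <= M by rewrite /M; lra.
have [n nP] := @inv8_small M e M0 e0.
have [_ _ pn] := psiP n; have mc := measurable_cgrad (tp n).
apply: (@le_trans _ _ ((1 + th) * (E + dm n) + C * (2 * c2 * 8^-1 ^+ n))%:E).
  apply: (@integral_lin_le _ _ _ mu (fun x => Phi (cgrad (psi n) x)) (fun x => Phi (cgrad (psi n) x - G x))) => //.
  - by lra.
  - exact: (measurable_Phi HB).
  - by apply: (measurable_Phi HB); exact: measurable_rV_sub.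
  - exact: (measurable_Phi HB).
  - by move=> x; exact: (Phi_ge0 HB).
  - by move=> x; exact: (Phi_ge0 HB).
  - by move=> x; exact: (Phi_ge0 HB).
  - move=> x; rewrite -[Phi (_ - _)]PhiN opprB; apply: le_trans (CP _ _).
    by rewrite addrC subrK.
rewrite lee_fin mulrDr [C * _]mulrA.
have h1 : (1 + th) * dm n <= (1 + th) * 8^-1 ^+ n by rewrite ler_wpM2l ?dm8// addr_ge0// ltW.
move: nP h1 C2 (e8 n); rewrite /M.
move: (C * (2 * c2)) (8^-1 ^+ n) (dm n) => X Y Z nP h1 X0 Y0.
have hz : (1 + th) * Y + X * Y <= e / 3 by lra.
by lra.
Qed.

(** Under x |-> x / t with t >= 1 the gradient shrinks pointwise while both integrals gain the
    factor t^N, so the energy becomes at most t^N times as large. For energies near [m0 < 0] this is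
    a strict decrease. *)
Lemma relaxed_norm v : measurable_fun setT v ->
  (\int[mu]_x (v x ^+ 2)%:E <= (rho ^+ 2)%:E)%E -> relaxed B v (level v) ->
  (\int[mu]_x (v x ^+ 2)%:E = (rho ^+ 2)%:E)%E.
Proof.
move=> mv v2 rv; apply/eqP; rewrite eq_le v2/= leNgt; apply/negP => lt2.
have p0 : 0 < p by apply: lt_trans p2.
have I0 : (0 <= \int[mu]_x (v x ^+ 2)%:E)%E by apply: integral_ge0 => x _; rewrite lee_fin sqr_ge0.
have [a a0 aE] : exists2 a : R, 0 <= a & (\int[mu]_x (v x ^+ 2)%:E = a%:E)%E.
  move: I0 lt2; case: (\int[mu]_x _)%E => [a|//|//] I0 _.
  by exists a.
move: lt2; rewrite aE lte_fin => lt2.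
have mlt := m0_lt0 HB N0 p2 pr r0.
(* [b] lies strictly between the squared norm of [v] and [rho ^+ 2]; dilating
   by [t] raises [b] to [rho ^+ 2] and multiplies the negative infimum by
   [t ^+ N > 1]. *)
pose b := (a + rho ^+ 2) / 2.
have ab : a < b by rewrite /b; lra.
have b0 : 0 < b by apply: le_lt_trans ab.
have br : b < rho ^+ 2 by rewrite /b; lra.
pose t := (rho ^+ 2 / b) `^ N%:R^-1.
have rb1 : 1 < rho ^+ 2 / b by rewrite ltr_pdivlMr// mul1r.
have rb0 : 0 < rho ^+ 2 / b by apply: lt_trans rb1.
have t0 : 0 < t by rewrite powR_gt0.
have tN : t ^+ N = rho ^+ 2 / b.
  rewrite -powR_mulrn ?(ltW t0)// /t -powRrM mulVf ?powRr1 ?(ltW rb0)//.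
  by rewrite pnatr_eq0 -lt0n.
have t1 : 1 <= t.
  rewrite leNgt; apply/negP => t1; move: rb1; rewrite -tN ltNge exprn_ile1 ?(ltW t0)// ltW//.
(* A weight below 1 for which a / s is still less than b, leaving the room k for the approximation
   error. *)
pose s := (a + b) / (2 * b).
have s01 : 0 < s < 1.
  apply/andP; split.
    by apply: divr_gt0; [exact: ltr_wpDl|exact: mulr_gt0].
  have bb : 0 < 2 * b by exact: mulr_gt0.
  by rewrite /s (ltr_pdivrMr _ _ bb) mul1r; lra.
have sb : s^-1 * a < b.
  move: s01 => /andP[s0 _]; rewrite ltr_pdivrMl// /s -mulrA.
  have -> : (2 * b)^-1 * b = 2^-1 by rewrite invfM mulfVK// gt_eqF.
  by lra.
pose k := b - s^-1 * a; have k0 : 0 < k by rewrite subr_gt0.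
(* Half of the admissible error: t^N (m0 + eps) is the mean of t^N m0 and m0, hence below m0. *)
pose eps := - m0 * (1 - (t ^+ N)^-1) / 2.
have tN1 : (t ^+ N)^-1 < 1 by rewrite tN invf_lt1.
have eps0 : 0 < eps.
  by rewrite /eps divr_gt0// mulr_gt0 ?oppr_gt0 ?subr_gt0.
have epE : t ^+ N * (m0 + eps) < m0.
  have TN0 : 0 < t ^+ N by rewrite exprn_gt0.
  have -> : t ^+ N * (m0 + eps) = m0 * (t ^+ N + 1) / 2.
    by rewrite /eps; field; rewrite gt_eqF.
  have : 1 < t ^+ N by rewrite tN.
  move: (t ^+ N) => T T1; rewrite -subr_gt0 (_ : m0 - _ = (- m0) * (T - 1) / 2); last by field.
  by rewrite divr_gt0// mulr_gt0 ?subr_gt0 ?oppr_gt0.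
have EE : level v < level v + 1 by rewrite ltrDl.
have [vf H] := energy_lower HB N0 p2 pr r0 mv v2 (ex_intro2 _ _ (level v) EE rv).
have [del d0 dP] := H _ eps0.
have s1 : 0 < 1 - s by rewrite subr_gt0; case/andP: s01.
pose d := Num.min del (Num.min (Num.min 1 eps) ((1 - s) * k)).
have dd : d <= del by rewrite ge_min lexx.
have d1 : d <= 1 by rewrite !ge_min lexx !orbT.
have de : d <= eps by rewrite !ge_min lexx !orbT.
have dk : d <= (1 - s) * k by rewrite !ge_min lexx !orbT.
have dgt : 0 < d by rewrite !lt_min d0 ltr01 eps0 mulr_gt0.
have [psi [tp pv pE]] := rv _ dgt; have hE := fine_genergy_le tp pE.
have [||hP _] := dP psi tp.
- by apply: le_trans hE _; rewrite lerD2l.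
- by apply: le_trans pv _; rewrite lee_fin.
have pb : (\int[mu]_x (psi x ^+ 2)%:E <= b%:E)%E.
  have mB : measurable_fun setT (fun x => psi x - v x) by apply: measurable_funB => //; exact: test_meas.
  have va : (\int[mu]_x (v x ^+ 2)%:E <= a%:E)%E by rewrite aE.
  have := integral_sqrD_weighted s01 mv mB va pv.
  under [X in (X <= _)%E -> _]eq_integral do rewrite addrC subrK.
  move/le_trans; apply; rewrite lee_fin -lerBrDl -/k.
  by rewrite ler_pdivrMl// mulrC -ler_pdivrMr// mulrC ler_pdivrMl// mulrC.
have td := dilate_test t0 tp.
have bd : test_ball rho (dilate t psi).
  split => //; rewrite integral_sqr_dilate//.
  apply: (@le_trans _ _ ((t ^+ N)%:E * b%:E)%E); first by rewrite lee_wpmul2l// lee_fin exprn_ge0// ltW.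
  by rewrite -EFinM tN mulfVK// gt_eqF.
have := m0_le HB N0 p2 pr r0 bd; rewrite /test_energy power_dilate//.
have gd : fine (Ge (dilate t psi)) <= t ^+ N * 1 * fine (Ge psi).
  have := @genergy_dilate R N B q c1 c2 HB t t0 1 1 psi ler01 tp.
  have -> : (fun x => 1 * dilate t psi x) = dilate t psi by apply/funext => x; rewrite mul1r.
  apply => xi; rewrite !mul1r; apply: (Phi_le HB).
  by rewrite ger0_norm ?invr_ge0 ?(ltW t0)// invf_le1.
rewrite fineM ?power_fin// -?/p//.
have pP : fine (power v) - eps <= fine (power psi) by move: hP; rewrite ler_distl => /andP[].
rewrite mulr1 in gd; move=> hm.
have TN0 : 0 < t ^+ N by rewrite exprn_gt0.
have concl (m g' g P' P : R) : t ^+ N * (m + eps) < m -> g' <= t ^+ N * g -> P - eps <= P' ->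
    g <= 2 * (m + P / p) + d -> m <= g' / 2 - t ^+ N * P' / p -> False.
  move=> {}epE {}gd {}pP {}hE {}hm.
  have hp : eps / p <= eps / 2 by rewrite ler_pM2l// lef_pV2 ?posrE// ltW.
  have P2 : P / p - eps / 2 <= P' / p.
    apply: le_trans (_ : (P - eps) / p <= _); last by rewrite ler_pM2r// invr_gt0.
    by rewrite mulrBl lerD2l lerN2.
  have h : g' / 2 - t ^+ N * P' / p <= t ^+ N * (m + eps).
    apply: le_trans (_ : t ^+ N * (g / 2 - P' / p) <= _).
      by rewrite mulrBr [in leRHS]mulrA [t ^+ N * (P' / p)]mulrA lerD2r ler_pM2r// invr_gt0.
    by rewrite ler_pM2l//; lra.
  by have := le_lt_trans (le_trans hm h) epE; rewrite ltxx.
exact: (concl _ _ _ _ _ epE gd pP hE hm).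
Qed.

End minimizer.

(** * The Euler-Lagrange equation *)

Section power_quotients.
Variable R : realType.
Implicit Types a c : R.

Local Notation tn := (fun n : nat => n.+1%:R^-1 : R).

Lemma harmonic_itv n : 0 < tn n <= 1.
Proof. by rewrite invr_gt0 ltr0n/= invf_le1// ler1n. Qed.

Let deriv (p a c t : R) : 2 < p -> is_derive (a + t *: c : R) c (fun s : R => `|s| `^ p)
  (c * (p * (`|a + t * c| `^ (p - 2) * (a + t * c)))).
Proof.
move=> p2; have := is_derive_dirZ c (is_derive_abs_powR (a + t * c) p2).
by rewrite [c *: 1]mulr1.
Qed.

Lemma abs_powR_quotient_le (p a c t : R) : 2 < p -> 0 < t <= 1 ->
  `|t^-1 * (`|a + t * c| `^ p - `|a| `^ p)| <= p * (`|a| + `|c|) `^ p.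
Proof.
move=> p2 /andP[t0 t1]; have p0 : 0 < p by apply: lt_trans p2.
have [s st E] := MVT_dir t (fun s => @deriv p a c s p2).
rewrite /= in E; rewrite E mulrC mulfK ?gt_eqF//.
rewrite !normrM (gtr0_norm p0) mulrCA ler_pM2l// [`| _ `^ _|]ger0_norm ?powR_ge0//.
have z0 : 0 <= `|a| + `|c| by rewrite addr_ge0.
have s1 : `|s| <= 1 by apply: le_trans st _; rewrite ger0_norm// ltW.
have h1 : `|a + s * c| <= `|a| + `|c|.
  by apply: le_trans (ler_normD _ _) _; rewrite lerD2l normrM ler_piMl.
have h2 : `|a + s * c| `^ (p - 2) <= (`|a| + `|c|) `^ (p - 2).
  by rewrite ge0_ler_powR ?nnegrE// subr_ge0 ltW.
have -> : (`|a| + `|c|) `^ p = (`|a| + `|c|) * ((`|a| + `|c|) `^ (p - 2) * (`|a| + `|c|)).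
  by rewrite -[in LHS](ger0_norm z0) abs_powR2// (ger0_norm z0) expr2; ring.
have X0 : 0 <= `|a + s * c| `^ (p - 2) * `|a + s * c| by rewrite mulr_ge0// powR_ge0.
apply: (ler_pM (normr_ge0 c) X0); first by rewrite lerDr.
exact: (ler_pM (powR_ge0 _ _) (normr_ge0 _) h2 h1).
Qed.

Lemma abs_powR_quotient_cvg (p a c : R) : 2 < p ->
  (tn n)^-1 * (`|a + tn n * c| `^ p - `|a| `^ p) @[n --> \oo] --> c * (p * (`|a| `^ (p - 2) * a)).
Proof.
move=> p2; have /is_derive_eps H := @deriv p a c 0 p2.
rewrite !scale0r !mul0r !addr0 in H; apply/cvgrPdist_le => e e0; have [d d0 dP] := H e e0.
have : \forall n \near \oo, `|tn n| < d.
  have /cvgrPdist_lt/(_ _ d0) := @cvg_harmonic R; apply: filterS => n.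
  by rewrite sub0r normrN.
apply: filterS => n nd; have /andP[t0 _] := harmonic_itv n; have := dP _ nd.
move: (tn n) t0 {nd} => t t0; rewrite [t *: c + a]addrC (gtr0_norm t0).
rewrite -ler_pdivrMr// -[X in _ / X](gtr0_norm t0) -normf_div distrC => h.
apply: le_trans h; rewrite le_eqVlt; apply/orP; left; apply/eqP; congr (`| _ |).
by rewrite -[t *: c]/(t * c); field; rewrite gt_eqF.
Qed.

End power_quotients.

Section euler_lagrange.
Variables (R : realType) (N : nat) (B b : R -> R) (q c1 c2 p rho : R).
Hypothesis HB : profile B q c1 c2.
Hypothesis b_ge0 : forall s : R, 0 <= s -> 0 <= b s.
Hypothesis b_le : forall s t : R, 0 <= s -> s <= t -> b s <= b t.
Hypothesis b_growth : forall s : R, b (s ^+ 2) * s ^+ 2 <= c2 * (s ^+ 2 + `|s| `^ q).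
Hypothesis b_tangent : forall s t : R, 0 <= s -> 0 <= t -> B t - B s <= b t * (t - s).
Hypothesis b_cvg : forall (s : nat -> R) (l : R), (forall n, 0 <= s n) -> 0 <= l ->
  s n @[n --> \oo] --> l -> b (s n) @[n --> \oo] --> b l.
Hypothesis N0 : (0 < N)%N.
Hypothesis p2 : 2 < p.
Hypothesis pr : p < 2 + 4 / N%:R.
Hypothesis r0 : 0 < rho.
Implicit Types (u v phi psi : 'rV[R]_N -> R) (G H : 'rV[R]_N -> 'rV[R]_N).
Implicit Types (xi eta : 'rV[R]_N).

Local Notation mu := (lebesgue_rV R N).
Local Notation Phi := (@Phi R N B).
Local Notation m0 := (@m0 R N B p rho).
Local Notation power := (@power R N p).
Local Notation level v := (2 * (m0 + fine (power v) / p)).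
Local Notation sobolev := (@sobolev R N B).
Local Notation tn := (fun n : nat => n.+1%:R^-1 : R).

Let q2 : 2 <= q. Proof. exact: profile_q HB. Qed.
Let c10 : 0 < c1. Proof. exact: profile_c1 HB. Qed.
Let c20 : 0 < c2. Proof. exact: profile_c2 HB. Qed.
Let p0 : 0 < p. Proof. exact: lt_trans p2. Qed.

Lemma measurable_b (f : 'rV[R]_N -> R) : measurable_fun setT f -> (forall x, 0 <= f x) ->
  measurable_fun setT (fun x => b (f x)).
Proof.
move=> mf f0; have -> : (fun x => b (f x)) = (fun s => b (Num.max 0 s)) \o f.
  by apply/funext => x /=; rewrite max_r.
apply: measurableT_comp => //; apply: nondecreasing_measurable => // s t st.
apply: b_le; first by rewrite le_max lexx.
by rewrite ge_max !le_max lexx st orbT.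
Qed.

(** From (x + y)^2 <= 2 (x^2 + y^2) and (x + y)^q <= 2^q (x^q + y^q) in the upper growth bound,
    divided by the lower growth constant. *)
Let K := c2 * (2 + 2 `^ q) / c1.

Let K0 : 0 <= K.
Proof. by rewrite /K divr_ge0 ?(ltW c10)// mulr_ge0 ?(ltW c20)// addr_ge0// powR_ge0. Qed.

(** Both factors are controlled by z = |xi| + |eta|: b by monotonicity through b(z^2), the other by
    z^2. The growth of b(z^2) z^2 then gives a majorant uniform in t. *)
Lemma b_dominated (t : R) xi eta : 0 <= t <= 1 ->
  `|b (dot (xi + t *: eta) (xi + t *: eta)) * (dot xi eta + t / 2 * dot eta eta)|
  <= K * Phi xi + K * Phi eta.
Proof.
move=> /andP[t0 t1]; pose z := enorm xi + enorm eta.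
have x0 := enorm_ge0 xi; have e0 := enorm_ge0 eta.
have z0 : 0 <= z by rewrite addr_ge0.
have h1 : b (dot (xi + t *: eta) (xi + t *: eta)) <= b (z ^+ 2).
  apply: b_le (dot_ge0 _) _; rewrite -enormE ler_sqr ?nnegrE ?enorm_ge0//.
  apply: le_trans (enormD _ _) _; rewrite lerD2l enormZ ger0_norm//.
  by rewrite ler_piMl.
have h2 : `|dot xi eta + t / 2 * dot eta eta| <= z ^+ 2.
  apply: le_trans (ler_normD _ _) _.
  have k1 := norm_dot_le xi eta.
  have k2 : `|t / 2 * dot eta eta| <= enorm eta ^+ 2.
    rewrite -enormE normrM [X in _ * X]ger0_norm ?sqr_ge0// ler_piMl ?sqr_ge0//.
    by rewrite ger0_norm ?divr_ge0//; lra.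
  rewrite /z sqrrD; move: k1 k2 (sqr_ge0 (enorm xi)) (mulr_ge0 x0 e0); lra.
rewrite normrM ger0_norm ?b_ge0 ?dot_ge0//.
apply: le_trans (_ : b (z ^+ 2) * z ^+ 2 <= _).
  by apply: ler_pM => //; apply: b_ge0; exact: dot_ge0.
apply: le_trans (b_growth z) _.
have f1 := Phi_lower HB xi; have f2 := Phi_lower HB eta.
have f3 := Phi_lower_q HB xi; have f4 := Phi_lower_q HB eta.
have z2 : z ^+ 2 <= 2 * (dot xi xi + dot eta eta).
  by rewrite -!enormE /z sqrrD; have := sqr_ge0 (enorm xi - enorm eta); rewrite sqrrB; lra.
have zq : `|z| `^ q <= 2 `^ q * (enorm xi `^ q + enorm eta `^ q).
  have := @abs_powRD_le R q (enorm xi) (enorm eta) (le_trans (ltW (ltr0Sn _ 1)) q2).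
  by rewrite [`|enorm xi|]ger0_norm// [`|enorm eta|]ger0_norm.
rewrite /K -mulrDr; apply: le_trans (_ : c2 * ((2 + 2 `^ q) * (c1^-1 * (Phi xi + Phi eta))) <= _); last first.
  by rewrite !mulrA.
rewrite ler_pM2l// mulrDl; apply: lerD.
  apply: le_trans z2 _; rewrite ler_pM2l// ler_pdivlMl// mulrDr.
  exact: lerD.
apply: le_trans zq _; rewrite ler_wpM2l ?powR_ge0// ler_pdivlMl// mulrDr.
exact: lerD.
Qed.

Lemma integrable_Phi u G : sobolev u G -> mu.-integrable setT (EFin \o (fun x => Phi (G x))).
Proof.
move=> uG; have [A _ AP] := sobolev_Phi_fin HB uG; have [_ mG _] := uG.
by apply: (ge0_integrable_le _ _ AP) => [|x]; [exact: (measurable_Phi HB)|exact: (Phi_ge0 HB)].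
Qed.

Lemma integrable_b_majorant u v G H : sobolev u G -> sobolev v H ->
  mu.-integrable setT (EFin \o (fun x => K * Phi (G x) + K * Phi (H x))).
Proof.
move=> uG vH.
have := integrableD measurableT (integrableZl measurableT K (integrable_Phi uG))
  (integrableZl measurableT K (integrable_Phi vH)).
by apply: eq_integrable.
Qed.

Let measurable_b_term (t : R) G H : measurable_fun setT G -> measurable_fun setT H ->
  measurable_fun setT (fun x => b (dot (G x + t *: H x) (G x + t *: H x)) *
    (dot (G x) (H x) + t / 2 * dot (H x) (H x))).
Proof.
move=> mG mH; have mS : measurable_fun setT (fun x => G x + t *: H x).
  by apply: measurable_rV_add => //; exact: measurable_rV_scale.
apply: measurable_funM; first by apply: measurable_b => [|x]; [exact: measurable_dot|exact: dot_ge0].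
by apply: measurable_funD; [exact: measurable_dot|apply: measurable_funM => //; exact: measurable_dot].
Qed.

Lemma integrable_flux u v G H : sobolev u G -> sobolev v H ->
  mu.-integrable setT (EFin \o (fun x => b (dot (G x) (G x)) * dot (G x) (H x))).
Proof.
move=> uG vH; have [_ mG _] := uG; have [_ mH _] := vH.
apply: le_integrable (integrable_b_majorant uG vH) => //.
  apply/measurable_EFinP; apply: measurable_funM; last exact: measurable_dot.
  by apply: measurable_b => [|x]; [exact: measurable_dot|exact: dot_ge0].
move=> x _ /=; rewrite lee_fin; have := @b_dominated 0 (G x) (H x).
rewrite lexx ler01 scale0r addr0 !mul0r addr0 => /(_ isT) /le_trans; apply.
exact: ler_norm.
Qed.

Lemma sobolev_power_fin u G : sobolev u G -> power u \is a fin_num.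
Proof.
move=> uG; have [A A0 AP] := sobolev_sqr_fin uG; have [E _ EP] := sobolev_Phi_fin HB uG.
(* Finiteness of the power was proved in a ball of any positive radius; A + 1 qualifies, its square
   being at least A. *)
have A1 : 0 < A + 1 by rewrite ltr_wpDl.
have [mu_ _ _] := uG; have rE := sobolev_relaxed HB uG EP.
have uA : (\int[mu]_x (u x ^+ 2)%:E <= ((A + 1) ^+ 2)%:E)%E.
  by apply: le_trans AP _; rewrite lee_fin expr2 mulrDr mulr1 !mulrDl; have := mulr_ge0 A0 A0; lra.
by have [] := relaxed_energy_ge HB N0 p2 pr A1 mu_ uA rE.
Qed.

Lemma integrable_power u G : sobolev u G -> mu.-integrable setT (EFin \o (fun x => `|u x| `^ p)).
Proof.
move=> uG; have pf := sobolev_power_fin uG; have [mu_ _ _] := uG.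
apply: (@ge0_integrable_le R N _ (fine (power u))) => [|x|].
- exact: measurable_power.
- exact: powR_ge0.
- by rewrite fineK.
Qed.

Lemma integrable_power_majorant u v G H : sobolev u G -> sobolev v H ->
  mu.-integrable setT (EFin \o (fun x => p * (`|u x| + `|v x|) `^ p)).
Proof.
move=> uG vH; have [mu_ _ _] := uG; have [mv _ _] := vH.
have iS := integrableD measurableT (integrableZl measurableT (p * 2 `^ p) (integrable_power uG))
  (integrableZl measurableT (p * 2 `^ p) (integrable_power vH)).
apply: le_integrable iS => //.
  apply/measurable_EFinP; apply: measurable_funM => //.
  apply: (measurableT_comp (measurable_powR p)).
  by apply: measurable_funD; exact: measurableT_comp.
move=> x _; rewrite [leRHS](_ : _ = (`|p * 2 `^ p * `|u x| `^ p + p * 2 `^ p * `|v x| `^ p|)%:E)//= lee_fin.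
have s0 : 0 <= `|u x| + `|v x| by rewrite addr_ge0.
rewrite ger0_norm; last by rewrite mulr_ge0 ?powR_ge0// ltW.
rewrite [leRHS]ger0_norm; last by rewrite addr_ge0// mulr_ge0 ?powR_ge0// mulr_ge0 ?powR_ge0// ltW.
rewrite -mulrDr -mulrA ler_pM2l//.
have := @abs_powRD_le R p `|u x| `|v x| (ltW p0).
by rewrite (ger0_norm s0) !normr_id.
Qed.

Lemma measurable_reaction u : measurable_fun setT u -> measurable_fun setT (fun x => `|u x| `^ (p - 2) * u x).
Proof.
move=> mu_; apply: measurable_funM => //; apply: (measurableT_comp (measurable_powR _)).
exact: measurableT_comp.
Qed.

Lemma integrable_reaction u v G H : sobolev u G -> sobolev v H ->
  mu.-integrable setT (EFin \o (fun x => `|u x| `^ (p - 2) * u x * v x)).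
Proof.
move=> uG vH; have [mu_ _ _] := uG; have [mv _ _] := vH.
apply: le_integrable (integrable_power_majorant uG vH) => //.
  by apply/measurable_EFinP; apply: measurable_funM => //; exact: measurable_reaction.
move=> x _ /=; rewrite lee_fin [leRHS]ger0_norm; last by rewrite mulr_ge0 ?powR_ge0// ltW.
(* The integrand, up to the factor p >= 1, is a limit of difference quotients that all obey the
   majorant. *)
have C := @abs_powR_quotient_cvg R p (u x) (v x) p2.
have h : `|v x * (p * (`|u x| `^ (p - 2) * u x))| <= p * (`|u x| + `|v x|) `^ p.
  apply: (cvgr_to_le (cvg_norm C)).
  by apply: nearW => n; apply: abs_powR_quotient_le => //; exact: harmonic_itv.
apply: le_trans h; rewrite mulrC !normrM ler_wpM2l//.
have p1 : 1 <= `|p| by rewrite gtr0_norm//; apply: ltW; apply: lt_trans p2; rewrite ltr1n.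
by rewrite ler_peMl// mulr_ge0.
Qed.

(** The differential of the energy at v in the direction phi, with G and H the weak gradients of v
    and phi; the factor 1/2 cancels the 2 from differentiating |xi|^2. *)
Definition first_variation v G phi H : R :=
  \int[mu]_x (b (dot (G x) (G x)) * dot (G x) (H x)) -
  \int[mu]_x (`|v x| `^ (p - 2) * v x * phi x).

Lemma integrable_product u v G H : sobolev u G -> sobolev v H ->
  mu.-integrable setT (EFin \o (fun x => u x * v x)).
Proof.
move=> uG vH; have [mu_ _ _] := uG; have [mv _ _] := vH.
have [A _ AP] := sobolev_sqr_fin uG; have [A' _ AP'] := sobolev_sqr_fin vH.
exact: (integrable_mul_sqr mu_ mv AP AP').
Qed.

Lemma first_variation_linear v G phi psi H H' (k : R) : sobolev v G -> sobolev phi H -> sobolev psi H' ->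
  first_variation v G (fun x => phi x + k * psi x) (fun x => H x + k *: H' x) =
  first_variation v G phi H + k * first_variation v G psi H'.
Proof.
move=> vG pH qH; rewrite /first_variation.
have i1 := integrable_flux vG pH; have i2 := integrable_flux vG qH.
have i3 := integrable_reaction vG pH; have i4 := integrable_reaction vG qH.
have E1 x : b (dot (G x) (G x)) * dot (G x) (H x + k *: H' x) =
    b (dot (G x) (G x)) * dot (G x) (H x) + k * (b (dot (G x) (G x)) * dot (G x) (H' x)).
  by rewrite !dotE; ring.
have E2 x : `|v x| `^ (p - 2) * v x * (phi x + k * psi x) =
    `|v x| `^ (p - 2) * v x * phi x + k * (`|v x| `^ (p - 2) * v x * psi x) by ring.
have i2' : mu.-integrable setT (EFin \o (fun x => k * (b (dot (G x) (G x)) * dot (G x) (H' x)))).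
  by have := integrableZl measurableT k i2; apply: eq_integrable.
have i4' : mu.-integrable setT (EFin \o (fun x => k * (`|v x| `^ (p - 2) * v x * psi x))).
  by have := integrableZl measurableT k i4; apply: eq_integrable.
rewrite (eq_Rintegral _ (fun x _ => E1 x)) (eq_Rintegral _ (fun x _ => E2 x)).
rewrite (RintegralD _ i1 i2')// (RintegralD _ i3 i4')// (RintegralZl k measurableT i2) (RintegralZl k measurableT i4).
by ring.
Qed.

Lemma cvg_Rintegral (f_ : nat -> 'rV[R]_N -> R) (f : 'rV[R]_N -> R) (g : 'rV[R]_N -> R) :
  (forall n, measurable_fun setT (f_ n)) -> measurable_fun setT f ->
  (forall x, f_ n x @[n --> \oo] --> f x) -> mu.-integrable setT (EFin \o g) ->
  (forall n x, `|f_ n x| <= g x) ->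
  \int[mu]_x f_ n x @[n --> \oo] --> \int[mu]_x f x.
Proof.
move=> mf_ mf cf ig fg.
have [|||||If _ C] := @dominated_cvg_real _ _ R mu f_ f (EFin \o g) => //.
- exact: aeW.
- by apply: aeW => x n; rewrite lee_fin.
by apply: fine_cvg; rewrite fineK//; exact: (integrable_fin_num measurableT If).
Qed.

Lemma norm_perturbation v G phi H : sobolev v G -> sobolev phi H ->
  (\int[mu]_x (v x ^+ 2)%:E = (rho ^+ 2)%:E)%E -> \int[mu]_x (v x * phi x) < 0 ->
  \forall n \near \oo, (\int[mu]_x ((v x + tn n * phi x) ^+ 2)%:E <= (rho ^+ 2)%:E)%E.
Proof.
move=> vG pH v2 neg; have i1 := integrable_product vG vG.
have i2 := integrable_product vG pH; have i3 := integrable_product pH pH.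
pose s := - \int[mu]_x (v x * phi x); have s0 : 0 < s by rewrite oppr_gt0.
pose a := \int[mu]_x (phi x * phi x).
have a0 : 0 <= a by apply: Rintegral_ge0 => x _; rewrite -expr2 sqr_ge0.
have a1 : 0 < a + 1 by rewrite ltr_wpDl.
have d0 : 0 < 2 * s / (a + 1) by rewrite divr_gt0// mulr_gt0.
have : \forall n \near \oo, `|tn n| < 2 * s / (a + 1).
  have /cvgrPdist_lt/(_ _ d0) := @cvg_harmonic R; apply: filterS => n.
  by rewrite sub0r normrN.
apply: filterS => n; have /andP[t0 _] := harmonic_itv R n; move: (tn n) t0 => t t0.
rewrite (gtr0_norm t0) ltr_pdivlMr// => ht.
have i2' : mu.-integrable setT (EFin \o (fun x => 2 * t * (v x * phi x))).
  by have := integrableZl measurableT (2 * t) i2; apply: eq_integrable.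
have i3' : mu.-integrable setT (EFin \o (fun x => t ^+ 2 * (phi x * phi x))).
  by have := integrableZl measurableT (t ^+ 2) i3; apply: eq_integrable.
have i23 : mu.-integrable setT (EFin \o (fun x => 2 * t * (v x * phi x) + t ^+ 2 * (phi x * phi x))).
  by have := integrableD measurableT i2' i3'; apply: eq_integrable.
have i123 : mu.-integrable setT (EFin \o (fun x => v x * v x + (2 * t * (v x * phi x) + t ^+ 2 * (phi x * phi x)))).
  by have := integrableD measurableT i1 i23; apply: eq_integrable.
have E x : (v x + t * phi x) ^+ 2 = v x * v x + (2 * t * (v x * phi x) + t ^+ 2 * (phi x * phi x)) by ring.
under eq_integral do rewrite E.
have := integrable_fin_num measurableT i123 => /fineK <-; rewrite lee_fin.
have -> : rho ^+ 2 = \int[mu]_x (v x * v x).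
  by rewrite /Rintegral; under eq_integral do rewrite -expr2; rewrite v2.
rewrite -[leLHS]/(\int[mu]_x _) (RintegralD measurableT i1 i23) (RintegralD measurableT i2' i3').
rewrite (RintegralZl _ measurableT i2) (RintegralZl _ measurableT i3) -/a.
rewrite -[\int[mu]_x (v x * phi x)]opprK -/s gerDl.
have -> : 2 * t * - s + t ^+ 2 * a = t * (t * a - 2 * s) by ring.
rewrite pmulr_rle0// subr_le0; apply: le_trans (ltW ht).
by rewrite ler_pM2l// lerDl.
Qed.

(** Minimality of v against v + t phi, divided by t. The tangent inequality for B at the perturbed
    point bounds the gradient part from above, using |G + t H|^2 - |G|^2 = 2 t (G . H + t |H|^2 /
    2). *)
Lemma energy_perturbation v G phi H (t : R) : 0 < t <= 1 -> sobolev v G -> sobolev phi H ->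
  (\int[mu]_x ((v x + t * phi x) ^+ 2)%:E <= (rho ^+ 2)%:E)%E ->
  (\int[mu]_x (Phi (G x))%:E = (level v)%:E)%E ->
  p^-1 * \int[mu]_x (t^-1 * (`|v x + t * phi x| `^ p - `|v x| `^ p)) <=
  \int[mu]_x (b (dot (G x + t *: H x) (G x + t *: H x)) * (dot (G x) (H x) + t / 2 * dot (H x) (H x))).
Proof.
move=> /andP[t0 t1] vG pH w2 vE; have [mv mG _] := vG; have [mp mH _] := pH.
have wS := sobolevD HB vG (sobolevZ HB t pH); have [mw mS _] := wS.
have iv := integrable_power vG; have iw := integrable_power wS.
have iG := integrable_Phi vG; have iS := integrable_Phi wS.
have iT : mu.-integrable setT (EFin \o (fun x => b (dot (G x + t *: H x) (G x + t *: H x)) *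
    (dot (G x) (H x) + t / 2 * dot (H x) (H x)))).
  apply: le_integrable (integrable_b_majorant vG pH) => //.
    by apply/measurable_EFinP; exact: measurable_b_term.
  move=> x _ /=; rewrite lee_fin; apply: le_trans (ler_norm _).
  by apply: b_dominated; rewrite (ltW t0).
set T := (X in _ <= X).
have rS : relaxed B (fun x => v x + t * phi x) (\int[mu]_x Phi (G x + t *: H x)).
  apply: (sobolev_relaxed HB wS); rewrite /Rintegral fineK//.
  exact: (integrable_fin_num measurableT iS).
have [_ lS] := relaxed_energy_ge HB N0 p2 pr r0 mw w2 rS.
have iT' : mu.-integrable setT (EFin \o (fun x => 2 * t * (b (dot (G x + t *: H x) (G x + t *: H x)) *
    (dot (G x) (H x) + t / 2 * dot (H x) (H x))))).
  by have := integrableZl measurableT (2 * t) iT; apply: eq_integrable.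
have iGT : mu.-integrable setT (EFin \o (fun x => Phi (G x) + 2 * t * (b (dot (G x + t *: H x) (G x + t *: H x)) *
    (dot (G x) (H x) + t / 2 * dot (H x) (H x))))).
  by have := integrableD measurableT iG iT'; apply: eq_integrable.
have hS : \int[mu]_x Phi (G x + t *: H x) <= \int[mu]_x Phi (G x) + 2 * t * T.
  rewrite /T -(RintegralZl _ measurableT iT) -(RintegralD measurableT iG iT').
  apply: (le_Rintegral measurableT iS iGT) => x _; rewrite -lerBlDl.
  apply: le_trans (b_tangent (dot_ge0 _) (dot_ge0 _)) _.
  rewrite le_eqVlt; apply/orP; left; apply/eqP; rewrite [2 * t * _]mulrCA; congr (_ * _).
  by rewrite !dotE (dotC (H x)); field.
have GE : \int[mu]_x Phi (G x) = level v by rewrite /Rintegral vE.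
have iD : mu.-integrable setT (EFin \o (fun x => `|v x + t * phi x| `^ p - `|v x| `^ p)).
  by have := integrableB measurableT iw iv; apply: eq_integrable.
rewrite (RintegralZl _ measurableT iD) (RintegralB measurableT iw iv).
rewrite GE in hS.
have concl (m W V P : R) : 2 * (m + W / p) <= P -> P <= 2 * (m + V / p) + 2 * t * T ->
    p^-1 * (t^-1 * (W - V)) <= T.
  move=> h1 h2; rewrite mulrCA ler_pdivrMl// mulrC.
  have := le_trans h1 h2; rewrite !mulrDr -addrA lerD2l -mulrA -mulrDr ler_pM2l// => h3.
  by rewrite mulrBl lerBlDl.
exact: (concl _ _ _ _ lS hS).
Qed.

(** A direction of negative scalar product with v stays in the ball for small steps, so
    [energy_perturbation] applies along t = 1 / (n + 1). Both sides converge dominatedly. *)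
Lemma first_variation_ge0 v G phi H : sobolev v G -> sobolev phi H ->
  (\int[mu]_x (v x ^+ 2)%:E = (rho ^+ 2)%:E)%E -> (\int[mu]_x (Phi (G x))%:E = (level v)%:E)%E ->
  \int[mu]_x (v x * phi x) < 0 -> 0 <= first_variation v G phi H.
Proof.
move=> vG pH v2 vE neg; have [mv mG _] := vG; have [mp mH _] := pH.
have t0 : tn n @[n --> \oo] --> (0 : R) := @cvg_harmonic R.
have hn := norm_perturbation vG pH v2 neg.
have cP : p^-1 * \int[mu]_x ((tn n)^-1 * (`|v x + tn n * phi x| `^ p - `|v x| `^ p)) @[n --> \oo] -->
    \int[mu]_x (`|v x| `^ (p - 2) * v x * phi x).
  have -> : \int[mu]_x (`|v x| `^ (p - 2) * v x * phi x) =
      p^-1 * \int[mu]_x (phi x * (p * (`|v x| `^ (p - 2) * v x))).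
    have i := integrable_reaction vG pH.
    rewrite -[LHS](mulKf (lt0r_neq0 p0)) -(RintegralZl _ measurableT i); congr (_ * _).
    by apply: eq_Rintegral => x _; ring.
  apply: cvgM; first exact: cvg_cst.
  apply: (cvg_Rintegral _ _ _ (integrable_power_majorant vG pH)).
  - move=> n; apply: measurable_funM => //; apply: measurable_funB; apply: measurable_power p2 _ _ => //.
    by apply: measurable_funD => //; exact: measurable_funM.
  - by apply: measurable_funM => //; apply: measurable_funM => //; exact: measurable_reaction.
  - by move=> x; exact: abs_powR_quotient_cvg.
  - by move=> n x; apply: abs_powR_quotient_le => //; exact: harmonic_itv.
have cT : \int[mu]_x (b (dot (G x + tn n *: H x) (G x + tn n *: H x)) * (dot (G x) (H x) + tn n / 2 * dot (H x) (H x)))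
    @[n --> \oo] --> \int[mu]_x (b (dot (G x) (G x)) * dot (G x) (H x)).
  apply: (cvg_Rintegral _ _ _ (integrable_b_majorant vG pH)).
  - by move=> n; exact: measurable_b_term.
  - apply: measurable_funM; last exact: measurable_dot.
    by apply: measurable_b => [|x]; [exact: measurable_dot|exact: dot_ge0].
  - move=> x; apply: cvgM.
      apply: b_cvg => [n||]; [exact: dot_ge0|exact: dot_ge0|].
      have E n : dot (G x + tn n *: H x) (G x + tn n *: H x) =
          dot (G x) (G x) + tn n * (2 * dot (G x) (H x)) + tn n * tn n * dot (H x) (H x).
        by rewrite !dotE (dotC (H x)); ring.
      under eq_fun do rewrite E.
      have : dot (G x) (G x) + tn n * (2 * dot (G x) (H x)) + tn n * tn n * dot (H x) (H x) @[n --> \oo] -->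
          dot (G x) (G x) + 0 * (2 * dot (G x) (H x)) + 0 * 0 * dot (H x) (H x).
        apply: cvgD; first by apply: cvgD; [exact: cvg_cst|apply: cvgM => //; exact: cvg_cst].
        by apply: cvgM; [exact: cvgM|exact: cvg_cst].
      by rewrite !mul0r !addr0.
    have : dot (G x) (H x) + tn n / 2 * dot (H x) (H x) @[n --> \oo] --> dot (G x) (H x) + 0 / 2 * dot (H x) (H x).
      apply: cvgD; first exact: cvg_cst.
      by apply: cvgM; [apply: cvgM => //; exact: cvg_cst|exact: cvg_cst].
    by rewrite !mul0r addr0.
  - move=> n x; apply: b_dominated; have /andP[h0 h1] := harmonic_itv R n.
    by rewrite (ltW h0).
rewrite /first_variation subr_ge0; apply: (ler_cvg_to cP cT).
apply: filterS hn => n h; apply: energy_perturbation => //; exact: harmonic_itv.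
Qed.

(** A linear functional nonnegative on the open half-space (v, phi) < 0 is nonnegative on the
    orthogonal complement of v, hence zero there by symmetry. It is thus determined by its value at
    v, and lambda is minus this value over rho^2. *)
Lemma lagrange_multiplier v G : sobolev v G ->
  (\int[mu]_x (v x ^+ 2)%:E = (rho ^+ 2)%:E)%E -> (\int[mu]_x (Phi (G x))%:E = (level v)%:E)%E ->
  exists lambda : R, forall phi H, sobolev phi H ->
    \int[mu]_x (b (dot (G x) (G x)) * dot (G x) (H x)) =
    \int[mu]_x ((`|v x| `^ (p - 2) * v x - lambda * v x) * phi x).
Proof.
move=> vG v2 vE; pose L := first_variation v G.
have rr : 0 < rho ^+ 2 by rewrite exprn_gt0.
have vv : \int[mu]_x (v x * v x) = rho ^+ 2.
  by rewrite /Rintegral; under eq_integral do rewrite -expr2; rewrite v2.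
have ipD phi psi H H' (k : R) : sobolev phi H -> sobolev psi H' ->
    \int[mu]_x (v x * (phi x + k * psi x)) = \int[mu]_x (v x * phi x) + k * \int[mu]_x (v x * psi x).
  move=> pH qH; have i1 := integrable_product vG pH; have i2 := integrable_product vG qH.
  have i2' : mu.-integrable setT (EFin \o (fun x => k * (v x * psi x))).
    by have := integrableZl measurableT k i2; apply: eq_integrable.
  rewrite -(RintegralZl _ measurableT i2) -(RintegralD measurableT i1 i2').
  by apply: eq_Rintegral => x _; ring.
have ker phi H : sobolev phi H -> \int[mu]_x (v x * phi x) = 0 -> 0 <= L phi H.
  move=> pH p_0; apply/ler_addgt0Pr => e e0.
  (* Subtracting k v moves phi into the open half-space and changes the functional by at most e. *)
  pose k := e / (`|L v G| + 1).
  have n1 : 0 < `|L v G| + 1 by rewrite ltr_wpDl.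
  have k0 : 0 < k by rewrite divr_gt0.
  have := sobolevD HB pH (sobolevZ HB (- k) vG) => S.
  have := first_variation_ge0 vG S v2 vE; rewrite (ipD _ _ _ _ _ pH vG) p_0 add0r vv.
  rewrite mulNr oppr_lt0 mulr_gt0// => /(_ isT).
  rewrite first_variation_linear// -/(L phi H) -/(L v G) => h; apply: le_trans h _.
  rewrite lerD2l mulNr -mulrN; apply: le_trans (_ : k * `|L v G| <= _).
    by rewrite ler_pM2l// -normrN ler_norm.
  by rewrite /k mulrAC ler_pdivrMr// ler_pM2l// lerDl.
exists (- (L v G / rho ^+ 2)) => phi H pH.
(* Coefficient of the orthogonal projection of phi onto v; phi - s v is orthogonal to v. *)
pose s := \int[mu]_x (v x * phi x) / rho ^+ 2.
have S1 := sobolevD HB pH (sobolevZ HB (- s) vG).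
have ip0 : \int[mu]_x (v x * (phi x + - s * v x)) = 0.
  by rewrite (ipD _ _ _ _ _ pH vG) vv mulNr /s mulfVK ?subrr// gt_eqF.
have S2 := sobolevZ HB (-1) S1.
have Z0 := sobolevZ HB 0 vG.
have h1 := ker _ _ S1 ip0.
(* The opposite direction, written as 0 v + (-1) (phi - s v) to match the form of
   [first_variation_linear]. *)
have S3 := sobolevD HB Z0 (sobolevZ HB (-1) S1).
have ip3 : \int[mu]_x (v x * (0 * v x + -1 * (phi x + - s * v x))) = 0.
  rewrite (ipD _ _ _ _ _ Z0 S1) ip0 mulr0 addr0.
  by under eq_Rintegral do rewrite mul0r mulr0; rewrite /Rintegral integral0.
have h2 := ker _ _ S3 ip3.
have LZ : L (fun x => 0 * v x) (fun x => 0 *: G x) = 0.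
  rewrite /L /first_variation.
  under eq_Rintegral do rewrite scale0r dotC dot0 mulr0.
  under [X in _ - X]eq_Rintegral do rewrite mul0r mulr0.
  by rewrite subrr.
have L1 : L (fun x => phi x + - s * v x) (fun x => H x + - s *: G x) = L phi H + - s * L v G.
  exact: first_variation_linear.
have L3 : L (fun x => 0 * v x + -1 * (phi x + - s * v x)) (fun x => 0 *: G x + -1 *: (H x + - s *: G x)) =
    0 + -1 * (L phi H + - s * L v G).
  by rewrite /L (first_variation_linear _ vG Z0 S1) -/L LZ L1.
rewrite L1 in h1; rewrite L3 add0r mulN1r oppr_ge0 in h2.
have LE : L phi H = s * L v G.
  by apply/eqP; rewrite -subr_eq0 -mulNr; apply/eqP/le_anti; rewrite h1 h2.
have i1 := integrable_reaction vG pH; have i2 := integrable_product vG pH.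
pose lam := - (L v G / rho ^+ 2).
have i2' : mu.-integrable setT (EFin \o (fun x => lam * (v x * phi x))).
  by have := integrableZl measurableT lam i2; apply: eq_integrable.
have -> : \int[mu]_x ((`|v x| `^ (p - 2) * v x - lam * v x) * phi x) =
    \int[mu]_x (`|v x| `^ (p - 2) * v x * phi x) - lam * \int[mu]_x (v x * phi x).
  rewrite -(RintegralZl _ measurableT i2) -(RintegralB measurableT i1 i2').
  by apply: eq_Rintegral => x _; ring.
have FE : \int[mu]_x (b (dot (G x) (G x)) * dot (G x) (H x)) =
    \int[mu]_x (`|v x| `^ (p - 2) * v x * phi x) + s * L v G.
  by rewrite -LE /L /first_variation addrC subrK.
rewrite FE; congr (_ + _); rewrite /lam /s mulNr opprK.
by rewrite mulrAC [in RHS]mulrAC; congr (_ / _); exact: mulrC.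
Qed.

End euler_lagrange.

(** * Ground states *)

Section profile_of_b.
Variables (R : realType) (b : R -> R).
Hypothesis b_gt0 : forall s : R, 0 <= s -> 0 < b s.
Hypothesis b_le : forall s t : R, 0 <= s -> s <= t -> b s <= b t.

Local Notation leb1 := (@lebesgue_measure R).

Lemma C1_nonneg_cvg (s : nat -> R) (l : R) : C1_nonneg b -> (forall n, 0 <= s n) -> 0 <= l ->
  s n @[n --> \oo] --> l -> b (s n) @[n --> \oo] --> b l.
Proof.
move=> [b' [_ Hb]] s0 l0 sl; have /cvgrPdist_le/(_ _ ltr01) := Hb l l0.
rewrite near_withinE /dnbhs near_withinE => /nbhs_ballP[d /= d0 dP].
have lip (t : R) : 0 <= t -> `|l - t| < d -> `|b l - b t| <= (`|b' l| + 1) * `|l - t|.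
  move=> t0 tl; have [->|tn] := eqVneq t l; first by rewrite !subrr normr0 mulr0.
  have := dP t; rewrite -ball_normE /= tl => /(_ isT tn).
  rewrite in_itv/= andbT => /(_ t0) h.
  have tl0 : t - l != 0 by rewrite subr_eq0.
  have E : b t - b l = (b t - b l) / (t - l) * (t - l) by rewrite mulfVK.
  rewrite distrC E normrM [`|l - t|]distrC ler_wpM2r//.
  rewrite -[X in `|X|](subKr (b' l)); apply: le_trans (ler_normB _ _) _.
  by rewrite lerD2l.
apply/cvgrPdist_le => e e0; have M0 : 0 < `|b' l| + 1 by rewrite ltr_wpDl.
have d1 : 0 < Num.min d (e / (`|b' l| + 1)) by rewrite lt_min d0 divr_gt0.
have /cvgrPdist_lt/(_ _ d1) := sl; apply: filterS => n; rewrite lt_min => /andP[h1 h2].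
apply: le_trans (lip _ (s0 n) h1) _; rewrite mulrC -ler_pdivlMr//; exact: ltW.
Qed.

Lemma integrable_b (x y : itv_bound R) (M : R) : (BLeft 0 <= x)%O -> (y <= BRight M)%O ->
  leb1.-integrable [set` Interval x y] (EFin \o b).
Proof.
move=> x0 yM; have bm : measurable_fun setT (fun s : R => b (Num.max 0 s)).
  apply: nondecreasing_measurable => // s t st; apply: b_le; first by rewrite le_max lexx.
  by rewrite ge_max !le_max lexx st orbT.
apply: (@integrableS _ _ _ leb1 `[0, M]%classic _ _ (measurable_itv _)) => //.
- by apply: subset_itv.
apply: (@eq_integrable _ _ _ leb1 _ (measurable_itv _) (EFin \o (fun s : R => b (Num.max 0 s)))).
  by move=> s; rewrite inE/= in_itv/= => /andP[s0 _]; rewrite max_r.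
apply: measurable_bounded_integrable => //.
- by rewrite /= lebesgue_measure_itv/=; case: ifP => _ //; rewrite -EFinD ltry.
- exact: measurable_funTS.
exists (b (Num.max 0 M)); split; first exact: num_real.
move=> k Mk s; rewrite /= in_itv/= => /andP[s0 sM].
apply: le_trans (ltW Mk); rewrite max_r// ger0_norm; last by rewrite ltW// b_gt0.
by apply: b_le => //; rewrite le_max sM orbT.
Qed.

Lemma primitive_le0 (s : R) : s <= 0 -> primitive b s = 0.
Proof.
rewrite /primitive le_eqVlt => /orP[/eqP ->|s0]; first by rewrite set_itv1 Rintegral_set1.
by rewrite set_itv_ge ?Rintegral_set0// bnd_simp -ltNge.
Qed.

Lemma primitive_sub (s t : R) : 0 <= s -> s <= t ->
  b s * (t - s) <= primitive b t - primitive b s <= b t * (t - s).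
Proof.
move=> s0 st; have t0 := le_trans s0 st.
have it : leb1.-integrable `[0, t] (EFin \o b) by exact: (@integrable_b _ _ t).
have ist : leb1.-integrable `]s, t] (EFin \o b) by apply: (@integrable_b _ _ t); rewrite ?bnd_simp.
rewrite /primitive (Rintegral_itvB it) ?bnd_simp//.
have fst : (leb1 `]s, t]%classic < +oo)%E.
  by rewrite lebesgue_measure_itv/=; case: ifP => _ //; rewrite -EFinD ltry.
have icst (c : R) : leb1.-integrable `]s, t] (EFin \o cst c).
  by apply: measurable_bounded_integrable => //; exact: bounded_cst.
have mst : fine (leb1 `]s, t]%classic) = t - s.
  rewrite lebesgue_measure_itv/= lte_fin.
  by have [->|ne] := eqVneq s t; [rewrite ltxx subrr|rewrite lt_neqAle ne st -EFinD].
rewrite -mst -!(@Rintegral_cst _ _ _ leb1 `]s, t]%classic)//; apply/andP; split.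
  apply: le_Rintegral => //; first exact: icst.
  by move=> x; rewrite /= in_itv/= => /andP[sx _]; apply: b_le => //; exact: ltW.
apply: le_Rintegral => //; first exact: icst.
by move=> x; rewrite /= in_itv/= => /andP[sx xt]; apply: b_le => //; apply: le_trans (ltW sx).
Qed.

Lemma primitive_tangent (s t : R) : 0 <= s -> 0 <= t ->
  primitive b t - primitive b s <= b t * (t - s).
Proof.
move=> s0 t0; have [st|ts] := leP s t; first by have /andP[] := primitive_sub s0 st.
have /andP[h _] := primitive_sub t0 (ltW ts).
by rewrite -opprB -[t - s]opprB mulrN lerN2.
Qed.

Lemma primitive_nondecreasing (s t : R) : s <= t -> primitive b s <= primitive b t.
Proof.
move=> st; have pge (x : R) : 0 <= primitive b x.
  by apply: Rintegral_ge0 => y; rewrite /= in_itv/= => /andP[y0 _]; rewrite ltW// b_gt0.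
have [s0|s0] := leP s 0; first by rewrite primitive_le0.
have /andP[h _] := primitive_sub (ltW s0) st.
by rewrite -subr_ge0; apply: le_trans h; rewrite mulr_ge0 ?subr_ge0// ltW// b_gt0// ltW.
Qed.

(** The tangent inequality taken at the intermediate point z towards x and towards y; with weights t
    and 1 - t the linear terms cancel. *)
Lemma primitive_convex (t x y : R) : 0 <= t <= 1 -> 0 <= x -> 0 <= y ->
  primitive b (t * x + (1 - t) * y) <= t * primitive b x + (1 - t) * primitive b y.
Proof.
move=> /andP[t0 t1] x0 y0; have t1' : 0 <= 1 - t by rewrite subr_ge0.
set z := t * x + (1 - t) * y; have z0 : 0 <= z by rewrite addr_ge0// mulr_ge0.
have h1 := ler_wpM2l t0 (primitive_tangent x0 z0).
have h2 := ler_wpM2l t1' (primitive_tangent y0 z0).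
have E : t * (b z * (z - x)) + (1 - t) * (b z * (z - y)) = 0 by rewrite /z; ring.
have := lerD h1 h2; rewrite E; lra.
Qed.

Variables (q c1 c2 : R).
Hypothesis c10 : 0 < c1.
Hypothesis b_growth : forall s : R,
  c1 * (s ^+ 2 + `|s| `^ q) <= b (s ^+ 2) * s ^+ 2 <= c2 * (s ^+ 2 + `|s| `^ q).

(* For [q < 2] the lower bound in [b_growth] would make [b] unbounded near 0. *)
Lemma growth_exponent : 2 <= q.
Proof.
rewrite leNgt; apply/negP => q2; have q20 : 0 < 2 - q by rewrite subr_gt0.
(* For s <= 1 with s^(2 - q) = m, monotonicity gives b(s^2) s^2 <= b(1) m s^q <= (c1 / 2) s^q,
   contradicting the lower growth bound. *)
have b1 := b_gt0 ler01; pose m := Num.min 1 (c1 / (2 * b 1)).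
have m0 : 0 < m by rewrite lt_min ltr01 divr_gt0// mulr_gt0.
have m1 : m <= 1 by rewrite ge_min lexx.
have mb : b 1 * m <= c1 / 2.
  apply: le_trans (_ : b 1 * (c1 / (2 * b 1)) <= _); first by rewrite ler_pM2l// ge_min lexx orbT.
  by rewrite le_eqVlt; apply/orP; left; apply/eqP; field; rewrite gt_eqF.
pose s := m `^ (2 - q)^-1; have s0 : 0 < s by rewrite powR_gt0.
have sq : s `^ (2 - q) = m by rewrite /s -powRrM mulVf ?gt_eqF// powRr1// ltW.
have s1 : s <= 1.
  rewrite [leRHS](_ : 1 = 1 `^ (2 - q)^-1); last by rewrite powR1.
  by rewrite ge0_ler_powR ?nnegrE ?invr_ge0 ?(ltW q20) ?(ltW m0).
have s2 : s ^+ 2 = m * s `^ q.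
  rewrite -sq -powRD; last by rewrite (gt_eqF s0) implybT.
  by rewrite subrK powR_mulrn// ltW.
have /andP[h _] := b_growth s; rewrite (gtr0_norm s0) in h.
have sq0 : 0 < s `^ q by rewrite powR_gt0.
have h1 : c1 * s `^ q <= b 1 * s ^+ 2.
  apply: le_trans (_ : c1 * (s ^+ 2 + s `^ q) <= _); first by rewrite ler_pM2l// lerDr sqr_ge0.
  apply: le_trans h _; rewrite ler_wpM2r ?sqr_ge0//; apply: b_le; first exact: sqr_ge0.
  by rewrite expr_le1// ltW.
move: h1; rewrite s2 mulrA ler_pM2r// => h1.
have lt2 : c1 / 2 < c1 by rewrite ltr_pdivrMr// ltr_pMr// ltr1n.
by have := le_lt_trans (le_trans h1 mb) lt2; rewrite ltxx.
Qed.

Lemma profile_primitive :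
  (forall s : R, c1 * (s ^+ 2 + `|s| `^ q) <= primitive b (s ^+ 2) <= c2 * (s ^+ 2 + `|s| `^ q)) ->
  profile (primitive b) q c1 c2.
Proof.
move=> HB; split => //.
- exact: growth_exponent.
- exact: primitive_le0.
- exact: primitive_nondecreasing.
- exact: primitive_convex.
Qed.

End profile_of_b.

Section ground_state.
Variables (R : realType) (N : nat) (b : R -> R) (q c1 c2 p rho : R).
Hypothesis HB : profile (primitive b) q c1 c2.
Hypothesis N0 : (0 < N)%N.
Hypothesis p2 : 2 < p.
Hypothesis pr : p < 2 + 4 / N%:R.
Hypothesis r0 : 0 < rho.
Implicit Types (u v : 'rV[R]_N -> R).

Local Notation mu := (lebesgue_rV R N).
Local Notation Phi := (@Phi R N (primitive b)).
Local Notation m0 := (@m0 R N (primitive b) p rho).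
Local Notation power := (@power R N p).

Lemma energyE v (E : R) : power v \is a fin_num -> (\int[mu]_x (Phi (grad v x))%:E = E%:E)%E ->
  energy b p v = (E / 2 - fine (power v) / p)%:E.
Proof.
move=> vf vE; have p0 : p != 0 by rewrite gt_eqF// (lt_trans _ p2).
rewrite /energy (poweR_Lnorm mu (EFin \o v) p0).
have -> : (\int[mu]_x (`|(EFin \o v) x| `^ p) = (fine (power v))%:E)%E by rewrite fineK.
have -> : (\int[mu]_x (primitive b (enorm (grad v x) ^+ 2))%:E = E%:E)%E.
  by rewrite -vE; apply: eq_integral => x _; rewrite enormE.
by rewrite -!EFinM -EFinB mulrC [p^-1 * _]mulrC.
Qed.

(** Transfers the infimum over test functions in the ball to all of the sphere in X: the exact
    gradient integral of v is also a relaxed bound, to which [relaxed_energy_ge] applies. *)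
Lemma sphere_energy_ge v : sphere q rho v -> (m0%:E <= energy b p v)%E.
Proof.
move=> [vX v2]; have vS := spaceX_sobolev HB vX; have [mv mg _] := vS.
have [A A0 AP] := sobolev_Phi_fin HB vS.
have I0 : (0 <= \int[mu]_x (Phi (grad v x))%:E)%E.
  by apply: integral_ge0 => x _; rewrite lee_fin (Phi_ge0 HB).
have If : (\int[mu]_x (Phi (grad v x))%:E)%E \is a fin_num.
  by rewrite ge0_fin_numE//; apply: le_lt_trans AP _; exact: ltry.
have rv : relaxed (primitive b) v (fine (\int[mu]_x (Phi (grad v x))%:E)).
  by apply: (sobolev_relaxed HB vS); rewrite fineK.
have v2' : (\int[mu]_x (v x ^+ 2)%:E <= (rho ^+ 2)%:E)%E.
  by rewrite -v2; under [leRHS]eq_integral do rewrite real_normK ?num_real//.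
have [vf h] := relaxed_energy_ge HB N0 p2 pr r0 mv v2' rv.
rewrite (energyE vf (esym (fineK If))) lee_fin.
by rewrite lerBrDr ler_pdivlMr// mulrC.
Qed.

Lemma minimizer_energy v G : sobolev (primitive b) v G -> power v \is a fin_num ->
  (\int[mu]_x (Phi (G x))%:E = (2 * (m0 + fine (power v) / p))%:E)%E ->
  (\int[mu]_x (Phi (grad v x))%:E = (2 * (m0 + fine (power v) / p))%:E)%E /\
  energy b p v = m0%:E.
Proof.
move=> vG vf GE; have [mv mG _] := vG.
have [_ mg _] := spaceX_sobolev HB (sobolev_spaceX HB vG).
have E : (\int[mu]_x (Phi (grad v x))%:E = (2 * (m0 + fine (power v) / p))%:E)%E.
  rewrite -GE; apply: ge0_ae_eq_integral => //.
  - by apply/measurable_EFinP; exact: (measurable_Phi HB).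
  - by apply/measurable_EFinP; exact: (measurable_Phi HB).
  - by move=> x _; rewrite lee_fin (Phi_ge0 HB).
  - by move=> x _; rewrite lee_fin (Phi_ge0 HB).
  - by apply: filterS (sobolev_grad HB vG) => x ->.
split => //; rewrite (energyE vf E); congr EFin.
by rewrite mulrC mulKf// addrK.
Qed.

Lemma radial_majorant_vanishes u (A : R) : 0 < A -> (forall x, 0 <= u x) ->
  (forall x, x != 0 -> u x <= radial_majorant A 2 x) -> vanishes_at_infinity u.
Proof.
move=> A0 u0 uA e e0; pose C := 2 * A * N%:R ^+ N.
have C0 : 0 <= C by rewrite mulr_ge0// mulr_ge0// ltW.
exists (Num.max 1 (C / e ^+ 2)) => x; rewrite gt_max => /andP[x1 xC].
have xx : 0 < enorm x by apply: lt_trans x1.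
rewrite ger0_norm//; apply: le_lt_trans (uA x _) _; first by rewrite -enorm_gt0.
have e2 : 0 < e ^+ 2 by rewrite exprn_gt0.
have xN : 0 < enorm x ^+ N by rewrite exprn_gt0.
rewrite /radial_majorant -/C powR12_sqrt ?divr_ge0 ?(ltW xN)//.
rewrite -(gtr0_norm e0) -sqrtr_sqr ltr_sqrt// ltr_pdivrMr// mulrC -ltr_pdivrMr//.
apply: lt_le_trans xC _; rewrite -[leLHS]expr1; apply: ler_weXn2l => //; exact: ltW.
Qed.

End ground_state.

Theorem theorem1p2 (R : realType) (N : nat) (rho : R) (b : R -> R) (p q : R)
  (hN : (3 <= N)%N)
  (hrho : 0 < rho)
  (b0_pos : forall s : R, 0 <= s -> 0 < b s)
  (b0_C1 : C1_nonneg b)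
  (hq : 1 < q)
  (b1 : exists c1 c2 : R, [/\ 0 < c1, 0 < c2 &
     forall s : R,
       c1 * (s ^+ 2 + `|s| `^ q) <= b (s ^+ 2) * s ^+ 2 <=
         c2 * (s ^+ 2 + `|s| `^ q) /\
       c1 * (s ^+ 2 + `|s| `^ q) <= primitive b (s ^+ 2) <=
         c2 * (s ^+ 2 + `|s| `^ q)])
  (b2 : forall s t : R, 0 <= s -> s <= t -> b s <= b t)
  (hp : 2 < p < (1 + 2 / N%:R) * Num.min 2 q) :
  exists u : 'rV[R]_N -> R,
    [/\ normalized_ground_state b q p rho u,
        forall x, 0 <= u x,
        radially_decreasing u,
        vanishes_at_infinity u &
        energy b p u = min_energy N b q p rho /\
        (min_energy N b q p rho < 0)%E].
Proof.
have [c1 [c2 [c10 c20 H]]] := b1.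
have HB : profile (primitive b) q c1 c2.
  by apply: profile_primitive => // s; have [] := H s.
have N0 : (0 < N)%N by apply: leq_trans hN.
move: hp => /andP[p2 pr0].
(* [profile_q] gives 2 <= q, so the minimum in the hypothesis on p is 2. *)
have pr : p < 2 + 4 / N%:R.
  move: pr0; rewrite min_l ?(profile_q HB)// mulrDl mul1r.
  by rewrite mulrAC (_ : 2 * 2 = 4)//; lra.
have [u [A [u0 [ur mu_] [A0 uA] u2 rel]]] := radial_minimizer HB N0 p2 pr hrho.
have [G [uG GE]] := relaxed_sobolev HB N0 p2 pr hrho mu_ u2 rel.
have u2' := relaxed_norm HB N0 p2 pr hrho mu_ u2 rel.
have [uf _] := relaxed_energy_ge HB N0 p2 pr hrho mu_ u2 rel.
have [gE eE] := minimizer_energy HB p2 uG uf GE.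
have uX := sobolev_spaceX HB uG; have uS := spaceX_sobolev HB uX.
have us : sphere q rho u.
  by split => //; rewrite -u2'; apply: eq_integral => x _; rewrite real_normK ?num_real.
(* The infimum over the sphere equals the one over the ball because the minimizer u lies on the
   sphere; ground state minimality then follows from minimality over the whole sphere. *)
have mE : min_energy N b q p rho = (@m0 R N (primitive b) p rho)%:E.
  apply/le_anti/andP; split; first by rewrite -eE; apply: ereal_inf_lbound; exists u.
  by apply: le_ereal_inf_tmp => _ [v vs <-]; exact: (sphere_energy_ge HB N0 p2 pr hrho).
exists u; split => //.
- split; last by move=> v [vs _]; rewrite eE; exact: (sphere_energy_ge HB N0 p2 pr hrho).
  split => //; have b_ge0 s : 0 <= s -> 0 <= b s by move=> s0; rewrite ltW// b0_pos.
  have b_gr (s : R) : b (s ^+ 2) * s ^+ 2 <= c2 * (s ^+ 2 + `|s| `^ q).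
    by have [/andP[]] := H s.
  have [lambda lamP] := lagrange_multiplier HB b_ge0 b2 b_gr (primitive_tangent b0_pos b2)
    (fun s l s0 l0 => C1_nonneg_cvg b0_C1 s0 l0) N0 p2 pr hrho uS u2' gE.
  exists lambda; split => // phi pX; have := lamP _ _ (spaceX_sobolev HB pX).
  by under eq_Rintegral do rewrite -enormE.
- exact: radially_nonincreasing_decreasing.
- exact: (radial_majorant_vanishes N0 A0 u0 uA).
- by rewrite eE mE lte_fin; split => //; exact: (m0_lt0 HB N0 p2 pr hrho).
Qed.
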